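(* Work in $\mathsf{ZF}+\mathsf{DC}$ and assume the Measure Uniformization Principle $\mathsf{MUP}$. Let $G=(\pi_1,\pi_2)$ be any game with Polish strategy spaces $X_1,X_2$ and bounded payoffs. Then for each $i\in\{1,2\}$ and each $s\in X_i$ the following are equivalent: (a) $s$ is rationalizable, i.e. $s\in\mathrm{RAT}_i(G)$; (b) $s$ is consistent with Rationality and Common Belief in Rationality, i.e. $s\in\mathrm{RCBR}_i(G)$; (c) player I has a winning strategy in the auxiliary Gale–Stewart game $G_s^{E}$, where $E=E^G=(E^G_1,E^G_2)$ is the pair of best response relations of $G$.
   Context: Conventions. $\mathsf{DC}$ is the Axiom of Dependent Choice. For a Polish space $X$, $\Delta(X)$ is the Polish space of Borel probability measures on $X$ (weak topology). A measure is identified with its completion; for arbitrary $S\subseteq X$, ''$\mu(S)=1$'' means $S$ is measurable for the completion of $\mu$ and has measure one. Always $\{i,j\}=\{1,2\}$. $\mathsf{MUP}$: for every family $\{A_x: x\in B\}$ of nonempty subsets of $\mathbb{R}$ indexed by a set $B\subseteq\mathbb{R}$ of positive Lebesgue measure there is a Borel function $f$ such that $\{x\in B: f(x)\notin A_x\}$ has Lebesgue measure $0$. Games. A (two-person strategic form) game $G=(\pi_1,\pi_2)$ is a pair of bounded (universally measurable) functions $\pi_i:X_1\times X_2\to\mathbb{R}$, with $X_1,X_2$ Polish (strategy spaces). For $s\in X_i$ and $\mu\in\Delta(X_j)$, $\pi_i(s,\mu)$ is the integral over $y\in X_j$ with respect to $\mu$ of player $i$'s payoff when $i$ plays $s$ and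 $j$ plays $y$. $s$ is a best response to $\mu$ if $\pi_i(s,\mu)\ge\pi_i(\bar s,\mu)$ for all $\bar s\in X_i$. Let $E_i^G=\{(s,\mu)\in X_i\times\Delta(X_j) : s\text{ is a best response to }\mu\}$. Rationalizability. Put $X_i^0=X_i$; $X_i^{\alpha+1}=\{s\in X_i^\alpha : \exists\mu\in\Delta(X_j)\ (\mu(X_j^\alpha)=1 \text{ and } (s,\mu)\in E_i^G)\}$; and $X_i^\alpha=\bigcap_{\beta<\alpha}X_i^\beta$ for limit $\alpha$. With $\alpha$ least such that $X_i^{\alpha+1}=X_i^\alpha$ for both $i$, $\mathrm{RAT}_i(G)=X_i^\alpha$. Type spaces. Put $X_i^{(0)}=X_j$ and $X_i^{(n)}=X_i^{(n-1)}\times\Delta(X_j^{(n-1)})$ for $n>0$. Let $T_i^0=\prod_{n>0}\Delta(X_i^{(n-1)})$, and let $T_i^1\subseteq T_i^0$ be the set of sequences $\delta_i=(\delta_i^1,\delta_i^2,\dots)$ with $\mathrm{marg}_{X_i^{(n-2)}}(\delta_i^n)=\delta_i^{n-1}$ for all $n>1$. By Kolmogorov extension each $\delta_i\in T_i^1$ determines a unique $\delta_i^*\in\Delta(X_j\times T_j^0)$ with $\mathrm{marg}_{X_i^{(n)}}\delta_i^*=\delta_i^{n+1}$ for all $n\ge 0$. For $k>1$ let $T_i^k=\{\delta_i\in T_i^1:\delta_i^*(X_j\times T_j^{k-1})=1\}$ and $T_i=\bigcap_{k\geq 1}T_i^k$. Then $T_i$ is Polish and $\lambda_i(\delta_i)=\delta_i^*$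 defines a homeomorphism $\lambda_i:T_i\to\Delta(X_j\times T_j)$. RCBR. Let $R_i^1=\{(s,t)\in X_i\times T_i : (s,\mathrm{marg}_{X_j}\lambda_i(t))\in E_i^G\}$ and $R_i^{n+1}=\{(s,t)\in R_i^n : \lambda_i(t)(R_j^n)=1\}$ for $n\ge1$. $\mathrm{RCBR}_i(G)=\{s\in X_i:\exists t\in T_i\ \forall n\ge 1\ (s,t)\in R_i^n\}$. The game $G_s^E$ (for $s\in X_i$ and $E=(E_1,E_2)$ with $E_i\subseteq X_i\times\Delta(X_j)$). Put $s_0=s$. For $n<\omega$, player I plays $(\mu_n,b_n)$ and then player II plays $s_{n+1}$. Rules: if $n$ is even, $\mu_n\in\Delta(X_j)$, $(s_n,\mu_n)\in E_i$, and $b_n\subseteq X_j$ is Borel with $\mu_n(b_n)=1$; if $n$ is odd, $\mu_n\in\Delta(X_i)$, $(s_n,\mu_n)\in E_j$, and $b_n\subseteq X_i$ is Borel with $\mu_n(b_n)=1$; and always $s_{n+1}\in b_n$. The first player to break a rule loses; I wins if play continues through all stages. *)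

(* Defs.v *)
(* Under the axiom of choice MUP is false (uniformize A_x = {g x} for a
   non-measurable g), and Rocq's types, once constructive_indefinite_description
   is assumed, satisfy choice.  Stating the theorem directly about Rocq types
   would therefore make it vacuous.  The theory ZF + DC + MUP is instead taken
   literally: all the mathematics takes place inside an arbitrary first-order
   structure for the language of set theory satisfying ZF, DC and MUP.

   Every mathematical object is an element of the structure V.  All predicates
   below quantify over V only (apart from quantifiers over the two players), so
   they are first-order in the membership relation; Rocq functions V -> V stand
   for definable class functions.  In particular the natural numbers, reals,
   measures, ordinals and strategies are those of V, not those of Rocq. *)
From Stdlib Require Import ClassicalEpsilon.

Set Implicit Arguments.
Unset Strict Implicit.
Unset Printing Implicit Defensive.

(** * Structures for the language of set theory, and the theory ZF *)

Class set_structure (V : Type) := {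
  mem : V -> V -> Prop;
  structure_nonempty : inhabited V }.

Notation "x ∈ y" := (mem x y) (at level 70, no associativity).

(* Separation and Replacement must range over first-order formulas only: with
   arbitrary V -> Prop predicates the structure would inherit choice from Rocq.
   Variables are de Bruijn indices. *)
Inductive formula : Type :=
| fmem : nat -> nat -> formula
| feq : nat -> nat -> formula
| fbot : formula
| fimp : formula -> formula -> formula
| fall : formula -> formula.

Definition push_env (V : Type) (x : V) (e : nat -> V) : nat -> V :=
  fun n => match n with O => x | S m => e m end.

Fixpoint sat (V : Type) (M : set_structure V) (e : nat -> V) (f : formula)
  : Prop :=
  match f with
  | fmem m n => e m ∈ e n
  | feq m n => e m = e n
  | fbot => False
  | fimp f1 f2 => sat M e f1 -> sat M e f2
  | fall f1 => forall x : V, sat M (push_env x e) f1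
  end.

Record ZF (V : Type) (M : set_structure V) : Prop := {
  zf_extensionality : forall a b : V, (forall x, x ∈ a <-> x ∈ b) -> a = b;
  zf_foundation : forall a : V, (exists x, x ∈ a) ->
    exists x, x ∈ a /\ forall y, y ∈ x -> ~ y ∈ a;
  zf_pairing : forall a b : V, exists c, forall x, x ∈ c <-> x = a \/ x = b;
  zf_union : forall a : V, exists u, forall x,
    x ∈ u <-> exists b, b ∈ a /\ x ∈ b;
  zf_powerset : forall a : V, exists p, forall x,
    x ∈ p <-> forall y, y ∈ x -> y ∈ a;
  zf_infinity : exists a : V,
    (exists z, z ∈ a /\ forall y, ~ y ∈ z) /\
    (forall x, x ∈ a ->
       exists x', x' ∈ a /\ forall y, y ∈ x' <-> y ∈ x \/ y = x);
  zf_separation : forall (f : formula) (e : nat -> V) (a : V),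
    exists b, forall x, x ∈ b <-> x ∈ a /\ sat M (push_env x e) f;
  zf_replacement : forall (f : formula) (e : nat -> V) (a : V),
    (forall x, x ∈ a -> exists! y, sat M (push_env y (push_env x e)) f) ->
    exists b, forall y,
      y ∈ b <-> exists x, x ∈ a /\ sat M (push_env y (push_env x e)) f }.

(* Definite description.  When P has no unique witness the value is the empty
   set, which keeps every term definable in a model of ZF. *)
Definition the (V : Type) (M : set_structure V) (P : V -> Prop) : V :=
  epsilon structure_nonempty
    (fun y => unique P y \/ (~ (exists! z, P z) /\ forall z, ~ z ∈ y)).

Definition compr (V : Type) (M : set_structure V) (P : V -> Prop) : V :=
  the M (fun c => forall z, z ∈ c <-> P z).

Notation "⟦ z | P ⟧" := (compr _ (fun z => P)) (at level 0, z name).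

(* A complete ordered field of V, given by its carrier, the graphs of addition
   and multiplication, and its order. *)
Record real_data (V : Type) := {
  RR : V;
  radd : V;
  rmul : V;
  rle : V }.

Inductive player : Type := P1 | P2.

Definition other (i : player) : player :=
  match i with P1 => P2 | P2 => P1 end.

Section InternalMathematics.

Context {V : Type} {M : set_structure V}.

(** * Basic set theory *)

Definition sub (a b : V) : Prop := forall x, x ∈ a -> x ∈ b.
Local Notation "a ⊆ b" := (sub a b) (at level 70, no associativity).

Definition emp : V := ⟦ z | False ⟧.
Definition upair (a b : V) : V := ⟦ z | z = a \/ z = b ⟧.
Definition opair (a b : V) : V := upair (upair a a) (upair a b).
Local Notation "⟨ a , b ⟩" := (opair a b) (at level 0).

Definition pi1 (p : V) : V := the M (fun x => exists y, p = ⟨x, y⟩).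
Definition pi2 (p : V) : V := the M (fun y => exists x, p = ⟨x, y⟩).

Definition union (a : V) : V := ⟦ z | exists b, b ∈ a /\ z ∈ b ⟧.
Definition pow (a : V) : V := ⟦ z | z ⊆ a ⟧.
Definition cup (a b : V) : V := ⟦ z | z ∈ a \/ z ∈ b ⟧.
Definition cap (a b : V) : V := ⟦ z | z ∈ a /\ z ∈ b ⟧.
Definition diff (a b : V) : V := ⟦ z | z ∈ a /\ ~ z ∈ b ⟧.
Definition prod (a b : V) : V :=
  ⟦ z | exists x y, x ∈ a /\ y ∈ b /\ z = ⟨x, y⟩ ⟧.
Definition disjoint (a b : V) : Prop := forall x, x ∈ a -> ~ x ∈ b.

Definition fn (f a b : V) : Prop :=
  f ⊆ prod a b /\ forall x, x ∈ a -> exists! y, ⟨x, y⟩ ∈ f.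
Definition fn_on (f a : V) : Prop := exists b, fn f a b.
Definition app (f x : V) : V := the M (fun y => ⟨x, y⟩ ∈ f).
Local Notation "f ∙ x" := (app f x) (at level 25, left associativity).

Definition lam (a : V) (F : V -> V) : V :=
  ⟦ p | exists x, x ∈ a /\ p = ⟨x, F x⟩ ⟧.
Definition preim (a : V) (F : V -> V) (b : V) : V := ⟦ x | x ∈ a /\ F x ∈ b ⟧.
Definition restrict (f a : V) : V :=
  ⟦ p | p ∈ f /\ exists x y, x ∈ a /\ p = ⟨x, y⟩ ⟧.

Definition succ (n : V) : V := ⟦ z | z ∈ n \/ z = n ⟧.
Definition omega : V :=
  ⟦ n | forall I : V, emp ∈ I -> (forall x, x ∈ I -> succ x ∈ I) -> n ∈ I ⟧.
Definition Union_seq (f : V) : V := ⟦ z | exists n, n ∈ omega /\ z ∈ f ∙ n ⟧.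

(* The n-th term of the sequence u_0 = a, u_{k+1} = F k u_k. *)
Definition rec (a : V) (F : V -> V -> V) (n : V) : V :=
  the M (fun y => exists h, fn_on h (succ n) /\ h ∙ emp = a /\
    (forall k, k ∈ n -> h ∙ succ k = F k (h ∙ k)) /\ y = h ∙ n).

Definition finite_sequences (a : V) : V :=
  ⟦ u | exists n, n ∈ omega /\ fn u n a ⟧.

Definition even (n : V) : Prop :=
  rec emp (fun _ p => diff (succ emp) p) n = emp.

Definition transitive (a : V) : Prop := forall x, x ∈ a -> x ⊆ a.
Definition ordinal (a : V) : Prop :=
  transitive a /\ forall x, x ∈ a -> transitive x.
Definition limit_ordinal (a : V) : Prop :=
  ordinal a /\ a <> emp /\ forall b, a <> succ b.

Definition DC : Prop :=
  forall a r : V, (exists x, x ∈ a) ->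
    (forall x, x ∈ a -> exists y, y ∈ a /\ ⟨x, y⟩ ∈ r) ->
    exists f, fn f omega a /\
      forall n, n ∈ omega -> ⟨f ∙ n, f ∙ succ n⟩ ∈ r.

(** * Real numbers *)

Section Reals.

Variable R : real_data V.

Definition plus (x y : V) : V := radd R ∙ ⟨x, y⟩.
Definition times (x y : V) : V := rmul R ∙ ⟨x, y⟩.
Definition le (x y : V) : Prop := ⟨x, y⟩ ∈ rle R.
Definition lt (x y : V) : Prop := le x y /\ x <> y.
Definition zero : V :=
  the M (fun z => z ∈ RR R /\ forall x, x ∈ RR R -> plus x z = x).
Definition one : V :=
  the M (fun u => u ∈ RR R /\ forall x, x ∈ RR R -> times x u = x).
Definition opp (x : V) : V := the M (fun y => y ∈ RR R /\ plus x y = zero).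
Definition minus (x y : V) : V := plus x (opp y).

Definition is_lub (P : V -> Prop) (s : V) : Prop :=
  s ∈ RR R /\ (forall r, P r -> le r s) /\
  forall u, u ∈ RR R -> (forall r, P r -> le r u) -> le s u.

Record complete_ordered_field : Prop := {
  plus_fn : fn (radd R) (prod (RR R) (RR R)) (RR R);
  times_fn : fn (rmul R) (prod (RR R) (RR R)) (RR R);
  le_rel : rle R ⊆ prod (RR R) (RR R);
  plus_assoc : forall x y z, x ∈ RR R -> y ∈ RR R -> z ∈ RR R ->
    plus x (plus y z) = plus (plus x y) z;
  plus_comm : forall x y, x ∈ RR R -> y ∈ RR R -> plus x y = plus y x;
  zero_exists : exists z, z ∈ RR R /\ forall x, x ∈ RR R -> plus x z = x;
  opp_exists : forall x, x ∈ RR R -> exists y, y ∈ RR R /\ plus x y = zero;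
  times_assoc : forall x y z, x ∈ RR R -> y ∈ RR R -> z ∈ RR R ->
    times x (times y z) = times (times x y) z;
  times_comm : forall x y, x ∈ RR R -> y ∈ RR R -> times x y = times y x;
  one_exists : exists u, u ∈ RR R /\ forall x, x ∈ RR R -> times x u = x;
  inv_exists : forall x, x ∈ RR R -> x <> zero ->
    exists y, y ∈ RR R /\ times x y = one;
  distributive : forall x y z, x ∈ RR R -> y ∈ RR R -> z ∈ RR R ->
    times x (plus y z) = plus (times x y) (times x z);
  zero_neq_one : zero <> one;
  le_antisym : forall x y, le x y -> le y x -> x = y;
  le_trans : forall x y z, le x y -> le y z -> le x z;
  le_total : forall x y, x ∈ RR R -> y ∈ RR R -> le x y \/ le y x;
  le_plus : forall x y z, x ∈ RR R -> y ∈ RR R -> z ∈ RR R ->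
    le x y -> le (plus x z) (plus y z);
  le_times : forall x y, le zero x -> le zero y -> le zero (times x y);
  lub_exists : forall a, a ⊆ RR R -> (exists x, x ∈ a) ->
    (exists u, u ∈ RR R /\ forall x, x ∈ a -> le x u) ->
    exists s, is_lub (fun x => x ∈ a) s }.

(* F 0 + ... + F (n-1) *)
Definition sum (n : V) (F : V -> V) : V := rec zero (fun k r => plus r (F k)) n.

Definition open_interval (a b : V) : V :=
  ⟦ x | x ∈ RR R /\ lt a x /\ lt x b ⟧.

(** * Topological spaces, Polish spaces, Borel sets *)

(* A topological space is a pair ⟨carrier, set of open sets⟩. *)
Definition car (S : V) : V := pi1 S.
Definition opens (S : V) : V := pi2 S.

Definition is_topology (X T : V) : Prop :=
  T ⊆ pow X /\ emp ∈ T /\ X ∈ T /\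
  (forall u v, u ∈ T -> v ∈ T -> cap u v ∈ T) /\
  (forall U, U ⊆ T -> union U ∈ T).

(* The space X with the coarsest topology containing B. *)
Definition generated_space (X B : V) : V :=
  ⟨X, ⟦ u | u ∈ pow X /\ forall T, is_topology X T -> B ⊆ T -> u ∈ T ⟧⟩.

Definition real_space : V :=
  generated_space (RR R)
    ⟦ u | exists a b, a ∈ RR R /\ b ∈ RR R /\ u = open_interval a b ⟧.

Definition prod_space (S S' : V) : V :=
  generated_space (prod (car S) (car S'))
    ⟦ w | exists u v, u ∈ opens S /\ v ∈ opens S' /\ w = prod u v ⟧.

Definition subspace (S a : V) : V :=
  ⟨a, ⟦ w | exists u, u ∈ opens S /\ w = cap u a ⟧⟩.

Definition metric (X d : V) : Prop :=
  fn d (prod X X) (RR R) /\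
  (forall x y, x ∈ X -> y ∈ X -> (d ∙ ⟨x, y⟩ = zero <-> x = y)) /\
  (forall x y, x ∈ X -> y ∈ X -> d ∙ ⟨x, y⟩ = d ∙ ⟨y, x⟩) /\
  (forall x y z, x ∈ X -> y ∈ X -> z ∈ X ->
     le (d ∙ ⟨x, z⟩) (plus (d ∙ ⟨x, y⟩) (d ∙ ⟨y, z⟩))).

Definition metric_opens (X d : V) : V :=
  ⟦ u | u ⊆ X /\ forall x, x ∈ u -> exists e, e ∈ RR R /\ lt zero e /\
        forall y, y ∈ X -> lt (d ∙ ⟨x, y⟩) e -> y ∈ u ⟧.

Definition cauchy (d f : V) : Prop :=
  forall e, e ∈ RR R -> lt zero e -> exists N, N ∈ omega /\
    forall m n, m ∈ omega -> n ∈ omega -> N ⊆ m -> N ⊆ n ->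
      lt (d ∙ ⟨f ∙ m, f ∙ n⟩) e.

Definition converges (d f x : V) : Prop :=
  forall e, e ∈ RR R -> lt zero e -> exists N, N ∈ omega /\
    forall n, n ∈ omega -> N ⊆ n -> lt (d ∙ ⟨f ∙ n, x⟩) e.

Definition countable (D : V) : Prop :=
  exists g, fn g D omega /\
    forall x y, x ∈ D -> y ∈ D -> g ∙ x = g ∙ y -> x = y.

Definition dense (S D : V) : Prop :=
  D ⊆ car S /\
  forall u, u ∈ opens S -> (exists x, x ∈ u) -> exists x, x ∈ u /\ x ∈ D.

Definition polish (S : V) : Prop :=
  (exists X T, S = ⟨X, T⟩) /\
  (exists D, countable D /\ dense S D) /\
  exists d, metric (car S) d /\ opens S = metric_opens (car S) d /\
    forall f, fn f omega (car S) -> cauchy d f ->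
      exists x, x ∈ car S /\ converges d f x.

Definition sigma_algebra (X A : V) : Prop :=
  A ⊆ pow X /\ X ∈ A /\ (forall a, a ∈ A -> diff X a ∈ A) /\
  (forall f, fn f omega A -> Union_seq f ∈ A).

Definition borel (S : V) : V :=
  ⟦ b | b ∈ pow (car S) /\
        forall A, sigma_algebra (car S) A -> opens S ⊆ A -> b ∈ A ⟧.

(** * Borel probability measures, completions, integrals *)

Definition probability (S mu : V) : Prop :=
  fn mu (borel S) (RR R) /\
  (forall b, b ∈ borel S -> le zero (mu ∙ b)) /\
  mu ∙ car S = one /\
  (forall f, fn f omega (borel S) ->
     (forall m n, m ∈ omega -> n ∈ omega -> m <> n ->
        disjoint (f ∙ m) (f ∙ n)) ->
     is_lub (fun r => exists n, n ∈ omega /\ r = sum n (fun k => mu ∙ (f ∙ k)))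
            (mu ∙ Union_seq f)).

Definition Prob (S : V) : V := ⟦ mu | probability S mu ⟧.

(* The set a is measurable for the completion of mu, which gives it value r. *)
Definition measure_is (S mu a r : V) : Prop :=
  a ⊆ car S /\ exists b c, b ∈ borel S /\ c ∈ borel S /\ b ⊆ a /\ a ⊆ c /\
    mu ∙ diff c b = zero /\ mu ∙ b = r.
Definition measurable (S mu a : V) : Prop := exists r, measure_is S mu a r.
Definition measure (S mu a : V) : V := the M (measure_is S mu a).

(* The integral, with respect to the completion of mu, of the bounded function
   x |-> F x: the supremum of the integrals of the simple functions below it. *)
Definition integral (S mu : V) (F : V -> V) : V :=
  the M (is_lub (fun r => exists n a c,
    n ∈ omega /\ fn a n (pow (car S)) /\ fn c n (RR R) /\
    (forall k, k ∈ n -> measurable S mu (a ∙ k)) /\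
    (forall k l, k ∈ n -> l ∈ n -> k <> l -> disjoint (a ∙ k) (a ∙ l)) /\
    (forall x, x ∈ car S -> exists k, k ∈ n /\ x ∈ a ∙ k) /\
    (forall k x, k ∈ n -> x ∈ a ∙ k -> le (c ∙ k) (F x)) /\
    r = sum n (fun k => times (c ∙ k) (measure S mu (a ∙ k))))).

Definition bounded (X f : V) : Prop :=
  exists K, K ∈ RR R /\
    forall x, x ∈ X -> le (opp K) (f ∙ x) /\ le (f ∙ x) K.

Definition universally_measurable (S f : V) : Prop :=
  forall mu b, mu ∈ Prob S -> b ∈ borel real_space ->
    measurable S mu (preim (car S) (app f) b).

Definition bounded_continuous (S f : V) : Prop :=
  fn f (car S) (RR R) /\ bounded (car S) f /\
  forall u, u ∈ opens real_space -> preim (car S) (app f) u ∈ opens S.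

(* Δ(S) with the weak topology. *)
Definition Delta (S : V) : V :=
  generated_space (Prob S)
    ⟦ w | exists f u, bounded_continuous S f /\ u ∈ opens real_space /\
          w = preim (Prob S) (fun mu => integral S mu (app f)) u ⟧.

(* The image on S' of the measure nu on S under the map F. *)
Definition image_measure (S S' : V) (F : V -> V) (nu : V) : V :=
  lam (borel S') (fun b => nu ∙ preim (car S) F b).

(** * Lebesgue measure on the line and measure uniformization *)

Definition lebesgue_null (a : V) : Prop :=
  a ⊆ RR R /\
  forall e, e ∈ RR R -> lt zero e -> exists l u,
    fn l omega (RR R) /\ fn u omega (RR R) /\
    (forall n, n ∈ omega -> le (l ∙ n) (u ∙ n)) /\
    (forall x, x ∈ a ->
       exists n, n ∈ omega /\ x ∈ open_interval (l ∙ n) (u ∙ n)) /\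
    (forall n, n ∈ omega -> le (sum n (fun k => minus (u ∙ k) (l ∙ k))) e).

Definition lebesgue_measurable (a : V) : Prop :=
  a ⊆ RR R /\
  exists b, b ∈ borel real_space /\ lebesgue_null (cup (diff a b) (diff b a)).

Definition positive_lebesgue_measure (a : V) : Prop :=
  lebesgue_measurable a /\ ~ lebesgue_null a.

Definition borel_function (f : V) : Prop :=
  fn f (RR R) (RR R) /\
  forall b, b ∈ borel real_space -> preim (RR R) (app f) b ∈ borel real_space.

Definition MUP : Prop :=
  forall B A : V, B ⊆ RR R -> positive_lebesgue_measure B ->
    fn A B (pow (RR R)) -> (forall x, x ∈ B -> exists y, y ∈ A ∙ x) ->
    exists f, borel_function f /\
      lebesgue_null ⟦ x | x ∈ B /\ ~ f ∙ x ∈ A ∙ x ⟧.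

(** * Games and rationalizability *)

(* strategies i is the space X_i; payoffs i is π_i, defined on X_1 × X_2 for
   both i. *)
Record game := {
  strategies : player -> V;
  payoffs : player -> V }.

Definition is_game (G : game) : Prop :=
  (forall i, polish (strategies G i)) /\
  forall i,
    fn (payoffs G i)
       (prod (car (strategies G P1)) (car (strategies G P2))) (RR R) /\
    bounded (prod (car (strategies G P1)) (car (strategies G P2)))
            (payoffs G i) /\
    universally_measurable (prod_space (strategies G P1) (strategies G P2))
                           (payoffs G i).

Section Game.

Variable G : game.

Local Notation X := (strategies G).

(* Player i's payoff when i plays s and the opponent plays y. *)
Definition payoff (i : player) (s y : V) : V :=
  payoffs G i ∙ match i with P1 => ⟨s, y⟩ | P2 => ⟨y, s⟩ end.

Definition expected_payoff (i : player) (s mu : V) : V :=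
  integral (X (other i)) mu (payoff i s).

(* E_i^G *)
Definition best_response (i : player) : V :=
  ⟦ p | exists s mu, p = ⟨s, mu⟩ /\ s ∈ car (X i) /\ mu ∈ Prob (X (other i)) /\
        forall s', s' ∈ car (X i) ->
          le (expected_payoff i s' mu) (expected_payoff i s mu) ⟧.

(* Families indexed by the players, coded as ordered pairs of V, for use in
   simultaneous recursions. *)
Definition both (F : player -> V) : V := ⟨F P1, F P2⟩.
Definition sel (i : player) (p : V) : V :=
  match i with P1 => pi1 p | P2 => pi2 p end.

Definition rat_step (A : V) : V :=
  both (fun i => ⟦ s | s ∈ sel i A /\ exists mu, mu ∈ Prob (X (other i)) /\
                       measure_is (X (other i)) mu (sel (other i) A) one /\
                       ⟨s, mu⟩ ∈ best_response i ⟧).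

Definition rat_sequence (h a : V) : Prop :=
  fn_on h a /\
  forall b, b ∈ a ->
    (b = emp -> h ∙ b = both (fun i => car (X i))) /\
    (forall c, b = succ c -> h ∙ b = rat_step (h ∙ c)) /\
    (limit_ordinal b ->
       h ∙ b = both (fun i => ⟦ s | s ∈ car (X i) /\
                                   forall c, c ∈ b -> s ∈ sel i (h ∙ c) ⟧)).

(* The pair (X_1^a, X_2^a), for an ordinal a. *)
Definition rat_stage (a : V) : V :=
  the M (fun A => exists h, rat_sequence h (succ a) /\ A = h ∙ a).

Definition rat_stable (a : V) : Prop :=
  ordinal a /\ rat_stage (succ a) = rat_stage a.

Definition RAT (i : player) : V :=
  the M (fun A => exists a, rat_stable a /\
    (forall b, b ∈ a -> ~ rat_stable b) /\ A = sel i (rat_stage a)).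

(** * Type spaces and common belief in rationality *)

(* The pair of spaces (X_1^(n), X_2^(n)). *)
Definition hierarchy (n : V) : V :=
  rec (both (fun i => X (other i)))
      (fun _ S => both (fun i => prod_space (sel i S)
                                            (Delta (sel (other i) S)))) n.
Definition Xn (i : player) (n : V) : V := sel i (hierarchy n).

(* The space T_i^0.  Its elements are functions t on omega, indexed from 0:
   t ∙ k stands for the (k+1)-st coordinate δ_i^{k+1}. *)
Definition T0 (i : player) : V :=
  let C := ⟦ t | fn_on t omega /\
                 forall k, k ∈ omega -> t ∙ k ∈ Prob (Xn i k) ⟧ in
  generated_space C
    ⟦ w | exists k u, k ∈ omega /\ u ∈ opens (Delta (Xn i k)) /\
          w = preim C (fun t => t ∙ k) u ⟧.

Definition T1 (i : player) : V :=
  ⟦ t | t ∈ car (T0 i) /\ forall k, k ∈ omega ->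
        image_measure (Xn i (succ k)) (Xn i k) pi1 (t ∙ succ k) = t ∙ k ⟧.

(* The projection X_j × T_j^0 -> X_i^(n),
   (x, t) |-> (... ((x, t_0), t_1), ..., t_{n-1}). *)
Definition proj (n z : V) : V := rec (pi1 z) (fun k p => ⟨p, pi2 z ∙ k⟩) n.

(* δ* *)
Definition extension (i : player) (t : V) : V :=
  let S := prod_space (X (other i)) (T0 (other i)) in
  the M (fun nu => nu ∈ Prob S /\ forall n, n ∈ omega ->
    image_measure S (Xn i n) (proj n) nu = t ∙ n).

(* The pair (T_1^{n+1}, T_2^{n+1}). *)
Definition Tk (n : V) : V :=
  rec (both T1)
      (fun _ S => both (fun i =>
         ⟦ t | t ∈ T1 i /\
               measure_is (prod_space (X (other i)) (T0 (other i)))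
                          (extension i t)
                          (prod (car (X (other i))) (sel (other i) S)) one ⟧))
      n.

Definition type_space (i : player) : V :=
  subspace (T0 i)
    ⟦ t | t ∈ T1 i /\ forall n, n ∈ omega -> t ∈ sel i (Tk n) ⟧.

Definition world (i : player) : V :=
  prod_space (X (other i)) (type_space (other i)).

(* λ_i(t): the measure δ* lives on X_j × T_j^0 and is read on its subspace
   X_j × T_j, to which its completion gives measure one. *)
Definition belief (i : player) (t : V) : V :=
  the M (fun nu => nu ∈ Prob (world i) /\
    forall c, c ∈ borel (prod_space (X (other i)) (T0 (other i))) ->
      nu ∙ cap c (car (world i)) = extension i t ∙ c).

(* The pair (R_1^{n+1}, R_2^{n+1}). *)
Definition Rn (n : V) : V :=
  rec (both (fun i =>
         ⟦ p | exists s t, p = ⟨s, t⟩ /\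
               s ∈ car (X i) /\ t ∈ car (type_space i) /\
               ⟨s, image_measure (world i) (X (other i)) pi1 (belief i t)⟩
                 ∈ best_response i ⟧))
      (fun _ A => both (fun i =>
         ⟦ p | p ∈ sel i A /\
               measure_is (world i) (belief i (pi2 p)) (sel (other i) A) one ⟧))
      n.

Definition RCBR (i : player) : V :=
  ⟦ s | s ∈ car (X i) /\ exists t, t ∈ car (type_space i) /\
        forall n, n ∈ omega -> ⟨s, t⟩ ∈ sel i (Rn n) ⟧.

(** * The auxiliary Gale-Stewart game *)

Section GaleStewart.

Variables (E : player -> V) (i : player) (s : V).

(* y is the sequence of moves of II, that is y ∙ n = s_{n+1}. *)
Definition gs_point (y n : V) : V :=
  the M (fun x => (n = emp /\ x = s) \/
                  exists m, m ∈ omega /\ n = succ m /\ x = y ∙ m).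

Definition gs_turn (n : V) (k : player) : Prop :=
  (even n /\ k = i) \/ (~ even n /\ k = other i).

(* A strategy sigma of I maps the finite sequence (s_1, ..., s_n) of the
   previous moves of II to the move of I at stage n. *)
Definition gs_legal_I (sigma y n : V) : Prop :=
  exists mu b, sigma ∙ restrict y n = ⟨mu, b⟩ /\
    forall k, gs_turn n k ->
      mu ∈ Prob (X (other k)) /\ ⟨gs_point y n, mu⟩ ∈ E k /\
      b ∈ borel (X (other k)) /\ mu ∙ b = one.

Definition gs_legal_II (sigma y n : V) : Prop :=
  exists mu b, sigma ∙ restrict y n = ⟨mu, b⟩ /\ gs_point y (succ n) ∈ b.

Definition gs_I_wins : Prop :=
  let moves := cup (car (X P1)) (car (X P2)) in
  exists sigma, fn_on sigma (finite_sequences moves) /\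
    forall y, fn y omega moves ->
      forall n, n ∈ omega ->
        (forall m, m ∈ n -> gs_legal_I sigma y m /\ gs_legal_II sigma y m) ->
        gs_legal_I sigma y n.

End GaleStewart.

End Game.

End Reals.

End InternalMathematics.

Arguments game V : clear implicits.
Arguments ZF V M : clear implicits.
Arguments DC V M : clear implicits.

(* Main.v *)
(* All three conditions say that s lies in some Z_i, where Z = (Z_1, Z_2) is
   post-fixed: every x in Z_k is a best response to a measure mu to whose
   completion Z_j has measure one.

   MUP is transferred from Lebesgue measure to any Borel probability measure nu
   on a Polish space by an injective map into the line, the sum of the
   distribution function of nu and of a Cantor-like code; atoms are treated
   separately.  Hence every subset of a Polish space is universally measurable
   and every total relation has a selection nu-almost everywhere.  With DC, a
   post-fixed Z and a point s of Z_i yield Borel sets B_k, with s in B_i, and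
   selections F_k of best-response beliefs such that F_k x (B_j) = 1 for x in
   B_k.  Player I then wins the game by playing (F_k x, B_j) at x; and x in B_k
   has the type whose belief is the image of F_k x under the map that pairs each
   y with the type of y, defined level by level along the hierarchy.  No
   measurability of these maps is needed, since every set is measurable.

   Conversely the points reachable in plays against a winning strategy form a
   post-fixed pair, and so do the sets RCBR_k: countable intersections of sets
   of measure one have measure one, and projections are measurable.

   Every instance of Separation, Replacement and recursion requires a
   first-order formula; the tactic dfn finds it. *)
From Stdlib Require Import ClassicalEpsilon PropExtensionality FunctionalExtensionality.
From HB Require Import structures.
From mathcomp Require Import all_boot all_order all_algebra lra ring.
From mathcomp Require boolp.
Require Import Defs.

Set Implicit Arguments.
Unset Strict Implicit.
Unset Printing Implicit Defensive.
Set Maximal Implicit Insertion.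

(** That every set is measurable is established only for measures on Polish spaces, and the only
    Polish spaces at hand are the strategy spaces. The spaces of the hierarchy, of types and of
    worlds are handled through [nice]: countably many bounded continuous functions whose positivity
    sets form a base. This passes to products and to [Delta], and it yields what is needed there:
    countable families that separate points and π-systems on which measures are compared. The
    measures constructed on these spaces are images of measures on strategy spaces. The obstacle is
    that sets such as R_j^n need not be Borel, while measure one for the completion demands a Borel
    subset of measure one. [graph_borel] finds such a subset inside the graph of the map from
    strategies to types. A value picked by Rocq's epsilon may enter a set of V only once a formula
    defining it is known. Hence suprema, codes and selections come with a characterization that
    determines them, and countable choices are drawn from DC inside V. *)

Lemma propeq (P Q : Prop) : (P <-> Q) -> P = Q.
Proof. exact: propositional_extensionality. Qed.

Lemma funeq {A B : Type} (f g : A -> B) : (forall x, f x = g x) -> f = g.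
Proof. exact: functional_extensionality. Qed.

(** * First-order definability *)

Section Definability.

Context {V : Type} {M : set_structure V}.

Inductive pterm := pvar (n : nat) | pcst (c : V).

Inductive pformula :=
| pmem (a b : pterm)
| peq (a b : pterm)
| pbot
| pimp (f g : pformula)
| pall (f : pformula).

Definition pval (e : nat -> V) t := match t with pvar n => e n | pcst c => c end.

Fixpoint psat (e : nat -> V) (f : pformula) : Prop :=
  match f with
  | pmem a b => pval e a ∈ pval e b
  | peq a b => pval e a = pval e b
  | pbot => False
  | pimp f g => psat e f -> psat e g
  | pall f => forall x, psat (push_env x e) f
  end.

Definition up (r : nat -> nat) n := if n is m.+1 then (r m).+1 else 0.

Definition tren (r : nat -> nat) t :=
  match t with pvar n => pvar (r n) | pcst c => pcst c end.

Fixpoint pren (r : nat -> nat) f :=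
  match f with
  | pmem a b => pmem (tren r a) (tren r b)
  | peq a b => peq (tren r a) (tren r b)
  | pbot => pbot
  | pimp f g => pimp (pren r f) (pren r g)
  | pall f => pall (pren (up r) f)
  end.

Lemma pval_tren e r t : pval e (tren r t) = pval (fun n => e (r n)) t.
Proof. by case: t. Qed.

Lemma psat_pren f r e : psat e (pren r f) <-> psat (fun n => e (r n)) f.
Proof.
elim: f r e => [a b|a b||f1 IH1 f2 IH2|f IH] r e //=; rewrite ?pval_tren //.
  by rewrite (propeq (IH1 _ _)) (propeq (IH2 _ _)).
have E x : (fun n => push_env x e (up r n)) = push_env x (fun n => e (r n)).
  by apply: funeq => -[].
by split=> H x; move: (H x); rewrite (propeq (IH _ _)) E.
Qed.

(* Terms pcst c name elements of V: they become the parameters of a formula of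
   the language.  Under d binders, index n < d is bound, d + 2n is the n-th free variable and
   d + 2n + 1 the n-th constant. *)
Definition cidx (l : list V) (c : V) : nat :=
  find (fun x => if excluded_middle_informative (x = c) then true else false) l.

Definition tcompile l d t :=
  match t with
  | pvar n => if (n < d)%N then n else (d + (n - d).*2)%N
  | pcst c => (d + (cidx l c).*2.+1)%N
  end.

Fixpoint pcompile l d f : formula :=
  match f with
  | pmem a b => fmem (tcompile l d a) (tcompile l d b)
  | peq a b => feq (tcompile l d a) (tcompile l d b)
  | pbot => fbot
  | pimp f g => fimp (pcompile l d f) (pcompile l d g)
  | pall f => fall (pcompile l d.+1 f)
  end.

Definition tconsts t := if t is pcst c then [:: c] else [::].

Fixpoint pconsts f :=
  match f with
  | pmem a b | peq a b => tconsts a ++ tconsts b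
  | pbot => [::]
  | pimp f g => pconsts f ++ pconsts g
  | pall f => pconsts f
  end.

Definition compiled_env l d (e e' : nat -> V) :=
  [/\ forall n, (n < d)%N -> e' n = e n,
      forall n, e' (d + n.*2)%N = e (d + n)%N &
      forall n c, List.In c l -> n = cidx l c -> e' (d + n.*2.+1)%N = c].

Lemma compiled_env_push l d e e' x : compiled_env l d e e' ->
  compiled_env l d.+1 (push_env x e) (push_env x e').
Proof.
case=> H1 H2 H3; split; first by case=> // n /H1.
- by move=> n; rewrite !addSn; apply: H2.
- by move=> n c Hc E; rewrite addSn /=; apply: H3.
Qed.

Lemma tcompile_val l d e e' t : compiled_env l d e e' ->
  (forall c, List.In c (tconsts t) -> List.In c l) ->
  e' (tcompile l d t) = pval e t.
Proof.
case=> H1 H2 H3; case: t => [n _|c Hc] /=; last first.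
  by apply: H3 => //; apply: Hc; left.
case: ltnP => [/H1 //|le_dn].
by rewrite H2 subnKC.
Qed.

Lemma pcompile_sat l f d e e' : compiled_env l d e e' ->
  (forall c, List.In c (pconsts f) -> List.In c l) ->
  sat M e' (pcompile l d f) <-> psat e f.
Proof.
elim: f d e e' => [a b|a b||f1 IH1 f2 IH2|f IH] d e e' He Hc //=.
- rewrite !(tcompile_val He) // => c Hi; apply: Hc => /=; apply: List.in_or_app; auto.
- rewrite !(tcompile_val He) // => c Hi; apply: Hc => /=; apply: List.in_or_app; auto.
- rewrite (propeq (IH1 _ _ _ He _)) ?(propeq (IH2 _ _ _ He _)) // => c Hi;
    apply: Hc => /=; apply: List.in_or_app; auto.
- by split=> H x; apply/(IH _ _ _ (compiled_env_push x He) Hc).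
Qed.

Definition base_env l (e : nat -> V) (n : nat) : V :=
  if odd n then List.nth n./2 l (e 0) else e n./2.

Lemma cidx_nth l c x0 : List.In c l -> List.nth (cidx l c) l x0 = c.
Proof.
elim: l => //= a l IH; rewrite /cidx /=.
case: excluded_middle_informative => //= Ha [/Ha|/IH] //.
Qed.

Lemma base_compiled l e : compiled_env l 0 e (base_env l e).
Proof.
split=> // n; rewrite /base_env add0n; first by rewrite odd_double doubleK.
by move=> c Hc ->; rewrite /= odd_double /= uphalf_double cidx_nth.
Qed.

(** Predicates are taken on whole environments: passing under a binder is the shift from [e] to
    [e 0] and [fun n => e n.+1], and no arity has to be tracked. *)
Definition definable (P : (nat -> V) -> Prop) : Prop :=
  exists f, forall e, P e <-> psat e f.

Definition definable_term (t : (nat -> V) -> V) : Prop :=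
  definable (fun e => e 0 = t (fun n => e n.+1)).

Lemma definable_formula1 P : definable (fun e => P (e 0)) ->
  exists f e, forall x, sat M (push_env x e) f <-> P x.
Proof.
case=> f Hf; case: (structure_nonempty) => v0.
pose l := pconsts f; exists (pcompile l 1 f), (base_env l (fun _ => v0)) => x.
rewrite (pcompile_sat (compiled_env_push x (base_compiled _ _))) //.
by rewrite -(propeq (Hf (push_env x _))).
Qed.

Lemma definable_formula2 P : definable (fun e => P (e 1) (e 0)) ->
  exists f e, forall x y, sat M (push_env y (push_env x e)) f <-> P x y.
Proof.
case=> f Hf; case: (structure_nonempty) => v0.
pose l := pconsts f; exists (pcompile l 2 f), (base_env l (fun _ => v0)) => x y.
rewrite (pcompile_sat (compiled_env_push y (compiled_env_push x (base_compiled _ _)))) //.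
by rewrite -(propeq (Hf (push_env y (push_env x _)))).
Qed.

Lemma definable_iff P Q : (forall e, P e <-> Q e) -> definable P -> definable Q.
Proof. by move=> E [f Hf]; exists f => e; rewrite -(propeq (E e)). Qed.

Lemma definable_ren P r : definable P -> definable (fun e => P (fun n => e (r n))).
Proof. by case=> f Hf; exists (pren r f) => e; rewrite (propeq (psat_pren _ _ _)). Qed.

Arguments definable_ren [P r] _.

Lemma definable_imp P Q : definable P -> definable Q ->
  definable (fun e => P e -> Q e).
Proof. by case=> f Hf [g Hg]; exists (pimp f g) => e /=; rewrite (propeq (Hf e)) (propeq (Hg e)). Qed.

Lemma definable_all (P : V -> (nat -> V) -> Prop) :
  definable (fun e => P (e 0) (fun n => e n.+1)) -> definable (fun e => forall x, P x e).
Proof.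
case=> f Hf; exists (pall f) => e /=.
by split=> H x; apply/(Hf (push_env x e)); apply: H.
Qed.

(** A proposition that does not depend on the environment is replaced by its truth value, decided
    outside V. It may therefore mention objects of any kind. *)
Lemma definable_const (P : Prop) : definable (fun _ => P).
Proof.
case: (classic P) => HP; last by exists pbot => e /=; tauto.
by exists (pimp pbot pbot) => e /=; tauto.
Qed.

Lemma definable_not P : definable P -> definable (fun e => ~ P e).
Proof. move=> H; exact: definable_imp H (definable_const False). Qed.

Lemma definable_or P Q : definable P -> definable Q -> definable (fun e => P e \/ Q e).
Proof.
move=> HP HQ; apply: definable_iff (definable_imp (definable_not HP) HQ) => e.
by case: (classic (P e)); tauto.
Qed.

Lemma definable_and P Q : definable P -> definable Q -> definable (fun e => P e /\ Q e).
Proof.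
move=> HP HQ; apply: definable_iff (definable_not (definable_imp HP (definable_not HQ))) => e.
by case: (classic (P e)); case: (classic (Q e)); tauto.
Qed.

Lemma definable_and3 P Q R : definable P -> definable Q -> definable R ->
  definable (fun e => [/\ P e, Q e & R e]).
Proof.
move=> HP HQ HR; apply: definable_iff (definable_and HP (definable_and HQ HR)) => e.
by split=> [[? []]|[]].
Qed.

Lemma definable_and4 P Q R S : definable P -> definable Q -> definable R -> definable S ->
  definable (fun e => [/\ P e, Q e, R e & S e]).
Proof.
move=> HP HQ HR HS; apply: definable_iff (definable_and HP (definable_and3 HQ HR HS)) => e.
by split=> [[? []]|[]].
Qed.

Lemma definable_equiv P Q : definable P -> definable Q -> definable (fun e => P e <-> Q e).
Proof. by move=> HP HQ; apply: definable_and; apply: definable_imp. Qed.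

Lemma definable_andb (P Q : (nat -> V) -> bool) : definable P -> definable Q ->
  definable (fun e => P e && Q e).
Proof.
move=> HP HQ; apply: definable_iff (definable_and HP HQ) => e.
by split=> [[-> ->]|/andP].
Qed.

Lemma definable_eq_prop P Q : definable P -> definable Q -> definable (fun e => P e = Q e).
Proof.
move=> HP HQ; apply: definable_iff (definable_equiv HP HQ) => e.
by split=> [/propeq|->].
Qed.

Lemma definable_ex (P : V -> (nat -> V) -> Prop) :
  definable (fun e => P (e 0) (fun n => e n.+1)) -> definable (fun e => exists x, P x e).
Proof.
move=> HP; apply: (@definable_iff (fun e => ~ forall x, ~ P x e)) => [e|].
  split=> [H|[x Hx] H]; last exact: (H x Hx).
  by apply: NNPP => H'; apply: H => x Hx; apply: H'; exists x.
apply: definable_not; apply: (definable_all (P := fun x e => ~ P x e)).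
exact: definable_not HP.
Qed.

(** Players are not elements of V; a quantifier over them is a conjunction of two formulas. *)
Lemma definable_all_player (P : player -> (nat -> V) -> Prop) :
  (forall i, definable (P i)) -> definable (fun e => forall i, P i e).
Proof.
move=> HP; apply: definable_iff (definable_and (HP P1) (HP P2)) => e.
by split=> [[] ? ? []|].
Qed.

Lemma definable_ex_player (P : player -> (nat -> V) -> Prop) :
  (forall i, definable (P i)) -> definable (fun e => exists i, P i e).
Proof.
move=> HP; apply: definable_iff (definable_or (HP P1) (HP P2)) => e.
by split=> [[]|[[]]]; eauto.
Qed.

Lemma term_var n : definable_term (fun e => e n).
Proof. by exists (peq (pvar 0) (pvar n.+1)). Qed.

Lemma term_const c : definable_term (fun _ => c).
Proof. by exists (peq (pvar 0) (pcst c)). Qed.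

Lemma term_ren t r : definable_term t -> definable_term (fun e => t (fun n => e (r n))).
Proof. exact: (definable_ren (r := up r)). Qed.

Arguments term_ren [t r] _.

(** The language has no function symbols, so a term is substituted through
    [exists y, y = t e /\ P y]. The renaming r lets P and t use the free variables at different
    indices. *)
Lemma definable_subst (P : V -> (nat -> V) -> Prop) t r :
  definable (fun e => P (e 0) (fun n => e n.+1)) -> definable_term t ->
  definable (fun e => P (t e) (fun n => e (r n))).
Proof.
move=> HP Ht.
apply: (@definable_iff (fun e => exists y, y = t e /\ P y (fun n => e (r n)))).
  by move=> e; split=> [[y [-> //]]|]; exists (t e).
apply: definable_ex; apply: definable_and => //=.
exact: (definable_ren (r := up r) HP).
Qed.

Arguments definable_subst [P t r] _ _.

Lemma term_subst (F : V -> (nat -> V) -> V) t r :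
  definable_term (fun e => F (e 0) (fun n => e n.+1)) -> definable_term t ->
  definable_term (fun e => F (t e) (fun n => e (r n))).
Proof.
move=> HF Ht; rewrite /definable_term.
apply: (@definable_iff (fun e => exists y, y = t (fun n => e n.+1) /\
                               e 0 = F y (fun n => e (r n).+1))).
  by move=> e; split=> [[y [-> //]]|]; exists (t (fun n => e n.+1)).
apply: definable_ex; apply: definable_and; first exact: (term_ren Ht).
(* Under the new binder, index 0 is the argument y and index 1 the value, the reverse of their order
   in the graph of F. *)
exact: (definable_ren (r := fun n => match n with 0 => 1 | 1 => 0 | m.+2 => (r m).+2 end) HF).
Qed.

Arguments term_subst [F t r] _ _.

Lemma definable_mem a b : definable_term a -> definable_term b ->
  definable (fun e => a e ∈ b e).
Proof.
move=> Ha Hb; apply: (definable_subst (P := fun x e => x ∈ b e) (r := id)) => //.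
apply: (definable_subst (P := fun y e => e 0 ∈ y) (r := id) (t := fun e => b (fun n => e n.+1))).
  by exists (pmem (pvar 1) (pvar 0)).
exact: (term_ren (r := succn) Hb).
Qed.

Lemma definable_eq a b : definable_term a -> definable_term b ->
  definable (fun e => a e = b e).
Proof.
move=> Ha Hb; exact: (definable_subst (P := fun x e => x = b e) (r := id)).
Qed.

Lemma definable_unique (P : V -> (nat -> V) -> Prop) x :
  definable (fun e => P (e 0) (fun n => e n.+1)) -> definable_term x ->
  definable (fun e => unique (fun y => P y e) (x e)).
Proof.
move=> HP Hx; rewrite /unique; apply: definable_and.
  exact: (definable_subst (r := id)).
apply: definable_all; apply: definable_imp => //.
by apply: definable_eq; [exact: (term_ren (r := succn) Hx)|exact: term_var].
Qed.

End Definability.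

Arguments definable_ren {V M P r} _.
Arguments term_ren {V M t r} _.
Arguments definable_subst {V M} P {t r} _ _.
Arguments term_subst {V M} F {t r} _ _.

(** ZF, DC, the field and MUP in one record: every later section depends on a single variable T,
    from which the structure and the reals are read off. *)
Record model (V : Type) := Model {
  model_struct : set_structure V;
  model_reals : real_data V;
  model_ZF : ZF V model_struct;
  model_DC : DC V model_struct;
  model_field : complete_ordered_field model_reals;
  model_MUP : MUP model_reals }.

(** * Definite descriptions and comprehension *)

Section DefiniteDescription.

Context {V : Type} {T : model V}.
#[local] Hint Extern 0 (set_structure _) => exact (model_struct T) : typeclass_instances.
Local Notation M := (@model_struct V T).
Local Notation HZF := (@model_ZF V T).

Lemma ext (a b : V) : (forall x, x ∈ a <-> x ∈ b) -> a = b.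
Proof. exact: (zf_extensionality HZF). Qed.

Lemma empty_exists : exists z : V, forall y, ~ y ∈ z.
Proof.
by case: (zf_infinity HZF) => a [[z [_ Hz]] _]; exists z.
Qed.

Lemma theP (P : V -> Prop) x : P x -> (forall y, P y -> y = x) -> the M P = x.
Proof.
move=> Px Hx; rewrite /the.
case: (epsilon_spec structure_nonempty
    (fun y => unique P y \/ (~ (exists! z, P z) /\ forall z, ~ z ∈ y)) _).
- by exists x; left; split=> // y /Hx.
- by case=> + _ => /Hx.
- by case=> H; case: H; exists x; split=> // y /Hx.
Qed.

Lemma the_junk (P : V -> Prop) : ~ (exists! x, P x) -> forall z, ~ z ∈ the M P.
Proof.
move=> HP; rewrite /the.
case: (epsilon_spec structure_nonempty
    (fun y => unique P y \/ (~ (exists! z, P z) /\ forall z, ~ z ∈ y)) _).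
- by case: empty_exists => z Hz; exists z; right.
- by move=> H; case: HP; exists (the M P).
- by case.
Qed.

(** The value is the unique witness if there is one and the memberless set otherwise; this
    alternative is a formula, although [the] is built from epsilon. *)
Lemma term_the (P : (nat -> V) -> V -> Prop) :
  definable (fun e => P (fun n => e n.+1) (e 0)) -> definable_term (fun e => the M (P e)).
Proof.
move=> HP.
have HU : definable (fun e => exists! x, P e x).
  apply: definable_ex.
  apply: (@definable_unique _ _ (fun y e => P (fun n => e n.+1) y) (fun e => e 0)).
    exact: (definable_ren (r := fun n => if n is m.+1 then m.+2 else 0) HP).
  exact: term_var.
rewrite /definable_term.
apply: (@definable_iff _ _ (fun e => unique (P (fun n => e n.+1)) (e 0) \/
   (~ (exists! x, P (fun n => e n.+1) x) /\ forall z, ~ z ∈ e 0))).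
  move=> e; split=> [[[H1 H2]|[H1 H2]]|->].
  - by symmetry; apply: theP => // y /H2.
  - by apply: ext => x; split=> [/H2 //|]; have /(_ x) := the_junk H1.
  case: (classic (exists! x, P (fun n => e n.+1) x)) => H.
    case: (H) => x [Px Hx]; left; rewrite (theP Px) // => y /Hx //.
  by right; split=> //; apply: the_junk.
apply: definable_or.
  apply: (@definable_unique _ _ (fun y e => P (fun n => e n.+1) y) (fun e => e 0)).
    exact: (definable_ren (r := fun n => if n is m.+1 then m.+2 else 0) HP).
  exact: term_var.
apply: definable_and; first by apply: definable_not; exact: (definable_ren (r := succn) HU).
apply: definable_all; apply: definable_not.
by apply: definable_mem; exact: term_var.
Qed.

Lemma term_compr (P : (nat -> V) -> V -> Prop) :
  definable (fun e => P (fun n => e n.+1) (e 0)) -> definable_term (fun e => compr M (P e)).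
Proof.
move=> HP; rewrite /compr; apply: term_the; apply: definable_all.
apply: definable_equiv; first by apply: definable_mem; exact: term_var.
exact: (definable_ren (r := fun n => if n is m.+1 then m.+2 else 0) HP).
Qed.

End DefiniteDescription.

Arguments ext {V} T a b _.

Notation "⟨ a , b ⟩" := (opair a b) (at level 0).
Notation "f ∙ x" := (app f x) (at level 25, left associativity).
Notation "a ⊆ b" := (Defs.sub a b) (at level 70, no associativity).

Lemma term_subst2 {V : Type} {M : set_structure V} (F : V -> V -> V) a b :
  definable_term (fun e => F (e 0) (e 1)) -> definable_term a -> definable_term b ->
  definable_term (fun e => F (a e) (b e)).
Proof.
move=> HF Ha Hb; apply: (term_subst (fun x e => F x (b e)) (r := id)) => //.
apply: (term_subst (fun y e => F (e 0) y) (r := id) (t := fun e => b (fun n => e n.+1))).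
  exact: (definable_ren (r := fun n => match n with 0 => 0 | 1 => 2 | 2 => 1 | m => m end) HF).
exact: (term_ren (r := succn)).
Qed.

Lemma definable_subst2 {V : Type} {M : set_structure V} (P : V -> V -> Prop) a b :
  definable (fun e => P (e 0) (e 1)) -> definable_term a -> definable_term b ->
  definable (fun e => P (a e) (b e)).
Proof.
move=> HF Ha Hb; apply: (definable_subst (fun x e => P x (b e)) (r := id)) => //.
apply: (definable_subst (fun y e => P (e 0) y) (r := id) (t := fun e => b (fun n => e n.+1))).
  exact: (definable_ren (r := fun n => match n with 0 => 1 | 1 => 0 | m => m end) HF).
exact: (term_ren (r := succn)).
Qed.

Lemma term_subst3 {V : Type} {M : set_structure V} (F : (nat -> V) -> V -> V -> V) a b r :
  definable_term (fun e => F (fun n => e n.+2) (e 1) (e 0)) -> definable_term a ->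
  definable_term b -> definable_term (fun e => F (fun n => e (r n)) (a e) (b e)).
Proof.
move=> HF Ha Hb.
apply: (term_subst (fun x e => F (fun n => e (r n)) x (b e)) (r := id)) => //.
apply: (term_subst (fun y e => F (fun n => e (r n).+1) (e 0) y) (r := id) (t := fun e => b (fun n => e n.+1))).
  exact: (definable_ren (r := fun n => match n with 0 => 0 | 1 => 1 | 2 => 2 | m.+3 => (r m).+3 end) HF).
exact: (term_ren (r := succn)).
Qed.

(* Hooks of the tactic dfn, redefined as operations become available. *)
Ltac dfn_real := fail.
Ltac dfn_sym6 := fail.
Ltac dfn_sym5 := fail.
Ltac dfn_sym4 := fail.
Ltac dfn_sym3 := fail.
Ltac dfn_sym2 := fail.
Ltac dfn_sym := fail.

Ltac dfn_hyp1 :=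
  lazymatch goal with
  | |- definable_term (fun e => ?F (@?a e)) =>
      match goal with
      | H : definable_term F |- _ => refine (term_ren H)
      | H : definable_term (fun e => F (e 0)) |- _ =>
          refine (@term_subst _ _ (fun x _ => F x) a id H _)
      end
  | |- definable (fun e => ?F (@?a e)) =>
      match goal with
      | H : definable F |- _ => refine (definable_ren H)
      | H : definable (fun e => F (e 0)) |- _ =>
          refine (@definable_subst _ _ (fun x _ => F x) a id H _)
      end
  end.

Ltac dfn_hyp2 :=
  lazymatch goal with
  | |- definable_term (fun e => ?F (@?a e) (@?b e)) =>
      match goal with
      | H : definable_term (fun e => F (e 0) (e 1)) |- _ =>
          refine (@term_subst2 _ _ F a b H _ _)
      | H : definable_term (fun e => F (fun n => e n.+1) (e 0)) |- _ =>
          refine (@term_subst _ _ (fun x e => F e x) b _ H _)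
      end
  | |- definable (fun e => ?F (@?a e) (@?b e)) =>
      match goal with
      | H : definable (fun e => F (e 0) (e 1)) |- _ =>
          refine (@definable_subst2 _ _ F a b H _ _)
      | H : definable (fun e => F (fun n => e n.+1) (e 0)) |- _ =>
          refine (@definable_subst _ _ (fun x e => F e x) b _ H _)
      end
  end.

Ltac dfn_hyp3 :=
  lazymatch goal with
  | |- definable_term (fun e => ?F _ (@?a e) (@?b e)) =>
      match goal with
      | H : definable_term (fun e => F (fun n => e n.+2) (e 1) (e 0)) |- _ =>
          refine (@term_subst3 _ _ F a b _ H _ _)
      end
  end.

Ltac dfn_hyp := first
  [ match goal with H : ?G |- ?G => exact H end
  | dfn_hyp1 | dfn_hyp2 | dfn_hyp3
  | match goal with H : forall i : player, definable_term _ |- _ => simple apply H end ].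

Ltac dfn_pred :=
  lazymatch goal with
  | |- definable (fun e => Defs.sub _ _) => unfold Defs.sub
  | |- definable (fun e => disjoint _ _) => unfold disjoint
  | |- definable (fun e => fn _ _ _) => unfold fn
  | |- definable (fun e => fn_on _ _) => unfold fn_on
  | |- definable (fun e => transitive _) => unfold Defs.transitive
  | |- definable (fun e => Defs.ordinal _) => unfold Defs.ordinal
  | |- definable (fun e => limit_ordinal _) => unfold limit_ordinal
  | |- definable (fun e => Defs.even _) => unfold Defs.even
  | |- definable (fun e => Defs.le _ _ _) => unfold Defs.le
  | |- definable (fun e => Defs.lt _ _ _) => unfold Defs.lt
  | |- definable (fun e => is_lub _ _ _) => unfold is_lub
  | |- definable (fun e => is_topology _ _) => unfold is_topology
  | |- definable (fun e => cauchy _ _ _) => unfold cauchy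
  | |- definable (fun e => converges _ _ _ _) => unfold converges
  | |- definable (fun e => countable _) => unfold countable
  | |- definable (fun e => dense _ _) => unfold dense
  | |- definable (fun e => sigma_algebra _ _) => unfold sigma_algebra
  | |- definable (fun e => probability _ _ _) => unfold probability
  | |- definable (fun e => measure_is _ _ _ _ _) => unfold measure_is
  | |- definable (fun e => measurable _ _ _ _) => unfold measurable
  | |- definable (fun e => bounded _ _ _) => unfold bounded
  | |- definable (fun e => bounded_continuous _ _ _) => unfold bounded_continuous
  end.

(** Terms that ignore the environment are treated before their head symbol is looked at: any object,
    however it was obtained, then counts as a parameter and is never unfolded. *)
Ltac dfn_step :=
  cbv beta;
  lazymatch goal with
  | |- definable (fun _ => ?P) => exact (definable_const P)
  | |- definable_term (fun _ => ?c) => exact (term_const c)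
  | |- definable_term (fun e => e _) => refine (term_var _)
  | |- definable (fun e => (@?A e) -> (@?B e)) => refine (@definable_imp _ _ A B _ _)
  | |- definable (fun e => (@?A e) /\ (@?B e)) => refine (@definable_and _ _ A B _ _)
  | |- definable (fun e => and3 (@?A e) (@?B e) (@?C e)) =>
      refine (@definable_and3 _ _ A B C _ _ _)
  | |- definable (fun e => and4 (@?A e) (@?B e) (@?C e) (@?D e)) =>
      refine (@definable_and4 _ _ A B C D _ _ _ _)
  | |- definable (fun e => (@?A e) \/ (@?B e)) => refine (@definable_or _ _ A B _ _)
  | |- definable (fun e => (@?A e) <-> (@?B e)) => refine (@definable_equiv _ _ A B _ _)
  | |- definable (fun e => is_true (andb (@?A e) (@?B e))) => refine (@definable_andb _ _ A B _ _)
  | |- definable (fun e => ~ (@?A e)) => refine (@definable_not _ _ A _)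
  | |- definable (fun e => forall x : player, @?P e x) =>
      refine (@definable_all_player _ _ (fun x e => P e x) _); intro
  | |- definable (fun e => forall x, @?P e x) =>
      first [ refine (@definable_all _ _ (fun x e => P e x) _) | dfn_real ]
  | |- definable (fun e => @ex player (@?P e)) =>
      refine (@definable_ex_player _ _ (fun x e => P e x) _); intro
  | |- definable (fun e => ex (@?P e)) =>
      first [ refine (@definable_ex _ _ (fun x e => P e x) _) | dfn_real ]
  | |- definable (fun e => unique (@?P e) (@?x e)) =>
      refine (@definable_unique _ _ (fun y e => P e y) x _ _)
  | |- definable (fun e => mem (@?a e) (@?b e)) => refine (@definable_mem _ _ a b _ _)
  | |- definable (fun e => @eq Prop (@?a e) (@?b e)) => refine (@definable_eq_prop _ _ a b _ _)
  | |- definable (fun e => @eq _ (@?a e) (@?b e)) =>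
      first [ refine (@definable_eq _ _ a b _ _) | dfn_real ]
  | |- definable_term (fun e => the _ (@?P e)) => refine (@term_the _ _ P _)
  | |- definable_term (fun e => compr _ (@?P e)) => refine (@term_compr _ _ P _)
  | |- _ => first [ dfn_hyp | dfn_sym | dfn_sym2 | dfn_sym3 | dfn_real | dfn_sym4 | dfn_sym5 | dfn_sym6 | dfn_pred ]
  end; cbv beta.

Ltac dfn := repeat dfn_step.

Section Terms.

Context {V : Type} {T : model V}.
#[local] Hint Extern 0 (set_structure _) => exact (model_struct T) : typeclass_instances.
Implicit Types (a b c : (nat -> V) -> V) (F G : (nat -> V) -> V -> V).

Lemma term_upair a b : definable_term a -> definable_term b ->
  definable_term (fun e => upair (a e) (b e)).
Proof. move=> Ha Hb; rewrite /upair; dfn. Qed.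

Lemma term_opair a b : definable_term a -> definable_term b ->
  definable_term (fun e => ⟨a e, b e⟩).
Proof. by move=> Ha Hb; rewrite /opair; do !apply: term_upair. Qed.

Lemma term_union a : definable_term a -> definable_term (fun e => union (a e)).
Proof. move=> Ha; rewrite /union; dfn. Qed.

Lemma term_pow a : definable_term a -> definable_term (fun e => pow (a e)).
Proof. move=> Ha; rewrite /pow; dfn. Qed.

Lemma term_cup a b : definable_term a -> definable_term b ->
  definable_term (fun e => cup (a e) (b e)).
Proof. move=> Ha Hb; rewrite /cup; dfn. Qed.

Lemma term_cap a b : definable_term a -> definable_term b ->
  definable_term (fun e => cap (a e) (b e)).
Proof. move=> Ha Hb; rewrite /cap; dfn. Qed.

Lemma term_diff a b : definable_term a -> definable_term b ->
  definable_term (fun e => diff (a e) (b e)).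
Proof. move=> Ha Hb; rewrite /diff; dfn. Qed.

Ltac dfn_sym ::=
  lazymatch goal with
  | |- definable_term (fun e => opair (@?a e) (@?b e)) => refine (@term_opair a b _ _)
  end.

Lemma term_pi1 a : definable_term a -> definable_term (fun e => pi1 (a e)).
Proof. move=> Ha; rewrite /pi1; dfn. Qed.

Lemma term_pi2 a : definable_term a -> definable_term (fun e => pi2 (a e)).
Proof. move=> Ha; rewrite /pi2; dfn. Qed.

Lemma term_prod a b : definable_term a -> definable_term b ->
  definable_term (fun e => Defs.prod (a e) (b e)).
Proof. move=> Ha Hb; rewrite /Defs.prod; dfn. Qed.

Lemma term_app a b : definable_term a -> definable_term b ->
  definable_term (fun e => a e ∙ b e).
Proof. move=> Ha Hb; rewrite /app; dfn. Qed.

Lemma term_lam a F : definable_term a ->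
  definable_term (fun e => F (fun n => e n.+1) (e 0)) ->
  definable_term (fun e => lam (a e) (F e)).
Proof. move=> Ha Hb; rewrite /lam; dfn. Qed.

Lemma term_preim a F b : definable_term a ->
  definable_term (fun e => F (fun n => e n.+1) (e 0)) -> definable_term b ->
  definable_term (fun e => preim (a e) (F e) (b e)).
Proof. move=> Ha HF Hb; rewrite /preim; dfn. Qed.

Lemma term_restrict a b : definable_term a -> definable_term b ->
  definable_term (fun e => restrict (a e) (b e)).
Proof. move=> Ha Hb; rewrite /restrict; dfn. Qed.

Lemma term_succ a : definable_term a -> definable_term (fun e => succ (a e)).
Proof. move=> Ha; rewrite /succ; dfn. Qed.

End Terms.

Ltac dfn_sym ::=
  lazymatch goal with
  | |- definable_term (fun e => opair (@?a e) (@?b e)) => refine (@term_opair _ _ a b _ _)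
  | |- definable_term (fun e => upair (@?a e) (@?b e)) => refine (@term_upair _ _ a b _ _)
  | |- definable_term (fun e => app (@?a e) (@?b e)) => refine (@term_app _ _ a b _ _)
  | |- definable_term (fun e => pi1 (@?a e)) => refine (@term_pi1 _ _ a _)
  | |- definable_term (fun e => pi2 (@?a e)) => refine (@term_pi2 _ _ a _)
  | |- definable_term (fun e => union (@?a e)) => refine (@term_union _ _ a _)
  | |- definable_term (fun e => pow (@?a e)) => refine (@term_pow _ _ a _)
  | |- definable_term (fun e => cup (@?a e) (@?b e)) => refine (@term_cup _ _ a b _ _)
  | |- definable_term (fun e => cap (@?a e) (@?b e)) => refine (@term_cap _ _ a b _ _)
  | |- definable_term (fun e => diff (@?a e) (@?b e)) => refine (@term_diff _ _ a b _ _)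
  | |- definable_term (fun e => Defs.prod (@?a e) (@?b e)) => refine (@term_prod _ _ a b _ _)
  | |- definable_term (fun e => restrict (@?a e) (@?b e)) => refine (@term_restrict _ _ a b _ _)
  | |- definable_term (fun e => succ (@?a e)) => refine (@term_succ _ _ a _)
  | |- definable_term (fun e => lam (@?a e) (@?F e)) => refine (@term_lam _ _ a F _ _)
  | |- definable_term (fun e => preim (@?a e) (@?F e) (@?b e)) => refine (@term_preim _ _ a F b _ _ _)
  end.

Section TermsRec.

Context {V : Type} {T : model V}.
#[local] Hint Extern 0 (set_structure _) => exact (model_struct T) : typeclass_instances.

Lemma term_Union_seq a : definable_term a -> definable_term (fun e => Union_seq (a e)).
Proof. move=> Ha; rewrite /Union_seq; dfn. Qed.

Lemma term_rec a F n : definable_term a ->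
  definable_term (fun e => F (fun n => e n.+2) (e 1) (e 0)) -> definable_term n ->
  definable_term (fun e => rec (a e) (F e) (n e)).
Proof. move=> Ha HF Hn; rewrite /rec; dfn. Qed.

Lemma term_both (F : (nat -> V) -> player -> V) :
  (forall i, definable_term (fun e => F e i)) -> definable_term (fun e => both (F e)).
Proof. move=> H; rewrite /both; dfn; exact: H. Qed.

Lemma term_sel i a : definable_term a -> definable_term (fun e => sel i (a e)).
Proof. case: i => Ha; rewrite /sel; dfn. Qed.

End TermsRec.

Ltac dfn_sym2 ::=
  lazymatch goal with
  | |- definable_term (fun e => Union_seq (@?a e)) => refine (@term_Union_seq _ _ a _)
  | |- definable_term (fun e => rec (@?a e) (@?F e) (@?n e)) => refine (@term_rec _ _ a F n _ _ _)
  | |- definable_term (fun e => both (@?F e)) => refine (@term_both _ _ F _); intro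
  | |- definable_term (fun e => sel ?i (@?a e)) => refine (@term_sel _ _ i a _)
  end.

#[export] Hint Extern 0 (definable _) => solve [dfn] : core.
#[export] Hint Extern 0 (definable_term _) => solve [dfn] : core.

(** * Sets, natural numbers and recursion *)

Definition image {V : Type} {M : set_structure V} (a : V) (F : V -> V) : V :=
  ⟦ y | exists x, x ∈ a /\ y = F x ⟧.

Section Sets.

Context {V : Type} {T : model V}.
#[local] Hint Extern 0 (set_structure _) => exact (model_struct T) : typeclass_instances.
Local Notation M := (@model_struct V T).
Local Notation HZF := (@model_ZF V T).
Implicit Types (a b c f x y z : V) (P : V -> Prop) (F : V -> V).

(** A comprehension term has the expected members only if the class is a set, which c witnesses.
    Membership laws are equalities of propositions so that they can be used with [rewrite]. *)
Lemma comprE P c : (forall z, z ∈ c <-> P z) -> forall z, (z ∈ compr M P) = P z.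
Proof.
move=> Hc z; apply: propeq.
have -> : compr M P = c; last exact: Hc.
apply: theP => // d Hd; apply: (ext T) => x.
by rewrite (propeq (Hc x)) (propeq (Hd x)).
Qed.

Lemma in_compr a P : definable (fun e => P (e 0)) -> (forall z, P z -> z ∈ a) ->
  forall z, (z ∈ compr M P) = P z.
Proof.
move=> HP Ha.
case: (definable_formula1 HP) => f [e Hf].
case: (zf_separation HZF f e a) => b Hb.
apply: (@comprE _ b) => z; rewrite (propeq (Hb z)) (propeq (Hf z)).
by split=> [[]|H] //; split=> //; apply: Ha.
Qed.

Lemma separation a P : definable (fun e => P (e 0)) ->
  exists b, forall z, (z ∈ b) = (z ∈ a /\ P z).
Proof.
move=> HP; exists (compr M (fun z => z ∈ a /\ P z)).
by apply: (in_compr (a := a)) => [|x []//]; dfn.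
Qed.

Lemma compr_eq P Q : (forall z, P z <-> Q z) -> compr M P = compr M Q.
Proof. by move=> H; congr compr; apply: funeq => z; apply: propeq. Qed.

Lemma in_emp z : (z ∈ emp) = False.
Proof. by case: (empty_exists (T := T)) => c Hc; apply: (@comprE _ c) => x; split=> // /Hc. Qed.

Lemma in_upair a b z : (z ∈ upair a b) = (z = a \/ z = b).
Proof. by case: (zf_pairing HZF a b) => c Hc; apply: (comprE Hc). Qed.

Lemma upair_inj a b c d : upair a b = upair c d -> (a = c /\ b = d) \/ (a = d /\ b = c).
Proof.
move=> E.
have [Ha Hb] : (a = c \/ a = d) /\ (b = c \/ b = d).
  by split; rewrite -in_upair -E in_upair; auto.
have [Hc Hd] : (c = a \/ c = b) /\ (d = a \/ d = b).
  by split; rewrite -in_upair E in_upair; auto.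
by case: Ha => ?; case: Hb => ?; case: Hc => ?; case: Hd => ?; subst; auto.
Qed.

Lemma opair_inj a b c d : ⟨a, b⟩ = ⟨c, d⟩ -> a = c /\ b = d.
Proof.
case/upair_inj=> -[/upair_inj H1 /upair_inj H2];
  by case: H1 => -[? ?]; case: H2 => -[? ?]; subst.
Qed.

Lemma pi1_pair a b : pi1 ⟨a, b⟩ = a.
Proof.
apply: theP; first by exists b.
by move=> y [z /opair_inj [-> _]].
Qed.

Lemma pi2_pair a b : pi2 ⟨a, b⟩ = b.
Proof.
apply: theP; first by exists a.
by move=> y [z /opair_inj [_ ->]].
Qed.

Lemma in_union a z : (z ∈ union a) = (exists b, b ∈ a /\ z ∈ b).
Proof. by case: (zf_union HZF a) => c Hc; apply: (comprE Hc). Qed.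

Lemma in_pow a z : (z ∈ pow a) = (z ⊆ a).
Proof. by case: (zf_powerset HZF a) => c Hc; apply: (comprE Hc). Qed.

Lemma in_cup a b z : (z ∈ cup a b) = (z ∈ a \/ z ∈ b).
Proof.
apply: (@comprE _ (union (upair a b))) => x; rewrite in_union; split.
  by case=> y []; rewrite in_upair => -[] ->; auto.
by case=> H; [exists a|exists b]; rewrite in_upair; auto.
Qed.

Lemma in_cap a b z : (z ∈ cap a b) = (z ∈ a /\ z ∈ b).
Proof. by apply: (in_compr (a := a)) => [|x []//]; dfn. Qed.

Lemma in_diff a b z : (z ∈ diff a b) = (z ∈ a /\ ~ z ∈ b).
Proof. by apply: (in_compr (a := a)) => [|x []//]; dfn. Qed.

Lemma sub_refl a : a ⊆ a. Proof. by []. Qed.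

Hint Resolve sub_refl : core.

Lemma sub_trans b a c : a ⊆ b -> b ⊆ c -> a ⊆ c.
Proof. by move=> H1 H2 x /H1 /H2. Qed.

Lemma sub_antisym a b : a ⊆ b -> b ⊆ a -> a = b.
Proof. by move=> H1 H2; apply: (ext T) => x; split; [apply: H1|apply: H2]. Qed.

Lemma in_prod a b z : (z ∈ Defs.prod a b) = (exists x y, x ∈ a /\ y ∈ b /\ z = ⟨x, y⟩).
Proof.
apply: (in_compr (a := pow (pow (cup a b)))) => [|w [x [y [Hx [Hy ->]]]]]; first by dfn.
rewrite in_pow => u; rewrite in_upair in_pow => -[] -> v; rewrite in_upair in_cup => -[] ->; auto.
Qed.

Lemma pair_in_prod a b x y : (⟨x, y⟩ ∈ Defs.prod a b) = (x ∈ a /\ y ∈ b).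
Proof.
rewrite in_prod; apply: propeq; split; last by case=> Hx Hy; exists x, y.
by case=> x' [y' [Hx [Hy /opair_inj [-> ->]]]].
Qed.

Lemma prodP a b z : z ∈ Defs.prod a b -> [/\ z = ⟨pi1 z, pi2 z⟩, pi1 z ∈ a & pi2 z ∈ b].
Proof. by rewrite in_prod => -[x [y [Hx [Hy ->]]]]; rewrite pi1_pair pi2_pair. Qed.

Lemma image_exists a F : definable_term (fun e => F (e 0)) ->
  exists c, forall y, y ∈ c <-> exists x, x ∈ a /\ y = F x.
Proof.
move=> HF.
have HP : definable (fun e => e 0 = F (e 1)) by dfn.
case: (definable_formula2 (P := fun x y => y = F x) HP) => f [e Hf].
case: (zf_replacement HZF (f := f) (e := e) (a := a)) => [x _|b Hb].
  by exists (F x); rewrite /unique; split; [apply/Hf|move=> y /Hf ->].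
by exists b => y; rewrite (propeq (Hb y)); split=> -[x [Hx /Hf Hy]]; exists x.
Qed.

Lemma in_image a F z : definable_term (fun e => F (e 0)) ->
  (z ∈ image a F) = (exists x, x ∈ a /\ z = F x).
Proof. by move=> HF; case: (image_exists a HF) => c Hc; apply: (comprE Hc). Qed.

Lemma in_lam a F z : definable_term (fun e => F (e 0)) ->
  (z ∈ lam a F) = (exists x, x ∈ a /\ z = ⟨x, F x⟩).
Proof. by move=> HF; apply: (@in_image a (fun x => ⟨x, F x⟩)); dfn. Qed.

Lemma in_preim a F b z : definable_term (fun e => F (e 0)) ->
  (z ∈ preim a F b) = (z ∈ a /\ F z ∈ b).
Proof. by move=> HF; apply: (in_compr (a := a)) => [|x []//]; dfn. Qed.

Lemma appE f a b x y : fn f a b -> ⟨x, y⟩ ∈ f -> f ∙ x = y.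
Proof.
case=> H1 H2 Hf.
have Hx : x ∈ a by have := H1 _ Hf; rewrite pair_in_prod; case.
apply: theP => // y' Hy'; case: (H2 x Hx) => z [_ Hz].
by rewrite -(Hz _ Hf) -(Hz _ Hy').
Qed.

Lemma app_in f a b x : fn f a b -> x ∈ a -> ⟨x, f ∙ x⟩ ∈ f.
Proof.
move=> Hf Hx; case: (Hf) => _ /(_ x Hx) [y [Hy _]].
by rewrite (appE Hf Hy).
Qed.

(** The value does not depend on x: a description without witness, used as a function, is
    constant. *)
Lemma app_empty f x : (forall z, ~ z ∈ f) -> f ∙ x = the M (fun _ => False).
Proof. by move=> H; rewrite /app; congr (the _ _); apply: funeq => y; apply: propeq; split=> [/H|[]]. Qed.

Lemma fn_app f a b x : fn f a b -> x ∈ a -> f ∙ x ∈ b.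
Proof.
move=> Hf Hx; have := app_in Hf Hx; case: Hf => H _ /H.
by rewrite pair_in_prod; case.
Qed.

Lemma in_fn f a b z : fn f a b -> (z ∈ f) = (exists x, x ∈ a /\ z = ⟨x, f ∙ x⟩).
Proof.
move=> Hf; apply: propeq; split=> [Hz|[x [Hx ->]]]; last exact: app_in Hf Hx.
case: (Hf) => /(_ _ Hz) /prodP [E H1 H2] _; exists (pi1 z); split=> //.
by rewrite (appE Hf (y := pi2 z)) -E.
Qed.

Lemma fn_dom f a b x y : fn f a b -> ⟨x, y⟩ ∈ f -> x ∈ a.
Proof. by case=> H _ /H; rewrite pair_in_prod; case. Qed.

Lemma fn_ext f g a b c : fn f a b -> fn g a c -> (forall x, x ∈ a -> f ∙ x = g ∙ x) -> f = g.
Proof.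
move=> Hf Hg E; apply: (ext T) => z; rewrite (in_fn _ Hf) (in_fn _ Hg).
by split=> -[x [Hx ->]]; exists x; rewrite E.
Qed.

Lemma fn_sub f a b c : fn f a b -> (forall x, x ∈ a -> f ∙ x ∈ c) -> fn f a c.
Proof.
move=> Hf Hc; case: (Hf) => H1 H2; split=> // z Hz.
have [E Ha Hb] := prodP (H1 _ Hz); rewrite E in Hz *.
by rewrite pair_in_prod; split=> //; rewrite -(appE Hf Hz); apply: Hc.
Qed.

Lemma fn_cod f a b c : fn f a b -> b ⊆ c -> fn f a c.
Proof. by move=> Hf Hc; apply: (fn_sub Hf) => x /(fn_app Hf) /Hc. Qed.

Lemma lam_fn a b F : definable_term (fun e => F (e 0)) ->
  (forall x, x ∈ a -> F x ∈ b) -> fn (lam a F) a b.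
Proof.
move=> HF Hb; split=> [z|x Hx].
  by rewrite in_lam // => -[x [Hx ->]]; rewrite pair_in_prod; auto.
exists (F x); split; first by rewrite in_lam //; exists x.
by move=> y; rewrite in_lam // => -[x' [_ /opair_inj [-> ->]]].
Qed.

Lemma lam_app a F x : definable_term (fun e => F (e 0)) -> x ∈ a -> lam a F ∙ x = F x.
Proof.
move=> HF Hx.
apply: (appE (lam_fn (b := image a F) HF _)).
  by move=> y Hy; rewrite in_image //; exists y.
by rewrite in_lam //; exists x.
Qed.

Lemma lam_fn_on a F : definable_term (fun e => F (e 0)) -> fn_on (lam a F) a.
Proof.
move=> HF; exists (image a F); apply: lam_fn => // x Hx.
by rewrite in_image //; exists x.
Qed.

Lemma lam_eq a F G : (forall x, x ∈ a -> F x = G x) -> lam a F = lam a G.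
Proof.
by move=> E; apply: compr_eq => z; split=> -[x [Hx ->]]; exists x; rewrite E.
Qed.

Lemma in_restrict f a b c z : fn f a b -> (z ∈ restrict f c) = (z ∈ f /\ pi1 z ∈ c).
Proof.
move=> Hf.
have -> : (z ∈ restrict f c) = (z ∈ f /\ exists x y, x ∈ c /\ z = ⟨x, y⟩).
  by apply: (in_compr (a := f)) => [|x []//]; dfn.
apply: propeq; split=> [[Hz [x [y [Hx E]]]]|[Hz Hc]].
  by split=> //; rewrite E pi1_pair.
split=> //; case: (Hf) => /(_ _ Hz) /prodP [E _ _] _; by exists (pi1 z), (pi2 z).
Qed.

Lemma restrict_fn f a b c : fn f a b -> c ⊆ a -> fn (restrict f c) c b.
Proof.
move=> Hf Hc; split=> [z|x Hx].
  rewrite (in_restrict _ _ Hf) => -[Hz H]; case: (Hf) => /(_ _ Hz) /prodP [E _ Hb] _.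
  by rewrite E pair_in_prod.
exists (f ∙ x); split.
  by rewrite (in_restrict _ _ Hf) pi1_pair; split=> //; apply: (app_in Hf); apply: Hc.
by move=> y; rewrite (in_restrict _ _ Hf) => -[/(appE Hf)].
Qed.

Lemma restrict_app f a b c x : fn f a b -> c ⊆ a -> x ∈ c -> restrict f c ∙ x = f ∙ x.
Proof.
move=> Hf Hc Hx; apply: (appE (restrict_fn Hf Hc)).
by rewrite (in_restrict _ _ Hf) pi1_pair; split=> //; apply: (app_in Hf); apply: Hc.
Qed.

Lemma restrict_ext f g a b b' c : fn f a b -> fn g a b' -> c ⊆ a ->
  (forall x, x ∈ c -> f ∙ x = g ∙ x) -> restrict f c = restrict g c.
Proof.
move=> Hf Hg Hc E; apply: (fn_ext (restrict_fn Hf Hc) (restrict_fn Hg Hc)) => x Hx.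
by rewrite (restrict_app Hf Hc Hx) (restrict_app Hg Hc Hx) E.
Qed.

Lemma in_succ a z : (z ∈ succ a) = (z ∈ a \/ z = a).
Proof.
apply: (@comprE _ (cup a (upair a a))) => x; rewrite in_cup in_upair; tauto.
Qed.

Lemma mem_irrefl a : ~ a ∈ a.
Proof.
move=> Ha; case: (zf_foundation HZF (a := upair a a)).
  by exists a; rewrite in_upair; auto.
move=> x []; rewrite in_upair => Hx /(_ a) H.
have E : x = a by case: Hx.
subst x.
by apply: H => //; rewrite in_upair; auto.
Qed.

Lemma mem_asym a b : a ∈ b -> ~ b ∈ a.
Proof.
move=> Hab Hba; case: (zf_foundation HZF (a := upair a b)).
  by exists a; rewrite in_upair; auto.
move=> x []; rewrite in_upair => -[] -> H.
  by apply: (H b) => //; rewrite in_upair; auto.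
by apply: (H a) => //; rewrite in_upair; auto.
Qed.

Lemma succ_inj a b : succ a = succ b -> a = b.
Proof.
move=> E.
have : a ∈ succ b by (rewrite -E in_succ; auto).
have : b ∈ succ a by (rewrite E in_succ; auto).
rewrite !in_succ => -[Hb|-> //] [Ha|//].
by case: (mem_asym Ha Hb).
Qed.

Lemma in_omega n : (n ∈ omega) =
  (forall I, emp ∈ I -> (forall x, x ∈ I -> succ x ∈ I) -> n ∈ I).
Proof.
case: (zf_infinity HZF) => a [[z [Hz Ez]] Ha].
apply: (in_compr (a := a)) => [|n' H]; first by dfn.
apply: H => [|x /Ha [x' [Hx' E]]].
  by have -> : emp = z by apply: (ext T) => x; rewrite in_emp; split=> // /Ez.
by have -> : succ x = x' by apply: (ext T) => u; rewrite in_succ (propeq (E u)).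
Qed.

Lemma emp_omega : emp ∈ omega. Proof. by rewrite in_omega => I H _. Qed.

Lemma succ_omega n : n ∈ omega -> succ n ∈ omega.
Proof. rewrite !in_omega => H I H1 H2; exact: H2 _ (H I H1 H2). Qed.

Lemma omega_ind P : definable (fun e => P (e 0)) -> P emp ->
  (forall n, n ∈ omega -> P n -> P (succ n)) -> forall n, n ∈ omega -> P n.
Proof.
move=> HP H0 HS n Hn.
case: (separation omega HP) => I HI.
have HnI : n ∈ I; last by move: HnI; rewrite HI => -[].
move: (Hn); rewrite in_omega => /(_ I); apply.
  by rewrite HI; split=> //; apply: emp_omega.
by move=> x; rewrite !HI => -[H1 H2]; split; [apply: succ_omega|apply: HS].
Qed.

Lemma omega_case n : n ∈ omega -> n = emp \/ exists m, m ∈ omega /\ n = succ m.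
Proof.
move: n; apply: omega_ind; [by dfn|by left|by move=> n Hn _; right; exists n].
Qed.

Lemma succ_not_emp n : succ n <> emp.
Proof.
move=> E; have : n ∈ succ n by (rewrite in_succ; auto).
by rewrite E in_emp.
Qed.

Lemma omega_trans n m : n ∈ omega -> m ∈ n -> m ∈ omega.
Proof.
move=> Hn; move: n Hn m; apply: omega_ind; first by dfn.
  by move=> m; rewrite in_emp.
by move=> n Hn IH m; rewrite in_succ => -[/IH|->].
Qed.

Lemma omega_mem_trans n m k : n ∈ omega -> m ∈ n -> k ∈ m -> k ∈ n.
Proof.
move=> Hn; move: n Hn m k; apply: omega_ind; first by dfn.
  by move=> m k; rewrite in_emp.
move=> n Hn IH m k; rewrite !in_succ => -[H1|->] H2; left=> //.
exact: IH H1 H2.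
Qed.

Lemma succ_mem n m : n ∈ omega -> m ∈ n -> succ m ∈ succ n.
Proof.
move=> Hn; move: n Hn m; apply: omega_ind; first by dfn.
  by move=> m; rewrite in_emp.
by move=> n Hn IH m; rewrite in_succ => -[/IH H|->]; rewrite (in_succ (succ n)); auto.
Qed.

Lemma emp_succ n : n ∈ omega -> emp ∈ succ n.
Proof.
move: n; apply: omega_ind; first by dfn.
  by rewrite in_succ; auto.
by move=> n Hn; rewrite (in_succ (succ n)); auto.
Qed.

Lemma omega_total n m : n ∈ omega -> m ∈ omega -> m ∈ n \/ m = n \/ n ∈ m.
Proof.
move=> Hn Hm; move: n Hn; apply: omega_ind; first by dfn.
  by case: (omega_case Hm) => [->|[k [Hk ->]]]; auto; right; right; apply: emp_succ.
move=> n Hn [H|[->|H]]; rewrite ?in_succ; auto.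
have := succ_mem Hm H; rewrite in_succ => -[]; auto.
Qed.

Lemma omega_sub n m : n ∈ omega -> m ∈ omega -> (m ⊆ n) = (m ∈ succ n).
Proof.
move=> Hn Hm; apply: propeq; rewrite in_succ; split.
  move=> H; case: (omega_total Hn Hm) => [|[]]; auto.
  by move=> /H /mem_irrefl.
by case=> [H k Hk|-> //]; apply: omega_mem_trans H Hk.
Qed.

Lemma sub_succ n : n ⊆ succ n.
Proof. by move=> x Hx; rewrite in_succ; auto. Qed.

Lemma in_succ_self n : n ∈ succ n.
Proof. by rewrite in_succ; auto. Qed.

Lemma omega_least P n : definable (fun e => P (e 0)) -> n ∈ omega -> P n ->
  exists m, [/\ m ∈ omega, P m & forall k, k ∈ m -> ~ P k].
Proof.
move=> HP Hn Pn.
case: (separation omega HP) => I HI.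
case: (zf_foundation HZF (a := I)) => [|m []]; first by exists n; rewrite HI.
rewrite HI => -[Hm Pm] H; exists m; split=> // k Hk Pk.
by apply: (H k) => //; rewrite HI; split=> //; apply: omega_trans Hk.
Qed.

Lemma omega_max n m : n ∈ omega -> m ∈ omega -> exists k, [/\ k ∈ omega, n ⊆ k & m ⊆ k].
Proof.
move=> Hn Hm; case: (classic (n ⊆ m)) => H; first by exists m.
exists n; split=> //; move: H; rewrite !omega_sub // !in_succ.
by case: (omega_total Hn Hm) => [|[->|]]; tauto.
Qed.

End Sets.

Arguments sub_refl {V T} a.
Arguments separation {V} T a P _.
Arguments in_compr {V T} a P _ _ z.
Arguments omega_ind {V T} P _ _ _ n _.
Arguments omega_least {V T} P {n} _ _ _.
Arguments sub_succ {V T} n.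
Arguments sub_trans {V T b a c} _ _.

#[export] Hint Resolve sub_refl emp_omega succ_omega in_succ_self emp_succ : core.

Section Recursion.

Context {V : Type} {T : model V}.
#[local] Hint Extern 0 (set_structure _) => exact (model_struct T) : typeclass_instances.

Variables (a : V) (F : V -> V -> V).
Hypothesis HF : definable_term (fun e => F (e 0) (e 1)).

Definition rec_graph (n h : V) : Prop := fn_on h (succ n) /\ h ∙ emp = a /\
  forall k, k ∈ n -> h ∙ succ k = F k (h ∙ k).

Lemma rec_graph_uniq n h h' : n ∈ omega -> rec_graph n h -> rec_graph n h' -> h = h'.
Proof.
move=> Hn [[b Hf] [H0 HS]] [[b' Hf'] [H0' HS']]; apply: (fn_ext Hf Hf') => x Hx.
have Hxo : x ∈ omega by apply: omega_trans (succ_omega Hn) Hx.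
move: x Hxo Hx; apply: omega_ind; first by dfn.
  by rewrite H0 H0'.
move=> m Hm IH; rewrite in_succ => Hm'.
have Hmn : m ∈ n.
  case: Hm' => [H|<-]; last exact: in_succ_self.
  exact: omega_mem_trans H (in_succ_self m).
by rewrite HS // HS' // IH // in_succ; auto.
Qed.

Lemma rec_graph_exists n : n ∈ omega -> exists h, rec_graph n h.
Proof.
move: n; apply: omega_ind; first by rewrite /rec_graph; dfn.
  exists (lam (succ emp) (fun _ => a)); split; last split.
  - by apply: lam_fn_on; dfn.
  - by rewrite lam_app.
  - by move=> k; rewrite in_emp.
move=> n Hn [h [[b Hf] [H0 HS]]].
pose (h' := cup h (upair ⟨succ n, F n (h ∙ n)⟩ ⟨succ n, F n (h ∙ n)⟩)).
have inh' z : (z ∈ h') = (z ∈ h \/ z = ⟨succ n, F n (h ∙ n)⟩).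
  by rewrite in_cup in_upair; apply: propeq; tauto.
have Hf' : fn h' (succ (succ n)) (cup b (upair (F n (h ∙ n)) (F n (h ∙ n)))).
  split=> [z|x].
    rewrite inh' => -[Hz|->]; last by (rewrite pair_in_prod in_succ in_cup in_upair; split; right; auto).
    have [E H1 H2] := prodP (proj1 Hf _ Hz).
    by rewrite E pair_in_prod in_succ in_cup; split; left.
  rewrite in_succ => -[Hx|->].
    exists (h ∙ x); split; first by rewrite inh'; left; apply: (app_in Hf Hx).
    move=> y; rewrite inh' => -[/(appE Hf) //|/opair_inj [E _]].
    by move: Hx; rewrite E => /mem_irrefl.
  exists (F n (h ∙ n)); split; first by rewrite inh'; auto.
  by move=> y; rewrite inh' => -[/(fn_dom Hf) /mem_irrefl //|/opair_inj [_ ->]].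
have old x : x ∈ succ n -> h' ∙ x = h ∙ x.
  by move=> Hx; apply: (appE Hf'); rewrite inh'; left; apply: (app_in Hf Hx).
exists h'; split; first by eexists; exact: Hf'.
split; first by rewrite old //; apply: emp_succ.
move=> k; rewrite in_succ => -[Hk|->].
  rewrite !old; [exact: HS|by rewrite in_succ; auto|exact: succ_mem].
rewrite (old n); last exact: in_succ_self.
by apply: (appE Hf'); rewrite inh'; auto.
Qed.

Lemma rec_unfold n h : n ∈ omega -> rec_graph n h -> rec a F n = h ∙ n.
Proof.
move=> Hn Hh; apply: theP; first by case: Hh => H1 [H2 H3]; exists h.
move=> y [h' [H1 [H2 [H3 ->]]]]; congr (app _ n).
by apply: (rec_graph_uniq Hn).
Qed.

Lemma rec0 : rec a F emp = a.
Proof.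
case: (rec_graph_exists emp_omega) => h Hh; rewrite (rec_unfold emp_omega Hh).
by case: Hh => _ [].
Qed.

Lemma recS n : n ∈ omega -> rec a F (succ n) = F n (rec a F n).
Proof.
move=> Hn; case: (rec_graph_exists (succ_omega Hn)) => h Hh.
rewrite (rec_unfold (succ_omega Hn) Hh).
case: (Hh) => [[b Hb] [H0 HS]]; rewrite HS; last exact: in_succ_self.
have Hsub : succ n ⊆ succ (succ n) by exact: sub_succ.
have Hr := restrict_fn Hb Hsub.
rewrite (rec_unfold Hn (h := restrict h (succ n))) ?(restrict_app Hb) //.
split; first by exists b.
split; first by rewrite (restrict_app Hb) //; apply: emp_succ.
move=> k Hk.
have Hk' : succ k ∈ succ n by apply: succ_mem.
rewrite !(restrict_app Hb) //; last by rewrite in_succ; auto.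
by apply: HS; rewrite in_succ; auto.
Qed.

End Recursion.

Tactic Notation "separate" constr(A) constr(P) "as" ident(W) ident(H) :=
  let X := fresh "X" in
  assert (X : definable (fun e => P (e 0))) by (cbv beta; dfn);
  destruct (separation _ A P X) as [W H]; clear X; cbv beta in H.

#[global] Opaque emp upair opair pi1 pi2 union pow cup cap diff Defs.prod app lam preim
  restrict succ omega rec image.

(** * Dependent choice and enumerations *)

Section PairingTerms.

Context {V : Type} {M : set_structure V}.

Definition snoc (f x y : V) : V := cup f (upair ⟨x, y⟩ ⟨x, y⟩).

Definition ite (P : Prop) (a b : V) : V :=
  the M (fun y => (P /\ y = a) \/ (~ P /\ y = b)).

Definition oadd (a b : V) : V := rec a (fun _ r => succ r) b.

(** One step of the walk along the antidiagonals of ω × ω: (a + 1, b) goes to (a, b + 1) and (0, b)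
    to (b + 1, 0). [union] is the predecessor. *)
Definition pair_step (q : V) : V :=
  ite (pi1 q = emp) ⟨succ (pi2 q), emp⟩ ⟨union (pi1 q), succ (pi2 q)⟩.

Definition unpair : V := lam omega (rec ⟨emp, emp⟩ (fun _ q => pair_step q)).

End PairingTerms.

Section Choice.

Context {V : Type} {T : model V}.
#[local] Hint Extern 0 (set_structure _) => exact (model_struct T) : typeclass_instances.

Lemma snoc_fn f n a y : n ∈ omega -> fn f n a -> y ∈ a ->
  [/\ fn (snoc f n y) (succ n) a, forall x, x ∈ n -> snoc f n y ∙ x = f ∙ x &
      snoc f n y ∙ n = y].
Proof.
move=> Hn Hf Hy.
have inh z : (z ∈ snoc f n y) = (z ∈ f \/ z = ⟨n, y⟩).
  by rewrite in_cup in_upair; apply: propeq; tauto.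
have H : fn (snoc f n y) (succ n) a.
  split=> [z|x].
    rewrite inh => -[Hz|->]; last by rewrite pair_in_prod.
    have [E H1 H2] := prodP (proj1 Hf _ Hz).
    by rewrite E pair_in_prod in_succ; split=> //; left.
  rewrite in_succ => -[Hx|->].
    exists (f ∙ x); split; first by rewrite inh; left; apply: app_in Hf Hx.
    move=> z; rewrite inh => -[/(appE Hf) //|/opair_inj [E _]].
    by move: Hx; rewrite E => /mem_irrefl.
  exists y; split; first by rewrite inh; right.
  by move=> z; rewrite inh => -[/(fn_dom Hf) /mem_irrefl //|/opair_inj [_ ->]].
split=> // [x Hx|]; apply: (appE H); rewrite inh; last by right.
by left; apply: app_in Hf Hx.
Qed.

Section Dependent.

Variables (a x0 : V) (P : V -> V -> Prop).
Hypothesis HP : definable (fun e => P (e 0) (e 1)).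

Definition chain n u := fn u (succ n) a /\ u ∙ emp = x0 /\
  forall k, k ∈ n -> P (u ∙ k) (u ∙ succ k).

Lemma definable_chain : definable (fun e => chain (e 0) (e 1)).
Proof. by rewrite /chain; dfn. Qed.

(** DC prescribes no initial value and speaks of a relation that is a set. It is applied to the set
    W of finite chains starting at x0, ordered by proper extension. Proper extension makes the
    domains grow, so the k-th chain is defined at k, and its value there no longer changes. *)
Lemma dependent_choice : x0 ∈ a -> (forall x, x ∈ a -> exists y, y ∈ a /\ P x y) ->
  exists f, [/\ fn f omega a, f ∙ emp = x0 & forall n, n ∈ omega -> P (f ∙ n) (f ∙ succ n)].
Proof.
have HC := definable_chain.
move=> Hx0 Hstep.
separate (pow (Defs.prod omega a)) (fun u => exists n, n ∈ omega /\ chain n u) as W inW.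
separate (Defs.prod W W) (fun p => pi1 p ⊆ pi2 p /\ pi1 p <> pi2 p) as r inr.
have chainW n u : n ∈ omega -> chain n u -> u ∈ W.
  move=> Hn Hu; rewrite inW; split; last by exists n.
  rewrite in_pow => z Hz; have [E H1 H2] := prodP (proj1 (proj1 Hu) _ Hz).
  by rewrite E pair_in_prod; split=> //; apply: omega_trans H1; apply: succ_omega.
case: (@model_DC _ T W r).
- exists (lam (succ emp) (fun _ => x0)); apply: (chainW emp) => //; split; last split.
  + exact: lam_fn.
  + by rewrite lam_app //; apply: emp_succ.
  + by move=> k; rewrite in_emp.
- move=> u Hu; move: (Hu); rewrite inW => -[_ [n [Hn [Hf [H0 HS]]]]].
  case: (Hstep (u ∙ n)) => [|y [Hy Py]]; first exact: fn_app Hf (in_succ_self n).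
  have [H1 H2 H3] := snoc_fn (succ_omega Hn) Hf Hy.
  have Hv : snoc u (succ n) y ∈ W.
    apply: (chainW (succ n)); first exact: succ_omega.
    split=> //; split; first by rewrite H2 //; apply: emp_succ.
    move=> k; rewrite in_succ => -[Hk|->]; last by rewrite H2 // H3.
    rewrite !H2; [exact: HS|exact: succ_mem|by rewrite in_succ; left].
  exists (snoc u (succ n) y); split=> //; rewrite inr pair_in_prod; split=> //.
  rewrite pi1_pair pi2_pair; split.
    by move=> z Hz; rewrite in_cup; left.
  move=> E; have := app_in H1 (in_succ_self _); rewrite -E => /(fn_dom Hf).
  exact: mem_irrefl.
move=> F [HF Hr].
have Hsub k : k ∈ omega -> F ∙ k ⊆ F ∙ succ k /\ F ∙ k <> F ∙ succ k.
  by move=> /Hr; rewrite inr pi1_pair pi2_pair => -[].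
have HFW k : k ∈ omega -> exists n, n ∈ omega /\ chain n (F ∙ k).
  by move=> /(fn_app HF); rewrite inW => -[].
have Hmono k j : k ∈ omega -> forall n, chain n (F ∙ k) -> j ∈ succ n -> F ∙ succ k ∙ j = F ∙ k ∙ j.
  move=> Hk n [Hn _] Hj; case: (HFW _ (succ_omega Hk)) => m [Hm [Hfm _]].
  by apply: (appE Hfm); apply: (proj1 (Hsub k Hk)); apply: app_in Hn Hj.
have Hdom k : k ∈ omega -> exists n, [/\ n ∈ omega, chain n (F ∙ k) & k ∈ succ n].
  move: k; apply: omega_ind; first by dfn.
    by case: (HFW emp emp_omega) => n [Hn Hc]; exists n; split=> //; apply: emp_succ.
  move=> k Hk [n [Hn Hc Hkn]]; case: (HFW _ (succ_omega Hk)) => m [Hm Hcm].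
  exists m; split=> //.
  have Hss : succ n ⊆ succ m.
    move=> j Hj; apply: (fn_dom (proj1 Hcm) (y := F ∙ k ∙ j)).
    by apply: (proj1 (Hsub k Hk)); apply: app_in (proj1 Hc) Hj.
  have Hnm : n ∈ m.
    have : n ∈ succ m by exact: Hss.
    rewrite in_succ => -[//|E]; case: (proj2 (Hsub k Hk)).
    rewrite -E in Hcm; apply: (fn_ext (proj1 Hc) (proj1 Hcm)) => j Hj.
    by rewrite (Hmono k j Hk n Hc Hj).
  apply: succ_mem => //; move: Hkn; rewrite in_succ => -[Hkn|-> //].
  exact: omega_mem_trans Hkn.
have Hd : definable_term (fun e => F ∙ (e 0) ∙ (e 0)) by dfn.
have Hv k : k ∈ omega -> F ∙ k ∙ k ∈ a.
  by move=> Hk; case: (Hdom k Hk) => n [Hn Hc Hkn]; apply: fn_app (proj1 Hc) Hkn.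
exists (lam omega (fun k => F ∙ k ∙ k)); split; first exact: lam_fn.
  rewrite lam_app //; case: (HFW emp emp_omega) => n [_ [_ [H _]]]; exact: H.
move=> k Hk; rewrite !lam_app //; last exact: succ_omega.
case: (Hdom k Hk) => n [Hn Hc Hkn].
case: (Hdom _ (succ_omega Hk)) => m [Hm Hcm Hkm].
rewrite -(Hmono k k Hk n Hc Hkn).
case: Hcm => _ [_]; apply.
move: Hkm; rewrite in_succ => -[H|<-]; last exact: in_succ_self.
exact: (omega_mem_trans Hm H (in_succ_self k)).
Qed.

End Dependent.

(** Dependent choice on pairs ⟨n, x⟩ whose first coordinate counts the stages. *)
Lemma countable_choice a (P : V -> V -> Prop) : definable (fun e => P (e 0) (e 1)) ->
  (forall n, n ∈ omega -> exists x, x ∈ a /\ P n x) ->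
  exists f, fn f omega a /\ forall n, n ∈ omega -> P n (f ∙ n).
Proof.
move=> HP H.
case: (H emp emp_omega) => x0 [Hx0 Px0].
have HD : definable (fun e => pi1 (e 1) = succ (pi1 (e 0)) /\ P (pi1 (e 1)) (pi2 (e 1))) by dfn.
case: (@dependent_choice (Defs.prod omega a) ⟨emp, x0⟩
   (fun p q => pi1 q = succ (pi1 p) /\ P (pi1 q) (pi2 q)) HD).
- by rewrite pair_in_prod.
- move=> p /prodP [E H1 H2]; case: (H _ (succ_omega H1)) => y [Hy Py].
  by exists ⟨succ (pi1 p), y⟩; rewrite pair_in_prod pi1_pair pi2_pair; split; first by split=> //; apply: succ_omega.
move=> f [Hf f0 fS].
have Hk k : k ∈ omega -> pi1 (f ∙ k) = k /\ P k (pi2 (f ∙ k)).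
  move: k; apply: omega_ind; first by dfn.
    by rewrite f0 pi1_pair pi2_pair.
  move=> k Hk [E _]; case: (fS k Hk) => E1 H1.
  by rewrite E1 E in H1 *.
exists (lam omega (fun k => pi2 (f ∙ k))); split.
  by apply: lam_fn => // k /(fn_app Hf) /prodP [].
by move=> k Hk'; rewrite lam_app //; apply: (proj2 (Hk k Hk')).
Qed.

Lemma ite_true (P : Prop) a b : P -> ite P a b = a.
Proof. by move=> H; apply: theP; [left|move=> y [[]|[]]]. Qed.

Lemma ite_false (P : Prop) a b : ~ P -> ite P a b = b.
Proof. by move=> H; apply: theP; [right|move=> y [[]|[]]]. Qed.

Lemma term_ite P a b : definable P -> definable_term a -> definable_term b ->
  definable_term (fun e => ite (P e) (a e) (b e)).
Proof. by move=> HP Ha Hb; rewrite /ite; dfn. Qed.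

End Choice.

Ltac dfn_sym3 ::=
  lazymatch goal with
  | |- definable_term (fun e => ite (@?P e) (@?a e) (@?b e)) => refine (@term_ite _ _ P a b _ _ _)
  end.

Section Pairing.

Context {V : Type} {T : model V}.
#[local] Hint Extern 0 (set_structure _) => exact (model_struct T) : typeclass_instances.

Lemma term_oadd a b : definable_term a -> definable_term b ->
  definable_term (fun e => oadd (a e) (b e)).
Proof. by move=> Ha Hb; rewrite /oadd; dfn. Qed.

Lemma oadd0 a : oadd a emp = a.
Proof. exact: rec0. Qed.

Lemma oaddS a b : b ∈ omega -> oadd a (succ b) = succ (oadd a b).
Proof. by move=> Hb; rewrite /oadd recS. Qed.

Lemma oadd_omega a b : a ∈ omega -> b ∈ omega -> oadd a b ∈ omega.
Proof.
move=> Ha; move: b; apply: omega_ind; first by rewrite /oadd; dfn.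
  by rewrite oadd0.
by move=> n Hn IH; rewrite oaddS //; apply: succ_omega.
Qed.

Lemma oSadd a b : b ∈ omega -> oadd (succ a) b = succ (oadd a b).
Proof.
move: b; apply: omega_ind; first by rewrite /oadd; dfn.
  by rewrite !oadd0.
by move=> n Hn IH; rewrite !oaddS // IH.
Qed.

Lemma o0add b : b ∈ omega -> oadd emp b = b.
Proof.
move: b; apply: omega_ind; first by rewrite /oadd; dfn.
  by rewrite oadd0.
by move=> n Hn IH; rewrite oaddS // IH.
Qed.

Lemma union_succ n : n ∈ omega -> union (succ n) = n.
Proof.
move=> Hn; apply: (ext T) => x; rewrite in_union; split.
  case=> b []; rewrite in_succ => -[Hb|-> //] Hx.
  exact: omega_mem_trans Hx.
by move=> Hx; exists n.
Qed.

Lemma unpair_rec n : n ∈ omega -> unpair ∙ n = rec ⟨emp, emp⟩ (fun _ q => pair_step q) n.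
Proof.
by move=> Hn; rewrite /unpair lam_app // /pair_step; dfn.
Qed.

Lemma unpairS n : n ∈ omega -> unpair ∙ succ n = pair_step (unpair ∙ n).
Proof.
move=> Hn; rewrite !unpair_rec //; last exact: succ_omega.
by rewrite recS // /pair_step; dfn.
Qed.

Lemma unpair_fn : fn unpair omega (Defs.prod omega omega).
Proof.
apply: lam_fn; first by rewrite /pair_step; dfn.
apply: omega_ind; first by rewrite /pair_step; dfn.
  by rewrite rec0 ?pair_in_prod // /pair_step; dfn.
move=> n Hn; rewrite -!unpair_rec //; last exact: succ_omega.
rewrite unpairS // => /prodP [E H1 H2].
case: (omega_case H1) => [H0|[m [Hm Em]]].
  by rewrite /pair_step ite_true // pair_in_prod; split=> //; apply: succ_omega.
rewrite /pair_step ite_false ?Em; last exact: succ_not_emp.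
by rewrite union_succ // pair_in_prod; split=> //; apply: succ_omega.
Qed.

(** The walk enters the antidiagonal of sum c + 1 from ⟨emp, c⟩, and d steps after ⟨c + d, emp⟩ it
    is at ⟨c, d⟩. *)
Lemma unpair_surj a b : a ∈ omega -> b ∈ omega ->
  exists n, n ∈ omega /\ unpair ∙ n = ⟨a, b⟩.
Proof.
have down c d : d ∈ omega -> c ∈ omega -> (exists n, n ∈ omega /\ unpair ∙ n = ⟨oadd c d, emp⟩) ->
    exists n, n ∈ omega /\ unpair ∙ n = ⟨c, d⟩.
  move=> Hd; move: d Hd c; apply: omega_ind; first by rewrite /oadd; dfn.
    by move=> c Hc; rewrite oadd0.
  move=> d Hd IH c Hc; rewrite oaddS // -oSadd // => /(IH _ (succ_omega Hc)) [n [Hn E]].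
  exists (succ n); split; first exact: succ_omega.
  rewrite unpairS // E /pair_step pi1_pair pi2_pair ite_false; last exact: succ_not_emp.
  by rewrite union_succ.
have diag c : c ∈ omega -> exists n, n ∈ omega /\ unpair ∙ n = ⟨c, emp⟩.
  move: c; apply: omega_ind; first by dfn.
    by exists emp; split=> //; rewrite unpair_rec // rec0 // /pair_step; dfn.
  move=> c Hc H; case: (down emp c Hc emp_omega) => [|n [Hn E]].
    by rewrite o0add.
  exists (succ n); split; first exact: succ_omega.
  by rewrite unpairS // E /pair_step pi1_pair pi2_pair ite_true.
by move=> Ha Hb; apply: down => //; apply: diag; apply: oadd_omega.
Qed.

Lemma countable_choice2 a (P : V -> V -> V -> Prop) :
  definable (fun e => P (e 0) (e 1) (e 2)) ->
  (forall n m, n ∈ omega -> m ∈ omega -> exists x, x ∈ a /\ P n m x) ->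
  exists f, fn f omega a /\ forall n m, n ∈ omega -> m ∈ omega ->
    exists k, k ∈ omega /\ P n m (f ∙ k).
Proof.
move=> HP H.
have HD : definable (fun e => P (pi1 (unpair ∙ e 0)) (pi2 (unpair ∙ e 0)) (e 1)).
  apply: (definable_subst (fun x e => P x (pi2 (unpair ∙ e 0)) (e 1)) (r := id)) => //.
  apply: (definable_subst (fun y e => P (e 0) y (e 2)) (r := id)) => //.
  exact: (definable_ren (r := fun n => match n with 0 => 1 | 1 => 0 | 2 => 3 | m => m end) HP).
case: (@countable_choice _ _ a (fun k x => P (pi1 (unpair ∙ k)) (pi2 (unpair ∙ k)) x) HD).
  by move=> k /(fn_app unpair_fn) /prodP [E H1 H2]; apply: H.
move=> f [Hf HPf]; exists f; split=> // n m Hn Hm.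
case: (unpair_surj Hn Hm) => k [Hk E]; exists k; split=> //.
by have := HPf k Hk; rewrite E pi1_pair pi2_pair.
Qed.

End Pairing.

Ltac dfn_sym3 ::=
  lazymatch goal with
  | |- definable_term (fun e => ite (@?P e) (@?a e) (@?b e)) => refine (@term_ite _ _ P a b _ _ _)
  | |- definable_term (fun e => oadd (@?a e) (@?b e)) => refine (@term_oadd _ _ a b _ _)
  end.

#[global] Opaque ite snoc pair_step unpair oadd.

Import Order.TTheory GRing.Theory Num.Theory.
Local Open Scope ring_scope.

(** * Arithmetic of the reals *)

Section Carrier.

Context {V : Type} {T : model V}.
#[local] Hint Extern 0 (set_structure _) => exact (model_struct T) : typeclass_instances.
Local Notation R := (model_reals T).

(** The reals of V as a Rocq type, turned into a mathcomp real field so that [lra] and [ring] do the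
    arithmetic. [rv] sends such a real to the element of V that it is, and [re] goes back. A
    real-valued function counts as definable when its composition with [rv] is. *)
Definition real_of (T' : model V) : Type := {x : V | @mem V (model_struct T') x (RR (model_reals T'))}.

Local Notation K := (real_of T).

Definition rv (x : K) : V := sval x.

Definition mk_real x (Hx : x ∈ RR R) : K := exist _ x Hx.

Lemma rv_in x : rv x ∈ RR R. Proof. exact: (proj2_sig x). Qed.

Lemma rv_inj : injective rv.
Proof.
move=> [x Hx] [y Hy]; rewrite /rv /= => E; subst y; congr exist.
exact: boolp.Prop_irrelevance.
Qed.

Let HF := model_field T.

Lemma zeroP : zero R ∈ RR R /\ forall x, x ∈ RR R -> plus R x (zero R) = x.
Proof.
case: (zero_exists HF) => z [Hz Ez].
suff -> : @zero V (model_struct T) R = z by split.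
apply: theP => [|y [Hy Ey]]; first by split.
by rewrite -(Ez y Hy) (plus_comm HF) // Ey.
Qed.

Lemma oneP : one R ∈ RR R /\ forall x, x ∈ RR R -> times R x (one R) = x.
Proof.
case: (one_exists HF) => z [Hz Ez].
suff -> : @one V (model_struct T) R = z by split.
apply: theP => [|y [Hy Ey]]; first by split.
by rewrite -(Ez y Hy) (times_comm HF) // Ey.
Qed.

Lemma plus_in x y : x ∈ RR R -> y ∈ RR R -> plus R x y ∈ RR R.
Proof. by move=> Hx Hy; apply: (fn_app (plus_fn HF)); rewrite pair_in_prod. Qed.

Lemma times_in x y : x ∈ RR R -> y ∈ RR R -> times R x y ∈ RR R.
Proof. by move=> Hx Hy; apply: (fn_app (times_fn HF)); rewrite pair_in_prod. Qed.

Lemma oppP x : x ∈ RR R -> opp R x ∈ RR R /\ plus R x (opp R x) = zero R.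
Proof.
move=> Hx; case: (opp_exists HF Hx) => z [Hz Ez].
suff -> : @opp V (model_struct T) R x = z by split.
apply: theP => [|y [Hy Ey]]; first by split.
have [H0 E0] := zeroP.
by rewrite -[y]E0 // -Ez (plus_assoc HF) // [plus R y x](plus_comm HF) // Ey (plus_comm HF) // E0.
Qed.

(* Sealed: conversion would otherwise unfold the arithmetic down to the axioms. *)
Lemma real_operations : {ops : ((K * K) * ((K -> K -> K) * (K -> K -> K) * (K -> K))) |
  [/\ rv ops.1.1 = zero R, rv ops.1.2 = one R,
      forall x y, rv (ops.2.1.1 x y) = plus R (rv x) (rv y),
      forall x y, rv (ops.2.1.2 x y) = times R (rv x) (rv y) &
      forall x, rv (ops.2.2 x) = opp R (rv x)]}.
Proof.
by exists ((mk_real (proj1 zeroP), mk_real (proj1 oneP)),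
  (fun x y => mk_real (plus_in (rv_in x) (rv_in y)),
   fun x y => mk_real (times_in (rv_in x) (rv_in y)),
   fun x => mk_real (proj1 (oppP (rv_in x))))).
Qed.

Definition k_zero : K := (sval real_operations).1.1.
Definition k_one : K := (sval real_operations).1.2.
Definition k_add : K -> K -> K := (sval real_operations).2.1.1.
Definition k_mul : K -> K -> K := (sval real_operations).2.1.2.
Definition k_opp : K -> K := (sval real_operations).2.2.

Lemma rv_k_zero : rv k_zero = zero R.
Proof. by rewrite /k_zero; case: real_operations => ops /= [] . Qed.
Lemma rv_k_one : rv k_one = one R.
Proof. by rewrite /k_one; case: real_operations => ops /= []. Qed.
Lemma rv_k_add x y : rv (k_add x y) = plus R (rv x) (rv y).
Proof. by rewrite /k_add; case: real_operations => ops /= []. Qed.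
Lemma rv_k_mul x y : rv (k_mul x y) = times R (rv x) (rv y).
Proof. by rewrite /k_mul; case: real_operations => ops /= []. Qed.
Lemma rv_k_opp x : rv (k_opp x) = opp R (rv x).
Proof. by rewrite /k_opp; case: real_operations => ops /= []. Qed.

Let kE := (rv_k_zero, rv_k_one, rv_k_add, rv_k_mul, rv_k_opp).

Lemma k_addA : associative k_add.
Proof. by move=> x y z; apply: rv_inj; rewrite !kE; apply: (plus_assoc HF); exact: rv_in. Qed.
Lemma k_addC : commutative k_add.
Proof. by move=> x y; apply: rv_inj; rewrite !kE; apply: (plus_comm HF); exact: rv_in. Qed.
Lemma k_add0 : left_id k_zero k_add.
Proof. by move=> x; rewrite k_addC; apply: rv_inj; rewrite !kE; apply: (proj2 zeroP); exact: rv_in. Qed.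
Lemma k_addN : left_inverse k_zero k_opp k_add.
Proof. by move=> x; rewrite k_addC; apply: rv_inj; rewrite !kE; apply: (proj2 (oppP _)); exact: rv_in. Qed.
Lemma k_mulA : associative k_mul.
Proof. by move=> x y z; apply: rv_inj; rewrite !kE; apply: (times_assoc HF); exact: rv_in. Qed.
Lemma k_mulC : commutative k_mul.
Proof. by move=> x y; apply: rv_inj; rewrite !kE; apply: (times_comm HF); exact: rv_in. Qed.
Lemma k_mul1 : left_id k_one k_mul.
Proof. by move=> x; rewrite k_mulC; apply: rv_inj; rewrite !kE; apply: (proj2 oneP); exact: rv_in. Qed.
Lemma k_mulDl : left_distributive k_mul k_add.
Proof.
move=> x y z; rewrite ![k_mul _ z]k_mulC; apply: rv_inj; rewrite !kE.
by apply: (distributive HF); exact: rv_in.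
Qed.

HB.instance Definition _ := boolp.gen_eqMixin K.
HB.instance Definition _ := boolp.gen_choiceMixin K.

Lemma k_one_neq0 : k_one != k_zero.
Proof. by apply/eqP => E; apply: (zero_neq_one HF); rewrite -rv_k_one E rv_k_zero. Qed.

HB.instance Definition _ := GRing.isZmodule.Build K k_addA k_addC k_add0 k_addN.
HB.instance Definition _ := GRing.Zmodule_isComNzRing.Build K
  k_mulA k_mulC k_mul1 k_mulDl k_one_neq0.

Lemma k_inv_ex (x : K) : exists y : K, (x != 0 -> y * x = 1) /\ (x = 0 -> y = 0).
Proof.
case: (eqVneq x 0) => [->|Hx]; first by exists 0.
case: (inv_exists HF (rv_in x)) => [E|y [Hy Ey]].
  by move/eqP: Hx; apply; apply: rv_inj; rewrite E rv_k_zero.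
exists (mk_real Hy); split=> [_|E]; last by rewrite E eqxx in Hx.
by rewrite mulrC; apply: rv_inj; rewrite rv_k_mul rv_k_one.
Qed.

Lemma k_inverse : {inv : K -> K | (forall x, x != 0 -> inv x * x = 1) /\ inv 0 = 0}.
Proof.
exists (fun x => proj1_sig (constructive_indefinite_description _ (k_inv_ex x))); split=> [x|];
  by case: constructive_indefinite_description => y /= [H1 H2] //; apply: H2.
Qed.

Definition k_inv : K -> K := sval k_inverse.

Lemma k_mulV (x : K) : x != 0 -> k_inv x * x = 1.
Proof. by rewrite /k_inv; case: k_inverse => inv /= [H _]; exact: H. Qed.
Lemma k_inv0 : k_inv 0 = 0.
Proof. by rewrite /k_inv; case: k_inverse => inv /= []. Qed.

HB.instance Definition _ := GRing.ComNzRing_isField.Build K (@k_mulV) k_inv0.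

Lemma k_order : {l : K -> K -> bool | forall x y, l x y <-> le R (rv x) (rv y)}.
Proof.
exists (fun x y => if excluded_middle_informative (le R (rv x) (rv y)) then true else false).
by move=> x y; case: excluded_middle_informative.
Qed.

Definition k_le : K -> K -> bool := sval k_order.

Lemma k_leP x y : k_le x y <-> le R (rv x) (rv y).
Proof. by rewrite /k_le; case: k_order. Qed.

Definition k_norm (x : K) : K := if k_le 0 x then x else - x.

Lemma k_le_add2r x y z : k_le x y -> k_le (x + z) (y + z).
Proof. by move/k_leP => H; apply/k_leP; rewrite !rv_k_add; apply: (le_plus HF) => //; exact: rv_in. Qed.

Lemma k_le0_add x y : k_le 0 x -> k_le 0 y -> k_le 0 (x + y).
Proof.
move=> Hx Hy; apply/k_leP; apply: (Defs.le_trans HF (y := rv y)); first by apply/k_leP.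
by apply/k_leP; rewrite -{1}[y]add0r; apply: k_le_add2r.
Qed.

Lemma k_le0_mul x y : k_le 0 x -> k_le 0 y -> k_le 0 (x * y).
Proof.
move=> /k_leP Hx /k_leP Hy; apply/k_leP; move: Hx Hy; rewrite rv_k_mul rv_k_zero.
exact: (le_times HF).
Qed.

Lemma k_le0_anti x : k_le 0 x -> k_le x 0 -> x = 0.
Proof. by move=> /k_leP Hx /k_leP Hy; apply: rv_inj; apply: (le_antisym HF). Qed.

Lemma k_sub_ge0 x y : k_le 0 (y - x) = k_le x y.
Proof.
apply/idP/idP => [/(@k_le_add2r _ _ x)|/(@k_le_add2r _ _ (- x))].
  by rewrite add0r subrK.
by rewrite subrr.
Qed.

Lemma k_le_total x : k_le 0 x || k_le x 0.
Proof. by case: (Defs.le_total HF (rv_in 0) (rv_in x)) => /k_leP ->; rewrite ?orbT. Qed.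

Lemma k_normN x : k_norm (- x) = k_norm x.
Proof.
rewrite /k_norm -{1}[- x]add0r k_sub_ge0.
case: (boolP (k_le x 0)) (k_le_total x) => Hx; case: (boolP (k_le 0 x)) => Hx' //= _.
  by rewrite (k_le0_anti Hx' Hx) oppr0.
by rewrite opprK.
Qed.

Lemma k_ge0_norm x : k_le 0 x -> k_norm x = x.
Proof. by rewrite /k_norm => ->. Qed.

HB.instance Definition _ := Num.IntegralDomain_isLeReal.Build K
  (@k_le0_add) (@k_le0_mul) (@k_le0_anti) k_sub_ge0 k_le_total k_normN (@k_ge0_norm) (fun _ _ => erefl).

Lemma rv_le (x y : K) : (x <= y) = (le R (rv x) (rv y)) :> Prop.
Proof. by apply: propeq; apply: k_leP. Qed.

(** The value off the reals is fixed to be 0 so that [rv (re x)] is a definable function of x. *)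
Lemma real_retraction : {r : V -> K |
  (forall x, r (rv x) = x) /\ (forall x, ~ x ∈ RR R -> r x = 0)}.
Proof.
exists (fun x => match excluded_middle_informative (x ∈ RR R) with
                 | left H => mk_real H | right _ => 0 end).
split=> x; case: excluded_middle_informative => [H|] //; first exact: rv_inj.
by case; exact: rv_in.
Qed.

Definition re : V -> K := sval real_retraction.

Lemma re_rv x : re (rv x) = x.
Proof. by rewrite /re; case: real_retraction => r /= []. Qed.

Lemma rv_re x : x ∈ RR R -> rv (re x) = x.
Proof. by move=> Hx; rewrite -[x in LHS]/(rv (mk_real Hx)) re_rv. Qed.

Lemma re_junk x : ~ x ∈ RR R -> re x = 0.
Proof. by rewrite /re; case: real_retraction => r /= [_ H]; exact: H. Qed.

Lemma rv_plus x y : rv (x + y) = plus R (rv x) (rv y). Proof. exact: rv_k_add. Qed.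
Lemma rv_times x y : rv (x * y) = times R (rv x) (rv y). Proof. exact: rv_k_mul. Qed.
Lemma rv_opp x : rv (- x) = opp R (rv x). Proof. exact: rv_k_opp. Qed.
Lemma rv_minus x y : rv (x - y) = minus R (rv x) (rv y).
Proof. by rewrite rv_plus rv_opp. Qed.
Lemma rv_zero : rv 0 = zero R. Proof. exact: rv_k_zero. Qed.
Lemma rv_one : rv 1 = one R. Proof. exact: rv_k_one. Qed.

End Carrier.

Ltac dfn_real_hyp1 :=
  lazymatch goal with
  | |- definable_term (fun e => rv (?F (@?a e))) =>
      match goal with
      | H : definable_term (fun e => rv (F (e 0%N))) |- _ =>
          refine (@term_subst _ _ (fun x _ => rv (F x)) a id H _)
      | H : definable_term (fun e => rv (F e)) |- _ => refine (term_ren H)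
      end
  end.

Ltac dfn_real_hyp2 :=
  lazymatch goal with
  | |- definable_term (fun e => rv (?F (@?a e) (@?b e))) =>
      match goal with
      | H : definable_term (fun e => rv (F (e 0%N) (e 1%N))) |- _ =>
          refine (@term_subst2 _ _ (fun x y => rv (F x y)) a b H _ _)
      | H : definable_term (fun e => rv (F (fun n => e n.+1) (e 0%N))) |- _ =>
          refine (@term_subst _ _ (fun x e => rv (F e x)) b _ H _)
      end
  end.

Ltac dfn_real_hyp3 :=
  lazymatch goal with
  | |- definable_term (fun e => rv (?F _ (@?a e) (@?b e))) =>
      match goal with
      | H : definable_term (fun e => rv (F (fun n => e n.+2) (e 1%N) (e 0%N))) |- _ =>
          refine (@term_subst3 _ _ (fun e x y => rv (F e x y)) a b _ H _ _)
      end
  end.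

Ltac dfn_real_krec :=
  lazymatch goal with
  | |- definable_term (fun e => rv (?F (@?a e) (re (@?b e)))) =>
      match goal with
      | H : definable_term (fun e => rv (F (e 0%N) (re (e 1%N)))) |- _ =>
          refine (@term_subst2 _ _ (fun x y => rv (F x (re y))) a b H _ _)
      end
  | |- definable_term (fun e => rv (?F _ (@?a e) (re (@?b e)))) =>
      match goal with
      | H : definable_term (fun e => rv (F (fun n => e n.+2) (e 1%N) (re (e 0%N)))) |- _ =>
          refine (@term_subst3 _ _ (fun e x y => rv (F e x (re y))) a b _ H _ _)
      end
  end.

Ltac dfn_real_hyp := first [ dfn_real_hyp1 | dfn_real_hyp2 | dfn_real_hyp3 | dfn_real_krec ].

Ltac dfn_real ::= dfn_real_hyp.

(** * Definability of real-valued terms *)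

Section RealTerms.

Context {V : Type} {T : model V}.
#[local] Hint Extern 0 (set_structure _) => exact (model_struct T) : typeclass_instances.
Local Notation R := (model_reals T).
Local Notation K := (real_of T).
Implicit Types (a b : (nat -> V) -> K).

Lemma reE x : rv (re x : K) = ite (x ∈ RR R) x (zero R).
Proof.
case: (classic (x ∈ RR R)) => H; first by rewrite ite_true // rv_re.
by rewrite ite_false // re_junk // rv_zero.
Qed.

Lemma term_re (t : (nat -> V) -> V) : definable_term t -> definable_term (fun e => rv (re (t e) : K)).
Proof.
move=> Ht; have -> : (fun e => rv (re (t e) : K)) = fun e => ite (t e ∈ RR R) (t e) (zero R).
  by apply: funeq => e; exact: reE.
dfn.
Qed.

Lemma definable_real_le a b : definable_term (fun e => rv (a e)) -> definable_term (fun e => rv (b e)) ->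
  definable (fun e => a e <= b e).
Proof.
move=> Ha Hb; have -> : (fun e => is_true (a e <= b e)) = fun e => le R (rv (a e)) (rv (b e)).
  by apply: funeq => e; exact: rv_le.
by dfn.
Qed.

Lemma definable_real_eq a b : definable_term (fun e => rv (a e)) -> definable_term (fun e => rv (b e)) ->
  definable (fun e => a e = b e).
Proof.
move=> Ha Hb; apply: (@definable_iff _ _ (fun e => rv (a e) = rv (b e))); last by dfn.
by move=> e; split=> [/rv_inj|->].
Qed.

Lemma definable_real_lt a b : definable_term (fun e => rv (a e)) -> definable_term (fun e => rv (b e)) ->
  definable (fun e => a e < b e).
Proof.
move=> Ha Hb; apply: (@definable_iff _ _ (fun e => a e <> b e /\ a e <= b e)).
  by move=> e; rewrite lt_neqAle; split=> [[/eqP -> ->]|/andP [/eqP]].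
apply: definable_and; last exact: definable_real_le.
by apply: definable_not; apply: definable_real_eq.
Qed.

Lemma term_real_add a b : definable_term (fun e => rv (a e)) -> definable_term (fun e => rv (b e)) ->
  definable_term (fun e => rv (a e + b e)).
Proof.
move=> Ha Hb; have -> : (fun e => rv (a e + b e)) = fun e => plus R (rv (a e)) (rv (b e)).
  by apply: funeq => e; exact: rv_plus.
by rewrite /plus; dfn.
Qed.

Lemma term_real_mul a b : definable_term (fun e => rv (a e)) -> definable_term (fun e => rv (b e)) ->
  definable_term (fun e => rv (a e * b e)).
Proof.
move=> Ha Hb; have -> : (fun e => rv (a e * b e)) = fun e => times R (rv (a e)) (rv (b e)).
  by apply: funeq => e; exact: rv_times.
by rewrite /times; dfn.
Qed.

Lemma term_real_opp a : definable_term (fun e => rv (a e)) -> definable_term (fun e => rv (- a e)).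
Proof.
move=> Ha; have -> : (fun e => rv (- a e)) = fun e => opp R (rv (a e)).
  by apply: funeq => e; exact: rv_opp.
by rewrite /opp /plus; dfn.
Qed.

(** A real obtained by any choice in Rocq becomes definable once a formula singles it out. *)
Lemma term_real_the (P : (nat -> V) -> V -> Prop) a :
  definable (fun e => P (fun n => e n.+1) (e 0%N)) ->
  (forall e, P e (rv (a e)) /\ forall y, P e y -> y = rv (a e)) ->
  definable_term (fun e => rv (a e)).
Proof.
move=> HP H; have -> : (fun e => rv (a e)) = fun e => the (model_struct T) (P e).
  by apply: funeq => e; symmetry; case: (H e) => H1 H2; apply: theP.
by dfn.
Qed.

(** Since [re] is onto, a quantifier over the field is a quantifier over V. *)
Lemma definable_all_real (P : K -> (nat -> V) -> Prop) :
  definable (fun e => P (re (e 0%N)) (fun n => e n.+1)) -> definable (fun e => forall x, P x e).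
Proof.
move=> H; apply: definable_iff (definable_all (P := fun x e => P (re x) e) H) => e.
by split=> Hx x; [rewrite -(re_rv x)|]; exact: Hx.
Qed.

Lemma definable_ex_real (P : K -> (nat -> V) -> Prop) :
  definable (fun e => P (re (e 0%N)) (fun n => e n.+1)) -> definable (fun e => exists x, P x e).
Proof.
move=> H; apply: definable_iff (definable_ex (P := fun x e => P (re x) e) H) => e.
by split=> -[x Hx]; [exists (re x)|exists (rv x); rewrite re_rv].
Qed.

Lemma term_real_if (P : (nat -> V) -> bool) a b : definable P ->
  definable_term (fun e => rv (a e)) -> definable_term (fun e => rv (b e)) ->
  definable_term (fun e => rv (if P e then a e else b e)).
Proof.
move=> HP Ha Hb.
have -> : (fun e => rv (if P e then a e else b e)) = fun e => ite (P e) (rv (a e)) (rv (b e)).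
  by apply: funeq => e; case: ifP => H; [rewrite ite_true|rewrite ite_false // H].
dfn.
Qed.

End RealTerms.

Ltac dfn_real ::= first [ dfn_real_hyp |
  lazymatch goal with
  | |- definable_term (fun e => rv (re (@?a e))) => refine (@term_re _ _ a _)
  | |- definable_term (fun e => rv (GRing.add (@?a e) (@?b e))) => refine (@term_real_add _ _ a b _ _)
  | |- definable_term (fun e => rv (GRing.mul (@?a e) (@?b e))) => refine (@term_real_mul _ _ a b _ _)
  | |- definable_term (fun e => rv (GRing.opp (@?a e))) => refine (@term_real_opp _ _ a _)
  | |- definable_term (fun e => rv (Order.max (@?a e) (@?b e))) => unfold Order.max
  | |- definable_term (fun e => rv (Order.min (@?a e) (@?b e))) => unfold Order.min
  | |- definable_term (fun e => rv (match (@?P e) with true => (@?a e) | false => (@?b e) end)) =>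
      refine (@term_real_if _ _ P a b _ _ _)
  | |- definable (fun e => is_true (Order.le (@?a e) (@?b e))) => refine (@definable_real_le _ _ a b _ _)
  | |- definable (fun e => is_true (Order.lt (@?a e) (@?b e))) => refine (@definable_real_lt _ _ a b _ _)
  | |- definable (fun e => @eq _ (@?a e) (@?b e)) => refine (@definable_real_eq _ _ a b _ _)
  | |- definable (fun e => forall x, @?P e x) => refine (@definable_all_real _ _ (fun x e => P e x) _)
  | |- definable (fun e => ex (@?P e)) => refine (@definable_ex_real _ _ (fun x e => P e x) _)
  end ].

Section RealInverse.

Context {V : Type} {T : model V}.
#[local] Hint Extern 0 (set_structure _) => exact (model_struct T) : typeclass_instances.
Local Notation K := (real_of T).

Lemma term_real_inv (a : (nat -> V) -> K) : definable_term (fun e => rv (a e)) -> definable_term (fun e => rv (a e)^-1).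
Proof.
move=> Ha.
have HD : definable (fun e => exists x : K, (a (fun n => e n.+1) = 0 /\ x = 0 \/
    a (fun n => e n.+1) <> 0 /\ x * a (fun n => e n.+1) = 1) /\ e 0%N = rv x) by dfn.
apply: (@term_real_the _ _ (fun e y => exists x : K, (a e = 0 /\ x = 0 \/
    a e <> 0 /\ x * a e = 1) /\ y = rv x) (fun e => (a e)^-1)) => // e; split.
  exists (a e)^-1; split=> //; case: (eqVneq (a e) 0) => [->|H]; first by rewrite invr0; left.
  by right; rewrite mulVf //; split=> //; apply/eqP.
move=> y [x [[[E ->]|[/eqP E1 E2]] ->]]; first by rewrite E invr0.
by congr rv; apply: (mulIf E1); rewrite mulVf.
Qed.

End RealInverse.

#[global] Opaque re.

Ltac dfn_sym4 ::=
  lazymatch goal with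
  | |- definable_term (fun e => rv (GRing.inv (@?a e))) => refine (@term_real_inv _ _ a _)
  end.

(** * Recursion, sums and limits of reals *)

Section RealSequences.

Context {V : Type} {T : model V}.
#[local] Hint Extern 0 (set_structure _) => exact (model_struct T) : typeclass_instances.
Local Notation K := (real_of T).
Implicit Types (F G : V -> K) (n m k : V).

Lemma real_recursion : {f : K -> (V -> K -> K) -> V -> K |
  forall a (F : V -> K -> K) n, f a F n = re (rec (rv a) (fun k r => rv (F k (re r))) n)}.
Proof. by exists (fun a (F : V -> K -> K) n => re (rec (rv a) (fun k r => rv (F k (re r))) n)). Qed.

Definition krec : K -> (V -> K -> K) -> V -> K := sval real_recursion.

Lemma krecE a (F : V -> K -> K) n : krec a F n = re (rec (rv a) (fun k r => rv (F k (re r))) n).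
Proof. by rewrite /krec; case: real_recursion. Qed.

Lemma term_krec (a : (nat -> V) -> K) (F : (nat -> V) -> V -> K -> K) (n : (nat -> V) -> V) :
  definable_term (fun e => rv (a e)) ->
  definable_term (fun e => rv (F (fun i => e i.+2) (e 1%N) (re (e 0%N)))) -> definable_term n ->
  definable_term (fun e => rv (krec (a e) (F e) (n e))).
Proof.
move=> Ha HF Hn.
have -> : (fun e => rv (krec (a e) (F e) (n e))) =
    fun e => rv (re (rec (rv (a e)) (fun k r => rv (F e k (re r))) (n e)) : K).
  by apply: funeq => e; rewrite krecE.
by dfn.
Qed.

Section Krec.
Variables (a : K) (F : V -> K -> K).
Hypothesis HF : definable_term (fun e => rv (F (e 0%N) (re (e 1%N)))).

Lemma krec0 : krec a F emp = a.
Proof. by rewrite krecE rec0 // re_rv. Qed.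

Lemma krecS n : n ∈ omega -> krec a F (succ n) = F n (krec a F n).
Proof. by move=> Hn; rewrite !krecE recS // re_rv. Qed.
End Krec.

Definition ksum n F : K := krec 0 (fun k r => r + F k) n.

Lemma ksum0 F : definable_term (fun e => rv (F (e 0%N))) -> ksum emp F = 0.
Proof. by move=> HF; rewrite /ksum krec0. Qed.

Lemma ksumS F n : definable_term (fun e => rv (F (e 0%N))) -> n ∈ omega ->
  ksum (succ n) F = ksum n F + F n.
Proof. by move=> HF Hn; rewrite /ksum krecS. Qed.

Lemma term_ksum (n : (nat -> V) -> V) (F : (nat -> V) -> V -> K) : definable_term n ->
  definable_term (fun e => rv (F (fun i => e i.+1) (e 0%N))) ->
  definable_term (fun e => rv (ksum (n e) (F e))).
Proof.
move=> Hn HF; rewrite /ksum; apply: (@term_krec (fun=> 0) (fun e k r => r + F e k)) => //; dfn.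
Qed.

End RealSequences.

#[global] Opaque krec ksum.

Ltac dfn_sym4 ::=
  lazymatch goal with
  | |- definable_term (fun e => rv (GRing.inv (@?a e))) => refine (@term_real_inv _ _ a _)
  | |- definable_term (fun e => rv (krec (@?a e) (@?F e) (@?n e))) => refine (@term_krec _ _ a F n _ _ _)
  | |- definable_term (fun e => rv (ksum (@?n e) (@?F e))) => refine (@term_ksum _ _ n F _ _)
  end.

Section Sums.

Context {V : Type} {T : model V}.
#[local] Hint Extern 0 (set_structure _) => exact (model_struct T) : typeclass_instances.
Local Notation R := (model_reals T).
Local Notation K := (real_of T).
Implicit Types (F G : V -> K) (n m k : V) (x y : K).
Local Notation re := (@re V T).
Local Notation rv := (@rv V T).
Local Notation dK F := (definable_term (fun e => rv (F (e 0%N)))).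

Lemma ksum_ext n F G : n ∈ omega -> dK F -> dK G ->
  (forall k, k ∈ n -> F k = G k) -> ksum n F = ksum n G.
Proof.
move=> Hn HF HG; move: n Hn; apply: omega_ind; first by dfn.
  by rewrite !ksum0.
move=> n Hn IH H; rewrite !ksumS // H // IH // => k Hk.
by apply: H; rewrite in_succ; left.
Qed.

Lemma ksum_le n F G : n ∈ omega -> dK F -> dK G ->
  (forall k, k ∈ n -> F k <= G k) -> ksum n F <= ksum n G.
Proof.
move=> Hn HF HG; move: n Hn; apply: omega_ind; first by dfn.
  by rewrite !ksum0.
move=> n Hn IH H; rewrite !ksumS //; apply: lerD; last exact: H.
by apply: IH => k Hk; apply: H; rewrite in_succ; left.
Qed.

Lemma ksum_add n F G : n ∈ omega -> dK F -> dK G ->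
  ksum n (fun k => F k + G k) = ksum n F + ksum n G.
Proof.
move=> Hn HF HG; move: n Hn; apply: omega_ind; first by dfn.
  by rewrite !ksum0 // addr0.
by move=> n Hn IH; rewrite !ksumS // IH; ring.
Qed.

Lemma ksum_mul n F x : n ∈ omega -> dK F -> ksum n (fun k => x * F k) = x * ksum n F.
Proof.
move=> Hn HF; move: n Hn; apply: omega_ind; first by dfn.
  by rewrite !ksum0 // mulr0.
by move=> n Hn IH; rewrite !ksumS // IH; ring.
Qed.

Lemma ksum_zero n F : n ∈ omega -> dK F -> (forall k, k ∈ n -> F k = 0) -> ksum n F = 0.
Proof.
move=> Hn HF; move: n Hn; apply: omega_ind; first by dfn.
  by rewrite !ksum0.
move=> n Hn IH H; rewrite ksumS // H // IH ?addr0 // => k Hk.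
by apply: H; rewrite in_succ; left.
Qed.

Lemma ksum_ge0 n F : n ∈ omega -> dK F -> (forall k, k ∈ n -> 0 <= F k) -> 0 <= ksum n F.
Proof.
move=> Hn HF H; rewrite -(@ksum_zero n (fun=> 0)) //.
by apply: ksum_le.
Qed.

Lemma ksum_exchange n m (F : V -> V -> K) : n ∈ omega -> m ∈ omega ->
  definable_term (fun e => rv (F (e 0%N) (e 1%N))) ->
  ksum n (fun i => ksum m (fun j => F i j)) = ksum m (fun j => ksum n (fun i => F i j)).
Proof.
move=> Hn Hm HF; move: n Hn; apply: omega_ind; first by dfn.
  by rewrite ksum0 // ksum_zero // => k Hk; rewrite ksum0.
move=> n Hn IH; rewrite ksumS // IH -ksum_add //.
by apply: ksum_ext => // k Hk; rewrite ksumS.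
Qed.

(** The embedding of omega into the field. *)
Definition kn n : K := ksum n (fun=> 1).

Lemma term_kn (n : (nat -> V) -> V) : definable_term n -> definable_term (fun e => rv (kn (n e))).
Proof. by move=> Hn; rewrite /kn; dfn. Qed.

Lemma kn0 : kn emp = 0. Proof. by rewrite /kn ksum0. Qed.

Lemma knS n : n ∈ omega -> kn (succ n) = kn n + 1.
Proof. by move=> Hn; rewrite /kn ksumS. Qed.

Lemma kn_ge0 n : n ∈ omega -> 0 <= kn n.
Proof. by move=> Hn; apply: ksum_ge0 => // k _; apply: ler01. Qed.

(** Completeness concerns sets of V, so P has to cut out a set of reals by Separation; an arbitrary
    predicate on the type of reals would not do. *)
Lemma sup_exists (P : K -> Prop) : definable (fun e => P (re (e 0%N))) ->
  (exists x, P x) -> (exists u, forall x, P x -> x <= u) ->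
  exists s, (forall x, P x -> x <= s) /\ forall u, (forall x, P x -> x <= u) -> s <= u.
Proof.
move=> HP [x0 Px0] [u Hu].
separate (RR R) (fun v => P (re v)) as a ina.
have inaP v : v ∈ a -> exists2 x, v = rv x & P x.
  by rewrite ina => -[Hv Pv]; exists (re v); rewrite ?rv_re.
have Pina x : P x -> rv x ∈ a.
  by move=> Px; rewrite ina re_rv; split=> //; exact: rv_in.
case: (@lub_exists _ _ _ (model_field T) a).
- by move=> v; rewrite ina => -[].
- by exists (rv x0); apply: Pina.
- exists (rv u); split; first exact: rv_in.
  by move=> v /inaP [x -> Px]; rewrite -rv_le; apply: Hu.
move=> s [Hs [H1 H2]]; exists (re s); split=> [x Px|y Hy].
  by rewrite rv_le rv_re //; apply: H1; apply: Pina.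
rewrite rv_le rv_re //; apply: H2; first exact: rv_in.
by move=> v /inaP [x -> Px]; rewrite -rv_le; apply: Hy.
Qed.

Lemma archimedean x : exists n, n ∈ omega /\ x < kn n.
Proof.
apply: NNPP => H.
case: (@sup_exists (fun y => exists n, n ∈ omega /\ y = kn n)).
- by rewrite /kn; dfn.
- by exists (kn emp), emp.
- exists x => y [n [Hn ->]]; rewrite leNgt; apply/negP => Hx; apply: H; by exists n.
move=> s [H1 H2].
have : s <= s - 1.
  apply: H2 => y [n [Hn ->]].
  have : kn n + 1 <= s by apply: H1; exists (succ n); rewrite knS; auto.
  lra.
lra.
Qed.

(** The numbers 3^-n are used as the sequence of all epsilons and as the digits of the Cantor-like
    code, where a base above 2 keeps the code injective. *)
Definition p3 n : K := krec 1 (fun _ r => r / 3) n.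

Lemma term_p3 (n : (nat -> V) -> V) : definable_term n -> definable_term (fun e => rv (p3 (n e))).
Proof. by move=> Hn; rewrite /p3; dfn. Qed.

Lemma p30 : p3 emp = 1. Proof. by rewrite /p3 krec0. Qed.
Lemma p3S n : n ∈ omega -> p3 (succ n) = p3 n / 3.
Proof. by move=> Hn; rewrite /p3 krecS. Qed.

Lemma p3_gt0 n : n ∈ omega -> 0 < p3 n.
Proof.
move: n; apply: omega_ind; first by rewrite /p3; dfn.
  by rewrite p30 ltr01.
by move=> n Hn IH; rewrite p3S //; lra.
Qed.

(** The first bound turns the Archimedean property into the convergence of 3^-n to 0; the second
    carries the induction. *)
Lemma p3_kn n : n ∈ omega -> kn n * p3 n <= 1 /\ p3 n <= 1.
Proof.
move: n; apply: omega_ind; first by rewrite /p3 /kn; dfn.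
  by rewrite kn0 p30; split; lra.
move=> n Hn [H1 H2]; rewrite knS // p3S //.
by have := p3_gt0 Hn; split; nra.
Qed.

Lemma p3_small x : 0 < x -> exists n, n ∈ omega /\ p3 n < x.
Proof.
move=> Hx; case: (archimedean x^-1) => n [Hn Hxn]; exists n; split=> //.
have [H _] := p3_kn Hn; have H0 := p3_gt0 Hn.
rewrite ltNge; apply/negP => Hle.
have : 1 < kn n * x.
  by rewrite -ltr_pdivrMr // mul1r.
have := kn_ge0 Hn; nra.
Qed.

(** If n codes (a, (b, l)), this is (a - b) 3^-l: an enumeration of the triadic rationals. *)
Definition rational n : K :=
  (kn (pi1 (unpair ∙ n)) - kn (pi1 (unpair ∙ (pi2 (unpair ∙ n))))) *
  p3 (pi2 (unpair ∙ (pi2 (unpair ∙ n)))).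

Lemma term_rational (n : (nat -> V) -> V) : definable_term n ->
  definable_term (fun e => rv (rational (n e))).
Proof. by move=> Hn; rewrite /rational /kn /p3; dfn. Qed.

(** With 3^-l < y - x, the least multiple of 3^-l above x is still below y. The shift by
    [kn k * p3 l] makes x positive, so that the search runs over omega and does not stop at 0. *)
Lemma rational_dense x y : x < y -> exists n, n ∈ omega /\ x < rational n < y.
Proof.
move=> Hxy; case: (@p3_small (y - x)) => [|l [Hl Hpl]]; first by lra.
have Hp := p3_gt0 Hl.
have Hdiv n z : n ∈ omega -> (z / p3 l < kn n) = (z < kn n * p3 l).
  by move=> Hn; rewrite ltr_pdivrMr.
case: (archimedean (- x / p3 l)) => k [Hk]; rewrite Hdiv // => Hk'.
case: (archimedean ((x + kn k * p3 l) / p3 l)) => i0 [Hi0 Hi0'].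
case: (@omega_least V T (fun i => (x + kn k * p3 l) / p3 l < kn i) i0) => //.
  by rewrite /kn /p3; dfn.
move=> i [Hi]; rewrite Hdiv // => Hi1 Hi2.
case: (omega_case Hi) => [E|[j [Hj E]]].
  by rewrite E kn0 in Hi1; lra.
have := Hi2 j; rewrite E => /(_ (in_succ_self j)); rewrite Hdiv // => /negP.
rewrite -leNgt => Hj'.
case: (unpair_surj Hk Hl) => m [Hm Em].
case: (unpair_surj Hi Hm) => n [Hn En].
exists n; split=> //; rewrite /rational En !pi2_pair Em !pi1_pair !pi2_pair.
by rewrite E knS // in Hi1 *; nra.
Qed.

Lemma real_le_eps x y : (forall n, n ∈ omega -> x <= y + p3 n) -> x <= y.
Proof.
move=> H; rewrite leNgt; apply/negP => Hxy.
case: (@p3_small (x - y)) => [|n [Hn Hp]]; first by lra.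
by have := H n Hn; lra.
Qed.

Lemma real_le_eps_mul x y c : 0 <= c -> (forall n, n ∈ omega -> x <= y + c * p3 n) -> x <= y.
Proof.
move=> Hc H; rewrite leNgt; apply/negP => Hxy.
case: (@p3_small ((x - y) / (c + 1))) => [|n [Hn Hp]].
  by apply: divr_gt0; lra.
have := H n Hn; rewrite ltr_pdivlMr in Hp; last by lra.
have := p3_gt0 Hn; nra.
Qed.

Lemma kfloor (N : V) (h x : K) : N ∈ omega -> 0 < h -> 0 <= x -> x < kn N * h ->
  exists k, [/\ k ∈ N, kn k * h <= x & x < kn k * h + h].
Proof.
move=> HN Hh Hx HxN.
case: (@omega_least V T (fun i => x < kn i * h) N) => //.
  by rewrite /kn; dfn.
move=> i [Hi Hi1 Hi2].
case: (omega_case Hi) => [E|[j [Hj E]]].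
  by rewrite E kn0 in Hi1; lra.
have := Hi2 j; rewrite E => /(_ (in_succ_self j)) => /negP; rewrite -leNgt => Hj'.
exists j; split=> //; last by rewrite E knS // in Hi1; lra.
have Hsub : j ∈ i by rewrite E.
case: (omega_total HN Hi) => [H|[H|H]].
- exact: omega_mem_trans H Hsub.
- by rewrite -H.
- by case: (Hi2 N H).
Qed.

(** The passage from the sums in the definition of measures and integrals, taken in V, to [ksum]. *)
Lemma sum_ksum n (F : V -> V) : n ∈ omega -> definable_term (fun e => F (e 0%N)) ->
  (forall k, k ∈ n -> F k ∈ RR R) -> sum R n F = rv (ksum n (fun k => re (F k))).
Proof.
move=> Hn HF.
have Hd : definable_term (fun e => plus R (e 1%N) (F (e 0%N))) by rewrite /plus; dfn.
move: n Hn; apply: omega_ind; first by rewrite /sum /plus; dfn.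
  by move=> _; rewrite /sum rec0 // ksum0 // rv_zero.
move=> n Hn IH H.
rewrite /sum recS // -/(sum R n F) IH; last by move=> k Hk; apply: H; rewrite in_succ; left.
by rewrite ksumS // rv_plus rv_re //; apply: H.
Qed.

End Sums.

Ltac dfn_sym5 ::=
  lazymatch goal with
  | |- definable_term (fun e => rv (kn (@?n e))) => refine (@term_kn _ _ n _)
  | |- definable_term (fun e => rv (p3 (@?n e))) => refine (@term_p3 _ _ n _)
  | |- definable_term (fun e => rv (rational (@?n e))) => refine (@term_rational _ _ n _)
  end.

#[global] Opaque kn p3 rational.

(** * Measures and completions *)

Section SpaceTerms.

Context {V : Type} {T : model V}.
#[local] Hint Extern 0 (set_structure _) => exact (model_struct T) : typeclass_instances.
Local Notation R := (model_reals T).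
Implicit Types (a b c S : (nat -> V) -> V) (F : (nat -> V) -> V -> V).

Lemma term_sum a F : definable_term a -> definable_term (fun e => F (fun n => e n.+1) (e 0%N)) ->
  definable_term (fun e => sum R (a e) (F e)).
Proof. by move=> Ha HF; rewrite /sum /plus; dfn. Qed.

Lemma term_generated_space a b : definable_term a -> definable_term b ->
  definable_term (fun e => generated_space (a e) (b e)).
Proof. by move=> Ha Hb; rewrite /generated_space; dfn. Qed.

Lemma term_borel S : definable_term S -> definable_term (fun e => borel (S e)).
Proof. by move=> HS; rewrite /borel /car /opens; dfn. Qed.

Lemma term_prod_space a b : definable_term a -> definable_term b ->
  definable_term (fun e => prod_space (a e) (b e)).
Proof.
move=> Ha Hb; rewrite /prod_space /car /opens; apply: term_generated_space; dfn.
Qed.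

End SpaceTerms.

Ltac dfn_sym6 ::=
  lazymatch goal with
  | |- definable_term (fun e => car (@?a e)) => unfold car
  | |- definable_term (fun e => opens (@?a e)) => unfold opens
  | |- definable_term (fun e => sum _ (@?a e) (@?F e)) => refine (@term_sum _ _ a F _ _)
  | |- definable_term (fun e => generated_space (@?a e) (@?b e)) =>
      refine (@term_generated_space _ _ a b _ _)
  | |- definable_term (fun e => prod_space (@?a e) (@?b e)) =>
      refine (@term_prod_space _ _ a b _ _)
  | |- definable_term (fun e => borel (@?a e)) => refine (@term_borel _ _ a _)
  end.

Section ProbabilityTerms.

Context {V : Type} {T : model V}.
#[local] Hint Extern 0 (set_structure _) => exact (model_struct T) : typeclass_instances.
Local Notation R := (model_reals T).
Implicit Types (a b c S : (nat -> V) -> V) (F : (nat -> V) -> V -> V).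

Lemma term_Prob S : definable_term S -> definable_term (fun e => Prob R (S e)).
Proof. by move=> HS; rewrite /Prob; dfn. Qed.

Lemma term_measure S a b : definable_term S -> definable_term a -> definable_term b ->
  definable_term (fun e => measure R (S e) (a e) (b e)).
Proof. by move=> HS Ha Hb; rewrite /measure; dfn. Qed.

Lemma term_image_measure S S' F a : definable_term S -> definable_term S' ->
  definable_term (fun e => F (fun n => e n.+1) (e 0%N)) -> definable_term a ->
  definable_term (fun e => image_measure (S e) (S' e) (F e) (a e)).
Proof. by move=> HS HS' HF Ha; rewrite /image_measure; dfn. Qed.

End ProbabilityTerms.

Ltac dfn_space :=
  lazymatch goal with
  | |- definable_term (fun e => car (@?a e)) => unfold car
  | |- definable_term (fun e => opens (@?a e)) => unfold opens
  | |- definable_term (fun e => plus _ _ _) => unfold plus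
  | |- definable_term (fun e => times _ _ _) => unfold times
  | |- definable_term (fun e => opp _ _) => unfold opp, plus
  | |- definable_term (fun e => minus _ _ _) => unfold minus, opp, plus
  | |- definable_term (fun e => open_interval _ _ _) => unfold open_interval
  | |- definable_term (fun e => subspace _ _) => unfold subspace
  | |- definable_term (fun e => metric_opens _ _ _) => unfold metric_opens
  | |- definable_term (fun e => sum _ (@?a e) (@?F e)) => refine (@term_sum _ _ a F _ _)
  | |- definable_term (fun e => generated_space (@?a e) (@?b e)) =>
      refine (@term_generated_space _ _ a b _ _)
  | |- definable_term (fun e => prod_space (@?a e) (@?b e)) =>
      refine (@term_prod_space _ _ a b _ _)
  | |- definable_term (fun e => borel (@?a e)) => refine (@term_borel _ _ a _)
  | |- definable_term (fun e => Prob _ (@?a e)) => refine (@term_Prob _ _ a _)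
  | |- definable_term (fun e => measure _ (@?S e) (@?a e) (@?b e)) =>
      refine (@term_measure _ _ S a b _ _ _)
  | |- definable_term (fun e => image_measure (@?S e) (@?S' e) (@?F e) (@?a e)) =>
      refine (@term_image_measure _ _ S S' F a _ _ _ _)
  end.

Ltac dfn_sym6 ::= dfn_space.

Section IntegralTerms.

Context {V : Type} {T : model V}.
#[local] Hint Extern 0 (set_structure _) => exact (model_struct T) : typeclass_instances.
Local Notation R := (model_reals T).

Lemma term_integral (S mu : (nat -> V) -> V) (F : (nat -> V) -> V -> V) :
  definable_term S -> definable_term mu ->
  definable_term (fun e => F (fun n => e n.+1) (e 0%N)) ->
  definable_term (fun e => integral R (S e) (mu e) (F e)).
Proof. by move=> HS Hmu HF; rewrite /integral; dfn. Qed.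

End IntegralTerms.

Ltac dfn_sym6 ::= first [ dfn_space |
  lazymatch goal with
  | |- definable_term (fun e => integral _ (@?S e) (@?mu e) (@?F e)) =>
      refine (@term_integral _ _ S mu F _ _ _)
  end ].

Section WeakTopologyTerms.

Context {V : Type} {T : model V}.
#[local] Hint Extern 0 (set_structure _) => exact (model_struct T) : typeclass_instances.
Local Notation R := (model_reals T).

Lemma term_Delta (S : (nat -> V) -> V) : definable_term S ->
  definable_term (fun e => Delta R (S e)).
Proof. by move=> HS; rewrite /Delta; dfn. Qed.

End WeakTopologyTerms.

Ltac dfn_space2 := first [ dfn_space |
  lazymatch goal with
  | |- definable_term (fun e => integral _ (@?S e) (@?mu e) (@?F e)) =>
      refine (@term_integral _ _ S mu F _ _ _)
  | |- definable_term (fun e => Delta _ (@?S e)) => refine (@term_Delta _ _ S _)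
  end ].

Ltac dfn_sym6 ::= dfn_space2.

Definition bigcup {V : Type} {M : set_structure V} (F : V -> V) : V := Union_seq (lam omega F).

Definition partial_union {V : Type} {M : set_structure V} (F : V -> V) (n : V) : V :=
  rec emp (fun k r => cup r (F k)) n.

Section Unions.

Context {V : Type} {T : model V}.
#[local] Hint Extern 0 (set_structure _) => exact (model_struct T) : typeclass_instances.
Implicit Types (X A a b : V) (F : V -> V).

Lemma in_Union_seq f z : (z ∈ Union_seq f) = (exists n, n ∈ omega /\ z ∈ f ∙ n).
Proof.
apply: (in_compr (union (image omega (app f)))); first by dfn.
move=> x [n [Hn Hx]]; rewrite in_union; exists (f ∙ n); split=> //.
by rewrite in_image //; exists n.
Qed.

Lemma in_bigcup F z : definable_term (fun e => F (e 0%N)) ->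
  (z ∈ bigcup F) = (exists n, n ∈ omega /\ z ∈ F n).
Proof.
move=> HF; rewrite in_Union_seq; apply: propeq.
by split=> -[n [Hn Hz]]; exists n; move: Hz; rewrite lam_app.
Qed.

Lemma bigcupE F : bigcup F = Union_seq (lam omega F).
Proof. by []. Qed.

Lemma Union_seqE f a : fn f omega a -> Union_seq f = bigcup (app f).
Proof.
move=> Hf; apply: (ext T) => x; rewrite in_Union_seq in_bigcup //; dfn.
Qed.

Lemma term_bigcup (F : (nat -> V) -> V -> V) :
  definable_term (fun e => F (fun n => e n.+1) (e 0%N)) -> definable_term (fun e => bigcup (F e)).
Proof. by move=> HF; rewrite /bigcup; dfn. Qed.

Lemma term_partial_union (F : (nat -> V) -> V -> V) (n : (nat -> V) -> V) :
  definable_term (fun e => F (fun i => e i.+1) (e 0%N)) -> definable_term n ->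
  definable_term (fun e => partial_union (F e) (n e)).
Proof.
move=> HF Hn; rewrite /partial_union; dfn.
Qed.

End Unions.

Ltac dfn_meas :=
  lazymatch goal with
  | |- definable_term (fun e => bigcup (@?F e)) => refine (@term_bigcup _ _ F _)
  | |- definable_term (fun e => partial_union (@?F e) (@?n e)) => refine (@term_partial_union _ _ F n _ _)
  end.

Ltac dfn_sym6 ::= first [ dfn_space2 | dfn_meas ].

Section Unions2.

Context {V : Type} {T : model V}.
#[local] Hint Extern 0 (set_structure _) => exact (model_struct T) : typeclass_instances.
Implicit Types (X A a b : V) (F : V -> V).

Lemma partial_union0 F : definable_term (fun e => F (e 0%N)) -> partial_union F emp = emp.
Proof. by move=> HF; rewrite /partial_union rec0. Qed.

Lemma partial_unionS F n : definable_term (fun e => F (e 0%N)) -> n ∈ omega ->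
  partial_union F (succ n) = cup (partial_union F n) (F n).
Proof. by move=> HF Hn; rewrite /partial_union recS. Qed.

Lemma in_partial_union F n z : definable_term (fun e => F (e 0%N)) -> n ∈ omega ->
  (z ∈ partial_union F n) = (exists k, k ∈ n /\ z ∈ F k).
Proof.
move=> HF; move: n; apply: omega_ind; first by dfn.
  by rewrite partial_union0 // in_emp; apply: propeq; split=> // -[k []]; rewrite in_emp.
move=> n Hn IH; rewrite partial_unionS // in_cup IH; apply: propeq; split.
  by case=> [[k [Hk Hz]]|Hz]; [exists k|exists n]; rewrite in_succ; auto.
by case=> k []; rewrite in_succ => -[Hk|->] Hz; [left; exists k|right].
Qed.

End Unions2.

#[global] Opaque Union_seq bigcup partial_union.

Section SigmaAlgebras.

Context {V : Type} {T : model V}.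
#[local] Hint Extern 0 (set_structure _) => exact (model_struct T) : typeclass_instances.
Variables (X A : V).
Hypothesis HA : sigma_algebra X A.
Implicit Types (a b : V) (F : V -> V).

Lemma sigma_sub a : a ∈ A -> a ⊆ X.
Proof. by case: HA => H _ /H; rewrite in_pow. Qed.

Lemma sigma_total : X ∈ A. Proof. by case: HA => _ []. Qed.

Lemma sigma_compl a : a ∈ A -> diff X a ∈ A.
Proof. by case: HA => _ [_ [H _]]; apply: H. Qed.

Lemma sigma_emp : emp ∈ A.
Proof.
have -> : (emp : V) = diff X X; last exact: (sigma_compl sigma_total).
by apply: (ext T) => x; rewrite in_emp in_diff; split=> // -[].
Qed.

Lemma sigma_Union f : fn f omega A -> Union_seq f ∈ A.
Proof. by case: HA => _ [_ [_ H]]; apply: H. Qed.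

Lemma sigma_bigcup F : definable_term (fun e => F (e 0%N)) ->
  (forall n, n ∈ omega -> F n ∈ A) -> bigcup F ∈ A.
Proof. by move=> HF H; apply: sigma_Union; apply: lam_fn. Qed.

Lemma sigma_cup a b : a ∈ A -> b ∈ A -> cup a b ∈ A.
Proof.
move=> Ha Hb.
have Hd : definable_term (fun e => ite (e 0%N = emp) a b) by dfn.
have -> : cup a b = bigcup (fun n => ite (n = emp) a b).
  apply: (ext T) => x; rewrite in_cup in_bigcup //; split.
    case=> Hx; first by exists emp; rewrite ite_true.
    by exists (succ emp); rewrite ite_false; [split; auto|exact: succ_not_emp].
  case=> n [_]; case: (classic (n = emp)) => H; first by rewrite ite_true; auto.
  by rewrite ite_false; auto.
apply: sigma_bigcup => // n _; case: (classic (n = emp)) => H; first by rewrite ite_true.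
by rewrite ite_false.
Qed.

Lemma sigma_cap a b : a ∈ A -> b ∈ A -> cap a b ∈ A.
Proof.
move=> Ha Hb.
have -> : cap a b = diff X (cup (diff X a) (diff X b)).
  apply: (ext T) => x; rewrite in_cap in_diff in_cup !in_diff; split.
    case=> Hx Hx'; split; first exact: (sigma_sub Ha).
    tauto.
  by move=> [Hx H]; split; apply: NNPP => H'; apply: H; auto.
by apply: sigma_compl; apply: sigma_cup; apply: sigma_compl.
Qed.

Lemma sigma_diff a b : a ∈ A -> b ∈ A -> diff a b ∈ A.
Proof.
move=> Ha Hb.
have -> : diff a b = cap a (diff X b).
  apply: (ext T) => x; rewrite in_cap !in_diff; split=> [[]|[? []]] //.
  by move=> Hx; split=> //; split=> //; apply: (sigma_sub Ha).
by apply: sigma_cap => //; apply: sigma_compl.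
Qed.

Lemma sigma_partial_union F n : definable_term (fun e => F (e 0%N)) ->
  n ∈ omega -> (forall k, k ∈ n -> F k ∈ A) -> partial_union F n ∈ A.
Proof.
move=> HF; move: n; apply: omega_ind; first by dfn.
  by rewrite partial_union0 // => _; exact: sigma_emp.
move=> n Hn IH H; rewrite partial_unionS //; apply: sigma_cup; last exact: H.
by apply: IH => k Hk; apply: H; rewrite in_succ; left.
Qed.

End SigmaAlgebras.

Arguments sigma_sub {V T X A} _ {a} _.

Section Measures.

Context {V : Type} {T : model V}.
#[local] Hint Extern 0 (set_structure _) => exact (model_struct T) : typeclass_instances.
Local Notation K := (real_of T).
Local Notation rv := (@rv V T).
Local Notation dK F := (definable_term (fun e => rv (F (e 0%N)))).
Implicit Types (X A a b : V) (F : V -> V) (m : V -> K).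

(** Probability measures in the form that is easiest to verify for images, completions and mixtures:
    finite additivity, and continuity from below put in terms of upper bounds c, without limits. The
    algebra A is arbitrary, to cover completions and full power sets. *)
Record is_measure X A m : Prop := {
  meas_sigma : sigma_algebra X A;
  meas_dfn : dK m;
  meas_ge0 : forall a, a ∈ A -> 0 <= m a;
  meas_one : m X = 1;
  meas_add : forall a b, a ∈ A -> b ∈ A -> disjoint a b -> m (cup a b) = m a + m b;
  meas_cont : forall F c, definable_term (fun e => F (e 0%N)) ->
    (forall n, n ∈ omega -> F n ∈ A) ->
    (forall n, n ∈ omega -> F n ⊆ F (succ n)) ->
    (forall n, n ∈ omega -> m (F n) <= c) -> m (bigcup F) <= c }.

Section Measure.

Variables (X A : V) (m : V -> K).
Hypothesis Hm : is_measure X A m.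
Let HA := meas_sigma Hm.
Let Hd := meas_dfn Hm.

Lemma meas_emp : m emp = 0.
Proof.
have := meas_add Hm (sigma_emp HA) (sigma_emp HA).
have -> : cup emp emp = (emp : V) by apply: (ext T) => x; rewrite in_cup; tauto.
have Hdis : disjoint (emp : V) emp by move=> x; rewrite in_emp.
move=> /(_ Hdis); lra.
Qed.

Lemma meas_split a b : a ∈ A -> b ∈ A -> m a = m (cap a b) + m (diff a b).
Proof.
move=> Ha Hb; have H1 := sigma_cap HA Ha Hb; have H2 := sigma_diff HA Ha Hb.
have Hdis : disjoint (cap a b) (diff a b) by move=> x; rewrite in_cap in_diff; tauto.
rewrite -(meas_add Hm) //; congr m; apply: (ext T) => x; rewrite in_cup in_cap in_diff.
by case: (classic (x ∈ b)); tauto.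
Qed.

Lemma meas_mono a b : a ∈ A -> b ∈ A -> a ⊆ b -> m a <= m b.
Proof.
move=> Ha Hb Hab; rewrite (meas_split Hb Ha).
have -> : cap b a = a.
  by apply: (ext T) => x; rewrite in_cap; split=> [[]|H] //; split=> //; apply: Hab.
by have := meas_ge0 Hm (sigma_diff HA Hb Ha); lra.
Qed.

Lemma meas_compl a : a ∈ A -> m (diff X a) = 1 - m a.
Proof.
move=> Ha; rewrite -(meas_one Hm) (meas_split (sigma_total HA) Ha).
have -> : cap X a = a.
  by apply: (ext T) => x; rewrite in_cap; split=> [[]|H] //; split=> //; apply: (sigma_sub HA Ha).
ring.
Qed.

Lemma meas_le1 a : a ∈ A -> m a <= 1.
Proof.
move=> Ha; rewrite -(meas_one Hm); apply: meas_mono => //; first exact: (sigma_total HA).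
exact: (sigma_sub HA Ha).
Qed.

Lemma meas_cup_le a b : a ∈ A -> b ∈ A -> m (cup a b) <= m a + m b.
Proof.
move=> Ha Hb; rewrite (meas_split (sigma_cup HA Ha Hb) Ha).
have H1 : m (cap (cup a b) a) <= m a.
  apply: meas_mono => //; first by apply: (sigma_cap HA) => //; apply: (sigma_cup HA).
  by move=> x; rewrite in_cap => -[].
have H2 : m (diff (cup a b) a) <= m b.
  apply: meas_mono => //; first by apply: (sigma_diff HA) => //; apply: (sigma_cup HA).
  by move=> x; rewrite in_diff in_cup; tauto.
lra.
Qed.

Lemma meas_partial_le F n : definable_term (fun e => F (e 0%N)) ->
  (forall n, n ∈ omega -> F n ∈ A) -> n ∈ omega ->
  m (partial_union F n) <= ksum n (fun k => m (F k)).
Proof.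
move=> HF HFA; move: n; apply: omega_ind; first by dfn.
  by rewrite partial_union0 // ksum0 // meas_emp.
move=> n Hn IH; rewrite partial_unionS // ksumS //.
apply: le_trans (meas_cup_le _ (HFA n Hn)) _; last by rewrite lerD2r.
by apply: (sigma_partial_union HA) => // k Hk; apply: HFA; apply: omega_trans Hk.
Qed.

Lemma bigcup_partial F : definable_term (fun e => F (e 0%N)) ->
  bigcup F = bigcup (partial_union F).
Proof.
move=> HF; apply: (ext T) => x; rewrite !in_bigcup //; split=> -[n [Hn Hx]].
  by exists (succ n); split; auto; rewrite in_partial_union; auto; exists n; auto.
move: Hx; rewrite in_partial_union // => -[k [Hk Hx]]; exists k; split=> //.
exact: omega_trans Hk.
Qed.

Lemma partial_mono F n : definable_term (fun e => F (e 0%N)) -> n ∈ omega ->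
  partial_union F n ⊆ partial_union F (succ n).
Proof. by move=> HF Hn x Hx; rewrite partial_unionS // in_cup; left. Qed.

Lemma meas_bigcup_le F c : definable_term (fun e => F (e 0%N)) ->
  (forall n, n ∈ omega -> F n ∈ A) ->
  (forall n, n ∈ omega -> ksum n (fun k => m (F k)) <= c) -> m (bigcup F) <= c.
Proof.
move=> HF HFA Hc; rewrite bigcup_partial //; apply: (meas_cont Hm) => //.
- move=> n Hn; apply: (sigma_partial_union HA) => // k Hk; apply: HFA.
  exact: omega_trans Hk.
- by move=> n Hn; exact: partial_mono.
- by move=> n Hn; apply: le_trans (Hc n Hn); apply: meas_partial_le.
Qed.

Lemma meas_bigcup_null F : definable_term (fun e => F (e 0%N)) ->
  (forall n, n ∈ omega -> F n ∈ A /\ m (F n) = 0) -> m (bigcup F) = 0.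
Proof.
move=> HF H; apply/eqP; rewrite eq_le; apply/andP; split.
  apply: meas_bigcup_le => //; first by move=> n /H [].
  by move=> n Hn; rewrite ksum_zero // => k Hk; case: (H k) => //; apply: omega_trans Hk.
by apply: (meas_ge0 Hm); apply: (sigma_bigcup HA) => // n /H [].
Qed.

Lemma meas_full_cap a b : a ∈ A -> b ∈ A -> m a = 1 -> m b = 1 -> m (cap a b) = 1.
Proof.
move=> Ha Hb Ea Eb; have Hd1 := sigma_diff HA Ha Hb.
have : m (diff a b) <= m (diff X b).
  apply: meas_mono => //; first exact: sigma_compl HA _ Hb.
  by move=> x; rewrite !in_diff => -[Hx H]; split=> //; apply: (sigma_sub HA Ha).
rewrite meas_compl //; have := meas_split Ha Hb; have := meas_ge0 Hm Hd1.
lra.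
Qed.

Lemma meas_partition (b : V -> V) n x : n ∈ omega -> definable_term (fun e => b (e 0%N)) ->
  (forall k, k ∈ n -> b k ∈ A) ->
  (forall k l, k ∈ n -> l ∈ n -> k <> l -> disjoint (b k) (b l)) ->
  x ∈ A -> x ⊆ partial_union b n -> m x = ksum n (fun k => m (cap x (b k))).
Proof.
move=> Hn Hb HbA Hdis Hx Hsub.
have Hss k : k ∈ n -> k ∈ omega by apply: omega_trans.
have main k : k ∈ omega -> k ∈ succ n -> m (cap x (partial_union b k)) = ksum k (fun k => m (cap x (b k))).
  move: k; apply: omega_ind; first by dfn.
    move=> _; rewrite partial_union0 // ksum0 // -meas_emp; congr m.
    by apply: (ext T) => z; rewrite in_cap in_emp; tauto.
  move=> k Hk IH Hkn.
  have Hkn' : k ∈ n.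
    move: Hkn; rewrite in_succ => -[H|<-] //; exact: omega_mem_trans H (in_succ_self k).
  rewrite ksumS // -IH; last by rewrite in_succ; left.
  have HP : partial_union b k ∈ A.
    apply: (sigma_partial_union HA) => // j Hj; apply: HbA; exact: (omega_mem_trans Hn Hkn').
  have Hk1 := sigma_cap HA Hx HP; have Hk2 := sigma_cap HA Hx (HbA k Hkn').
  rewrite -(meas_add Hm) //.
    congr m; apply: (ext T) => z; rewrite partial_unionS // in_cup !in_cap in_cup; tauto.
  move=> z; rewrite !in_cap in_partial_union // => -[_ [j [Hj Hzj]]] [_ Hzk].
  apply: (Hdis j k) Hzj Hzk => //; first by apply: (omega_mem_trans Hn Hkn').
  by move=> E; move: Hj; rewrite E; apply: mem_irrefl.
rewrite -main //; congr m; apply: (ext T) => z; rewrite in_cap; split=> [Hz|[]//].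
by split=> //; apply: Hsub.
Qed.

Lemma meas_disjoint_sum (b : V -> V) n : n ∈ omega -> definable_term (fun e => b (e 0%N)) ->
  (forall k, k ∈ n -> b k ∈ A) ->
  (forall k l, k ∈ n -> l ∈ n -> k <> l -> disjoint (b k) (b l)) ->
  m (partial_union b n) = ksum n (fun k => m (b k)).
Proof.
move=> Hn Hb HbA Hdis.
rewrite (meas_partition Hn Hb HbA Hdis) //; last exact: (sigma_partial_union HA).
apply: ksum_ext => // k Hk; congr m; apply: (ext T) => z; rewrite in_cap in_partial_union //.
by split=> [[]|Hz] //; split=> //; exists k.
Qed.

End Measure.

Lemma bigcap_full X A m F : is_measure X A m -> definable_term (fun e => F (e 0%N)) ->
  (forall n, n ∈ omega -> F n ∈ A /\ m (F n) = 1) ->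
  exists b, [/\ b ∈ A, m b = 1 & forall x, x ∈ b <-> x ∈ X /\ forall n, n ∈ omega -> x ∈ F n].
Proof.
move=> Hm HF H; have HA := meas_sigma Hm.
have HU : bigcup (fun n => diff X (F n)) ∈ A.
  by apply: (sigma_bigcup HA) => // n /H [H1 _]; apply: (sigma_compl HA).
exists (diff X (bigcup (fun n => diff X (F n)))); split.
- exact: (sigma_compl HA).
- rewrite (meas_compl Hm) // (meas_bigcup_null Hm) ?subr0 // => n /H [H1 H2].
  by split; [exact: (sigma_compl HA)|rewrite (meas_compl Hm) // H2 subrr].
- move=> x; rewrite in_diff in_bigcup //; split=> [[Hx Hn]|[Hx Hn]]; split=> //.
    by move=> n Hno; apply: NNPP => H'; apply: Hn; exists n; rewrite in_diff.
  by case=> n [/Hn H1]; rewrite in_diff; tauto.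
Qed.

End Measures.

Definition completion {V : Type} {M : set_structure V} (R : real_data V) (S mu : V) : V :=
  ⟦ a | measurable R S mu a ⟧.

Definition lambda_system {V : Type} {M : set_structure V} (X D : V) : Prop :=
  D ⊆ pow X /\ X ∈ D /\ (forall a, a ∈ D -> diff X a ∈ D) /\
  forall f, fn f omega D ->
    (forall m n, m ∈ omega -> n ∈ omega -> m <> n -> disjoint (f ∙ m) (f ∙ n)) ->
    Union_seq f ∈ D.

(** * Borel sets, probabilities and the π-λ theorem *)

Section Borel.

Context {V : Type} {T : model V}.
#[local] Hint Extern 0 (set_structure _) => exact (model_struct T) : typeclass_instances.
Local Notation R := (model_reals T).
Local Notation K := (real_of T).
Local Notation re := (@re V T).
Local Notation rv := (@rv V T).
Local Notation dK F := (definable_term (fun e => rv (F (e 0%N)))).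
Implicit Types (X A a b S mu : V) (F : V -> V) (m : V -> K).

Lemma car_pair X A : car ⟨X, A⟩ = X. Proof. exact: pi1_pair. Qed.
Lemma opens_pair X A : opens ⟨X, A⟩ = A. Proof. exact: pi2_pair. Qed.

Lemma in_borel S b : (b ∈ borel S) = (b ∈ pow (car S) /\
  forall A, sigma_algebra (car S) A -> opens S ⊆ A -> b ∈ A).
Proof. by apply: (in_compr (pow (car S))) => [|x []//]; dfn. Qed.

Lemma pow_sigma X : sigma_algebra X (pow X).
Proof.
split=> //; split; first by rewrite in_pow.
split=> [a _|f Hf]; first by rewrite in_pow => x; rewrite in_diff => -[].
rewrite in_pow => x; rewrite in_Union_seq => -[n [Hn Hx]].
by have := fn_app Hf Hn; rewrite in_pow; apply.
Qed.

Lemma borel_sigma S : sigma_algebra (car S) (borel S).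
Proof.
split=> [b|]; first by rewrite in_borel => -[].
split; first by rewrite in_borel in_pow; split=> // A [_ []].
split=> [a|f Hf]; rewrite in_borel.
  move=> [H1 H2]; rewrite in_borel; split.
    by rewrite in_pow => x; rewrite in_diff => -[].
  by move=> A HA HO; case: (HA) => _ [_ [H _]]; apply: H; apply: H2.
split; last first.
  move=> A HA HO; case: (HA) => _ [_ [_ H]]; apply: H; apply: (fn_sub Hf) => n Hn.
  by have := fn_app Hf Hn; rewrite in_borel => -[_]; apply.
rewrite in_pow => x; rewrite in_Union_seq => -[n [Hn Hx]].
by have := fn_app Hf Hn; rewrite in_borel in_pow => -[+ _]; apply.
Qed.

Lemma open_borel S u : opens S ⊆ pow (car S) -> u ∈ opens S -> u ∈ borel S.
Proof. by move=> HO Hu; rewrite in_borel; split=> [|A HA H]; [apply: HO|apply: H]. Qed.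

Lemma in_Prob S mu : (mu ∈ Prob R S) = probability R S mu.
Proof.
apply: (in_compr (pow (Defs.prod (borel S) (RR R)))); first by dfn.
by move=> x [[H _] _]; rewrite in_pow.
Qed.

(** The sequence a, b, emp, emp, ..., which reduces finite unions to countable ones. *)
Definition duo a b (n : V) : V := ite (n = emp) a (ite (n = succ emp) b emp).

Lemma definable_duo a b : definable_term (fun e => duo a b (e 0%N)).
Proof. by rewrite /duo; dfn. Qed.

Lemma duo0 a b : duo a b emp = a. Proof. by rewrite /duo ite_true. Qed.
Lemma duo1 a b : duo a b (succ emp) = b.
Proof. by rewrite /duo ite_false ?ite_true //; exact: succ_not_emp. Qed.
Lemma duoSS a b n : duo a b (succ (succ n)) = emp.
Proof.
rewrite /duo ite_false ?ite_false //; last exact: succ_not_emp.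
by move/succ_inj; exact: succ_not_emp.
Qed.

Lemma duo_case a b n : n ∈ omega -> duo a b n = a \/ duo a b n = b \/ duo a b n = emp.
Proof.
move=> Hn; case: (omega_case Hn) => [->|[k [Hk ->]]]; first by rewrite duo0; auto.
by case: (omega_case Hk) => [->|[l [Hl ->]]]; rewrite ?duo1 ?duoSS; auto.
Qed.

Lemma bigcup_duo a b : bigcup (duo a b) = cup a b.
Proof.
have Hd := definable_duo a b.
apply: (ext T) => x; rewrite in_bigcup // in_cup; split.
  case=> n [Hn]; case: (duo_case a b Hn) => [->|[->|->]]; auto; by rewrite in_emp.
by case=> Hx; [exists emp; rewrite duo0|exists (succ emp); rewrite duo1; split; auto].
Qed.

Lemma duo_disjoint a b k l : disjoint a b -> k ∈ omega -> l ∈ omega -> k <> l ->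
  disjoint (duo a b k) (duo a b l).
Proof.
move=> Hab Hk Hl Hkl x.
case: (omega_case Hk) => [Ek|[k' [Hk' Ek]]]; case: (omega_case Hl) => [El|[l' [Hl' El]]]; subst => //.
- rewrite duo0; case: (omega_case Hl') => [->|[l [Hl'' ->]]]; rewrite ?duo1 ?duoSS ?in_emp //.
    exact: Hab.
  tauto.
- rewrite duo0; case: (omega_case Hk') => [->|[l [Hl'' ->]]]; rewrite ?duo1 ?duoSS ?in_emp //.
  by move=> H1 H2; apply: (Hab x).
- case: (omega_case Hk') => [Ek|[k [_ ->]]]; last by rewrite duoSS in_emp.
  case: (omega_case Hl') => [El|[l [_ ->]]]; last by rewrite duoSS in_emp; tauto.
  by subst.
Qed.

Definition disjointed F (n : V) : V := diff (F n) (partial_union F n).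

Lemma bigcup_disjointed F : definable_term (fun e => F (e 0%N)) ->
  bigcup F = bigcup (disjointed F).
Proof.
move=> HF.
have HG : definable_term (fun e => disjointed F (e 0%N)) by rewrite /disjointed; dfn.
apply: (ext T) => x; rewrite !in_bigcup //; split=> -[n [Hn Hx]]; last first.
  by exists n; move: Hx; rewrite in_diff => -[].
case: (@omega_least V T (fun k => x ∈ F k) n) => //.
move=> k [Hk Hxk Hl]; exists k; rewrite in_diff in_partial_union //; do 2!split=> //.
by case=> j [Hj]; apply: Hl.
Qed.

Lemma disjointed_disjoint F k l : definable_term (fun e => F (e 0%N)) ->
  k ∈ omega -> l ∈ omega -> k <> l -> disjoint (disjointed F k) (disjointed F l).
Proof.
move=> HF Hk Hl Hkl x; rewrite !in_diff !in_partial_union // => -[Hxk H1] [Hxl H2].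
by case: (omega_total Hk Hl) => [H|[H|H]]; [apply: H1; exists l|apply: Hkl|apply: H2; exists k].
Qed.

Section FromProbability.

Variables (S mu : V).
Hypothesis Hmu : mu ∈ Prob R S.
Let m b := re (mu ∙ b).
Let HA := borel_sigma S.

Lemma prob_fn : fn mu (borel S) (RR R).
Proof. by move: Hmu; rewrite in_Prob => -[]. Qed.

Lemma prob_rv b : b ∈ borel S -> mu ∙ b = rv (m b).
Proof. by move=> Hb; rewrite /m rv_re //; apply: fn_app prob_fn Hb. Qed.

Let m_ge0 b : b ∈ borel S -> 0 <= m b.
Proof.
move=> Hb; rewrite rv_le rv_zero -prob_rv //; move: Hmu; rewrite in_Prob => -[_ [H _]].
exact: H.
Qed.

Lemma prob_lub F : definable_term (fun e => F (e 0%N)) -> (forall n, n ∈ omega -> F n ∈ borel S) ->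
  (forall k l, k ∈ omega -> l ∈ omega -> k <> l -> disjoint (F k) (F l)) ->
  (forall n, n ∈ omega -> ksum n (fun k => m (F k)) <= m (bigcup F)) /\
  forall c, (forall n, n ∈ omega -> ksum n (fun k => m (F k)) <= c) -> m (bigcup F) <= c.
Proof.
move=> HF HFA Hdis; move: (Hmu); rewrite in_Prob => -[_ [_ [_ H]]].
have Hlam : fn (lam omega F) omega (borel S) by apply: lam_fn.
have HU : bigcup F ∈ borel S by apply: (sigma_bigcup HA).
case: (H _ Hlam) => [k l Hk Hl Hkl|]; first by rewrite !lam_app //; apply: Hdis.
rewrite -bigcupE => _ [H1 H2].
have Hs n : n ∈ omega -> sum R n (fun k => mu ∙ (lam omega F ∙ k)) = rv (ksum n (fun k => m (F k))).
  move=> Hn; rewrite sum_ksum //; last first.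
    move=> k Hk; apply: fn_app prob_fn _; rewrite lam_app //; first apply: HFA.
      exact: omega_trans Hk.
    exact: omega_trans Hk.
  have Hd1 : dK (fun k => re (mu ∙ (lam omega F ∙ k))) by dfn.
  have Hd2 : dK (fun k => re (mu ∙ F k)) by dfn.
  congr rv; apply: ksum_ext => //; rewrite /m.
  by move=> k Hk; rewrite lam_app //; apply: omega_trans Hk.
split=> [n Hn|c Hc].
  by rewrite rv_le -prob_rv //; apply: H1; exists n; rewrite Hs.
rewrite rv_le -prob_rv //; apply: H2; first exact: rv_in.
by move=> r [n [Hn ->]]; rewrite Hs // -rv_le; apply: Hc.
Qed.

(** The constant sequence emp is disjoint with union emp, and two of its terms already give 2 m(emp)
    ≤ m(emp). *)
Let m_emp : m emp = 0.
Proof.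
case: (@prob_lub (fun=> emp)) => //.
- by move=> n _; apply: (sigma_emp HA).
- by move=> k l _ _ _ x; rewrite in_emp.
move=> H _; have := H _ (succ_omega (succ_omega emp_omega)).
have -> : bigcup (fun=> emp) = (emp : V).
  by apply: (ext T) => x; rewrite in_bigcup // in_emp; split=> // -[n []].
have Hd : dK (fun=> m emp) by rewrite /m; dfn.
rewrite !ksumS //; auto; rewrite ksum0 // => H1.
have := m_ge0 (sigma_emp HA); lra.
Qed.

Let m_add a b : a ∈ borel S -> b ∈ borel S -> disjoint a b -> m (cup a b) = m a + m b.
Proof.
move=> Ha Hb Hab.
have HF := definable_duo a b.
have HmF : dK (fun n => m (duo a b n)) by rewrite /m; dfn.
have two n : n ∈ omega -> ksum (succ (succ n)) (fun k => m (duo a b k)) = m a + m b.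
  move: n; apply: omega_ind; first by dfn.
    by rewrite !ksumS //; auto; rewrite ksum0 // duo0 duo1 add0r.
  move=> n Hn IH; rewrite ksumS //; auto.
  by rewrite IH duoSS m_emp addr0.
case: (@prob_lub (duo a b)) => //.
- by move=> n /(duo_case a b) [->|[->|->]] //; apply: (sigma_emp HA).
- by move=> k l; apply: duo_disjoint.
rewrite bigcup_duo => H1 H2; apply/eqP; rewrite eq_le; apply/andP; split; last by rewrite -(two emp) //; apply: H1; auto.
apply: H2 => n Hn; have := m_ge0 Ha; have := m_ge0 Hb.
case: (omega_case Hn) => [->|[k [Hk ->]]]; first by rewrite ksum0 //; lra.
case: (omega_case Hk) => [->|[l [Hl ->]]]; last by rewrite two.
by rewrite ksumS // ksum0 // duo0; lra.
Qed.

Let m_mono a b : a ∈ borel S -> b ∈ borel S -> a ⊆ b -> m a <= m b.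
Proof.
move=> Ha Hb Hab.
have -> : b = cup a (diff b a).
  apply: (ext T) => x; rewrite in_cup in_diff; case: (classic (x ∈ a)) => Hx; last by tauto.
  by split=> _; [left|apply: Hab].
have Hd := sigma_diff HA Hb Ha.
rewrite m_add //; first by have := m_ge0 Hd; lra.
by move=> x Hx; rewrite in_diff; tauto.
Qed.

Lemma prob_measure : is_measure (car S) (borel S) m.
Proof.
split; [exact: HA|by rewrite /m; dfn|exact: @m_ge0| |exact: @m_add|].
  move: Hmu; rewrite in_Prob => -[_ [_ [E _]]].
  by apply: rv_inj; rewrite -prob_rv ?rv_one //; apply: (sigma_total HA).
move=> F c HF HFA Hinc Hc.
pose (G := disjointed F).
have HG : definable_term (fun e => G (e 0%N)) by rewrite /G /disjointed; dfn.
have HmG : dK (fun n => m (G n)) by rewrite /m; dfn.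
have HPA n : n ∈ omega -> partial_union F n ∈ borel S.
  move=> Hn; apply: (sigma_partial_union HA) => // k Hk; apply: HFA.
  exact: omega_trans Hk.
have HGA n : n ∈ omega -> G n ∈ borel S.
  by move=> Hn; apply: (sigma_diff HA); auto.
rewrite (bigcup_disjointed HF); case: (@prob_lub G) => //.
  by move=> k l; apply: disjointed_disjoint.
move=> _; apply=> n Hn.
have -> : ksum n (fun k => m (G k)) = m (partial_union F n).
  have HmP : dK (fun k => m (partial_union F k)) by rewrite /m; dfn.
  move: n Hn; apply: omega_ind; first by dfn.
    by rewrite ksum0 // partial_union0 // m_emp.
  move=> n Hn IH; rewrite ksumS // IH -m_add //; auto; last first.
    by move=> x Hx; rewrite in_diff; tauto.
  congr m; rewrite partial_unionS //; apply: (ext T) => x; rewrite !in_cup in_diff.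
  by case: (classic (x ∈ partial_union F n)); tauto.
have c0 : 0 <= c by apply: le_trans (Hc emp emp_omega); apply: m_ge0; auto.
case: (omega_case Hn) => [->|[k [Hk ->]]]; first by rewrite partial_union0 // m_emp.
apply: le_trans (Hc k Hk); apply: m_mono; auto.
have Hup j : j ∈ omega -> forall i, i ∈ succ j -> F i ⊆ F j.
  move: j; apply: omega_ind; first by dfn.
    by move=> i; rewrite in_succ in_emp => -[//|->].
  move=> j Hj IH i; rewrite in_succ => -[Hi|-> //].
  exact: sub_trans (IH i Hi) (Hinc j Hj).
move=> x; rewrite in_partial_union; auto.
by move=> -[i [Hi Hx]]; apply: (Hup k Hk i Hi).
Qed.

End FromProbability.

Lemma measure_prob S m : is_measure (car S) (borel S) m -> lam (borel S) (fun b => rv (m b)) ∈ Prob R S.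
Proof.
move=> Hm; have HA := meas_sigma Hm; have Hd := meas_dfn Hm.
have Hlam b : b ∈ borel S -> lam (borel S) (fun b => rv (m b)) ∙ b = rv (m b).
  by move=> Hb; rewrite lam_app.
rewrite in_Prob; split; first by apply: lam_fn => // b _; apply: rv_in.
split; first by move=> b Hb; rewrite Hlam // -rv_zero -rv_le; apply: (meas_ge0 Hm).
split; first by rewrite Hlam ?(meas_one Hm) ?rv_one //; apply: (sigma_total HA).
move=> f Hf Hdis.
have Hs n : n ∈ omega -> sum R n (fun k => lam (borel S) (fun b => rv (m b)) ∙ (f ∙ k)) =
    rv (m (partial_union (app f) n)).
  move=> Hn; have Hno k : k ∈ n -> k ∈ omega by apply: omega_trans.
  have Hfa k : k ∈ omega -> f ∙ k ∈ borel S by apply: fn_app Hf.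
  rewrite sum_ksum //; last by move=> k Hk; rewrite Hlam; auto; apply: rv_in.
  congr rv; rewrite (meas_disjoint_sum Hm) //; auto.
  by apply: ksum_ext => // k Hk; rewrite Hlam; auto; rewrite re_rv.
have HU := sigma_Union HA Hf; rewrite Hlam //.
split; first exact: rv_in.
split=> [r [n [Hn ->]]|u Hu H].
  rewrite Hs // -rv_le; apply: (meas_mono Hm) => //.
    by apply: (sigma_partial_union HA) => // k Hk; apply: (fn_app Hf); apply: omega_trans Hk.
  move=> x; rewrite in_partial_union // in_Union_seq => -[k [Hk Hx]].
  by exists k; split=> //; apply: omega_trans Hk.
rewrite -(rv_re Hu) -rv_le (Union_seqE Hf) (bigcup_partial (F := app f)) //.
apply: (meas_cont Hm) => //.
- move=> n Hn; apply: (sigma_partial_union HA) => // k Hk; apply: (fn_app Hf).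
  exact: omega_trans Hk.
- by move=> n Hn; exact: partial_mono.
- by move=> n Hn; rewrite rv_le rv_re // -Hs //; apply: H; exists n.
Qed.

Lemma prob_ext S mu nu : mu ∈ Prob R S -> nu ∈ Prob R S ->
  (forall b, b ∈ borel S -> mu ∙ b = nu ∙ b) -> mu = nu.
Proof. by move=> Hmu Hnu; apply: fn_ext (prob_fn Hmu) (prob_fn Hnu). Qed.

Section Lambda.

Variables (X P D : V).
Hypotheses (HPX : P ⊆ pow X) (HPcap : forall a b, a ∈ P -> b ∈ P -> cap a b ∈ P).

Lemma lambda_disjoint D' F : lambda_system X D' -> definable_term (fun e => F (e 0%N)) ->
  (forall n, n ∈ omega -> F n ∈ D') ->
  (forall k l, k ∈ omega -> l ∈ omega -> k <> l -> disjoint (F k) (F l)) -> bigcup F ∈ D'.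
Proof.
case=> _ [_ [_ H]] HF HFD Hdis; rewrite bigcupE; apply: H; first exact: lam_fn.
by move=> k l Hk Hl Hkl; rewrite !lam_app //; apply: Hdis.
Qed.

Lemma lambda_cup D' a b : lambda_system X D' -> a ∈ D' -> b ∈ D' -> disjoint a b -> cup a b ∈ D'.
Proof.
move=> HD' Ha Hb Hab; rewrite -bigcup_duo; apply: lambda_disjoint => //.
- exact: definable_duo.
- move=> n /(duo_case a b) [->|[->|->]] //.
  case: HD' => _ [HX [H _]]; have -> : (emp : V) = diff X X; last exact: H.
  by apply: (ext T) => x; rewrite in_emp in_diff; tauto.
- by move=> k l; apply: duo_disjoint.
Qed.

(** Dynkin's π-λ theorem. The least λ-system D0 containing P is closed under intersections, hence a
    σ-algebra, and b belongs to every σ-algebra containing P. *)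
Lemma pi_lambda b : lambda_system X D -> P ⊆ D ->
  (forall A, sigma_algebra X A -> P ⊆ A -> b ∈ A) -> b ∈ D.
Proof.
move=> HD HPD Hb.
have HL : definable (fun e => lambda_system (e 0%N) (e 1%N)) by rewrite /lambda_system; dfn.
separate (pow X) (fun d => forall D', lambda_system X D' -> P ⊆ D' -> d ∈ D') as D0 inD0.
have sub0 d : d ∈ D0 -> forall x, x ∈ d -> x ∈ X by rewrite inD0 in_pow => -[].
have HD0 : lambda_system X D0.
  split; first by move=> d; rewrite inD0 => -[].
  split; first by rewrite inD0 in_pow; split=> // D' [_ []].
  split=> [a|f Hf Hdis]; rewrite inD0.
    move=> [_ Ha]; rewrite inD0 in_pow; split; first by move=> x; rewrite in_diff => -[].
    by move=> D' HD' HPD'; case: (HD') => _ [_ [H _]]; apply: H; apply: Ha.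
  rewrite in_pow; split.
    move=> x; rewrite in_Union_seq => -[n [Hn Hx]]; exact: (sub0 _ (fn_app Hf Hn)).
  move=> D' HD' HPD'; case: (HD') => _ [_ [_ H]]; apply: H => //.
  by apply: (fn_sub Hf) => n Hn; have := fn_app Hf Hn; rewrite inD0 => -[_]; apply.
have Hcomp : forall a, a ∈ D0 -> diff X a ∈ D0 by case: HD0 => _ [_ []].
have HPD0 p : p ∈ P -> p ∈ D0 by move=> Hp; rewrite inD0; split=> [|D' _]; [apply: HPX|apply].
(* For fixed a, the d with d ∩ a in D0 form a λ-system. This is used twice: for a in P, by [HPcap],
   and then for every a in D0. *)
have Da a : a ∈ D0 -> (forall p, p ∈ P -> cap p a ∈ D0) -> forall d, d ∈ D0 -> cap d a ∈ D0.
  move=> Ha HPa d Hd.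
  separate (pow X) (fun d => cap d a ∈ D0) as E inE.
  have capX : cap X a = a.
    by apply: (ext T) => x; rewrite in_cap; split=> [[]|Hx] //; split=> //; apply: (sub0 a).
  have HE : lambda_system X E.
    split; first by move=> x; rewrite inE => -[].
    split; first by rewrite inE in_pow capX.
    split=> [c|f Hf Hdis]; rewrite inE.
      move=> [Hc Hca]; rewrite inE in_pow; split; first by move=> x; rewrite in_diff => -[].
      (* A λ-system admits only complements and disjoint unions, and the right-hand side is written
         with these. *)
      have -> : cap (diff X c) a = diff X (cup (diff X a) (cap c a)).
        apply: (ext T) => x; rewrite in_cap !in_diff in_cup !in_diff in_cap; split.
          by tauto.
        by move=> [Hx H]; case: (classic (x ∈ a)); tauto.
      apply: (Hcomp); apply: lambda_cup => //; first exact: Hcomp.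
      by move=> x; rewrite in_diff in_cap; tauto.
    split.
      rewrite in_pow => x; rewrite in_Union_seq => -[n [Hn Hx]].
      by have := fn_app Hf Hn; rewrite inE in_pow => -[H _]; apply: H.
    have -> : cap (Union_seq f) a = bigcup (fun n => cap (f ∙ n) a).
      apply: (ext T) => x; rewrite in_cap in_Union_seq in_bigcup //; split.
        by move=> [[n [Hn Hx]] Hxa]; exists n; rewrite in_cap.
      by move=> [n [Hn]]; rewrite in_cap => -[H1 H2]; split=> //; exists n.
    apply: lambda_disjoint => //.
      by move=> n Hn; have := fn_app Hf Hn; rewrite inE => -[].
    move=> k l Hk Hl Hkl x; rewrite !in_cap => -[H1 _] [H2 _].
    exact: (Hdis k l Hk Hl Hkl x).
  have HPE : P ⊆ E by move=> p Hp; rewrite inE; split; [apply: HPX|apply: HPa].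
  by move: Hd; rewrite inD0 => -[_ /(_ E HE HPE)]; rewrite inE => -[].
have capC u v : cap u v = cap v u by apply: (ext T) => x; rewrite !in_cap; tauto.
have Dcap a d : a ∈ D0 -> d ∈ D0 -> cap a d ∈ D0.
  move=> Ha Hd; apply: (Da) => // p Hp; rewrite capC; apply: (Da); auto.
have Dcup a d : a ∈ D0 -> d ∈ D0 -> cup a d ∈ D0.
  move=> Ha Hd; have -> : cup a d = diff X (cap (diff X a) (diff X d)).
    apply: (ext T) => x; rewrite in_cup in_diff in_cap !in_diff; split.
      by case=> Hx; (split; [by apply: (sub0 _ _ x Hx)|tauto]).
    by move=> [Hx H]; case: (classic (x ∈ a)); case: (classic (x ∈ d)); tauto.
  by apply: (Hcomp); apply: Dcap; apply: Hcomp.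
have HS : sigma_algebra X D0.
  case: (HD0) => H1 [H2 [H3 H4]]; do 3!split=> //.
  move=> f Hf; rewrite (Union_seqE Hf).
  have Hdf : definable_term (fun e => f ∙ (e 0%N)) by dfn.
  rewrite (bigcup_disjointed Hdf); apply: lambda_disjoint => //.
  - by rewrite /disjointed; dfn.
  - move=> n Hn; rewrite /disjointed.
    have HP' : partial_union (app f) n ∈ D0.
      move: n Hn; apply: omega_ind; first by dfn.
        rewrite partial_union0 //; have -> : (emp : V) = diff X X; last exact: Hcomp.
        by apply: (ext T) => x; rewrite in_emp in_diff; tauto.
      by move=> n Hn IH; rewrite partial_unionS //; apply: Dcup => //; apply: fn_app Hf Hn.
    have -> : diff (f ∙ n) (partial_union (app f) n) = cap (f ∙ n) (diff X (partial_union (app f) n)).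
      apply: (ext T) => x; rewrite in_cap !in_diff; split; last by tauto.
      by move=> [Hx H]; do 2!split=> //; apply: (sub0 _ (fn_app Hf Hn)).
    by apply: Dcap; [apply: fn_app Hf Hn|apply: Hcomp].
  - by move=> k l Hk Hl Hkl; apply: disjointed_disjoint.
have : b ∈ D0 by apply: Hb => // p /HPD0.
by rewrite inD0 => -[_]; apply.
Qed.

End Lambda.

End Borel.

(** * The completion of a measure *)

Section Completion.

Context {V : Type} {T : model V}.
#[local] Hint Extern 0 (set_structure _) => exact (model_struct T) : typeclass_instances.
Local Notation R := (model_reals T).
Local Notation re := (@re V T).
Local Notation rv := (@rv V T).
Variables (S mu : V).
Hypothesis Hmu : mu ∈ Prob R S.
Let m b := re (mu ∙ b).
Let Hm : is_measure (car S) (borel S) m := prob_measure Hmu.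
Let HA : sigma_algebra (car S) (borel S) := @borel_sigma V T S.
Local Notation cm := (fun a => re (measure R S mu a)).
Local Notation C := (completion R S mu).

Definition sandwich a b c := [/\ b ∈ borel S, c ∈ borel S, b ⊆ a, a ⊆ c & m (diff c b) = 0].

Lemma sandwich_eq a b c : sandwich a b c -> m c = m b.
Proof.
case=> Hb Hc Hba Hac H0; rewrite (meas_split Hm Hc Hb) H0 addr0; congr m.
by apply: (ext T) => x; rewrite in_cap; split=> [[]|Hx] //; split=> //; apply: Hac; apply: Hba.
Qed.

Lemma measure_is_sandwich a r : measure_is R S mu a r <->
  a ⊆ car S /\ exists b c, sandwich a b c /\ r = rv (m b).
Proof.
split=> -[Ha].
  case=> b [c [Hb [Hc [Hba [Hac [E0 E1]]]]]]; split=> //; exists b, c; split; last first.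
    by rewrite -E1 (prob_rv Hmu).
  by split=> //; rewrite /m E0 -rv_zero re_rv.
case=> b [c [[Hb Hc Hba Hac E0] ->]]; split=> //; exists b, c; do 4!split=> //.
have Hd := sigma_diff HA Hc Hb.
by rewrite (prob_rv Hmu Hd) -[re _]/(m _) E0 rv_zero (prob_rv Hmu Hb).
Qed.

(** Each inner Borel set lies in each outer one, so all inner sets have the same measure. *)
Lemma sandwich_uniq a b c b' c' : sandwich a b c -> sandwich a b' c' -> m b = m b'.
Proof.
have le d e d' e' : sandwich a d e -> sandwich a d' e' -> m d <= m d'.
  move=> H H'; rewrite -(sandwich_eq H'); case: H H' => Hd _ Hda _ _ [_ He _ Hae _].
  by apply: (meas_mono Hm) => //; exact: sub_trans Hda Hae.
by move=> H H'; apply/eqP; rewrite eq_le (le _ _ _ _ H H') (le _ _ _ _ H' H).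
Qed.

Lemma measure_sandwich a b c : a ⊆ car S -> sandwich a b c -> re (measure R S mu a) = m b.
Proof.
move=> Ha Hs; have -> : measure R S mu a = rv (m b); last by rewrite re_rv.
apply: theP; first by apply/measure_is_sandwich; split=> //; exists b, c.
move=> r /measure_is_sandwich [_ [b' [c' [Hs' ->]]]].
by rewrite (sandwich_uniq Hs' Hs).
Qed.

Lemma in_completion a : (a ∈ C) = (a ⊆ car S /\ exists b c, sandwich a b c).
Proof.
have -> : (a ∈ C) = measurable R S mu a.
  apply: (in_compr (pow (car S))); first by dfn.
  by move=> x [r [H _]]; rewrite in_pow.
apply: propeq; split.
  by case=> r /measure_is_sandwich [H [b [c [H1 _]]]]; split=> //; exists b, c.
by case=> H [b [c Hs]]; exists (rv (m b)); apply/measure_is_sandwich; split=> //; exists b, c.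
Qed.

Lemma measure_isP a r : measure_is R S mu a r <-> a ∈ C /\ r = rv (re (measure R S mu a)).
Proof.
rewrite (propeq (measure_is_sandwich _ _)) in_completion; split.
  by case=> Ha [b [c [Hs ->]]]; rewrite (measure_sandwich Ha Hs); do 2!split=> //; exists b, c.
case=> -[Ha [b [c Hs]]] ->; split=> //; exists b, c; split=> //.
by rewrite (measure_sandwich Ha Hs).
Qed.

Lemma completion_inner a : a ∈ C -> exists b, [/\ b ∈ borel S, b ⊆ a & m b = cm a].
Proof.
rewrite in_completion => -[Ha [b [c Hs]]]; exists b; rewrite (measure_sandwich Ha Hs).
by case: Hs.
Qed.

Lemma completion_outer a : a ∈ C -> exists c, [/\ c ∈ borel S, a ⊆ c & m c = cm a].
Proof.
rewrite in_completion => -[Ha [b [c Hs]]]; exists c.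
by rewrite (measure_sandwich Ha Hs) -(sandwich_eq Hs); case: Hs.
Qed.

Lemma borel_sandwich b : b ∈ borel S -> b ⊆ car S /\ sandwich b b b.
Proof.
move=> Hb; split; first exact: (sigma_sub HA Hb).
split=> //; rewrite -(meas_emp Hm); congr m.
by apply: (ext T) => x; rewrite in_diff in_emp; tauto.
Qed.

Lemma completion_borel b : b ∈ borel S -> b ∈ C /\ cm b = m b.
Proof.
move=> /borel_sandwich [H1 H2]; split; last exact: measure_sandwich H1 H2.
by rewrite in_completion; split=> //; exists b, b.
Qed.

(** Closing the completion under countable unions requires Borel bounds for all terms at once. *)
Lemma choose_sandwich F : definable_term (fun e => F (e 0%N)) ->
  (forall n, n ∈ omega -> F n ∈ C) ->
  exists b c, [/\ fn b omega (borel S), fn c omega (borel S) &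
    forall n, n ∈ omega -> sandwich (F n) (b ∙ n) (c ∙ n)].
Proof.
move=> HF HFC.
case: (@countable_choice V T (Defs.prod (borel S) (borel S))
  (fun n p => pi1 p ⊆ F n /\ F n ⊆ pi2 p /\ m (diff (pi2 p) (pi1 p)) = 0)).
- by rewrite /m; dfn.
- move=> n /HFC; rewrite in_completion => -[Ha [b [c [Hb Hc Hba Hac E]]]].
  by exists ⟨b, c⟩; rewrite pair_in_prod pi1_pair pi2_pair.
move=> f [Hf H]; exists (lam omega (fun n => pi1 (f ∙ n))), (lam omega (fun n => pi2 (f ∙ n))).
split.
- by apply: lam_fn => // n Hn; case: (prodP (fn_app Hf Hn)).
- by apply: lam_fn => // n Hn; case: (prodP (fn_app Hf Hn)).
- move=> n Hn; rewrite !lam_app //; case: (prodP (fn_app Hf Hn)) => _ H1 H2.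
  by case: (H n Hn) => H3 [H4 H5]; split.
Qed.

Lemma sandwich_bigcup F (b c : V) : definable_term (fun e => F (e 0%N)) ->
  fn b omega (borel S) -> fn c omega (borel S) ->
  (forall n, n ∈ omega -> sandwich (F n) (b ∙ n) (c ∙ n)) ->
  sandwich (bigcup F) (bigcup (app b)) (bigcup (app c)).
Proof.
move=> HF Hb Hc H.
have Hb' : definable_term (fun e => b ∙ (e 0%N)) by dfn.
have Hc' : definable_term (fun e => c ∙ (e 0%N)) by dfn.
have HbA n : n ∈ omega -> b ∙ n ∈ borel S by apply: fn_app Hb.
have HcA n : n ∈ omega -> c ∙ n ∈ borel S by apply: fn_app Hc.
have HUb := sigma_bigcup HA Hb' HbA; have HUc := sigma_bigcup HA Hc' HcA.
split=> //.
- move=> x; rewrite !in_bigcup // => -[n [Hn Hx]]; exists n; split=> //.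
  by case: (H n Hn) => _ _ H1 _ _; apply: H1.
- move=> x; rewrite !in_bigcup // => -[n [Hn Hx]]; exists n; split=> //.
  by case: (H n Hn) => _ _ _ H1 _; apply: H1.
apply/eqP; rewrite eq_le; apply/andP; split; last by apply: (meas_ge0 Hm); apply: (sigma_diff HA).
have HD : definable_term (fun e => diff (c ∙ (e 0%N)) (b ∙ (e 0%N))) by dfn.
have HDA n : n ∈ omega -> diff (c ∙ n) (b ∙ n) ∈ borel S by move=> Hn; apply: (sigma_diff HA); auto.
rewrite -(@meas_bigcup_null V T _ _ _ Hm (fun n => diff (c ∙ n) (b ∙ n)) HD); last by move=> n Hn; split; [exact: HDA|case: (H n Hn)].
apply: (meas_mono Hm); [exact: (sigma_diff HA)|exact: (sigma_bigcup HA)|].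
move=> x; rewrite in_diff !in_bigcup // => -[[n [Hn Hx]] Hx'].
by exists n; rewrite in_diff; do 2!split=> //; move=> Hxb; apply: Hx'; exists n.
Qed.

Lemma completion_sigma : sigma_algebra (car S) C.
Proof.
split; first by move=> a; rewrite in_completion in_pow => -[].
split; first by case: (completion_borel (sigma_total HA)).
split=> [a|f Hf].
  rewrite !in_completion => -[Ha [b [c [Hb Hc Hba Hac E]]]].
  split; first by move=> x; rewrite in_diff => -[].
  exists (diff (car S) c), (diff (car S) b); split; try exact: (sigma_compl HA).
  - by move=> x; rewrite !in_diff => -[H1 H2]; split=> // /Hac.
  - by move=> x; rewrite !in_diff => -[H1 H2]; split=> // /Hba.
  rewrite -E; congr m; apply: (ext T) => x; rewrite !in_diff; split.
    by move=> [[H1 H2] H3]; split=> //; apply: NNPP => H4; apply: H3.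
  by move=> [H1 H2]; have H3 := sigma_sub HA Hc _ H1; tauto.
have HF : definable_term (fun e => f ∙ (e 0%N)) by dfn.
have HFC n : n ∈ omega -> f ∙ n ∈ C by apply: fn_app Hf.
case: (choose_sandwich HF HFC) => b [c [Hb Hc Hs]].
rewrite (Union_seqE Hf) in_completion; split; last first.
  by exists (bigcup (app b)), (bigcup (app c)); apply: sandwich_bigcup.
move=> x; rewrite in_bigcup // => -[n [/HFC]]; rewrite in_completion => -[H _]; exact: H.
Qed.

Lemma completion_measure : is_measure (car S) C cm.
Proof.
have HC := completion_sigma.
split=> //.
- by move=> a /completion_inner [b [Hb _ <-]]; apply: (meas_ge0 Hm).
- case: (completion_borel (sigma_total HA)) => _ ->; exact: (meas_one Hm).
- move=> a a' Ha Ha' Hdis.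
  have : cup a a' ∈ C by apply: (sigma_cup HC).
  move: Ha Ha'; rewrite !in_completion => -[Ha [b [c Hs]]] [Ha' [b' [c' Hs']]] [HU _].
  have HsU : sandwich (cup a a') (cup b b') (cup c c').
    case: Hs Hs' => H1 H2 H3 H4 H5 [H1' H2' H3' H4' H5']; split; try exact: (sigma_cup HA).
    - by move=> x; rewrite !in_cup => -[/H3|/H3']; auto.
    - by move=> x; rewrite !in_cup => -[/H4|/H4']; auto.
    have D1 := sigma_diff HA H2 H1; have D2 := sigma_diff HA H2' H1'.
    have D3 := sigma_diff HA (sigma_cup HA H2 H2') (sigma_cup HA H1 H1').
    apply/eqP; rewrite eq_le (meas_ge0 Hm D3) andbT.
    have := meas_cup_le Hm D1 D2; rewrite H5 H5' addr0; apply: le_trans.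
    apply: (meas_mono Hm) => //; first exact: (sigma_cup HA).
    by move=> x; rewrite in_diff !in_cup !in_diff; tauto.
  rewrite (measure_sandwich HU HsU) (measure_sandwich Ha Hs) (measure_sandwich Ha' Hs').
  case: Hs Hs' => H1 H2 H3 H4 H5 [H1' H2' H3' H4' H5'].
  by apply: (meas_add Hm) => // x /H3 Hx /H3'; apply: Hdis.
move=> F c HF HFC Hinc Hc.
case: (choose_sandwich HF HFC) => b [d [Hb Hd Hs]].
have HsU := sandwich_bigcup HF Hb Hd Hs.
have HU : bigcup F ⊆ car S by apply: (sigma_sub HC); apply: (sigma_bigcup HC).
rewrite (measure_sandwich HU HsU).
have Hb' : definable_term (fun e => b ∙ (e 0%N)) by dfn.
have HbA n : n ∈ omega -> b ∙ n ∈ borel S by apply: fn_app Hb.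
have HPA n : n ∈ omega -> partial_union (app b) n ∈ borel S.
  move=> Hn; apply: (sigma_partial_union HA) => // k Hk; apply: HbA.
  exact: omega_trans Hk.
rewrite (bigcup_partial Hb'); apply: (meas_cont Hm) => //.
  by move=> n Hn; exact: partial_mono.
have Hcm n : n ∈ omega -> m (d ∙ n) <= c.
  move=> Hn; rewrite (sandwich_eq (Hs n Hn)) -(measure_sandwich _ (Hs n Hn)); first exact: Hc.
  exact: (sigma_sub HC (HFC n Hn)).
have Hup j : j ∈ omega -> forall i, i ∈ succ j -> F i ⊆ F j.
  move: j; apply: omega_ind; first by dfn.
    by move=> i; rewrite in_succ in_emp => -[//|->].
  move=> j Hj IH i; rewrite in_succ => -[Hi|-> //].
  exact: sub_trans (IH i Hi) (Hinc j Hj).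
have HdA n : n ∈ omega -> d ∙ n ∈ borel S by apply: fn_app Hd.
move=> n Hn; case: (omega_case Hn) => [->|[k [Hk ->]]].
  rewrite partial_union0 // (meas_emp Hm); apply: le_trans (Hcm emp emp_omega).
  by apply: (meas_ge0 Hm); auto.
apply: le_trans (Hcm k Hk); apply: (meas_mono Hm); auto.
move=> x; rewrite in_partial_union; auto.
move=> -[i [Hi Hx]].
have Hio : i ∈ omega by apply: omega_trans Hi; auto.
case: (Hs i Hio) => _ _ H1 _ _; case: (Hs k Hk) => _ _ _ H2 _.
by apply: H2; apply: (Hup k Hk i Hi); apply: H1.
Qed.

Lemma full_measure a : measure_is R S mu a (one R) <-> a ∈ C /\ cm a = 1.
Proof.
rewrite (propeq (measure_isP _ _)); split=> -[Ha E]; split=> //.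
  by apply: rv_inj; rewrite -E rv_one.
by rewrite E rv_one.
Qed.

(** For measure one the whole space serves as outer set, so an inner Borel set of measure one is
    enough. This is the form used below. *)
Lemma full_borel a : measure_is R S mu a (one R) <->
  a ⊆ car S /\ exists b, [/\ b ∈ borel S, b ⊆ a & mu ∙ b = one R].
Proof.
split.
  by case=> Ha [b [c [Hb [Hc [Hba [Hac [E0 E1]]]]]]]; split=> //; exists b.
case=> Ha [b [Hb Hba E]]; rewrite (propeq (measure_is_sandwich _ _)); split=> //.
have E1 : m b = 1 by rewrite /m E -rv_one re_rv.
exists b, (car S); split; last by rewrite E1 rv_one.
split=> //; first exact: (sigma_total HA).
by rewrite (meas_compl Hm) // E1 subrr.
Qed.

End Completion.

Section Transfer.

Context {V : Type} {T : model V}.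
#[local] Hint Extern 0 (set_structure _) => exact (model_struct T) : typeclass_instances.
Local Notation K := (real_of T).
Lemma total_image X (m : V -> K) S (Y : V) (h : V -> V) : is_measure X (pow X) m ->
  definable_term (fun e => h (e 0%N)) -> Y ⊆ X -> m Y = 1 ->
  (forall y, y ∈ Y -> h y ∈ car S) ->
  is_measure (car S) (borel S) (fun b => m (preim Y h b)).
Proof.
move=> Hm Hh HYX HY HhS; have Hd := meas_dfn Hm.
have inp b x : (x ∈ preim Y h b) = (x ∈ Y /\ h x ∈ b) by rewrite in_preim.
have HP b : preim Y h b ∈ pow X by rewrite in_pow => x; rewrite inp => -[/HYX].
split.
- exact: borel_sigma.
- by dfn.
- by move=> b _; apply: (meas_ge0 Hm).
- rewrite -HY; congr m; apply: (ext T) => x; rewrite inp.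
  by split=> [[]|Hx] //; split=> //; apply: HhS.
- move=> a b Ha Hb Hab; rewrite -(meas_add Hm) //; last first.
    by move=> x; rewrite !inp => -[_ H1] [_ H2]; apply: (Hab _ H1 H2).
  by congr m; apply: (ext T) => x; rewrite in_cup !inp in_cup; tauto.
- move=> F c HF HFA Hinc Hc.
  have -> : preim Y h (bigcup F) = bigcup (fun n => preim Y h (F n)).
    apply: (ext T) => x; rewrite inp !in_bigcup //; split.
      by move=> [Hx [n [Hn Hxn]]]; exists n; rewrite inp.
    by move=> [n [Hn]]; rewrite inp => -[Hx Hxn]; split=> //; exists n.
  apply: (meas_cont Hm) => //.
  by move=> n Hn x; rewrite !inp => -[H1 H2]; split=> //; apply: (Hinc n).
Qed.

End Transfer.

(** * Measure uniformization on Polish spaces *)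

Section Codes.

Context {V : Type} {T : model V}.
#[local] Hint Extern 0 (set_structure _) => exact (model_struct T) : typeclass_instances.
Local Notation R := (model_reals T).
Local Notation K := (real_of T).
Local Notation re := (@re V T).
Local Notation rv := (@rv V T).
Local Notation dK F := (definable_term (fun e => rv (F (e 0%N)))).
Implicit Types (F : V -> K).

(** The supremum is picked by epsilon, which says nothing about definability; [term_code] recovers
    it for the suprema in use. *)
Lemma real_sup : {f : (V -> K) -> K | forall F, dK F ->
  (exists u, forall n, n ∈ omega -> F n <= u) ->
  (forall n, n ∈ omega -> F n <= f F) /\ (forall u, (forall n, n ∈ omega -> F n <= u) -> f F <= u)} .
Proof.
exists (fun F => epsilon (inhabits 0) (fun s : K => (forall n, n ∈ omega -> F n <= s) /\
  (forall u, (forall n, n ∈ omega -> F n <= u) -> s <= u))) => F HF [u Hu].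
apply: (epsilon_spec (inhabits 0) (fun s : K => (forall n, n ∈ omega -> F n <= s) /\
  (forall u, (forall n, n ∈ omega -> F n <= u) -> s <= u))).
case: (@sup_exists V T (fun y => exists n, n ∈ omega /\ y = F n)).
- by dfn.
- by exists (F emp), emp; auto.
- by exists u => x [n [Hn ->]]; apply: Hu.
move=> s [H1 H2]; exists s; split=> [n Hn|v Hv]; first by apply: H1; exists n.
by apply: H2 => x [n [Hn ->]]; apply: Hv.
Qed.

Definition code_part (s n : V) : K := ksum n (fun k => re (ite (k ∈ s) (rv (p3 k)) (zero R))).

Lemma definable_code_part : definable_term (fun e => rv (code_part (e 0%N) (e 1%N))).
Proof. by rewrite /code_part; dfn. Qed.

(** The sum of 3^-n over n ∈ s. *)
Definition code (s : V) : K := sval real_sup (code_part s).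

Let Hcp := definable_code_part.

Lemma code_part0 s : code_part s emp = 0.
Proof. by rewrite /code_part ksum0. Qed.

Lemma code_partS_in s n : n ∈ omega -> n ∈ s -> code_part s (succ n) = code_part s n + p3 n.
Proof. by move=> Hn Hs; rewrite /code_part ksumS // ite_true // re_rv. Qed.

Lemma code_partS_out s n : n ∈ omega -> ~ n ∈ s -> code_part s (succ n) = code_part s n.
Proof. by move=> Hn Hs; rewrite /code_part ksumS // ite_false // -rv_zero re_rv addr0. Qed.

Lemma code_part_step s n : n ∈ omega ->
  code_part s n <= code_part s (succ n) <= code_part s n + p3 n.
Proof.
move=> Hn; have := p3_gt0 Hn (T := T); case: (classic (n ∈ s)) => Hs.
  by rewrite code_partS_in //; lra.
by rewrite code_partS_out //; lra.
Qed.

Lemma code_part_mono s n k : n ∈ omega -> k ∈ succ n -> code_part s k <= code_part s n.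
Proof.
move=> Hn; move: n Hn k; apply: omega_ind; first by dfn.
  by move=> k; rewrite in_succ in_emp => -[//|->].
move=> n Hn IH k; rewrite in_succ => -[/IH H|-> //]; apply: le_trans H _.
by case/andP: (code_part_step s Hn).
Qed.

(** 3/2 3^-n is the whole tail, the sum of 3^-k over k ≥ n; added to the partial sums it gives upper
    bounds that decrease with n. *)
Lemma code_part_upper s n k : n ∈ omega -> k ∈ succ n ->
  code_part s n + 3 / 2 * p3 n <= code_part s k + 3 / 2 * p3 k.
Proof.
move=> Hn; move: n Hn k; apply: omega_ind; first by dfn.
  by move=> k; rewrite in_succ in_emp => -[//|->].
move=> n Hn IH k; rewrite in_succ => -[/IH H|-> //]; apply: le_trans H.
by rewrite p3S //; have := code_part_step s Hn; lra.
Qed.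

Lemma code_bounds s : (forall n, n ∈ omega -> code_part s n <= code s) /\
  (forall n, n ∈ omega -> code s <= code_part s n + 3 / 2 * p3 n).
Proof.
have H1 n k : n ∈ omega -> k ∈ omega -> code_part s k <= code_part s n + 3 / 2 * p3 n.
  move=> Hn Hk; have Hpn := p3_gt0 Hn (T := T); have Hpk := p3_gt0 Hk (T := T).
  case: (omega_total Hn Hk) => [H|[->|H]]; last 1 first.
  - by have := code_part_upper s Hk (eq_ind_r id (or_introl H) (in_succ k n)); lra.
  - by have := code_part_mono s Hn (eq_ind_r id (or_introl H) (in_succ n k)); lra.
  - lra.
case: (svalP real_sup (code_part s)) => [||H2 H3]; first by dfn.
  by exists (code_part s emp + 3 / 2 * p3 emp) => n Hn; apply: H1.
by split=> // n Hn; apply: H3 => k Hk; apply: H1.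
Qed.

(** At the first difference s' gains 3^-n, while the digits after n can give s at most 3/2 3^-(n+1)
    = 3^-n / 2. *)
Lemma code_lt s s' n : n ∈ omega -> (forall k, k ∈ n -> k ∈ s <-> k ∈ s') ->
  ~ n ∈ s -> n ∈ s' -> code s < code s'.
Proof.
move=> Hn Hk Hs Hs'; have Hp := p3_gt0 Hn (T := T).
have E : code_part s n = code_part s' n.
  apply: ksum_ext => // k Hkn; congr (re (ite _ _ _)).
  exact: propeq (Hk k Hkn).
case: (code_bounds s) => _ /(_ (succ n) (succ_omega Hn)).
rewrite code_partS_out // p3S //.
case: (code_bounds s') => /(_ (succ n) (succ_omega Hn)) + _.
rewrite code_partS_in // E; lra.
Qed.

Lemma code_inj s s' : s ⊆ omega -> s' ⊆ omega -> code s = code s' -> s = s'.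
Proof.
move=> Hs Hs' E; apply: NNPP => Hne.
have [n [Hn Hdiff]] : exists n, n ∈ omega /\ ~ (n ∈ s <-> n ∈ s').
  apply: NNPP => H; apply: Hne; apply: (ext T) => x; apply: NNPP => Hx; apply: H; exists x.
  split=> //; apply: NNPP => Hxo; apply: Hx; split=> Hx; case: Hxo; auto.
case: (@omega_least V T (fun n => ~ (n ∈ s <-> n ∈ s')) n) => //.
move=> k [Hk Hdk Hmin].
have Hbelow j : j ∈ k -> j ∈ s <-> j ∈ s' by move=> Hj; apply: NNPP; apply: Hmin.
case: (classic (k ∈ s)) => Hks; case: (classic (k ∈ s')) => Hks'; try tauto.
  have : code s' < code s by apply: (@code_lt _ _ k) => // j /Hbelow; tauto.
  by rewrite E ltxx.
have : code s < code s' by apply: (@code_lt _ _ k).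
by rewrite E ltxx.
Qed.

Lemma code_range s : 0 <= code s <= 3 / 2.
Proof.
case: (code_bounds s) => /(_ emp emp_omega) + /(_ emp emp_omega).
by rewrite code_part0 p30; lra.
Qed.

Lemma lt_code s t : t < code s <-> exists n, n ∈ omega /\ t < code_part s n.
Proof.
case: (code_bounds s) => H1 H2; split=> [H|[n [Hn Ht]]]; last exact: lt_le_trans Ht (H1 n Hn).
case: (@p3_small V T ((code s - t) / 2)) => [|n [Hn Hp]]; first by lra.
by exists n; split=> //; have := H2 n Hn; lra.
Qed.

(** The lower bounds by partial sums and the upper bounds with the tail added differ by 3/2 3^-n, so
    together they determine the code. *)
Lemma term_code (s : (nat -> V) -> V) : definable_term s -> definable_term (fun e => rv (code (s e))).
Proof.
move=> Hs; apply: (@term_real_the _ _ (fun e y => exists x : K, y = rv x /\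
   (forall n, n ∈ omega -> code_part (s e) n <= x) /\
   forall n, n ∈ omega -> x <= code_part (s e) n + 3 / 2 * p3 n)); first by dfn.
move=> e; case: (code_bounds (s e)) => H1 H2; split; first by exists (code (s e)).
move=> y [x [-> [H3 H4]]]; congr rv; apply/eqP; rewrite eq_le; apply/andP; split;
  apply: (@real_le_eps_mul _ _ _ _ (3 / 2)); try lra; move=> n Hn.
  exact: le_trans (H4 n Hn) (lerD (H1 n Hn) (lexx _)).
exact: le_trans (H2 n Hn) (lerD (H3 n Hn) (lexx _)).
Qed.

End Codes.

Ltac dfn_code :=
  lazymatch goal with
  | |- definable_term (fun e => rv (code (@?s e))) => refine (@term_code _ _ s _)
  end.

Ltac dfn_sym6 ::= first [ dfn_space2 | dfn_meas | dfn_code ].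

(** * Open and Borel sets of the line *)

Section RealSpace.

Context {V : Type} {T : model V}.
#[local] Hint Extern 0 (set_structure _) => exact (model_struct T) : typeclass_instances.
Local Notation R := (model_reals T).
Local Notation K := (real_of T).
Local Notation re := (@re V T).
Local Notation rv := (@rv V T).
Local Notation dK F := (definable_term (fun e => rv (F (e 0%N)))).

Lemma in_open_interval a b x : (x ∈ open_interval R a b) = (x ∈ RR R /\ lt R a x /\ lt R x b).
Proof. by apply: (in_compr (RR R)) => [|y []//]; dfn. Qed.

Lemma rv_lt (x y : K) : (x < y) = lt R (rv x) (rv y) :> Prop.
Proof.
rewrite lt_neqAle /lt -rv_le; apply: propeq; split.
  by case/andP => /eqP H1 H2; split=> // /rv_inj.
by case=> H1 H2; apply/andP; split=> //; apply/eqP => E; apply: H2; rewrite E.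
Qed.

Lemma in_interval (a b x : K) : (rv x ∈ open_interval R (rv a) (rv b)) = (a < x < b) :> Prop.
Proof.
rewrite in_open_interval -!rv_lt; apply: propeq; split=> [[_ [-> ->]] //|/andP [H1 H2]].
by split; first exact: rv_in.
Qed.

Lemma in_generated_opens X B u : (u ∈ opens (generated_space X B)) =
  (u ∈ pow X /\ forall A, is_topology X A -> B ⊆ A -> u ∈ A).
Proof. by rewrite opens_pair; apply: (in_compr (pow X)) => [|x []//]; dfn. Qed.

Lemma car_generated X B : car (generated_space X B) = X.
Proof. exact: car_pair. Qed.

Lemma generated_topology X B : is_topology X (opens (generated_space X B)).
Proof.
split; first by move=> u; rewrite in_generated_opens => -[].
split; first by rewrite in_generated_opens in_pow; split=> [x|A [_ []]] //; rewrite in_emp.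
split; first by rewrite in_generated_opens in_pow; split=> // A [_ [_ []]].
split=> [u v|U HU]; rewrite in_generated_opens.
  move=> [Hu Hu']; rewrite !in_generated_opens => -[Hv Hv']; split.
    by move: Hu; rewrite !in_pow => Hu x; rewrite in_cap => -[/Hu].
  by move=> A HA HB; case: (HA) => _ [_ [_ [H _]]]; apply: H; auto.
split.
  rewrite in_pow => x; rewrite in_union => -[b [/HU]]; rewrite in_generated_opens in_pow.
  by move=> [H _] /H.
move=> A HA HB; case: (HA) => _ [_ [_ [_ H]]]; apply: H => u /HU.
by rewrite in_generated_opens => -[_]; apply.
Qed.

Lemma generated_sub X B u : B ⊆ pow X -> u ∈ B -> u ∈ opens (generated_space X B).
Proof. by move=> HB Hu; rewrite in_generated_opens; split=> [|A _]; auto. Qed.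

(** Induction over a generated topology that avoids writing open sets as unions of finite
    intersections: the sets u with P u x at each of their points x form a topology containing B. *)
Lemma generated_open_ind X B (P : V -> V -> Prop) u x :
  definable (fun e => P (e 0%N) (e 1%N)) -> B ⊆ pow X ->
  (forall u x, u ∈ B -> x ∈ u -> P u x) ->
  (forall x, x ∈ X -> P X x) ->
  (forall u v x, x ∈ u -> x ∈ v -> P u x -> P v x -> P (cap u v) x) ->
  (forall u v x, u ⊆ v -> v ⊆ X -> P u x -> P v x) ->
  u ∈ opens (generated_space X B) -> x ∈ u -> P u x.
Proof.
move=> HP HB H1 H2 H3 H4; rewrite in_generated_opens => -[Hu H] Hx.
separate (pow X) (fun u => forall x, x ∈ u -> P u x) as A inA.
have HA : is_topology X A.
  split; first by move=> v; rewrite inA => -[].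
  split; first by rewrite inA in_pow; split=> y; rewrite in_emp.
  split; first by rewrite inA in_pow.
  split=> [v w|U HU]; rewrite inA.
    move=> [Hv Hv']; rewrite !inA !in_pow => -[Hw Hw']; split.
      by move: Hv; rewrite in_pow => Hv y; rewrite in_cap => -[/Hv].
    by move=> y; rewrite in_cap => -[Hyv Hyw]; apply: H3; auto.
  have HUX : union U ⊆ X.
    move=> y; rewrite in_union => -[b [/HU]]; rewrite inA in_pow => -[Hb _]; exact: Hb.
  rewrite in_pow; split=> // y; rewrite in_union => -[b [Hb Hyb]].
  have := HU b Hb; rewrite inA => -[_ /(_ y Hyb)]; apply: H4 => // z Hz.
  by rewrite in_union; exists b.
have : u ∈ A by apply: H => // v Hv; rewrite inA; split=> [|y]; [apply: HB|apply: H1].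
by rewrite inA => -[_]; apply.
Qed.

Lemma in_intervals u : (u ∈ ⟦ u | exists a b, a ∈ RR R /\ b ∈ RR R /\ u = open_interval R a b ⟧) =
  (exists a b : K, u = open_interval R (rv a) (rv b)).
Proof.
have -> : (u ∈ ⟦ u | exists a b, a ∈ RR R /\ b ∈ RR R /\ u = open_interval R a b ⟧) =
    (exists a b, a ∈ RR R /\ b ∈ RR R /\ u = open_interval R a b).
  apply: (in_compr (pow (RR R))); first by dfn.
  by move=> x [a [b [_ [_ ->]]]]; rewrite in_pow => y; rewrite in_open_interval => -[].
apply: propeq; split=> [[a [b [Ha [Hb ->]]]]|[a [b ->]]].
  by exists (re a), (re b); rewrite !rv_re.
by exists (rv a), (rv b); do 2!(split; first exact: rv_in).
Qed.

Lemma car_real_space : car (real_space R) = RR R.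
Proof. exact: car_generated. Qed.

Lemma real_topology : is_topology (RR R) (opens (real_space R)).
Proof. exact: generated_topology. Qed.

Lemma interval_open (a b : K) : open_interval R (rv a) (rv b) ∈ opens (real_space R).
Proof.
apply: generated_sub; last by rewrite in_intervals; exists a, b.
move=> u; rewrite in_intervals => -[a' [b' ->]]; rewrite in_pow => x.
by rewrite in_open_interval => -[].
Qed.

Lemma open_real u (x : K) : u ∈ opens (real_space R) -> rv x ∈ u ->
  exists a b : K, a < x < b /\ forall y : K, a < y < b -> rv y ∈ u.
Proof.
move=> Hu Hx.
have : exists a b : K, a < re (rv x) < b /\ forall y : K, a < y < b -> rv y ∈ u; last by rewrite re_rv.
apply: (@generated_open_ind _ _ (fun u v => exists a b : K, a < re v < b /\
   forall y : K, a < y < b -> rv y ∈ u) _ _ _ _ _ _ _ _ Hu Hx).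
- by dfn.
- move=> v; rewrite in_intervals => -[a [b ->]]; rewrite in_pow => y.
  by rewrite in_open_interval => -[].
- move=> v y; rewrite in_intervals => -[a [b ->]] Hy; exists a, b.
  have Hy' : y ∈ RR R by move: Hy; rewrite in_open_interval => -[].
  by rewrite -in_interval rv_re //; split=> // z; rewrite in_interval.
- move=> y Hy; exists (re y - 1), (re y + 1); split; first by lra.
  by move=> z _; exact: rv_in.
- move=> v w y _ _ [a [b [H1 H2]]] [a' [b' [H1' H2']]].
  exists (Num.max a a'), (Num.min b b'); rewrite gt_max lt_min.
  split; first by move/andP: H1 => [-> ->]; move/andP: H1' => [-> ->].
  move=> z; rewrite gt_max lt_min => /andP [/andP [Ha Ha'] /andP [Hb Hb']].
  by rewrite in_cap; split; [apply: H2; rewrite Ha Hb|apply: H2'; rewrite Ha' Hb'].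
- move=> v w y Hvw _ [a [b [H1 H2]]]; exists a, b; split=> // z Hz.
  by apply: Hvw; apply: H2.
Qed.

Lemma open_real_rational u (x : K) : u ∈ opens (real_space R) -> rv x ∈ u ->
  exists n m, [/\ n ∈ omega, m ∈ omega, rational n < x < rational m &
    forall y : K, rational n < y < rational m -> rv y ∈ u].
Proof.
move=> Hu Hx; case: (open_real Hu Hx) => a [b [/andP [Ha Hb] H]].
case: (rational_dense Ha) => n [Hn /andP [Hn1 Hn2]].
case: (rational_dense Hb) => m [Hm /andP [Hm1 Hm2]].
exists n, m; split=> //; first by rewrite Hn2 Hm1.
move=> y /andP [H1 H2]; apply: H.
by rewrite (lt_trans Hn1 H1) (lt_trans H2 Hm2).
Qed.

(** The sets {t < g} generate: an interval (l, u) comes from {l < g} and the union of the sets {g ≤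
    u - 3^-n}, and an open set is a countable union of intervals with triadic end points. *)
Lemma preim_real_borel X A (g : V -> K) : sigma_algebra X A -> dK g ->
  (forall t : K, exists a, a ∈ A /\ forall x, x ∈ a <-> x ∈ X /\ t < g x) ->
  forall b, b ∈ borel (real_space R) -> preim X (fun x => rv (g x)) b ∈ A.
Proof.
move=> HA Hg Hgt b Hb.
have inp c x : (x ∈ preim X (fun x => rv (g x)) c) = (x ∈ X /\ rv (g x) ∈ c) by rewrite in_preim.
separate (pow (RR R)) (fun b => preim X (fun x => rv (g x)) b ∈ A) as B inB.
have HB : sigma_algebra (RR R) B.
  split; first by move=> x; rewrite inB => -[].
  split.
    rewrite inB in_pow; split=> //.
    have -> : preim X (fun x => rv (g x)) (RR R) = X; last exact: (sigma_total HA).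
    by apply: (ext T) => x; rewrite inp; split=> [[]|H] //; split=> //; exact: rv_in.
  split=> [c|f Hf]; rewrite inB.
    move=> [Hc Hc']; rewrite inB in_pow; split; first by move=> x; rewrite in_diff => -[].
    have -> : preim X (fun x => rv (g x)) (diff (RR R) c) =
        diff X (preim X (fun x => rv (g x)) c); last exact: (sigma_compl HA).
    apply: (ext T) => x; rewrite inp !in_diff inp; have := rv_in (g x); tauto.
  split.
    rewrite in_pow => x; rewrite in_Union_seq => -[n [Hn Hx]].
    by have := fn_app Hf Hn; rewrite inB in_pow => -[H _]; apply: H.
  have -> : preim X (fun x => rv (g x)) (Union_seq f) =
      bigcup (fun n => preim X (fun x => rv (g x)) (f ∙ n)).
    apply: (ext T) => x; rewrite inp in_Union_seq in_bigcup //; split.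
      by move=> [Hx [n [Hn Hxn]]]; exists n; rewrite inp.
    by move=> [n [Hn]]; rewrite inp => -[Hx Hxn]; split=> //; exists n.
  by apply: (sigma_bigcup HA) => // n Hn; have := fn_app Hf Hn; rewrite inB => -[].
have Hint (l u : K) : preim X (fun x => rv (g x)) (open_interval R (rv l) (rv u)) ∈ A.
  have Hle t : exists a, a ∈ A /\ forall x, x ∈ a <-> x ∈ X /\ g x <= t.
    case: (Hgt t) => a [Ha Hat]; exists (diff X a); split; first exact: (sigma_compl HA).
    move=> x; rewrite in_diff (propeq (Hat x)) leNgt.
    by split=> -[Hx H]; split=> //; [apply/negP => Ht; apply: H|move=> [_ Ht]; rewrite Ht in H].
  case: (@countable_choice V T A (fun n a => forall x, x ∈ a <-> x ∈ X /\ g x <= u - p3 n)).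
  - by dfn.
  - by move=> n Hn; exact: Hle.
  move=> f [Hf Hfu]; case: (Hgt l) => a [Ha Hal].
  have -> : preim X (fun x => rv (g x)) (open_interval R (rv l) (rv u)) =
      cap a (bigcup (app f)).
    apply: (ext T) => x; rewrite inp in_cap (propeq (Hal x)) in_bigcup //.
    rewrite in_interval; split.
      move=> [Hx /andP [H1 H2]]; split=> //; case: (@p3_small V T (u - g x)) => [|n [Hn Hp]].
        by lra.
      exists n; split=> //; rewrite (propeq (Hfu n Hn x)); split=> //; lra.
    move=> [[Hx H1] [n [Hn]]]; rewrite (propeq (Hfu n Hn x)) => -[_ H2]; split=> //.
    by rewrite H1; have := p3_gt0 Hn (T := T); lra.
  apply: (sigma_cap HA) => //; apply: (sigma_bigcup HA); first by dfn.
  by move=> n Hn; apply: fn_app Hf Hn.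
move: Hb; rewrite in_borel car_real_space => -[Hb Hb'].
have : b ∈ B.
  apply: Hb' => // u Hu; rewrite inB; split; first by case: real_topology => H _; apply: H.
  have -> : preim X (fun x => rv (g x)) u = bigcup (fun n => bigcup (fun m =>
      ite (forall y : K, rational n < y < rational m -> rv y ∈ u)
       (preim X (fun x => rv (g x)) (open_interval R (rv (rational n)) (rv (rational m)))) emp)).
    apply: (ext T) => x; rewrite inp in_bigcup; last by dfn.
    split.
      move=> [Hx Hgu]; case: (open_real_rational Hu Hgu) => n [m [Hn Hm H1 H2]].
      exists n; split=> //; rewrite in_bigcup; last by dfn.
      by exists m; split=> //; rewrite ite_true // inp in_interval.
    move=> [n [Hn]]; rewrite in_bigcup; last by dfn.
    move=> [m [Hm]]; case: (classic (forall y : K, rational n < y < rational m -> rv y ∈ u)) => H.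
      by rewrite ite_true // inp in_interval => -[Hx /H].
    by rewrite ite_false // in_emp.
  apply: (sigma_bigcup HA); first by dfn.
  move=> n Hn; apply: (sigma_bigcup HA); first by dfn.
  move=> m Hm; case: (classic (forall y : K, rational n < y < rational m -> rv y ∈ u)) => H.
    by rewrite ite_true.
  by rewrite ite_false //; exact: (sigma_emp HA).
by rewrite inB => -[].
Qed.

End RealSpace.

(** * An injection into the line compatible with Lebesgue null sets *)

Section Uniformization.

Context {V : Type} {T : model V}.
#[local] Hint Extern 0 (set_structure _) => exact (model_struct T) : typeclass_instances.
Local Notation R := (model_reals T).
Local Notation K := (real_of T).
Local Notation re := (@re V T).
Local Notation rv := (@rv V T).
Local Notation dK F := (definable_term (fun e => rv (F (e 0%N)))).
Variables (S nu U : V).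
Hypotheses (Hnu : nu ∈ Prob R S) (HU : fn U omega (borel S))
  (Hsep : forall x y, x ∈ car S -> y ∈ car S ->
     (forall n, n ∈ omega -> x ∈ U ∙ n <-> y ∈ U ∙ n) -> x = y).
Let m b := re (nu ∙ b).
Let Hm : is_measure (car S) (borel S) m := prob_measure Hnu.
Let HA : sigma_algebra (car S) (borel S) := @borel_sigma V T S.
Local Notation X := (car S).

Definition trace (x : V) : V := ⟦ n | n ∈ omega /\ x ∈ U ∙ n ⟧.

Let Htr : definable_term (fun e => trace (e 0%N)).
Proof. by rewrite /trace; dfn. Qed.

Lemma in_trace x n : (n ∈ trace x) = (n ∈ omega /\ x ∈ U ∙ n).
Proof. by apply: (in_compr omega) => [|y []//]; dfn. Qed.

Lemma psi_exists : {f : V -> K | forall x, f x = code (trace x)}.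
Proof. by exists (fun x => code (trace x)). Qed.

(** The point x is sent to the sum of 3^-n over the n with x ∈ U_n; this is injective because the
    U_n separate points. *)
Definition psi : V -> K := sval psi_exists.

Lemma psiE x : psi x = code (trace x).
Proof. by rewrite /psi; case: psi_exists. Qed.

Let Hpsi : dK psi.
Proof. by rewrite (funeq psiE); dfn. Qed.

Let psi_range x : 0 <= psi x <= 3 / 2. Proof. by rewrite psiE; exact: code_range. Qed.

Lemma psi_inj x y : x ∈ X -> y ∈ X -> psi x = psi y -> x = y.
Proof.
rewrite !psiE => Hx Hy E; apply: Hsep => // n Hn.
have Htw z : trace z ⊆ omega by move=> k; rewrite in_trace => -[].
have := code_inj (Htw x) (Htw y) E => Et.
have : (n ∈ trace x) = (n ∈ trace y) by rewrite Et.
by rewrite !in_trace => E'; split=> H; [have : n ∈ omega /\ y ∈ U ∙ n by rewrite -E'|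
  have : n ∈ omega /\ x ∈ U ∙ n by rewrite E'] => -[].
Qed.

(** {t < psi} is the union over n of the sets where the n-th partial sum exceeds t, and one more
    digit splits such a set along U_n. *)
Lemma psi_gt (t : K) : exists a, a ∈ borel S /\ forall x, x ∈ a <-> x ∈ X /\ t < psi x.
Proof.
have Hcp := @definable_code_part V T.
have part n : n ∈ omega -> forall t : K, exists a, a ∈ borel S /\
    forall x, x ∈ a <-> x ∈ X /\ t < code_part (trace x) n.
  move: n; apply: omega_ind; first by dfn.
    move=> s; case: (classic (is_true (s < 0))) => Hs.
      exists X; split; first exact: (sigma_total HA).
      by move=> x; rewrite code_part0; split=> [|[]].
    exists emp; split; first exact: (sigma_emp HA).
    by move=> x; rewrite code_part0 in_emp; split=> // -[].
  move=> n Hn IH s; case: (IH s) => a [Ha Has]; case: (IH (s - p3 n)) => b [Hb Hbs].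
  have HUn : U ∙ n ∈ borel S by apply: fn_app HU Hn.
  exists (cup (cap (U ∙ n) b) (diff a (U ∙ n))); split.
    by apply: (sigma_cup HA); [apply: (sigma_cap HA)|apply: (sigma_diff HA)].
  move=> x; rewrite in_cup in_cap in_diff (propeq (Has x)) (propeq (Hbs x)).
  case: (classic (x ∈ U ∙ n)) => Hx.
    rewrite code_partS_in ?in_trace // ltrBlDr; tauto.
  by rewrite code_partS_out ?in_trace //; tauto.
case: (@countable_choice V T (borel S) (fun n a => forall x, x ∈ a <-> x ∈ X /\ t < code_part (trace x) n)).
- by dfn.
- by move=> n Hn; apply: part.
move=> f [Hf Hft]; exists (bigcup (app f)); split.
  by apply: (sigma_bigcup HA) => [|n Hn]; [dfn|apply: fn_app Hf Hn].
move=> x; rewrite in_bigcup; last by dfn.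
rewrite psiE (propeq (lt_code _ _)); split.
  by move=> [n [Hn]]; rewrite (propeq (Hft n Hn x)) => -[Hx Ht]; split=> //; exists n.
by move=> [Hx [n [Hn Ht]]]; exists n; split=> //; rewrite (propeq (Hft n Hn x)).
Qed.

Let psi_preim := @preim_real_borel V T X (borel S) psi HA Hpsi psi_gt.

Let interval_borel (a b : K) : open_interval R (rv a) (rv b) ∈ borel (real_space R).
Proof.
apply: open_borel; last exact: interval_open.
by case: (@real_topology V T) => H _; rewrite car_real_space.
Qed.

(** The values of psi lie in [0, 3/2], so the end points -1 here and 2 in [high] cut nothing off:
    the two sets are {psi < t} and {t < psi}. *)
Definition low (t : K) : V := preim X (fun x => rv (psi x)) (open_interval R (rv (-1)) (rv t)).
Definition high (t : K) : V := preim X (fun x => rv (psi x)) (open_interval R (rv t) (rv 2)).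
Definition level (t : K) : V := diff X (cup (low t) (high t)).

Lemma in_low t x : (x ∈ low t) = (x ∈ X /\ psi x < t).
Proof.
rewrite in_preim // in_interval; congr and; apply: propeq.
by have := psi_range x; split=> [/andP [] //|->]; rewrite andbT; lra.
Qed.

Lemma in_high t x : (x ∈ high t) = (x ∈ X /\ t < psi x).
Proof.
rewrite in_preim // in_interval; congr and; apply: propeq.
by have := psi_range x; split=> [/andP [] //|->]; rewrite /=; lra.
Qed.

Lemma in_level t x : (x ∈ level t) = (x ∈ X /\ psi x = t).
Proof.
rewrite in_diff in_cup in_low in_high; apply: propeq; split.
  move=> [Hx H]; split=> //; apply/eqP; rewrite eq_le !leNgt.
  by apply/andP; split; apply/negP => H'; apply: H; auto.
by move=> [Hx ->]; split=> //; rewrite ltxx => -[[]|[]].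
Qed.

Let low_borel t : low t ∈ borel S. Proof. exact: psi_preim. Qed.
Let high_borel t : high t ∈ borel S. Proof. exact: psi_preim. Qed.
Let level_borel t : level t ∈ borel S.
Proof. by apply: (sigma_compl HA); apply: (sigma_cup HA). Qed.

(** Recorded here, while [low] can still be unfolded. *)
Let strip_term a b : definable_term (fun e => diff (low (b - p3 (e 0%N))) (low (a + p3 (e 0%N)))).
Proof. by rewrite /low; dfn. Qed.

(** The distribution function of psi under nu, with strict inequality: the atom at x then appears as
    a jump of height [point_mass x] immediately after x. *)
Lemma mass_exists : {f : V -> K | forall x, f x = m (low (psi x))}.
Proof. by exists (fun x => m (low (psi x))). Qed.
Definition mass : V -> K := sval mass_exists.
Let massE x : mass x = m (low (psi x)).
Proof. by rewrite /mass; case: mass_exists. Qed.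

Lemma point_mass_exists : {f : V -> K | forall x, f x = m (level (psi x))}.
Proof. by exists (fun x => m (level (psi x))). Qed.
Definition point_mass : V -> K := sval point_mass_exists.
Let point_massE x : point_mass x = m (level (psi x)).
Proof. by rewrite /point_mass; case: point_mass_exists. Qed.

(* Adding psi makes the distribution function strictly increasing. *)
Definition rank (x : V) : K := mass x + psi x.

Let Hmass : dK mass.
Proof. by rewrite (funeq massE) /m /low; dfn. Qed.
Let Hpoint : dK point_mass.
Proof. by rewrite (funeq point_massE) /m /level /low /high; dfn. Qed.
Let Hrank : dK rank.
Proof. by rewrite /rank; dfn. Qed.

#[local] Opaque low high level.

Lemma mass_jump x y : psi x < psi y -> mass x + point_mass x <= mass y.
Proof.
move=> Hxy; rewrite !massE point_massE -(meas_add Hm) //; last first.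
  by move=> z; rewrite in_low in_level => -[_ H] [_ E]; rewrite E ltxx in H.
apply: (meas_mono Hm) => //; first exact: (sigma_cup HA).
move=> z; rewrite in_cup !in_low in_level => -[[Hz H]|[Hz E]]; split=> //.
  exact: lt_trans H Hxy.
by rewrite E.
Qed.

Lemma rank_jump x y : psi x < psi y -> rank x + point_mass x < rank y.
Proof. by move=> Hxy; have := mass_jump Hxy; rewrite /rank; lra. Qed.

Let point_ge0 x : 0 <= point_mass x. Proof. by rewrite point_massE; apply: (meas_ge0 Hm). Qed.

Lemma rank_lt x y : psi x < psi y <-> rank x < rank y.
Proof.
split=> [H|H]; first by have := rank_jump H; have := point_ge0 x; lra.
rewrite ltNge; apply/negP; rewrite le_eqVlt => /orP [/eqP E|H'].
  by move: H; rewrite /rank !massE E ltxx.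
by have := rank_jump H'; have := point_ge0 y; lra.
Qed.

Lemma rank_inj x y : x ∈ X -> y ∈ X -> rank x = rank y -> x = y.
Proof.
move=> Hx Hy E; apply: psi_inj => //; apply/eqP; rewrite eq_le !leNgt.
by apply/andP; split; apply/negP => /rank_lt; rewrite E ltxx.
Qed.

Lemma strip_mass x y : x ∈ X -> y ∈ X -> m (diff (low (psi y)) (low (psi x))) <= Num.max 0 (rank y - rank x).
Proof.
move=> Hx Hy; have [H|H] := leP (psi y) (psi x).
  have -> : diff (low (psi y)) (low (psi x)) = emp.
    apply: (ext T) => z; rewrite in_diff !in_low in_emp; split=> // -[[Hz H1] H2].
    by apply: H2; split=> //; apply: lt_le_trans H1 H.
  by rewrite (meas_emp Hm) le_max lexx.
have := meas_split Hm (low_borel (psi y)) (low_borel (psi x)).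
have -> : cap (low (psi y)) (low (psi x)) = low (psi x).
  apply: (ext T) => z; rewrite in_cap !in_low; split=> [[]|[Hz Hzx]] //.
  by do 2!split=> //; apply: lt_trans Hzx H.
rewrite -!massE => E.
by rewrite le_max; apply/orP; right; rewrite /rank; lra.
Qed.

(* The image of the atomless part of nu under rank is dominated by Lebesgue measure. *)
Lemma rank_interval (l u : K) : l <= u -> exists B, [/\ B ∈ borel S, m B <= u - l &
  forall x, x ∈ X -> l < rank x < u -> point_mass x = 0 -> x ∈ B].
Proof.
move=> Hlu.
case: (classic (exists x, x ∈ X /\ l < rank x < u)) => [[x0 [Hx0 Hlu0]]|Hno]; last first.
  exists emp; split; [exact: (sigma_emp HA)|rewrite (meas_emp Hm); lra|].
  by move=> x Hx Hlux; case: Hno; exists x.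
have HP : definable (fun e => exists x, x ∈ X /\ l < rank x < u /\ re (e 0%N) = psi x) by dfn.
case: (@sup_exists V T (fun t => exists x, x ∈ X /\ l < rank x < u /\ t = psi x)) => //.
- by exists (psi x0), x0.
- by exists (3 / 2) => t [x [_ [_ ->]]]; case/andP: (psi_range x).
move=> b [Hb1 Hb2].
case: (@sup_exists V T (fun t => exists x, x ∈ X /\ l < rank x < u /\ - t = psi x)).
- by dfn.
- by exists (- psi x0), x0; rewrite opprK.
- by exists 0 => t [x [_ [_ E]]]; have := psi_range x; rewrite -E; lra.
(* a' is the supremum of -psi, so a and b are the infimum and the supremum of psi over the points
   with rank in (l, u). *)
move=> a' [Ha1 Ha2]; pose (a := - a').
have La x : x ∈ X -> l < rank x < u -> a <= psi x <= b.
  move=> Hx Hr; apply/andP; split; last by apply: Hb1; exists x.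
  have : - psi x <= a' by apply: Ha1; exists x; rewrite opprK.
  by rewrite /a; lra.
have nb t : t < b -> exists x, [/\ x ∈ X, l < rank x < u & t < psi x].
  move=> Ht; apply: NNPP => H; have : b <= t; last by lra.
  apply: Hb2 => s [x [Hx [Hr ->]]]; rewrite leNgt; apply/negP => Hs; apply: H; by exists x.
have na t : a < t -> exists x, [/\ x ∈ X, l < rank x < u & psi x < t].
  move=> Ht; apply: NNPP => H; have : a' <= - t; last by rewrite /a in Ht; lra.
  apply: Ha2 => s [x [Hx [Hr E]]]; rewrite lerNr leNgt E; apply/negP => Hs; apply: H.
  by exists x.
(* These strips exhaust a < psi < b. Each lies between two points of rank in (l, u), so its mass is
   at most u - l. The levels psi = a and psi = b are added separately: a level without atom is a
   null set. *)
pose (F n := diff (low (b - p3 n)) (low (a + p3 n))).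
have HF : definable_term (fun e => F (e 0%N)) by exact: strip_term.
have HFA n : n ∈ omega -> F n ∈ borel S by move=> _; apply: (sigma_diff HA).
have HFU : m (bigcup F) <= u - l.
  apply: (meas_cont Hm) => //.
    move=> n Hn x; rewrite !in_diff !in_low p3S // => -[[Hx H1] H2]; have Hp := p3_gt0 Hn (T := T).
    split; first by split=> //; lra.
    by move=> [_ H3]; apply: H2; split=> //; lra.
  move=> n Hn; have Hp := p3_gt0 Hn (T := T).
  case: (nb (b - p3 n)) => [|y [Hy Hry Hby]]; first by lra.
  case: (na (a + p3 n)) => [|x [Hx Hrx Hax]]; first by lra.
  apply: (@le_trans _ _ (m (diff (low (psi y)) (low (psi x))))).
    apply: (meas_mono Hm) => //; [by apply: (HFA)|by apply: (sigma_diff HA)|].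
    move=> z; rewrite !in_diff !in_low => -[[Hz H1] H2]; split; first by split=> //; lra.
    by move=> [_ H3]; apply: H2; split=> //; lra.
  apply: le_trans (strip_mass Hx Hy) _; rewrite ge_max; lra.
have Hnl t : exists N, [/\ N ∈ borel S, m N = 0 &
    forall x, x ∈ X -> psi x = t -> point_mass x = 0 -> x ∈ N].
  case: (classic (m (level t) = 0)) => H.
    by exists (level t); split=> // x Hx E _; rewrite in_level.
  exists emp; split; [exact: (sigma_emp HA)|exact: (meas_emp Hm)|].
  by move=> x Hx E; rewrite point_massE E => E'; case: H.
have [Na [Hna Ena Ha]] := Hnl a; have [Nb [Hnb Enb Hb]] := Hnl b.
have HUF : bigcup F ∈ borel S by apply: (sigma_bigcup HA).
exists (cup (bigcup F) (cup Na Nb)); split.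
- by do 2!(apply: (sigma_cup HA) => //).
- apply: le_trans (meas_cup_le Hm HUF (sigma_cup HA Hna Hnb)) _.
  rewrite -[u - l]addr0; apply: lerD => //; apply: le_trans (meas_cup_le Hm Hna Hnb) _.
  by rewrite Ena Enb addr0.
move=> x Hx Hr Hpx; rewrite !in_cup.
case/andP: (La x Hx Hr); rewrite le_eqVlt => /orP [/eqP E _|Hax].
  by right; left; apply: Ha.
rewrite le_eqVlt => /orP [/eqP E|Hxb]; first by right; right; apply: Hb.
left; rewrite in_bigcup //.
case: (@p3_small V T (Num.min (psi x - a) (b - psi x))) => [|n [Hn]].
  by rewrite lt_min; lra.
rewrite lt_min => /andP [H1 H2]; exists n; split=> //.
rewrite in_diff !in_low; split; first by split=> //; lra.
by move=> [_ H3]; lra.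
Qed.

Lemma outer_null (Y : V) :
  (forall n, n ∈ omega -> exists B, [/\ B ∈ borel S, m B <= p3 n & forall x, x ∈ Y -> x ∈ B]) ->
  exists B, [/\ B ∈ borel S, m B = 0 & forall x, x ∈ Y -> x ∈ B].
Proof.
move=> H; case: (@countable_choice V T (borel S) (fun n B => m B <= p3 n /\ forall x, x ∈ Y -> x ∈ B)).
- by rewrite /m; dfn.
- by move=> n /H [B [H1 H2 H3]]; exists B.
move=> f [Hf Hfn].
have HfA n : n ∈ omega -> diff X (f ∙ n) ∈ borel S.
  by move=> Hn; apply: (sigma_compl HA); apply: fn_app Hf Hn.
have HB : bigcup (fun n => diff X (f ∙ n)) ∈ borel S by apply: (sigma_bigcup HA).
have HB' := sigma_compl HA HB.
have HYX x : x ∈ Y -> x ∈ X.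
  move=> Hx; apply: (sigma_sub HA (fn_app Hf emp_omega)).
  by case: (Hfn emp emp_omega) => _; apply.
exists (diff X (bigcup (fun n => diff X (f ∙ n)))); split=> //.
  apply/eqP; rewrite eq_le (meas_ge0 Hm HB') andbT; apply: real_le_eps => n Hn.
  rewrite add0r; apply: le_trans (proj1 (Hfn n Hn)); apply: (meas_mono Hm) => //.
    exact: fn_app Hf Hn.
  move=> x; rewrite in_diff in_bigcup // => -[Hx Hx']; apply: NNPP => H'; apply: Hx'.
  by exists n; rewrite in_diff.
move=> x Hx; rewrite in_diff; split; first exact: HYX.
rewrite in_bigcup // => -[n [Hn]]; rewrite in_diff => -[_]; apply.
by case: (Hfn n Hn) => _; apply.
Qed.

(** A cover of N by intervals of total length at most 3^-n pulls back, interval by interval through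
    [rank_interval], to Borel sets whose union has measure at most 3^-n. *)
Lemma rank_null (N : V) : lebesgue_null R N ->
  exists B, [/\ B ∈ borel S, m B = 0 &
    forall x, x ∈ X -> rv (rank x) ∈ N -> point_mass x = 0 -> x ∈ B].
Proof.
case=> _ HN.
separate X (fun x => rv (rank x) ∈ N /\ point_mass x = 0) as Y inY.
case: (@outer_null Y) => [|B [H1 H2 H3]]; last first.
  by exists B; split=> // x Hx Hxn Hp; apply: H3; rewrite inY.
move=> n Hn; have Hp := p3_gt0 Hn (T := T).
case: (HN (rv (p3 n))); first exact: rv_in.
  by rewrite -rv_zero -rv_lt.
move=> l [u [Hl [Hu [Hle [Hcov Hsum]]]]].
have Hrl k : k ∈ omega -> l ∙ k = rv (re (l ∙ k)) by move=> Hk; rewrite rv_re //; apply: fn_app Hl Hk.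
have Hru k : k ∈ omega -> u ∙ k = rv (re (u ∙ k)) by move=> Hk; rewrite rv_re //; apply: fn_app Hu Hk.
case: (@countable_choice V T (borel S) (fun k B => m B <= re (u ∙ k) - re (l ∙ k) /\
   forall x, x ∈ X -> re (l ∙ k) < rank x < re (u ∙ k) -> point_mass x = 0 -> x ∈ B)).
- by rewrite /m; dfn.
- move=> k Hk; case: (@rank_interval (re (l ∙ k)) (re (u ∙ k))).
    by rewrite rv_le -Hrl // -Hru //; apply: Hle.
  by move=> B [H1 H2 H3]; exists B.
move=> f [Hf Hfk].
have HfA k : k ∈ omega -> f ∙ k ∈ borel S by apply: fn_app Hf.
exists (bigcup (app f)); split; first by apply: (sigma_bigcup HA).
  apply: (meas_bigcup_le Hm) => //.
  move=> j Hj.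
  have Hs : sum R j (fun k => minus R (u ∙ k) (l ∙ k)) = rv (ksum j (fun k => re (u ∙ k) - re (l ∙ k))).
    have Hjo k : k ∈ j -> k ∈ omega by apply: omega_trans.
    have Emin k : k ∈ j -> minus R (u ∙ k) (l ∙ k) = rv (re (u ∙ k) - re (l ∙ k)).
      by move=> /Hjo Hk; rewrite rv_minus -Hrl // -Hru.
    rewrite sum_ksum //; first congr rv; last by move=> k Hk; rewrite Emin //; exact: rv_in.
    by apply: ksum_ext => //; move=> k Hk; rewrite Emin // re_rv.
  have := Hsum j Hj; rewrite Hs -rv_le; apply: le_trans.
  have Hmf : dK (fun k => m (f ∙ k)) by rewrite /m; dfn.
  apply: ksum_le => // k Hk; apply: (proj1 (Hfk k _)).
  exact: omega_trans Hk.
move=> x; rewrite inY in_bigcup; last by dfn.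
move=> [Hx [Hxn Hpx]]; case: (Hcov _ Hxn) => k [Hk]; rewrite (Hrl k Hk) (Hru k Hk) in_interval => Hr.
by exists k; split=> //; apply: (proj2 (Hfk k Hk)).
Qed.

(** Rank is a strictly increasing function of psi, so {t < rank}, if not empty, is {a < psi} or {a ≤
    psi}, where a is the infimum of psi on it. *)
Lemma rank_preim_borel b : b ∈ borel (real_space R) -> preim X (fun x => rv (rank x)) b ∈ borel S.
Proof.
apply: (preim_real_borel HA) => // t.
case: (classic (exists x, x ∈ X /\ t < rank x)) => [[x0 [Hx0 Ht0]]|Hno]; last first.
  exists emp; split; first exact: (sigma_emp HA).
  by move=> x; rewrite in_emp; split=> // Hx; apply: Hno; exists x.
case: (@sup_exists V T (fun s => exists x, x ∈ X /\ t < rank x /\ - s = psi x)).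
- by dfn.
- by exists (- psi x0), x0; rewrite opprK.
- by exists 0 => s [x [_ [_ E]]]; have := psi_range x; rewrite -E; lra.
move=> a' [Ha1 Ha2]; pose (a := - a').
have na s : a < s -> exists x, [/\ x ∈ X, t < rank x & psi x < s].
  move=> Hs; apply: NNPP => H; have : a' <= - s; last by rewrite /a in Hs; lra.
  apply: Ha2 => r [x [Hx [Hr E]]]; rewrite lerNr leNgt E; apply/negP => Hs'; apply: H.
  by exists x.
have La x : x ∈ X -> t < rank x -> a <= psi x.
  move=> Hx Hr; have : - psi x <= a' by apply: Ha1; exists x; rewrite opprK.
  by rewrite /a; lra.
have Hup x : x ∈ X -> a < psi x -> t < rank x.
  move=> Hx /na [y [Hy Hty]] /rank_lt; lra.
case: (classic (exists x, x ∈ X /\ t < rank x /\ psi x = a)) => [[y [Hy [Hty Ey]]]|Hno].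
  exists (cup (level a) (high a)); split; first exact: (sigma_cup HA).
  move=> x; rewrite in_cup in_level in_high; split.
    move=> [[Hx E]|[Hx /Hup H]]; split=> //; last exact: H.
    by rewrite (psi_inj Hx Hy) // E.
  move=> [Hx Hr]; have := La x Hx Hr; rewrite le_eqVlt => /orP [/eqP ->|H]; auto.
exists (high a); split=> // x; rewrite in_high; split=> -[Hx H]; split=> //; first exact: Hup.
have := La x Hx H; rewrite le_eqVlt => /orP [/eqP E|//].
by case: Hno; exists x.
Qed.

(** Everything used later of the injection g into the line and of the mass h of points; h x = 0 says
    that x is not an atom of nu. *)
Lemma rank_package : exists g h : V -> K, [/\ dK g /\ dK h,
  forall x y, x ∈ X -> y ∈ X -> g x = g y -> x = y,
  (forall x, 0 <= h x) /\ (forall x y, g x < g y -> g x + h x < g y),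
  forall N, lebesgue_null R N -> exists B, [/\ B ∈ borel S, m B = 0 &
    forall x, x ∈ X -> rv (g x) ∈ N -> h x = 0 -> x ∈ B] &
  forall b, b ∈ borel (real_space R) -> preim X (fun x => rv (g x)) b ∈ borel S].
Proof.
exists rank, point_mass; split=> //.
- by move=> x y Hx Hy E; apply (rank_inj Hx Hy E).
- by split=> // x y /rank_lt; exact: rank_jump.
- by move=> N HN; apply (rank_null HN).
- by move=> b Hb; apply (rank_preim_borel Hb).
Qed.

End Uniformization.

(** * Measurability of all sets and selection almost everywhere *)

Section Selection.

Context {V : Type} {T : model V}.
#[local] Hint Extern 0 (set_structure _) => exact (model_struct T) : typeclass_instances.
Local Notation R := (model_reals T).
Local Notation K := (real_of T).
Local Notation re := (@re V T).
Local Notation rv := (@rv V T).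
Local Notation dK F := (definable_term (fun e => rv (F (e 0%N)))).
Variables (S nu U : V).
Hypotheses (Hnu : nu ∈ Prob R S) (HU : fn U omega (borel S))
  (Hsep : forall x y, x ∈ car S -> y ∈ car S ->
     (forall n, n ∈ omega -> x ∈ U ∙ n <-> y ∈ U ∙ n) -> x = y).
Let m b := re (nu ∙ b).
Let Hm : is_measure (car S) (borel S) m := prob_measure Hnu.
Let HA : sigma_algebra (car S) (borel S) := @borel_sigma V T S.
Local Notation X := (car S).

Lemma interval_borel (a b : K) : open_interval R (rv a) (rv b) ∈ borel (real_space R).
Proof.
apply: open_borel; last exact: interval_open.
by case: (@real_topology V T) => H _; rewrite car_real_space.
Qed.

Lemma point_borel (t : K) : exists c, c ∈ borel (real_space R) /\ forall x : K, rv x ∈ c <-> x = t.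
Proof.
pose proof (@borel_sigma V T (real_space R)) as HB.
have HF : definable_term (fun e => cup (open_interval R (rv (t - kn (e 0%N))) (rv t))
    (open_interval R (rv t) (rv (t + kn (e 0%N))))) by dfn.
exists (diff (RR R) (bigcup (fun n => cup (open_interval R (rv (t - kn n)) (rv t))
    (open_interval R (rv t) (rv (t + kn n)))))); split.
  rewrite -{1}car_real_space; apply: (sigma_compl HB); apply: (sigma_bigcup HB) => // n Hn.
  by apply: (sigma_cup HB); apply: interval_borel.
move=> x; rewrite in_diff in_bigcup //; split=> [[_ H]|->].
  case: (@archimedean V T `|x - t|) => n [Hn Hx].
  have [Hlt|Hgt|//] := ltgtP x t; case: H; exists n; split=> //; rewrite in_cup !in_interval.
    by left; move: Hx; rewrite ltr0_norm ?subr_lt0 //; lra.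
  by right; move: Hx; rewrite gtr0_norm ?subr_gt0 //; lra.
split; first exact: rv_in.
by move=> [n [Hn]]; rewrite in_cup !in_interval !ltxx andbF => -[].
Qed.

Lemma total_borel : RR R ∈ borel (real_space R).
Proof. by rewrite -[RR R]car_real_space; apply: sigma_total (borel_sigma _). Qed.

Lemma lebesgue_total : lebesgue_measurable R (RR R).
Proof.
split=> //; exists (RR R); split; first exact: total_borel.
have -> : cup (diff (RR R) (RR R)) (diff (RR R) (RR R)) = emp.
  by apply: (ext T) => x; rewrite in_cup in_diff in_emp; tauto.
split=> [x|e He He0]; first by rewrite in_emp.
have Hz : zero R ∈ RR R by rewrite -rv_zero; exact: rv_in.
have Hl : fn (lam omega (fun _ => zero R)) omega (RR R) by apply: lam_fn.
exists (lam omega (fun _ => zero R)), (lam omega (fun _ => zero R)).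
have E n : n ∈ omega -> lam omega (fun _ => zero R) ∙ n = rv 0 by move=> Hn; rewrite lam_app // rv_zero.
do 2!split=> //; split; first by move=> n Hn; rewrite E // -rv_le.
split=> [x|n Hn]; first by rewrite in_emp.
rewrite sum_ksum //; last first.
  by move=> k /(omega_trans Hn) Hk; rewrite E // -rv_minus; exact: rv_in.
rewrite ksum_zero //.
  by rewrite -(rv_re He) -rv_le; apply: ltW; rewrite rv_lt rv_re // rv_zero.
by move=> k /(omega_trans Hn) Hk; rewrite E // -rv_minus re_rv subr0.
Qed.

Definition uniformizes (g h : V -> K) (Q : V -> K -> Prop) (f B : V) : Prop :=
  borel_function R f /\ (B ∈ borel S /\ m B = 0) /\
  forall x, x ∈ X -> h x = 0 -> ~ x ∈ B -> Q x (re (f ∙ rv (g x))).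

(* When the whole line is null, so is the atomless part of nu. *)
Lemma uniformization (g h : V -> K) (Q : V -> K -> Prop) : dK g -> dK h ->
  (forall x y, x ∈ X -> y ∈ X -> g x = g y -> x = y) ->
  (forall N, lebesgue_null R N -> exists B, [/\ B ∈ borel S, m B = 0 &
    forall x, x ∈ X -> rv (g x) ∈ N -> h x = 0 -> x ∈ B]) ->
  definable (fun e => Q (e 0%N) (re (e 1%N))) -> (forall x, x ∈ X -> exists r, Q x r) ->
  exists f B, uniformizes g h Q f B.
Proof.
move=> Hg Hh Hinj Hnull HQ HQex.
case: (classic (lebesgue_null R (RR R))) => HR.
  case: (Hnull _ HR) => B [HB E H]; exists (lam (RR R) (fun x => x)), B.
  have Hf : fn (lam (RR R) (fun x => x)) (RR R) (RR R) by apply: lam_fn.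
  split; last by split=> // x Hx Hhx []; apply: H => //; exact: rv_in.
  split=> // b Hb; have -> : preim (RR R) (app (lam (RR R) (fun x => x))) b = b; last by [].
  have HbR : b ⊆ RR R by have := sigma_sub (borel_sigma _) Hb; rewrite car_real_space.
  apply: (ext T) => x; rewrite in_preim; last by dfn.
  by split=> [[Hx]|Hx]; rewrite lam_app //; [split=> //|]; apply: HbR.
(* Off the range of g the condition is vacuous and the section is the whole line; on the range,
   injectivity of g leaves a single x. *)
pose (A := lam (RR R) (fun r : V => ⟦ v | v ∈ RR R /\ forall x, x ∈ X -> r = rv (g x) -> Q x (re v) ⟧)).
have inA r v : r ∈ RR R -> (v ∈ A ∙ r) = (v ∈ RR R /\ forall x, x ∈ X -> r = rv (g x) -> Q x (re v)).
  move=> Hr; rewrite /A lam_app //.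
  by apply: (in_compr (RR R)) => [|z []//]; dfn.
case: (@model_MUP V T (RR R) A) => //.
- by split=> //; exact: lebesgue_total.
- apply: lam_fn; first by dfn.
  move=> r Hr; rewrite in_pow => v; move: (inA r v Hr); rewrite /A lam_app //.
  by move=> -> [].
- move=> r Hr; case: (classic (exists x, x ∈ X /\ r = rv (g x))) => [[x [Hx E]]|Hno].
    case: (HQex x Hx) => v Hv; exists (rv v); rewrite inA //; split; first exact: rv_in.
    move=> y Hy E'; rewrite re_rv; suff -> : y = x by [].
    by apply: Hinj => //; apply: rv_inj; rewrite -E -E'.
  exists r; rewrite inA //; split=> // x Hx E; case: Hno; by exists x.
move=> f [Hf HfN].
case: (Hnull _ HfN) => B [HB E H]; exists f, B; split=> //; split=> // x Hx Hhx HxB.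
apply: NNPP => HQx; apply: HxB; apply: H => //.
have -> : (rv (g x) ∈ ⟦ x | x ∈ RR R /\ ~ f ∙ x ∈ A ∙ x ⟧) =
    (rv (g x) ∈ RR R /\ ~ f ∙ rv (g x) ∈ A ∙ rv (g x)).
  by apply: (in_compr (RR R)) => [|z []//]; dfn.
split; first exact: rv_in.
by rewrite inA; [move=> [_ H']; apply: HQx; apply: H'|exact: rv_in].
Qed.

Section Atoms.

Variables (g h : V -> K).
Hypotheses (Hg : dK g) (Hh : dK h) (Hinj : forall x y, x ∈ X -> y ∈ X -> g x = g y -> x = y)
  (Hh0 : forall x, 0 <= h x) (Hjump : forall x y, g x < g y -> g x + h x < g y)
  (Hpre : forall b, b ∈ borel (real_space R) -> preim X (fun x => rv (g x)) b ∈ borel S).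

(** By [Hjump] the intervals (g x, g x + h x) at the atoms are disjoint, so an enumerated rational
    lying in such an interval identifies its atom. This makes the atoms countable without any
    choice. *)
Definition atom_index n x : Prop := n ∈ omega /\ g x < rational n < g x + h x.

Lemma atom_index_uniq n x y : x ∈ X -> y ∈ X -> atom_index n x -> atom_index n y -> x = y.
Proof.
move=> Hx Hy [_ /andP [H1 H2]] [_ /andP [H3 H4]]; apply: Hinj => //.
by have [/Hjump H|/Hjump H|//] := ltgtP (g x) (g y); lra.
Qed.

Lemma atom_index_exists x : h x <> 0 -> exists n, atom_index n x.
Proof.
move=> Hx; have H : g x < g x + h x.
  by rewrite ltrDl lt_neqAle Hh0 andbT; apply/eqP => E; apply: Hx.
by case: (rational_dense H) => n [Hn Hr]; exists n.
Qed.

Lemma singleton_borel x : x ∈ X -> upair x x ∈ borel S.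
Proof.
move=> Hx; case: (point_borel (g x)) => c [Hc Hcx]; have := Hpre Hc.
have -> : preim X (fun x => rv (g x)) c = upair x x; last by [].
apply: (ext T) => y; rewrite in_preim // in_upair (propeq (Hcx _)); split.
  by move=> [Hy E]; left; apply: Hinj.
by case=> ->.
Qed.

(** Each index belongs to at most one atom, so any set of atoms is a countable union of
    singletons. *)
Lemma atomic_borel Y : exists a, a ∈ borel S /\ forall x, x ∈ a <-> [/\ x ∈ X, x ∈ Y & h x <> 0].
Proof.
have HF : definable_term (fun e => ⟦ x | x ∈ X /\ x ∈ Y /\ atom_index (e 0%N) x ⟧) by rewrite /atom_index; dfn.
have inF n x : (x ∈ ⟦ x | x ∈ X /\ x ∈ Y /\ atom_index n x ⟧) = (x ∈ X /\ x ∈ Y /\ atom_index n x).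
  by apply: (in_compr X) => [|z []//]; rewrite /atom_index; dfn.
exists (bigcup (fun n => ⟦ x | x ∈ X /\ x ∈ Y /\ atom_index n x ⟧)); split.
  apply: (sigma_bigcup HA) => // n Hn.
  case: (classic (exists x, x ∈ X /\ x ∈ Y /\ atom_index n x)) => [[x [Hx [HxY Hxn]]]|Hno].
    have -> : ⟦ x | x ∈ X /\ x ∈ Y /\ atom_index n x ⟧ = upair x x; last by apply: singleton_borel.
    apply: (ext T) => y; rewrite inF in_upair; split.
      by move=> [Hy [_ Hyn]]; left; apply: atom_index_uniq Hyn Hxn.
    by case=> ->.
  have -> : ⟦ x | x ∈ X /\ x ∈ Y /\ atom_index n x ⟧ = emp; last by apply: (sigma_emp HA).
  by apply: (ext T) => y; rewrite inF in_emp; split=> // Hy; apply: Hno; exists y.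
move=> x; rewrite in_bigcup //; split.
  move=> [n [Hn]]; rewrite inF => -[Hx [HxY [_ /andP [H1 H2]]]]; split=> // E.
  by rewrite E in H2; lra.
by move=> [Hx HxY /atom_index_exists [n Hnx]]; exists n; rewrite inF; case: (Hnx).
Qed.

End Atoms.

(** Uniformizing the graph of the indicator of Y gives a Borel function that decides membership in Y
    off a null set and off the atoms; the part of Y made of atoms is Borel outright. *)
Lemma measurable_all Y : Y ⊆ X -> Y ∈ completion R S nu.
Proof.
move=> HY; case: (rank_package Hnu HU (@Hsep)) => g [h [[Hg Hh] Hinj [Hh0 Hjump] Hnull Hpre]].
case: (@uniformization g h (fun x r => x ∈ Y <-> r = 1)) => //.
- by move=> x Hx; case: (classic (x ∈ Y)) => H; [exists 1|exists 0]; split=> // E;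
    have := ltr01 (R := K); rewrite E ltxx.
move=> f [B [[Hf Hfb] [[HB EB] Hunif]]].
case: (point_borel 1) => c [Hc Hc1].
have HC : preim X (fun x => rv (g x)) (preim (RR R) (app f) c) ∈ borel S by apply: Hpre; apply: Hfb.
have inC x : x ∈ preim X (fun x => rv (g x)) (preim (RR R) (app f) c) <->
    x ∈ X /\ re (f ∙ rv (g x)) = 1.
  rewrite in_preim // in_preim; last by dfn.
  have Hfr : f ∙ rv (g x) ∈ RR R by apply: fn_app Hf _; exact: rv_in.
  rewrite -{1}(rv_re Hfr) (propeq (Hc1 _)); have := rv_in (g x); tauto.
move: HC inC; move: (preim X _ _) => C HC inC.
case: (atomic_borel Hg Hh Hinj Hh0 Hjump Hpre X) => At [HAt inAt].
case: (atomic_borel Hg Hh Hinj Hh0 Hjump Hpre Y) => Yt [HYt inYt].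
have HCA := sigma_diff HA (sigma_diff HA HC HAt) HB.
rewrite (in_completion Hnu); split=> //.
exists (cup Yt (diff (diff C At) B)), (cup (cup Yt (diff (diff C At) B)) B).
have HD := sigma_cup HA HYt HCA.
split=> //; first exact: (sigma_cup HA).
- move=> x; rewrite in_cup !in_diff (propeq (inYt x)) (propeq (inC x)) (propeq (inAt x)).
  move=> [[] //|[[[Hx E] Hat] HxB]]; rewrite (propeq (Hunif x Hx _ HxB)) //.
  by apply: NNPP => Hhx; apply: Hat.
- move=> x HxY; rewrite !in_cup !in_diff (propeq (inYt x)) (propeq (inC x)) (propeq (inAt x)).
  have Hx := HY x HxY.
  case: (classic (x ∈ B)) => HxB; first by right.
  left; case: (classic (h x = 0)) => Hhx; last by left.
  right; split=> //; split; last by case.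
  by split=> //; apply/(Hunif x Hx Hhx HxB).
apply/eqP; rewrite eq_le (meas_ge0 Hm) ?andbT; last first.
  by apply: (sigma_diff HA) => //; apply: (sigma_cup HA).
rewrite -EB; apply: (meas_mono Hm) => //.
  by apply: (sigma_diff HA) => //; apply: (sigma_cup HA).
by move=> x; rewrite in_diff in_cup; tauto.
Qed.

(** The coding c by subsets of omega embeds the values W in the line, so a selection of reals can be
    decoded into W. At atoms the value is chosen by countable choice along [atom_index]. *)
Lemma selection (W : V) (c : V -> V) (P : V -> V -> Prop) :
  definable_term (fun e => c (e 0%N)) -> definable (fun e => P (e 0%N) (e 1%N)) ->
  (forall w, w ∈ W -> c w ⊆ omega) ->
  (forall w w', w ∈ W -> w' ∈ W -> c w = c w' -> w = w') ->
  (forall x, x ∈ X -> exists w, w ∈ W /\ P x w) ->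
  exists f B, [/\ fn f X W, B ∈ borel S, m B = 1 & forall x, x ∈ B -> P x (f ∙ x)].
Proof.
move=> Hc HP HcW Hcinj HPex.
case: (rank_package Hnu HU (@Hsep)) => g [h [[Hg Hh] Hinj [Hh0 Hjump] Hnull Hpre]].
have Hcode : dK (fun w => code (c w)) by dfn.
case: (@uniformization g h (fun x r => exists w, w ∈ W /\ P x w /\ r = code (c w))) => //.
- by move=> x Hx; case: (HPex x Hx) => w [Hw HPw]; exists (code (c w)), w.
move=> f [B [[Hf _] [[HB EB] Hunif]]].
have [x0 Hx0] : exists x, x ∈ X.
  apply: NNPP => H; have E : X = emp.
    by apply: (ext T) => x; rewrite in_emp; split=> // Hx; apply: H; exists x.
  by have := meas_one Hm; rewrite E (meas_emp Hm) => /eqP; rewrite eq_sym oner_eq0.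
case: (HPex x0 Hx0) => w0 [Hw0 _].
case: (@countable_choice V T W (fun n w => forall x, x ∈ X -> atom_index g h n x -> P x w)).
- by rewrite /atom_index; dfn.
- move=> n Hn; case: (classic (exists x, x ∈ X /\ atom_index g h n x)) => [[x [Hx Hxn]]|Hno].
    case: (HPex x Hx) => w [Hw HPw]; exists w; split=> // y Hy Hyn.
    by rewrite (atom_index_uniq Hinj Hjump Hy Hx Hyn Hxn).
  by exists w0; split=> // x Hx Hxn; case: Hno; exists x.
move=> a [Ha Han].
(* At most one w is good for x, so the selection is given by description and stays definable. An
   atom has many indices; the least one is prescribed. *)
pose (good (x w : V) := [/\ w ∈ W, P x w & (h x = 0 /\ code (c w) = re (f ∙ rv (g x))) \/
  (h x <> 0 /\ exists n, atom_index g h n x /\ (forall k, k ∈ n -> ~ atom_index g h k x) /\ w = a ∙ n)]).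
have Hgood : definable (fun e => good (e 0%N) (e 1%N)) by rewrite /good /atom_index; dfn.
have good_uniq x w w' : good x w -> good x w' -> w = w'.
  move=> [Hw _ [[E1 E2]|[E1 [n [[Hn Hna] [Hmin ->]]]]]] [Hw' _ [[E1' E2']|[E1' [n' [[Hn' Hna'] [Hmin' ->]]]]]] //.
    by apply: Hcinj => //; apply: code_inj; [apply: HcW|apply: HcW|rewrite E2 E2'].
  by case: (omega_total Hn Hn') => [/Hmin|[->|/Hmin']] // [].
pose (F (x : V) := ite (exists w, good x w) (the (model_struct T) (good x)) w0).
have Hthe : definable_term (fun e => the (model_struct T) (good (e 0%N))).
  by apply: (term_the (P := fun e => good (e 0%N))); dfn.
have HF : definable_term (fun e => F (e 0%N)) by rewrite /F; dfn.
have FE x w : good x w -> F x = w.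
  move=> Hw; rewrite /F ite_true; last by exists w.
  by apply: theP => // y Hy; apply: good_uniq Hy Hw.
exists (lam X F), (diff X B); split.
- apply: lam_fn => // x Hx; case: (classic (exists w, good x w)) => [[w Hw]|H].
    by rewrite (FE _ _ Hw); case: Hw.
  by rewrite /F ite_false.
- exact: (sigma_compl HA).
- by rewrite (meas_compl Hm) // EB subr0.
move=> x; rewrite in_diff => -[Hx HxB]; rewrite lam_app //.
suff [w Hw] : exists w, good x w by rewrite (FE _ _ Hw); case: Hw.
case: (classic (h x = 0)) => Hhx.
  by case: (Hunif x Hx Hhx HxB) => w [Hw [HPw E]]; exists w; split=> //; left.
case: (atom_index_exists g Hh0 Hhx) => n0 Hn0.
case: (@omega_least V T (fun n => atom_index g h n x) n0) => //; first by rewrite /atom_index; dfn.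
  by case: Hn0.
move=> n [Hn Hnx Hmin]; exists (a ∙ n); split; first exact: fn_app Ha Hn.
  exact: (Han n Hn x Hx Hnx).
by right; split=> //; exists n.
Qed.

End Selection.

(** * Integration *)

Section Integrals.

Context {V : Type} {T : model V}.
#[local] Hint Extern 0 (set_structure _) => exact (model_struct T) : typeclass_instances.
Local Notation R := (model_reals T).
Local Notation K := (real_of T).
Local Notation re := (@re V T).
Local Notation rv := (@rv V T).
Local Notation dK F := (definable_term (fun e => rv (F (e 0%N)))).

Lemma kn_lt n k : n ∈ omega -> k ∈ n -> kn k + 1 <= kn n :> K.
Proof.
move=> Hn; move: n Hn k; apply: omega_ind; first by dfn.
  by move=> k; rewrite in_emp.
move=> n Hn IH k; rewrite in_succ knS // => -[/IH H|-> //].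
by apply: le_trans H _; rewrite lerDl ler01.
Qed.

Section Integral.

Variables (X A : V) (m : V -> K).
Hypothesis Hm : is_measure X A m.
Let HA := meas_sigma Hm.
Let Hmd := meas_dfn Hm.

Definition simple (n a c : V) : Prop :=
  [/\ n ∈ omega, fn a n A, fn c n (RR R) &
   (forall k l, k ∈ n -> l ∈ n -> k <> l -> disjoint (a ∙ k) (a ∙ l)) /\
   (forall x, x ∈ X -> exists k, k ∈ n /\ x ∈ a ∙ k)].

Definition simple_sum (n a c : V) : K := ksum n (fun k => re (c ∙ k) * m (a ∙ k)).

Lemma definable_simple : definable (fun e => simple (e 0%N) (e 1%N) (e 2%N)).
Proof. by rewrite /simple; dfn. Qed.

Lemma definable_simple_sum : definable_term (fun e => rv (simple_sum (e 0%N) (e 1%N) (e 2%N))).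
Proof. by rewrite /simple_sum; dfn. Qed.

Lemma simple_split n a c x : simple n a c -> x ∈ A -> m x = ksum n (fun k => m (cap x (a ∙ k))).
Proof.
move=> [Hn Ha _ [Hdis Hcov]] Hx; apply: (meas_partition Hm) => //.
  by move=> k Hk; apply: fn_app Ha Hk.
move=> y Hy; rewrite in_partial_union //.
by apply: Hcov; apply: (sigma_sub HA Hx).
Qed.

(** Additivity and monotonicity of the integral all follow from this one inequality between three
    functions. On the common refinement each of the three sums becomes a triple sum weighted by the
    masses [w i j l]. *)
Lemma simple_sum3 n1 a1 c1 n2 a2 c2 n3 a3 c3 (e : K) :
  simple n1 a1 c1 -> simple n2 a2 c2 -> simple n3 a3 c3 ->
  (forall i j l x, i ∈ n1 -> j ∈ n2 -> l ∈ n3 -> x ∈ a1 ∙ i -> x ∈ a2 ∙ j -> x ∈ a3 ∙ l ->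
     re (c1 ∙ i) + re (c2 ∙ j) + re (c3 ∙ l) <= e) ->
  simple_sum n1 a1 c1 + simple_sum n2 a2 c2 + simple_sum n3 a3 c3 <= e.
Proof.
move=> H1 H2 H3 He.
have [Hn1 Ha1 _ _] := H1; have [Hn2 Ha2 _ _] := H2; have [Hn3 Ha3 _ _] := H3.
have A1 i : i ∈ n1 -> a1 ∙ i ∈ A by apply: fn_app Ha1.
have A2 i : i ∈ n2 -> a2 ∙ i ∈ A by apply: fn_app Ha2.
have A3 i : i ∈ n3 -> a3 ∙ i ∈ A by apply: fn_app Ha3.
pose (w (i j l : V) := m (cap (cap (a1 ∙ i) (a2 ∙ j)) (a3 ∙ l))).
have Aw i j l : i ∈ n1 -> j ∈ n2 -> l ∈ n3 -> cap (cap (a1 ∙ i) (a2 ∙ j)) (a3 ∙ l) ∈ A.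
  by move=> Hi Hj Hl; apply: (sigma_cap HA); [apply: (sigma_cap HA)|]; auto.
have m12 i j : i ∈ n1 -> j ∈ n2 -> m (cap (a1 ∙ i) (a2 ∙ j)) = ksum n3 (w i j).
  by move=> Hi Hj; apply: (simple_split H3); apply: (sigma_cap HA); auto.
have Hwd : definable_term (fun e => rv (w (e 0%N) (e 1%N) (e 2%N))) by rewrite /w; dfn.
have E1 : simple_sum n1 a1 c1 =
    ksum n1 (fun i => ksum n2 (fun j => ksum n3 (fun l => re (c1 ∙ i) * w i j l))).
  apply: ksum_ext => //; try by rewrite /w; dfn.
  move=> i Hi; rewrite (simple_split H2 (A1 i Hi)) -ksum_mul //.
  apply: ksum_ext => //; try by rewrite /w; dfn.
  move=> j Hj; rewrite m12 // -ksum_mul //; rewrite /w; dfn.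
have E2 : simple_sum n2 a2 c2 =
    ksum n1 (fun i => ksum n2 (fun j => ksum n3 (fun l => re (c2 ∙ j) * w i j l))).
  rewrite ksum_exchange //; last by rewrite /w; dfn.
  apply: ksum_ext => //; try by rewrite /w; dfn.
  move=> j Hj; rewrite (simple_split H1 (A2 j Hj)) -ksum_mul //.
  apply: ksum_ext => //; try by rewrite /w; dfn.
  move=> i Hi.
  have -> : cap (a2 ∙ j) (a1 ∙ i) = cap (a1 ∙ i) (a2 ∙ j).
    by apply: (ext T) => x; rewrite !in_cap; tauto.
  rewrite m12 // -ksum_mul //; rewrite /w; dfn.
have E3 : simple_sum n3 a3 c3 =
    ksum n1 (fun i => ksum n2 (fun j => ksum n3 (fun l => re (c3 ∙ l) * w i j l))).
  have -> : ksum n1 (fun i => ksum n2 (fun j => ksum n3 (fun l => re (c3 ∙ l) * w i j l))) =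
      ksum n1 (fun i => ksum n3 (fun l => ksum n2 (fun j => re (c3 ∙ l) * w i j l))).
    apply: ksum_ext => //; try by rewrite /w; dfn.
    by move=> i Hi; apply: ksum_exchange => //; rewrite /w; dfn.
  rewrite ksum_exchange //; last by rewrite /w; dfn.
  apply: ksum_ext => //; try by rewrite /w; dfn.
  move=> l Hl; rewrite (simple_split H1 (A3 l Hl)) -ksum_mul //.
  apply: ksum_ext => //; try by rewrite /w; dfn.
  move=> i Hi; rewrite (simple_split H2 (x := cap (a3 ∙ l) (a1 ∙ i))); last first.
    by apply: (sigma_cap HA); auto.
  rewrite -ksum_mul //; apply: ksum_ext => //; try by rewrite /w; dfn.
  move=> j Hj; congr (_ * m _).
  by apply: (ext T) => x; rewrite !in_cap; tauto.
have E0 : e = ksum n1 (fun i => ksum n2 (fun j => ksum n3 (fun l => e * w i j l))).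
  rewrite -[LHS]mulr1 -(meas_one Hm) (simple_split H1 (sigma_total HA)) -ksum_mul //.
  apply: ksum_ext => //; try by rewrite /w; dfn.
  move=> i Hi; have -> : cap X (a1 ∙ i) = a1 ∙ i.
    by apply: (ext T) => x; rewrite in_cap; split=> [[]|Hx] //; split=> //; apply: (sigma_sub HA (A1 i Hi)).
  rewrite (simple_split H2 (A1 i Hi)) -ksum_mul //.
  apply: ksum_ext => //; try by rewrite /w; dfn.
  move=> j Hj; rewrite m12 // -ksum_mul //; rewrite /w; dfn.
rewrite E1 E2 E3 E0 -ksum_add //; try by rewrite /w; dfn.
rewrite -ksum_add //; try by rewrite /w; dfn.
apply: ksum_le => //; try by rewrite /w; dfn.
move=> i Hi; rewrite -ksum_add //; try by rewrite /w; dfn.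
rewrite -ksum_add //; try by rewrite /w; dfn.
apply: ksum_le => //; try by rewrite /w; dfn.
move=> j Hj; rewrite -ksum_add //; try by rewrite /w; dfn.
rewrite -ksum_add //; try by rewrite /w; dfn.
apply: ksum_le => //; try by rewrite /w; dfn.
move=> l Hl; rewrite -!mulrDl.
case: (classic (exists x, x ∈ cap (cap (a1 ∙ i) (a2 ∙ j)) (a3 ∙ l))) => [[x]|Hno].
  rewrite !in_cap => -[[Hx1 Hx2] Hx3]; apply: ler_wpM2r; first by apply: (meas_ge0 Hm); auto.
  exact: (He i j l x).
(* On an empty cell [He] gives nothing, but the cell has mass zero. *)
have -> : w i j l = 0; last by rewrite !mulr0.
rewrite /w -(meas_emp Hm); congr m; apply: (ext T) => x; rewrite in_emp; split=> // Hx.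
by apply: Hno; exists x.
Qed.

Lemma simple_map n a c (f : K -> K) : dK (fun x => f (re x)) -> simple n a c ->
  simple n a (lam n (fun k => rv (f (re (c ∙ k))))) /\
  forall k, k ∈ n -> re (lam n (fun k => rv (f (re (c ∙ k)))) ∙ k) = f (re (c ∙ k)).
Proof.
move=> Hf [Hn Ha Hc Hdis].
have Hd : definable_term (fun e => rv (f (re (c ∙ e 0%N)))).
  exact: (@term_subst _ _ (fun x _ => rv (f (re x))) (fun e => c ∙ e 0%N) id).
split; last by move=> k Hk; rewrite lam_app // re_rv.
by split=> //; apply: lam_fn => // k _; exact: rv_in.
Qed.

Lemma simple_const (t : K) : exists n a c, [/\ simple n a c,
  forall k, k ∈ n -> re (c ∙ k) = t & simple_sum n a c = t].
Proof.
have H1 : succ emp ∈ omega by apply: succ_omega.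
exists (succ emp), (lam (succ emp) (fun _ => X)), (lam (succ emp) (fun _ => rv t)); split.
- split=> //.
  + by apply: lam_fn => // k _; exact: (sigma_total HA).
  + by apply: lam_fn => // k _; exact: rv_in.
  + split=> [k l|x Hx]; first by rewrite !in_succ !in_emp => -[//|->] [//|->].
    by exists emp; rewrite in_succ lam_app ?in_succ; auto.
- by move=> k Hk; rewrite lam_app // re_rv.
rewrite /simple_sum ksumS // ksum0 // add0r !lam_app //; try by (rewrite in_succ; auto).
by rewrite re_rv (meas_one Hm) mulr1.
Qed.

Lemma simple_sum_neg n a c : simple n a c ->
  simple_sum n a (lam n (fun k => rv (- re (c ∙ k)))) = - simple_sum n a c.
Proof.
move=> Hs; have [Hn _ _ _] := Hs; rewrite -mulN1r /simple_sum -ksum_mul //.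
apply: ksum_ext => // k Hk; case: (@simple_map n a c (fun x => - x)) => // _ ->//.
by rewrite mulN1r mulNr.
Qed.

Lemma simple_sum_shift n a c (e : K) : simple n a c ->
  simple_sum n a (lam n (fun k => rv (re (c ∙ k) - e))) = simple_sum n a c - e.
Proof.
move=> Hs; have [Hn Ha _ _] := Hs.
have E : - e = ksum n (fun k => - e * m (a ∙ k)).
  rewrite ksum_mul // -[LHS]mulr1 -(meas_one Hm) (simple_split Hs (sigma_total HA)); congr (_ * _).
  apply: ksum_ext => // k Hk; congr m; apply: (ext T) => x; rewrite in_cap.
  by split=> [[]|Hx] //; split=> //; apply: (sigma_sub HA (fn_app Ha Hk)).
rewrite {2}E /simple_sum -ksum_add //; apply: ksum_ext => // k Hk.
by rewrite lam_app // re_rv mulrDl.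
Qed.

(** The integral as a relation, by uniform approximation from both sides: simple functions within
    3^-n of F whose sums are within 3^-n of r. [integral_value] compares it with the supremum of
    lower sums. *)
Definition has_integral (F : V -> K) (r : K) : Prop :=
  forall n, n ∈ omega -> exists N a c, [/\ simple N a c,
    forall k x, k ∈ N -> x ∈ a ∙ k -> re (c ∙ k) - p3 n <= F x <= re (c ∙ k) + p3 n &
    simple_sum N a c - p3 n <= r <= simple_sum N a c + p3 n].

Lemma integral_sum3 F G H (r q s e : K) : has_integral F r -> has_integral G q ->
  has_integral H s -> (forall x, x ∈ X -> F x + G x + H x <= e) -> r + q + s <= e.
Proof.
(* Three errors 3^-n come from the values and three from the sums. *)
move=> HF HG HH He; apply: (@real_le_eps_mul _ _ _ _ 6); first by lra.
move=> n Hn; have Hp := p3_gt0 Hn (T := T).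
case: (HF n Hn) => n1 [a1 [c1 [H1 F1 S1]]].
case: (HG n Hn) => n2 [a2 [c2 [H2 F2 S2]]].
case: (HH n Hn) => n3 [a3 [c3 [H3 F3 S3]]].
have := simple_sum3 (e := e + 3 * p3 n) H1 H2 H3.
have Hc : forall i j l x, i ∈ n1 -> j ∈ n2 -> l ∈ n3 -> x ∈ a1 ∙ i -> x ∈ a2 ∙ j -> x ∈ a3 ∙ l ->
   re (c1 ∙ i) + re (c2 ∙ j) + re (c3 ∙ l) <= e + 3 * p3 n.
  move=> i j l x Hi Hj Hl Hx1 Hx2 Hx3.
  have Hx : x ∈ X by case: H1 => _ Ha1 _ _; apply: (sigma_sub HA (fn_app Ha1 Hi)).
  have := He x Hx; have := F1 i x Hi Hx1; have := F2 j x Hj Hx2; have := F3 l x Hl Hx3.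
  move: (F x) (G x) (H x) (re (c1 ∙ i)) (re (c2 ∙ j)) (re (c3 ∙ l)) (p3 n) => *; lra.
move=> /(_ Hc); move: S1 S2 S3.
move: (simple_sum n1 a1 c1) (simple_sum n2 a2 c2) (simple_sum n3 a3 c3) (p3 n) => *; lra.
Qed.

Lemma integral_opp F r : has_integral F r -> has_integral (fun x => - F x) (- r).
Proof.
move=> HF n Hn; case: (HF n Hn) => N [a [c [H1 H2 H3]]].
case: (@simple_map N a c (fun x => - x)) => // Hs Hk.
exists N, a, (lam N (fun k => rv (- re (c ∙ k)))); split=> //; last first.
  by rewrite simple_sum_neg //; move: H3; move: (simple_sum N a c) (p3 n) => *; lra.
move=> k x HkN Hx; rewrite Hk //; have := H2 k x HkN Hx.
by move: (re (c ∙ k)) (F x) (p3 n) => *; lra.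
Qed.

Arguments integral_opp [F r] _.

Lemma integral_const (t : K) : has_integral (fun _ => t) t.
Proof.
move=> n Hn; have Hp := p3_gt0 Hn (T := T).
case: (simple_const t) => N [a [c [H1 H2 H3]]]; exists N, a, c; split=> //.
  by move=> k x Hk _; rewrite H2 //; lra.
by rewrite H3; lra.
Qed.

Arguments integral_const t : clear implicits.

Lemma integral_le F G r q (e : K) : has_integral F r -> has_integral G q ->
  (forall x, x ∈ X -> F x <= G x + e) -> r <= q + e.
Proof.
move=> HF HG H; have H' := integral_sum3 (e := e) HF (integral_opp HG) (integral_const 0).
have : r - q + 0 <= e by apply: H' => x /H; lra.
lra.
Qed.

Lemma integral_add F G H r q s : has_integral F r -> has_integral G q -> has_integral H s ->
  (forall x, x ∈ X -> H x = F x + G x) -> s = r + q.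
Proof.
move=> HF HG HH HE; apply/eqP; rewrite eq_le; apply/andP; split.
  have H1 := integral_sum3 (e := 0) (integral_opp HF) (integral_opp HG) HH.
  have : - r - q + s <= 0 by apply: H1 => x /HE ->; lra.
  lra.
have H1 := integral_sum3 (e := 0) HF HG (integral_opp HH).
have : r + q - s <= 0 by apply: H1 => x /HE ->; lra.
lra.
Qed.

Lemma integral_indicator a (t : K) : a ∈ A ->
  has_integral (fun x => re (ite (x ∈ a) (rv t) (zero R))) (t * m a).
Proof.
move=> Ha n Hn; have Hp := p3_gt0 Hn (T := T).
have H1 : succ emp ∈ omega by apply: succ_omega.
have H2 : succ (succ emp) ∈ omega by apply: succ_omega.
have k01 k : k ∈ succ (succ emp) -> k = emp \/ k = succ emp.
  by rewrite !in_succ in_emp => -[[]|]; auto.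
have i0 : emp ∈ succ (succ emp) by rewrite !in_succ; auto.
have i1 : succ emp ∈ succ (succ emp) by rewrite !in_succ; auto.
pose (A' := lam (succ (succ emp)) (fun k : V => ite (k = emp) a (diff X a))).
pose (c := lam (succ (succ emp)) (fun k : V => ite (k = emp) (rv t) (zero R))).
have A0 : A' ∙ emp = a by rewrite /A' lam_app // ite_true.
have A1 : A' ∙ succ emp = diff X a by rewrite /A' lam_app // ite_false //; exact: succ_not_emp.
have c0 : re (c ∙ emp) = t by rewrite /c lam_app // ite_true // re_rv.
have c1 : re (c ∙ succ emp) = 0.
  by rewrite /c lam_app // ite_false -?rv_zero ?re_rv //; exact: succ_not_emp.
exists (succ (succ emp)), A', c; split.
- split=> //.
  + apply: lam_fn => // k /k01 [->|->]; first by rewrite ite_true.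
    by rewrite ite_false; [apply: (sigma_compl HA)|exact: succ_not_emp].
  + apply: lam_fn => // k /k01 [->|->]; first by rewrite ite_true //; exact: rv_in.
    by rewrite ite_false -?rv_zero; [exact: rv_in|exact: succ_not_emp].
  + split=> [k l /k01 [->|->] /k01 [->|->]|x Hx] //; rewrite ?A0 ?A1.
    * by move=> _ x Hx; rewrite in_diff => -[].
    * by move=> _ x; rewrite in_diff => -[].
    case: (classic (x ∈ a)) => Hxa; first by exists emp; rewrite A0.
    by exists (succ emp); rewrite A1 in_diff.
- move=> k x /k01 [->|->]; rewrite ?A0 ?A1 ?c0 ?c1.
    by move=> Hx; rewrite ite_true // re_rv; lra.
  by rewrite in_diff => -[_ Hx]; rewrite ite_false // -rv_zero re_rv; lra.
rewrite /simple_sum ksumS // ksumS // ksum0 // A0 A1 c0 c1.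
by move: (t * m a) => *; lra.
Qed.

Arguments integral_indicator [a] t _.

Definition measurable_real (F : V -> K) : Prop :=
  forall t : K, exists a, a ∈ A /\ forall x, x ∈ a <-> x ∈ X /\ t < F x.

Lemma simple_approx F (b : K) n : dK F -> measurable_real F ->
  (forall x, x ∈ X -> - b <= F x <= b) -> n ∈ omega ->
  exists N a c, simple N a c /\
    forall k x, k ∈ N -> x ∈ a ∙ k -> re (c ∙ k) <= F x <= re (c ∙ k) + p3 n.
Proof.
move=> HF HFm Hb Hn; have Hp := p3_gt0 Hn (T := T).
case: (@archimedean V T (2 * b / p3 n)) => N [HN]; rewrite ltr_pdivrMr // => HbN.
(* Slices of height 3^-n counted downwards from b; by the choice of N, the first N of them cover
   [-b, b]. Each slice contains its upper end, so it is a difference of two sets of the form {t <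
   F}. *)
pose c0 (k : V) : K := b - kn k * p3 n - p3 n.
have Hc0 : dK c0 by rewrite /c0; dfn.
pose (a0 (k : V) := ⟦ x | x ∈ X /\ c0 k < F x <= c0 k + p3 n ⟧).
have Ha0 : definable_term (fun e => a0 (e 0%N)) by rewrite /a0; dfn.
have ina k x : (x ∈ a0 k) = (x ∈ X /\ c0 k < F x <= c0 k + p3 n).
  by apply: (in_compr X) => [|z []//]; dfn.
have a0A k : a0 k ∈ A.
  case: (HFm (c0 k)) => u [Hu Hux]; case: (HFm (c0 k + p3 n)) => v [Hv Hvx].
  have -> : a0 k = diff u v; last exact: (sigma_diff HA).
  apply: (ext T) => x; rewrite ina in_diff (propeq (Hux x)) (propeq (Hvx x)) leNgt.
  split=> [[Hx /andP [H1 /negP H2]]|[[Hx H1] H2]]; first by split=> // -[].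
  by split=> //; rewrite H1; apply/negP => H3; apply: H2.
exists N, (lam N a0), (lam N (fun k => rv (c0 k))); split; last first.
  move=> k x Hk; rewrite !lam_app // ina re_rv => -[_ /andP [H1 H2]].
  by rewrite H2 ltW.
split=> //; first by apply: lam_fn.
  by apply: lam_fn => // k _; exact: rv_in.
split=> [k l Hk Hl Hkl x|x Hx].
  rewrite !lam_app // !ina /c0 => -[_ /andP [H1 H2]] [_ /andP [H3 H4]].
  have Hko := omega_trans HN Hk; have Hlo := omega_trans HN Hl.
  have mono i j : i ∈ omega -> j ∈ i -> kn j * p3 n + p3 n <= kn i * p3 n :> K.
    move=> Hi Hj; rewrite -{2}[p3 n]mul1r -mulrDl; apply: ler_wpM2r; first exact: ltW.
    exact: kn_lt.
  case: (omega_total Hko Hlo) => [/(mono _ _ Hko)|[E|/(mono _ _ Hlo)]]; last 1 first.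
  - lra.
  - lra.
  - by case: Hkl.
case: (@kfloor V T N (p3 n) (b - F x)) => // [||k [Hk H1 H2]].
- by have := Hb x Hx; lra.
- by have := Hb x Hx; lra.
exists k; split=> //; rewrite lam_app // ina /c0; split=> //.
lra.
Qed.

Lemma lower_sum_le F n N a c N' a' c' : simple N a c -> simple N' a' c' ->
  (forall k x, k ∈ N -> x ∈ a ∙ k -> re (c ∙ k) <= F x) ->
  (forall k x, k ∈ N' -> x ∈ a' ∙ k -> F x <= re (c' ∙ k) + p3 n) ->
  simple_sum N a c <= simple_sum N' a' c' + p3 n.
Proof.
move=> Hs Hs' Hc Hc'; case: (simple_const 0) => N0 [a0 [c0 [H0 E0 S0]]].
case: (@simple_map N' a' c' (fun x => - x)) => // Hs'' Ek.
have := simple_sum3 (e := p3 n) Hs Hs'' H0.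
rewrite S0 simple_sum_neg // => H; move: (simple_sum _ _ _) (simple_sum _ _ _) H => u v H.
suff : v - u + 0 <= p3 n by lra.
apply: H => i j l x Hi Hj Hl Hxi Hxj _; rewrite Ek // E0 //.
have := Hc i x Hi Hxi; have := Hc' j x Hj Hxj.
by move: (re (c ∙ i)) (re (c' ∙ j)) (F x) (p3 n) => *; lra.
Qed.

Lemma integral_exists F (b : K) : dK F -> measurable_real F ->
  (forall x, x ∈ X -> - b <= F x <= b) -> exists r, has_integral F r.
Proof.
move=> HF HFm Hb.
have Hds := definable_simple; have Hdss := definable_simple_sum.
case: (@sup_exists V T (fun r => exists N a c, [/\ simple N a c,
  forall k x, k ∈ N -> x ∈ a ∙ k -> re (c ∙ k) <= F x & r = simple_sum N a c])).
- by rewrite /simple /simple_sum; dfn.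
- case: (simple_approx HF HFm Hb emp_omega) => N [a [c [Hs Hc]]].
  by exists (simple_sum N a c), N, a, c; split=> // k x Hk /(Hc k x Hk) /andP [].
- case: (simple_approx HF HFm Hb emp_omega) => N [a [c [Hs Hc]]].
  exists (simple_sum N a c + p3 emp) => r [N' [a' [c' [Hs' Hc' ->]]]].
  by apply: (lower_sum_le (F := F)) => // k x Hk /(Hc k x Hk) /andP [].
move=> r [H1 H2]; exists r => n Hn; have Hp := p3_gt0 Hn (T := T).
case: (simple_approx HF HFm Hb Hn) => N [a [c [Hs Hc]]]; exists N, a, c; split=> //.
  move=> k x Hk Hx; have := Hc k x Hk Hx.
  by move: (re (c ∙ k)) (F x) (p3 n) Hp => *; lra.
apply/andP; split.
  apply: (@le_trans _ _ (simple_sum N a c)); first by rewrite lerBlDr lerDl ltW.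
  by apply: H1; exists N, a, c; split=> // k x Hk /(Hc k x Hk) /andP [].
apply: H2 => s [N' [a' [c' [Hs' Hc' ->]]]].
by apply: (lower_sum_le (F := F)) => // k x Hk /(Hc k x Hk) /andP [].
Qed.

Lemma measurable_lt F G (e : K) : dK F -> dK G -> measurable_real F -> measurable_real G ->
  exists a, a ∈ A /\ forall x, x ∈ a <-> x ∈ X /\ F x < G x + e.
Proof.
move=> HF HG HFm HGm.
have HFl t : exists a, a ∈ A /\ forall x, x ∈ a <-> x ∈ X /\ F x <= t.
  case: (HFm t) => a [Ha Hat]; exists (diff X a); split; first exact: (sigma_compl HA).
  move=> x; rewrite in_diff (propeq (Hat x)) leNgt.
  by split=> -[Hx H]; split=> //; [apply/negP => Ht; apply: H|move=> [_ Ht]; rewrite Ht in H].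
case: (@countable_choice V T A (fun n a => forall x, x ∈ a <-> x ∈ X /\ F x <= rational n < G x + e)).
- by dfn.
- move=> n Hn; case: (HFl (rational n)) => u [Hu Hux]; case: (HGm (rational n - e)) => v [Hv Hvx].
  exists (cap u v); split; first exact: (sigma_cap HA).
  move=> x; rewrite in_cap (propeq (Hux x)) (propeq (Hvx x)) ltrBlDr.
  by split=> [[[Hx ->] [_ ->]]|[Hx /andP [H1 H2]]].
move=> f [Hf Hfn]; exists (bigcup (app f)); split.
  by apply: (sigma_bigcup HA) => // n Hn; apply: fn_app Hf Hn.
move=> x; rewrite in_bigcup //; split.
  by move=> [n [Hn /(Hfn n Hn) [Hx /andP [H1 H2]]]]; split=> //; apply: le_lt_trans H1 H2.
move=> [Hx /rational_dense [n [Hn /andP [H1 H2]]]]; exists n; split=> //; apply/(Hfn n Hn).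
by rewrite H2 ltW.
Qed.

(** Monotone convergence for bounded functions. The sets B n where F < G n + 3^-k increase to X, so
    one of them has measure above 1 - 3^-k, and off it F exceeds G n by at most b. The total error
    is (1 + b) 3^-k. *)
Lemma integral_sup F (G : V -> V -> K) (r : V -> K) s b u : dK F ->
  definable_term (fun e => rv (G (e 0%N) (e 1%N))) -> measurable_real F ->
  (forall n, n ∈ omega -> measurable_real (G n)) ->
  has_integral F s -> (forall n, n ∈ omega -> has_integral (G n) (r n)) ->
  (forall n x, n ∈ omega -> x ∈ X -> G n x <= G (succ n) x) ->
  (forall n x, n ∈ omega -> x ∈ X -> F x <= G n x + b) -> 0 <= b ->
  (forall x (e : K), x ∈ X -> 0 < e -> exists n, n ∈ omega /\ F x < G n x + e) ->
  (forall n, n ∈ omega -> r n <= u) -> s <= u.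
Proof.
move=> HF HG HFm HGm HFs HGr Hmono Hb Hb0 Hsup Hu.
apply: (@real_le_eps_mul _ _ _ _ (1 + b)); first by lra.
move=> k Hk; have Hp := p3_gt0 Hk (T := T).
pose (B (n : V) := ⟦ x | x ∈ X /\ F x < G n x + p3 k ⟧).
have HB : definable_term (fun e => B (e 0%N)) by rewrite /B; dfn.
have inB n x : (x ∈ B n) = (x ∈ X /\ F x < G n x + p3 k).
  by apply: (in_compr X) => [|z []//]; dfn.
have HGd n : dK (G n) by dfn.
have BA n : n ∈ omega -> B n ∈ A.
  move=> Hn; case: (measurable_lt (p3 k) HF (HGd n) HFm (HGm n Hn)) => a [Ha Hax].
  suff -> : B n = a by []; apply: (ext T) => x; rewrite inB (propeq (Hax x)); tauto.
have HBX : bigcup B = X.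
  apply: (ext T) => x; rewrite in_bigcup //; split; first by case=> n [Hn]; rewrite inB => -[].
  by move=> Hx; case: (Hsup x (p3 k) Hx Hp) => n [Hn H]; exists n; rewrite inB.
have [n [Hn Hnm]] : exists n, n ∈ omega /\ 1 - p3 k < m (B n).
  apply: NNPP => Hno; have : m (bigcup B) <= 1 - p3 k; last by rewrite HBX (meas_one Hm); lra.
  apply: (meas_cont Hm) => //.
    move=> n Hn x; rewrite !inB => -[Hx H]; split=> //; have := Hmono n x Hn Hx.
    by move: (G n x) (G (succ n) x) (F x) (p3 k) H => *; lra.
  by move=> n Hn; rewrite leNgt; apply/negP => H; apply: Hno; exists n.
have HC := sigma_compl HA (BA n Hn).
have := integral_sum3 (e := p3 k) HFs (integral_opp (HGr n Hn)) (integral_opp (integral_indicator b HC)).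
rewrite (meas_compl Hm); last exact: BA.
move=> H.
have : s - r n - b * (1 - m (B n)) <= p3 k.
  apply: H => x Hx; case: (classic (x ∈ diff X (B n))) => HxB.
    rewrite ite_true // re_rv; have := Hb n x Hn Hx.
    by move: (F x) (G n x) (p3 k) Hp => *; lra.
  rewrite ite_false // -rv_zero re_rv.
  have : x ∈ B n by apply: NNPP => HxB'; apply: HxB; rewrite in_diff.
  by rewrite inB => -[_]; move: (F x) (G n x) (p3 k) => *; lra.
have : b * (1 - m (B n)) <= b * p3 k by apply: ler_wpM2l => //; lra.
have := Hu n Hn; rewrite mulrDl mul1r.
by move: (r n) (b * _) (b * p3 k) (p3 k) => *; lra.
Qed.

End Integral.

End Integrals.

Arguments integral_opp {V T X A m} Hm [F r] _.
Arguments integral_const {V T X A m} Hm t.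
Arguments integral_indicator {V T X A m} Hm [a] t _.

(** * Continuous functions and the weak topology *)

(** Closure under intersections makes the countable base a π-system, on which measures can be
    compared. *)
Definition base {V : Type} {M : set_structure V} (S W : V) : Prop :=
  [/\ fn W omega (opens S), (forall u x, u ∈ opens S -> x ∈ u ->
      exists n, [/\ n ∈ omega, x ∈ W ∙ n & sub (W ∙ n) u]) &
      forall n m, n ∈ omega -> m ∈ omega -> exists k, k ∈ omega /\ W ∙ k = cap (W ∙ n) (W ∙ m)].

(** The T0 axiom; with a countable base it gives a sequence of open sets that separates points. *)
Definition separated {V : Type} {M : set_structure V} (S : V) : Prop :=
  forall x y, x ∈ car S -> y ∈ car S -> (forall u, u ∈ opens S -> x ∈ u <-> y ∈ u) -> x = y.

Section Bases.

Context {V : Type} {T : model V}.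
#[local] Hint Extern 0 (set_structure _) => exact (model_struct T) : typeclass_instances.
Local Notation R := (model_reals T).
Local Notation re := (@re V T).
Local Notation rv := (@rv V T).

Lemma unpair_pi n : n ∈ omega -> pi1 (unpair ∙ n) ∈ omega /\ pi2 (unpair ∙ n) ∈ omega.
Proof. by move=> Hn; case: (prodP (fn_app unpair_fn Hn)). Qed.

Lemma enumerate2 (W : V) (A : V -> V -> V) : definable_term (fun e => A (e 0%N) (e 1%N)) ->
  (forall n m, n ∈ omega -> m ∈ omega -> A n m ∈ W) ->
  exists f, fn f omega W /\ forall n m, n ∈ omega -> m ∈ omega -> exists k, k ∈ omega /\ f ∙ k = A n m.
Proof.
move=> HA HW.
have Hd : definable_term (fun e => A (pi1 (unpair ∙ (e 0%N))) (pi2 (unpair ∙ (e 0%N)))) by dfn.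
exists (lam omega (fun k => A (pi1 (unpair ∙ k)) (pi2 (unpair ∙ k)))); split.
  by apply: lam_fn => // k /unpair_pi [H1 H2]; apply: HW.
move=> n m Hn Hm; case: (unpair_surj Hn Hm) => k [Hk E]; exists k; split=> //.
by rewrite lam_app // E pi1_pair pi2_pair.
Qed.

(* Levels: each sequence lists all values of op on the previous one. *)
Lemma operation_closure (W u : V) (op : V -> V -> V) : definable_term (fun e => op (e 0%N) (e 1%N)) ->
  (forall a b, a ∈ W -> b ∈ W -> op a b ∈ W) -> (forall a, a ∈ W -> op a a = a) -> fn u omega W ->
  exists f, [/\ fn f omega W, (forall n, n ∈ omega -> exists k, k ∈ omega /\ f ∙ k = u ∙ n) &
    forall n m, n ∈ omega -> m ∈ omega -> exists k, k ∈ omega /\ f ∙ k = op (f ∙ n) (f ∙ m)].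
Proof.
move=> Hop HW Hid Hu.
pose (step (r : V) := lam omega (fun n => op (r ∙ pi1 (unpair ∙ n)) (r ∙ pi2 (unpair ∙ n)))).
have Hstep : definable_term (fun e => step (e 0%N)) by rewrite /step; dfn.
pose (L (k : V) := rec u (fun _ r : V => step r) k).
have HL : definable_term (fun e => L (e 0%N)) by rewrite /L; dfn.
have L0 : L emp = u by rewrite /L rec0 //; dfn.
have LS k : k ∈ omega -> L (succ k) = step (L k) by move=> Hk; rewrite /L recS //; dfn.
have step_app r n : n ∈ omega -> step r ∙ n = op (r ∙ pi1 (unpair ∙ n)) (r ∙ pi2 (unpair ∙ n)).
  by move=> Hn; rewrite /step lam_app //; dfn.
have LW k : k ∈ omega -> fn (L k) omega W.
  move: k; apply: omega_ind; [by dfn|by rewrite L0|move=> k Hk IH; rewrite LS //].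
  apply: lam_fn; first by dfn.
  by move=> n /unpair_pi [H1 H2]; apply: HW; apply: fn_app IH _.
have Lop k n m : k ∈ omega -> n ∈ omega -> m ∈ omega ->
    exists j, j ∈ omega /\ L (succ k) ∙ j = op (L k ∙ n) (L k ∙ m).
  move=> Hk Hn Hm; case: (unpair_surj Hn Hm) => j [Hj E]; exists j; split=> //.
  by rewrite LS // step_app // E pi1_pair pi2_pair.
have Lmono k i n : k ∈ omega -> i ∈ succ k -> n ∈ omega -> exists j, j ∈ omega /\ L k ∙ j = L i ∙ n.
  move=> Hk; move: k Hk i n; apply: omega_ind; first by dfn.
    by move=> i n; rewrite in_succ in_emp => -[//|->] Hn; exists n.
  move=> k Hk IH i n; rewrite in_succ => -[Hi|->] Hn; last by exists n.
  case: (IH i n Hi Hn) => j [Hj E]; case: (Lop k j j Hk Hj Hj) => l [Hl E']; exists l; split=> //.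
  by rewrite E' Hid; [exact: E|exact: fn_app (LW k Hk) Hj].
have HFd : definable_term (fun e => L (pi1 (unpair ∙ (e 0%N))) ∙ pi2 (unpair ∙ (e 0%N))) by dfn.
pose (f := lam omega (fun k : V => L (pi1 (unpair ∙ k)) ∙ pi2 (unpair ∙ k))).
have fE k : k ∈ omega -> f ∙ k = L (pi1 (unpair ∙ k)) ∙ pi2 (unpair ∙ k) by move=> Hk; rewrite /f lam_app.
have fL k j : k ∈ omega -> j ∈ omega -> exists l, l ∈ omega /\ f ∙ l = L k ∙ j.
  move=> Hk Hj; case: (unpair_surj Hk Hj) => l [Hl E]; exists l; split=> //.
  by rewrite fE // E pi1_pair pi2_pair.
exists f; split.
- by apply: lam_fn => // k /unpair_pi [H1 H2]; apply: fn_app (LW _ H1) H2.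
- by move=> n Hn; case: (fL emp n emp_omega Hn) => k [Hk E]; exists k; rewrite E L0.
move=> n m Hn Hm; rewrite !fE //.
have [Hn1 Hn2] := unpair_pi Hn; have [Hm1 Hm2] := unpair_pi Hm.
case: (omega_max Hn1 Hm1) => k [Hk Hnk Hmk]; rewrite !omega_sub // in Hnk Hmk.
case: (Lmono k _ _ Hk Hnk Hn2) => i [Hi <-]; case: (Lmono k _ _ Hk Hmk Hm2) => j [Hj <-].
by case: (Lop k i j Hk Hi Hj) => l [Hl <-]; apply: fL => //; apply: succ_omega.
Qed.

Lemma base_generated X B W : B ⊆ pow X -> fn W omega (opens (generated_space X B)) ->
  (forall n m, n ∈ omega -> m ∈ omega -> exists k, k ∈ omega /\ W ∙ k = cap (W ∙ n) (W ∙ m)) ->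
  (forall x, x ∈ X -> exists n, n ∈ omega /\ x ∈ W ∙ n) ->
  (forall u x, u ∈ B -> x ∈ u -> exists n, [/\ n ∈ omega, x ∈ W ∙ n & W ∙ n ⊆ u]) ->
  base (generated_space X B) W.
Proof.
move=> HB HW Hcap HX Hsub; split=> // u x Hu Hx.
have HWX n : n ∈ omega -> W ∙ n ⊆ X.
  by move=> Hn; have := fn_app HW Hn; rewrite in_generated_opens in_pow => -[].
apply: (@generated_open_ind V T X B (fun u x => exists n, [/\ n ∈ omega, x ∈ W ∙ n & W ∙ n ⊆ u]) u x) => //.
- by move=> y Hy; case: (HX y Hy) => n [Hn H]; exists n; split=> //; apply: HWX.
- move=> v w y _ _ [n [Hn H1 H2]] [m [Hm H3 H4]]; case: (Hcap n m Hn Hm) => k [Hk E].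
  exists k; rewrite E in_cap; split=> // z; rewrite !in_cap => -[Hz1 Hz2].
  by split; [apply: H2|apply: H4].
- by move=> v w y Hvw _ [n [Hn H1 H2]]; exists n; split=> //; apply: sub_trans Hvw.
Qed.

Section Base.

Variables S W : V.
Hypotheses (HS : is_topology (car S) (opens S)) (HW : base S W).

Let HSX : opens S ⊆ pow (car S). Proof. by case: HS. Qed.

Lemma base_fn : fn W omega (borel S).
Proof.
case: HW => H _ _; apply: fn_cod H _ => u Hu; exact: open_borel.
Qed.

Lemma base_separates : separated S -> forall x y, x ∈ car S -> y ∈ car S ->
  (forall n, n ∈ omega -> x ∈ W ∙ n <-> y ∈ W ∙ n) -> x = y.
Proof.
case: HW => _ Hb _ Hsep x y Hx Hy H; apply: Hsep => // u Hu; split=> Hz.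
  by case: (Hb u x Hu Hz) => n [Hn Hxn Hsub]; apply: Hsub; apply/H.
by case: (Hb u y Hu Hz) => n [Hn Hxn Hsub]; apply: Hsub; apply/H.
Qed.

Lemma open_bigcup_base u : u ∈ opens S -> u = bigcup (fun n => ite (W ∙ n ⊆ u) (W ∙ n) emp).
Proof.
move=> Hu; have Hd : definable_term (fun e => ite (W ∙ e 0%N ⊆ u) (W ∙ e 0%N) emp) by rewrite /sub; dfn.
apply: (ext T) => x; rewrite in_bigcup //; split.
  case: HW => _ Hb _ Hx; case: (Hb u x Hu Hx) => n [Hn Hxn Hsub]; exists n; split=> //.
  by rewrite ite_true.
move=> [n [Hn]]; case: (classic (W ∙ n ⊆ u)) => H; first by rewrite ite_true // => /H.
by rewrite ite_false // in_emp.
Qed.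

Lemma base_sigma A : sigma_algebra (car S) A -> (forall n, n ∈ omega -> W ∙ n ∈ A) -> borel S ⊆ A.
Proof.
move=> HA HWA b; rewrite in_borel => -[_]; apply=> // u Hu; rewrite (open_bigcup_base Hu).
apply: (sigma_bigcup HA); first by rewrite /sub; dfn.
move=> n Hn; case: (classic (W ∙ n ⊆ u)) => H; first by rewrite ite_true //; apply: HWA.
by rewrite ite_false //; exact: (sigma_emp HA).
Qed.

(** The π-λ theorem, with the base as π-system. *)
Lemma prob_base_ext mu nu : mu ∈ Prob R S -> nu ∈ Prob R S ->
  (forall n, n ∈ omega -> mu ∙ (W ∙ n) = nu ∙ (W ∙ n)) -> mu = nu.
Proof.
move=> Hmu Hnu E; apply: (@prob_ext V T S) => // b Hb.
have Hm := prob_measure Hmu; have Hn := prob_measure Hnu.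
have HA := @borel_sigma V T S.
separate (borel S) (fun b => mu ∙ b = nu ∙ b) as D inD.
separate (borel S) (fun b => exists n, n ∈ omega /\ b = W ∙ n) as P inP.
have rvE c : c ∈ borel S -> re (mu ∙ c) = re (nu ∙ c) -> mu ∙ c = nu ∙ c.
  by move=> Hc E'; rewrite (prob_rv Hmu) // (prob_rv Hnu) // E'.
have Hb' : b ∈ D; last by move: Hb'; rewrite inD => -[].
apply: (@pi_lambda V T (car S) P D).
- by move=> c; rewrite inP => -[Hc _]; case: HA => H _; apply: H.
- move=> a c; rewrite !inP => -[Ha [n [Hn' ->]]] [Hc [m [Hm' ->]]].
  case: HW => _ _ H; case: (H n m Hn' Hm') => k [Hk Ek]; split; last by exists k.
  by rewrite -Ek; apply: (fn_app base_fn).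
- split; first by move=> c; rewrite inD => -[Hc _]; case: HA => H _; apply: H.
  split.
    rewrite inD; split; first exact: (sigma_total HA).
    by apply: rvE; [exact: (sigma_total HA)|rewrite (meas_one Hm) (meas_one Hn)].
  split=> [a|f Hf Hdis].
    rewrite !inD => -[Ha Ea]; split; first exact: (sigma_compl HA).
    by apply: rvE; [exact: (sigma_compl HA)|rewrite (meas_compl Hm) // (meas_compl Hn) // Ea].
  have HfB k : k ∈ omega -> f ∙ k ∈ borel S by move=> Hk; have := fn_app Hf Hk; rewrite inD => -[].
  have HfE k : k ∈ omega -> mu ∙ (f ∙ k) = nu ∙ (f ∙ k) by move=> Hk; have := fn_app Hf Hk; rewrite inD => -[].
  have HU : bigcup (app f) ∈ borel S by apply: (sigma_bigcup HA).
  rewrite (Union_seqE Hf) inD; split=> //; apply: rvE => //.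
  have Hfd : definable_term (fun e => f ∙ e 0%N) by [].
  case: (prob_lub Hmu Hfd HfB Hdis) => H1 H2; case: (prob_lub Hnu Hfd HfB Hdis) => H3 H4.
  have Es n : n ∈ omega -> ksum n (fun k => re (mu ∙ (f ∙ k))) = ksum n (fun k => re (nu ∙ (f ∙ k))).
    by move=> Hn'; apply: ksum_ext => // k Hk; rewrite HfE //; apply: omega_trans Hk.
  apply/eqP; rewrite eq_le; apply/andP; split.
    by apply: H2 => n Hn'; rewrite Es //; apply: H3.
  by apply: H4 => n Hn'; rewrite -Es //; apply: H1.
- move=> c; rewrite inP inD => -[Hc [n [Hn' Ec]]]; split=> //; rewrite Ec; exact: E.
move=> A HA' HPA; apply: (base_sigma HA') => // n Hn'; apply: HPA.
by rewrite inP; split; [apply: (fn_app base_fn)|exists n].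
Qed.

(** The lower Dedekind cuts of the measures of all basic open sets, joined into one subset of omega:
    this is the coding through which measures are selected. *)
Definition prob_code (mu : V) : V :=
  ⟦ n | n ∈ omega /\ rational (pi2 (unpair ∙ n)) < re (mu ∙ (W ∙ pi1 (unpair ∙ n))) ⟧.

Lemma in_prob_code mu n : (n ∈ prob_code mu) = (n ∈ omega /\
  rational (pi2 (unpair ∙ n)) < re (mu ∙ (W ∙ pi1 (unpair ∙ n)))).
Proof. by apply: (in_compr omega) => [|y []//]; dfn. Qed.

Lemma prob_code_inj mu nu : mu ∈ Prob R S -> nu ∈ Prob R S -> prob_code mu = prob_code nu -> mu = nu.
Proof.
move=> Hmu Hnu E; apply: prob_base_ext => // n Hn.
have Hle q r : (forall k, k ∈ prob_code q -> k ∈ prob_code r) -> re (q ∙ (W ∙ n)) <= re (r ∙ (W ∙ n)).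
  move=> H; rewrite leNgt; apply/negP => /rational_dense [m [Hm /andP [H1 H2]]].
  case: (unpair_surj Hn Hm) => k [Hk Ek]; have := H k.
  rewrite !in_prob_code Ek pi1_pair pi2_pair => H'.
  by have [_ H3] := H' (conj Hk H2); have := lt_trans H1 H3; rewrite ltxx.
rewrite (prob_rv Hmu (fn_app base_fn Hn)) (prob_rv Hnu (fn_app base_fn Hn)); congr rv.
by apply/eqP; rewrite eq_le; apply/andP; split; apply: Hle => k; rewrite E.
Qed.

End Base.

End Bases.

(** * Nice spaces *)

Section Continuous.

Context {V : Type} {T : model V}.
#[local] Hint Extern 0 (set_structure _) => exact (model_struct T) : typeclass_instances.
Local Notation R := (model_reals T).
Local Notation K := (real_of T).
Local Notation re := (@re V T).
Local Notation rv := (@rv V T).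
Local Notation dK F := (definable_term (fun e => rv (F (e 0%N)))).

Definition open_set S (P : V -> Prop) : Prop :=
  exists u, u ∈ opens S /\ forall x, x ∈ u <-> x ∈ car S /\ P x.

(** Bounded continuous functions with nonnegative values. Continuity is tested on rays, which
    generate the topology of the line and are convenient for minima, maxima and truncations. *)
Definition bcont S (F : V -> K) : Prop :=
  (exists b : K, forall x, x ∈ car S -> 0 <= F x <= b) /\
  forall t : K, open_set S (fun x => t < F x) /\ open_set S (fun x => F x < t).

Definition cf (S : V) : V := ⟦ f | fn f (car S) (RR R) /\ bcont S (fun x => re (f ∙ x)) ⟧.

Lemma in_cf S f : (f ∈ cf S) = (fn f (car S) (RR R) /\ bcont S (fun x => re (f ∙ x))).
Proof.
apply: (in_compr (pow (Defs.prod (car S) (RR R)))); first by rewrite /bcont /open_set; dfn.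
by move=> g [[H _] _]; rewrite in_pow.
Qed.

(** The sets {0 < f}, for countably many bounded continuous f, contain arbitrarily small
    neighbourhoods of every point. This combines a countable base with enough continuous functions
    to handle the weak topology. *)
Definition nice_at S (F : V) : Prop := fn F omega (cf S) /\ forall u x, u ∈ opens S -> x ∈ u ->
  exists n, [/\ n ∈ omega, 0 < re (F ∙ n ∙ x) & forall y, y ∈ car S -> 0 < re (F ∙ n ∙ y) -> y ∈ u].

Definition nice S : Prop := [/\ is_topology (car S) (opens S), separated S & exists F, nice_at S F].

Section Space.

Variable S : V.
Hypothesis HS : is_topology (car S) (opens S).
Local Notation X := (car S).

Lemma topology_sub u x : u ∈ opens S -> x ∈ u -> x ∈ X.
Proof. by case: HS => H _ /H; rewrite in_pow; apply. Qed.

Lemma topology_emp : emp ∈ opens S. Proof. by case: HS => _ []. Qed.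
Lemma topology_total : X ∈ opens S. Proof. by case: HS => _ [_ []]. Qed.
Lemma topology_cap u v : u ∈ opens S -> v ∈ opens S -> cap u v ∈ opens S.
Proof. by case: HS => _ [_ [_ [H _]]]; apply: H. Qed.
Lemma topology_union U : U ⊆ opens S -> union U ∈ opens S.
Proof. by case: HS => _ [_ [_ [_ H]]]; apply: H. Qed.

Lemma open_set_ext P Q : (forall x, x ∈ X -> P x <-> Q x) -> open_set S P -> open_set S Q.
Proof.
move=> E [u [Hu H]]; exists u; split=> // x; rewrite (propeq (H x)).
by split=> -[Hx HP]; split=> //; apply/(E x Hx).
Qed.

Lemma open_set_all (P : V -> Prop) : (forall x, x ∈ X -> P x) -> open_set S P.
Proof. by move=> H; exists X; split=> [|x]; [exact: topology_total|split=> [Hx|[]] //; split; auto]. Qed.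

Lemma open_set_none (P : V -> Prop) : (forall x, x ∈ X -> ~ P x) -> open_set S P.
Proof.
move=> H; exists emp; split=> [|x]; first exact: topology_emp.
by rewrite in_emp; split=> // -[Hx /(H x Hx)].
Qed.

Lemma open_set_and P Q : open_set S P -> open_set S Q -> open_set S (fun x => P x /\ Q x).
Proof.
move=> [u [Hu H1]] [v [Hv H2]]; exists (cap u v); split; first exact: topology_cap.
by move=> x; rewrite in_cap (propeq (H1 x)) (propeq (H2 x)); tauto.
Qed.

Lemma open_local (Q : V -> Prop) : definable (fun e => Q (e 0%N)) ->
  (forall x, x ∈ X -> Q x -> exists u, [/\ u ∈ opens S, x ∈ u & forall y, y ∈ u -> Q y]) -> open_set S Q.
Proof.
move=> HQ H; separate (opens S) (fun u => forall y, y ∈ u -> Q y) as U inU.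
exists (union U); split; first by apply: topology_union => u; rewrite inU => -[].
move=> x; rewrite in_union; split.
  by move=> [u []]; rewrite inU => -[Hu HuQ] Hx; split; [exact: topology_sub Hx|auto].
by move=> [Hx /(H x Hx) [u [Hu Hxu Hy]]]; exists u; rewrite inU.
Qed.

Lemma open_set_or P Q : definable (fun e => P (e 0%N)) -> definable (fun e => Q (e 0%N)) ->
  open_set S P -> open_set S Q -> open_set S (fun x => P x \/ Q x).
Proof.
move=> HP HQ [u [Hu H1]] [v [Hv H2]]; apply: open_local; first by dfn.
move=> x Hx [Hp|Hq]; [exists u|exists v]; split=> //; try by [apply/H1|apply/H2].
  by move=> y /H1 [_]; left.
by move=> y /H2 [_]; right.
Qed.

Lemma bcont_const (c : K) : 0 <= c -> bcont S (fun=> c).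
Proof.
move=> Hc; split; first by exists c => x _; rewrite Hc lexx.
by move=> t; split; [case: (classic (is_true (t < c)))|case: (classic (is_true (c < t)))] => H;
  try (by apply: open_set_all); apply: open_set_none.
Qed.

Lemma bcont_min F G : dK F -> dK G -> bcont S F -> bcont S G -> bcont S (fun x => Num.min (F x) (G x)).
Proof.
move=> HF HG [[b Hb] HFc] [[c Hc] HGc]; split.
  exists b => x Hx; rewrite le_min ge_min; have := Hb x Hx; have := Hc x Hx.
  by move=> /andP [-> _] /andP [-> ->].
move=> t; case: (HFc t) => F1 F2; case: (HGc t) => G1 G2; split.
  by apply: open_set_ext (open_set_and F1 G1) => x Hx; rewrite lt_min; split=> [[-> ->]|/andP].
by apply: open_set_ext (open_set_or _ _ F2 G2) => // x Hx; rewrite gt_min; split=> [[|] ->|/orP]; rewrite ?orbT.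
Qed.

Lemma bcont_max F G : dK F -> dK G -> bcont S F -> bcont S G -> bcont S (fun x => Num.max (F x) (G x)).
Proof.
move=> HF HG [[b Hb] HFc] [[c Hc] HGc]; split.
  exists (Num.max b c) => x Hx; rewrite le_max ge_max !le_max; have := Hb x Hx; have := Hc x Hx.
  by move=> /andP [_ ->] /andP [-> ->]; rewrite orbT.
move=> t; case: (HFc t) => F1 F2; case: (HGc t) => G1 G2; split.
  by apply: open_set_ext (open_set_or _ _ F1 G1) => // x Hx; rewrite lt_max; split=> [[|] ->|/orP]; rewrite ?orbT.
by apply: open_set_ext (open_set_and F2 G2) => x Hx; rewrite gt_max; split=> [[-> ->]|/andP].
Qed.

Lemma bcont_scale F (c : K) : 0 <= c -> bcont S F -> bcont S (fun x => c * F x).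
Proof.
rewrite le_eqVlt => /orP [/eqP <-|Hc] HF.
  have -> : (fun x => 0 * F x) = (fun=> 0) by apply: funeq => x; rewrite mul0r.
  exact: bcont_const.
case: HF => [[b Hb] HFc]; split.
  exists (c * b) => x Hx; have /andP [H1 H2] := Hb x Hx.
  by rewrite mulr_ge0 ?(ltW Hc) //= ler_wpM2l // ltW.
move=> t; case: (HFc (t / c)) => F1 F2; split.
  by apply: open_set_ext F1 => x Hx; rewrite ltr_pdivrMr // mulrC.
by apply: open_set_ext F2 => x Hx; rewrite ltr_pdivlMr // mulrC.
Qed.

Lemma bcont_pos (F : V -> K) (q b : K) : (forall x, x ∈ X -> F x <= b) ->
  (forall t : K, open_set S (fun x => t < F x) /\ open_set S (fun x => F x < t)) ->
  bcont S (fun x => Num.max 0 (F x - q)).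
Proof.
move=> Hb HF; split.
  exists (Num.max 0 (b - q)) => x Hx; rewrite le_max lexx /= ge_max le_max lexx /=.
  by rewrite le_max lerD2r Hb // orbT.
move=> t; case: (HF (t + q)) => F1 F2; split.
  have [Ht|Ht] := ltP t 0; first by apply: open_set_all => x _; rewrite lt_max Ht.
  by apply: open_set_ext F1 => x Hx; rewrite lt_max ltNge Ht /= ltrBrDr.
have [Ht|Ht] := ltP 0 t; last first.
  by apply: open_set_none => x _; rewrite gt_max ltNge Ht.
by apply: open_set_ext F2 => x Hx; rewrite gt_max Ht /= ltrBlDr.
Qed.

Lemma bcont_ext F G : (forall x, x ∈ X -> F x = G x) -> bcont S F -> bcont S G.
Proof.
move=> E [[b Hb] HF]; split; first by exists b => x Hx; rewrite -E // Hb.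
by move=> t; case: (HF t) => H1 H2; split; [apply: open_set_ext H1|apply: open_set_ext H2] => x Hx; rewrite E.
Qed.

Lemma cf_lam F : dK F -> bcont S F -> lam X (fun x => rv (F x)) ∈ cf S.
Proof.
move=> HF Hc; rewrite in_cf; split; first by apply: lam_fn => // x _; exact: rv_in.
by apply: bcont_ext Hc => x Hx; rewrite lam_app // re_rv.
Qed.

Lemma cf_bcont f : f ∈ cf S -> bcont S (fun x => re (f ∙ x)).
Proof. by rewrite in_cf => -[]. Qed.

Lemma cf_ge0 f x : f ∈ cf S -> x ∈ X -> 0 <= re (f ∙ x).
Proof. by case/cf_bcont => [[b Hb] _] /Hb /andP []. Qed.

Definition fmin (f g : V) : V := lam X (fun x => rv (Num.min (re (f ∙ x)) (re (g ∙ x)))).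
Definition fmax (f g : V) : V := lam X (fun x => rv (Num.max (re (f ∙ x)) (re (g ∙ x)))).

Lemma fmin_app f g x : x ∈ X -> re (fmin f g ∙ x) = Num.min (re (f ∙ x)) (re (g ∙ x)).
Proof. by move=> Hx; rewrite /fmin lam_app ?re_rv // /Order.min; dfn. Qed.

Lemma fmax_app f g x : x ∈ X -> re (fmax f g ∙ x) = Num.max (re (f ∙ x)) (re (g ∙ x)).
Proof. by move=> Hx; rewrite /fmax lam_app ?re_rv // /Order.max; dfn. Qed.

Lemma fmin_cf f g : f ∈ cf S -> g ∈ cf S -> fmin f g ∈ cf S.
Proof.
move=> Hf Hg; apply: (@cf_lam (fun x => Num.min (re (f ∙ x)) (re (g ∙ x)))).
  by rewrite /Order.min; dfn.
by apply: bcont_min => //; apply: cf_bcont.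
Qed.

Lemma fmax_cf f g : f ∈ cf S -> g ∈ cf S -> fmax f g ∈ cf S.
Proof.
move=> Hf Hg; apply: (@cf_lam (fun x => Num.max (re (f ∙ x)) (re (g ∙ x)))).
  by rewrite /Order.max; dfn.
by apply: bcont_max => //; apply: cf_bcont.
Qed.

Lemma cf_eta f : f ∈ cf S -> lam X (fun x => rv (re (f ∙ x))) = f.
Proof.
rewrite in_cf => -[Hf _]; apply: (@fn_ext V T _ _ X (RR R) (RR R)) => //.
  by apply: lam_fn => // x _; exact: rv_in.
by move=> x Hx; rewrite lam_app // rv_re //; apply: fn_app Hf Hx.
Qed.

Lemma fmin_id f : f ∈ cf S -> fmin f f = f.
Proof. by move=> Hf; rewrite -[RHS](cf_eta Hf) /fmin; apply: lam_eq => x _; rewrite minxx. Qed.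

Lemma fmax_id f : f ∈ cf S -> fmax f f = f.
Proof. by move=> Hf; rewrite -[RHS](cf_eta Hf) /fmax; apply: lam_eq => x _; rewrite maxxx. Qed.

Lemma min_closure F : fn F omega (cf S) -> exists G, [/\ fn G omega (cf S),
  forall n, n ∈ omega -> exists k, k ∈ omega /\ G ∙ k = F ∙ n &
  forall n m, n ∈ omega -> m ∈ omega -> exists k, k ∈ omega /\ G ∙ k = fmin (G ∙ n) (G ∙ m)].
Proof.
move=> HF; apply: (operation_closure (W := cf S) (op := fmin)) HF.
- by rewrite /fmin /Order.min; dfn.
- by move=> a b; exact: fmin_cf.
- by move=> a; exact: fmin_id.
Qed.

Lemma max_closure F : fn F omega (cf S) -> exists G, [/\ fn G omega (cf S),
  forall n, n ∈ omega -> exists k, k ∈ omega /\ G ∙ k = F ∙ n &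
  forall n m, n ∈ omega -> m ∈ omega -> exists k, k ∈ omega /\ G ∙ k = fmax (G ∙ n) (G ∙ m)].
Proof.
move=> HF; apply: (operation_closure (W := cf S) (op := fmax)) HF.
- by rewrite /fmax /Order.max; dfn.
- by move=> a b; exact: fmax_cf.
- by move=> a; exact: fmax_id.
Qed.

(** {0 < min f g} is the intersection of {0 < f} and {0 < g}, so closing the family under minima
    closes its base under intersections. *)
Lemma nice_base F : nice_at S F -> exists G W, [/\ nice_at S G, base S W &
  forall n x, n ∈ omega -> x ∈ W ∙ n <-> x ∈ X /\ 0 < re (G ∙ n ∙ x)].
Proof.
move=> [HF HFb]; case: (min_closure HF) => G [HG HGF HGm].
case: (@countable_choice V T (opens S) (fun n w => forall x, x ∈ w <-> x ∈ X /\ 0 < re (G ∙ n ∙ x))) => //.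
  by move=> n Hn; case: (cf_bcont (fn_app HG Hn)) => _ /(_ 0) [].
move=> W [HW HWn]; exists G, W; split.
- split=> // u x Hu Hx; case: (HFb u x Hu Hx) => n [Hn H1 H2].
  by case: (HGF n Hn) => k [Hk E]; exists k; rewrite E.
- split=> // [u x Hu Hx|n m Hn Hm].
    case: (HFb u x Hu Hx) => n [Hn H1 H2]; case: (HGF n Hn) => k [Hk E]; exists k.
    have Hxu := topology_sub Hu Hx.
    split=> //; first by apply/(HWn k Hk); rewrite E.
    by move=> y /(HWn k Hk); rewrite E => -[Hy]; apply: H2.
  case: (HGm n m Hn Hm) => k [Hk E]; exists k; split=> //.
  apply: (ext T) => x; rewrite in_cap (propeq (HWn k Hk x)) (propeq (HWn n Hn x)) (propeq (HWn m Hm x)) E.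
  split=> [[Hx]|[[Hx H1] [_ H2]]]; first by rewrite fmin_app // lt_min => /andP [].
  by rewrite fmin_app // lt_min H1 H2.
by move=> n x Hn; exact: HWn.
Qed.

End Space.

Lemma bcont_comp S S' (h : V -> V) F : definable_term (fun e => h (e 0%N)) ->
  (forall x, x ∈ car S -> h x ∈ car S') ->
  (forall u, u ∈ opens S' -> preim (car S) h u ∈ opens S) -> bcont S' F -> bcont S (fun x => F (h x)).
Proof.
move=> Hh HX Hpre [[b Hb] HF]; split; first by exists b => x Hx; apply: Hb; apply: HX.
move=> t; case: (HF t) => [[u [Hu H1]] [v [Hv H2]]]; split.
  exists (preim (car S) h u); split; first exact: Hpre.
  by move=> x; rewrite in_preim // (propeq (H1 _)); split=> [[Hx []]|[Hx H]] //; do !split=> //; apply: HX.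
exists (preim (car S) h v); split; first exact: Hpre.
by move=> x; rewrite in_preim // (propeq (H2 _)); split=> [[Hx []]|[Hx H]] //; do !split=> //; apply: HX.
Qed.

(** Two functions are allowed for each subbasic set because those of interest are cut out by two
    conditions: the sides of a rectangle, or the ends of an interval for a mean. *)
Lemma nice_generated X B F : B ⊆ pow X -> fn F omega (cf (generated_space X B)) ->
  (forall x, x ∈ X -> exists n, n ∈ omega /\ 0 < re (F ∙ n ∙ x)) ->
  (forall u x, u ∈ B -> x ∈ u -> exists n m, [/\ n ∈ omega, m ∈ omega,
     0 < re (F ∙ n ∙ x) /\ 0 < re (F ∙ m ∙ x) &
     forall y, y ∈ X -> 0 < re (F ∙ n ∙ y) -> 0 < re (F ∙ m ∙ y) -> y ∈ u]) ->
  separated (generated_space X B) -> nice (generated_space X B).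
Proof.
move=> HB HF HX HFB Hsep.
have HS : is_topology (car (generated_space X B)) (opens (generated_space X B)).
  by rewrite car_generated; exact: generated_topology.
split=> //; case: (min_closure HS HF) => G [HG HGF HGm]; exists G; split=> // u x Hu Hx.
rewrite car_generated.
have mG n m y : y ∈ X -> re (fmin (generated_space X B) (G ∙ n) (G ∙ m) ∙ y) =
    Num.min (re (G ∙ n ∙ y)) (re (G ∙ m ∙ y)).
  by move=> Hy; rewrite fmin_app // car_generated.
have : x ∈ X /\ exists n, [/\ n ∈ omega, 0 < re (G ∙ n ∙ x) &
    forall y, y ∈ X -> 0 < re (G ∙ n ∙ y) -> y ∈ u]; last by case.
apply: (@generated_open_ind V T X B (fun u x => x ∈ X /\ exists n, [/\ n ∈ omega, 0 < re (G ∙ n ∙ x) &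
   forall y, y ∈ X -> 0 < re (G ∙ n ∙ y) -> y ∈ u]) u x) => //.
- move=> v y Hv Hy; have Hyx : y ∈ X by have := HB v Hv; rewrite in_pow; apply.
  split=> //; case: (HFB v y Hv Hy) => n [m [Hn Hm [H1 H2] H3]].
  case: (HGF n Hn) => n' [Hn' En]; case: (HGF m Hm) => m' [Hm' Em].
  case: (HGm n' m' Hn' Hm') => k [Hk E]; exists k; rewrite E; split=> //.
    by rewrite mG // lt_min En Em H1 H2.
  by move=> z Hz; rewrite mG // lt_min En Em => /andP [H4 H5]; apply: H3.
- move=> y Hy; split=> //; case: (HX y Hy) => n [Hn H]; case: (HGF n Hn) => n' [Hn' En].
  by exists n'; rewrite En.
- move=> v w y _ _ [Hy [n [Hn H1 H2]]] [_ [m [Hm H3 H4]]]; split=> //.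
  case: (HGm n m Hn Hm) => k [Hk E]; exists k; rewrite E; split=> //.
    by rewrite mG // lt_min H1 H3.
  by move=> z Hz; rewrite mG // lt_min in_cap => /andP [H5 H6]; split; [apply: H2|apply: H4].
- by move=> v w y Hvw _ [Hy [n [Hn H1 H2]]]; split=> //; exists n; split=> // z Hz /(H2 z Hz) /Hvw.
Qed.

End Continuous.

Ltac unfold_nice := rewrite /nice /separated /nice_at /cf /bcont /open_set.

Section Polish.

Context {V : Type} {T : model V}.
#[local] Hint Extern 0 (set_structure _) => exact (model_struct T) : typeclass_instances.
Local Notation R := (model_reals T).
Local Notation K := (real_of T).
Local Notation re := (@re V T).
Local Notation rv := (@rv V T).
Local Notation dK F := (definable_term (fun e => rv (F (e 0%N)))).
Local Notation nice := (@nice V T).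
Local Notation open_set := (@open_set V T).
Local Notation cf := (@cf V T).

Lemma in_metric_opens X d u : (u ∈ metric_opens R X d) =
  (u ⊆ X /\ forall x, x ∈ u -> exists e : K, 0 < e /\ forall y, y ∈ X -> lt R (d ∙ ⟨x, y⟩) (rv e) -> y ∈ u).
Proof.
have -> : (u ∈ metric_opens R X d) = (u ⊆ X /\ forall x, x ∈ u -> exists e, e ∈ RR R /\ lt R (zero R) e /\
   forall y, y ∈ X -> lt R (d ∙ ⟨x, y⟩) e -> y ∈ u).
  apply: (in_compr (pow X)); first by rewrite /sub; dfn.
  by move=> z [H _]; rewrite in_pow.
apply: propeq; split=> -[Hu H]; split=> // x /H.
  move=> [e [He [H0 H']]]; exists (re e); rewrite rv_lt rv_re // rv_zero; split=> //.
move=> [e [He H']]; exists (rv e); rewrite -rv_zero -rv_lt; split; [exact: rv_in|by []].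
Qed.

(** For p in the dense set and k ∈ omega, the function max(0, 3^-k - d(p, x)) is positive exactly on
    the ball of radius 3^-k about p. *)
Lemma polish_nice S : polish R S -> nice S.
Proof.
move=> [_ [[D [[g [Hg Hginj]] [HDX Hdense]]] [d [[Hd [Hd0 [Hdsym Hdtri]]] [Hop _]]]]].
move: Hop; set X := car S in HDX Hd Hd0 Hdsym Hdtri *; move=> Hop.
pose (r (x y : V) := re (d ∙ ⟨x, y⟩)).
have rE x y : x ∈ X -> y ∈ X -> d ∙ ⟨x, y⟩ = rv (r x y).
  by move=> Hx Hy; rewrite /r rv_re //; apply: (fn_app Hd); rewrite pair_in_prod.
have Hr : definable_term (fun e => rv (r (e 0%N) (e 1%N))) by rewrite /r; dfn.
have r0 x : x ∈ X -> r x x = 0.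
  by move=> Hx; apply: rv_inj; rewrite -rE // rv_zero; apply/(Hd0 x x Hx Hx).
have r_eq x y : x ∈ X -> y ∈ X -> r x y = 0 -> x = y.
  by move=> Hx Hy E; apply/(Hd0 x y Hx Hy); rewrite rE // E rv_zero.
have rsym x y : x ∈ X -> y ∈ X -> r x y = r y x.
  by move=> Hx Hy; apply: rv_inj; rewrite -!rE //; apply: Hdsym.
have rtri x y z : x ∈ X -> y ∈ X -> z ∈ X -> r x z <= r x y + r y z.
  by move=> Hx Hy Hz; rewrite rv_le rv_plus -!rE //; apply: Hdtri.
have r_ge0 x y : x ∈ X -> y ∈ X -> 0 <= r x y.
  by move=> Hx Hy; have := rtri x y x Hx Hy Hx; rewrite r0 // (rsym y x) //; lra.
have inop u : (u ∈ opens S) = (u ⊆ X /\ forall x, x ∈ u -> exists e : K, 0 < e /\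
    forall y, y ∈ X -> r x y < e -> y ∈ u).
  rewrite Hop in_metric_opens; apply: propeq; split=> -[Hu H]; split=> // x Hx;
    case: (H x Hx) => e [He Hy]; exists e; split=> // y Hyx Hr'; apply: Hy => //.
    by rewrite rE // -?rv_lt //; apply: Hu.
  by move: Hr'; rewrite rE // -?rv_lt //; apply: Hu.
have HS : is_topology X (opens S).
  split; first by move=> u; rewrite inop in_pow => -[].
  split; first by rewrite inop; split=> x; rewrite in_emp.
  split; first by rewrite inop; split=> // x Hx; exists 1; rewrite ltr01.
  split=> [u v|U HU]; rewrite !inop.
    move=> [Hu Hu'] [Hv Hv']; split; first by move=> x; rewrite in_cap => -[/Hu].
    move=> x; rewrite in_cap => -[Hxu Hxv]; case: (Hu' x Hxu) => e [He H1]; case: (Hv' x Hxv) => f [Hf H2].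
    exists (Num.min e f); rewrite lt_min He Hf; split=> // y Hy; rewrite lt_min in_cap => /andP [H3 H4].
    by split; [apply: H1|apply: H2].
  split.
    by move=> x; rewrite in_union => -[b [/HU]]; rewrite inop => -[Hb _] /Hb.
  move=> x; rewrite in_union => -[b [Hb Hx]]; have := HU b Hb; rewrite inop => -[_ /(_ x Hx) [e [He H]]].
  by exists e; split=> // y Hy Hxy; rewrite in_union; exists b; split=> //; apply: H.
have ball p (t : K) : p ∈ X -> open_set S (fun x => r p x < t).
  move=> Hp; apply: (open_local HS); first by dfn.
  move=> x Hx Hpx; separate X (fun y => r p y < t) as B inB.
  exists B; split; [|by rewrite inB|by move=> y; rewrite inB => -[]].
  rewrite inop; split; first by move=> y; rewrite inB => -[].
  move=> y; rewrite inB => -[Hy Hpy]; exists (t - r p y); split; first by lra.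
  by move=> z Hz Hyz; rewrite inB; split=> //; have := rtri p y z Hp Hy Hz; lra.
have coball p (t : K) : p ∈ X -> open_set S (fun x => t < r p x).
  move=> Hp; apply: (open_local HS); first by dfn.
  move=> x Hx Hpx; separate X (fun y => t < r p y) as B inB.
  exists B; split; [|by rewrite inB|by move=> y; rewrite inB => -[]].
  rewrite inop; split; first by move=> y; rewrite inB => -[].
  move=> y; rewrite inB => -[Hy Hpy]; exists (r p y - t); split; first by lra.
  by move=> z Hz Hyz; rewrite inB; split=> //; have := rtri p z y Hp Hz Hy; rewrite (rsym z y) //; lra.
split=> //.
  move=> x y Hx Hy H; apply: r_eq => //; apply/eqP; rewrite eq_le r_ge0 // andbT.
  apply: real_le_eps => n Hn; rewrite add0r; apply: ltW; have Hp := p3_gt0 Hn (T := T).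
  case: (ball x (p3 n) Hx) => u [Hu Hux].
  have : x ∈ u by apply/Hux; rewrite r0.
  by move/(H u Hu)/Hux => [].
case: (@countable_choice2 V T (cf S) (fun n k f => forall p x, p ∈ D -> g ∙ p = n -> x ∈ X ->
   re (f ∙ x) = if 0 < p3 k - r p x then p3 k - r p x else 0)).
- by dfn.
- move=> n k Hn Hk; case: (classic (exists p, p ∈ D /\ g ∙ p = n)) => [[p [Hp Ep]]|Hno]; last first.
    (* An index that codes no point of the dense set receives the zero function. *)
    exists (lam X (fun=> rv 0)); split; last by move=> p x Hp Ep; case: Hno; exists p.
    by apply: (@cf_lam V T S (fun=> 0)) => //; apply: bcont_const.
  have HpX : p ∈ X by apply: HDX.
  have Hdf : dK (fun x => if 0 < p3 k - r p x then p3 k - r p x else 0) by dfn.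
  exists (lam X (fun x => rv (if 0 < p3 k - r p x then p3 k - r p x else 0))); split; last first.
    move=> q x Hq Eq Hx; rewrite lam_app // re_rv.
    by rewrite (Hginj q p) // Ep Eq.
  apply: cf_lam => //.
  apply: (@bcont_ext V T S (fun x => Num.max 0 ((fun x => - r p x) x - (- p3 k)))).
    by move=> x Hx; rewrite /Order.max opprK addrC.
  apply: (@bcont_pos V T S HS _ _ 0); first by move=> x Hx; rewrite oppr_le0 r_ge0.
  move=> t; split.
    by apply: open_set_ext (ball p (- t) HpX) => x Hx; rewrite ltrNr.
  by apply: open_set_ext (coball p (- t) HpX) => x Hx; rewrite ltrNl.
move=> F [HF HFn]; exists F; split=> // u x; rewrite inop => -[Hu Hu'] Hx.
case: (Hu' x Hx) => e [He Hball]; have HxX := Hu x Hx.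
case: (@p3_small V T (e / 2)) => [|k [Hk Hke]]; first by lra.
have Hpk := p3_gt0 Hk (T := T).
case: (ball x (p3 k) HxX) => b [Hb Hbx].
case: (Hdense b Hb) => [|p [Hpb HpD]]; first by exists x; apply/Hbx; rewrite r0.
move/Hbx: Hpb => [HpX Hxp].
have Hgp : g ∙ p ∈ omega by apply: fn_app Hg HpD.
case: (HFn (g ∙ p) k Hgp Hk) => n [Hn Hnp]; exists n; split=> //.
  rewrite (Hnp p x) // (rsym p x) //; have -> : 0 < p3 k - r x p by lra.
  lra.
move=> y Hy; rewrite (Hnp p y) //; case: ifP => [H _|_]; last by rewrite ltxx.
by apply: Hball => //; have := rtri x p y HxX HpX Hy; lra.
Qed.

End Polish.

(** * Products of spaces *)

Section Products.

Context {V : Type} {T : model V}.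
#[local] Hint Extern 0 (set_structure _) => exact (model_struct T) : typeclass_instances.
Variables S S' : V.
Hypotheses (HS : is_topology (car S) (opens S)) (HS' : is_topology (car S') (opens S')).
Local Notation X := (car S).
Local Notation X' := (car S').
Local Notation P := (prod_space S S').

Definition rectangles : V := ⟦ w | exists u v, u ∈ opens S /\ v ∈ opens S' /\ w = Defs.prod u v ⟧.

Lemma prod_spaceE : P = generated_space (Defs.prod X X') rectangles. Proof. by []. Qed.

Lemma in_rectangles w : (w ∈ rectangles) = (exists u v, u ∈ opens S /\ v ∈ opens S' /\ w = Defs.prod u v).
Proof.
apply: (in_compr (pow (Defs.prod X X'))); first by dfn.
move=> z [u [v [Hu [Hv ->]]]]; rewrite in_pow => y; rewrite !in_prod => -[a [b [H1 [H2 ->]]]]; exists a, b.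
by split; [exact: (topology_sub HS Hu H1)|split=> //; exact: (topology_sub HS' Hv H2)].
Qed.

Lemma rectangles_sub : rectangles ⊆ pow (Defs.prod X X').
Proof.
move=> w; rewrite in_rectangles => -[u [v [Hu [Hv ->]]]]; rewrite in_pow => y; rewrite !in_prod => -[a [b [H1 [H2 ->]]]]; exists a, b.
by split; [exact: (topology_sub HS Hu H1)|split=> //; exact: (topology_sub HS' Hv H2)].
Qed.

Arguments rectangles_sub : clear implicits.

Lemma car_prod : car P = Defs.prod X X'. Proof. exact: car_generated. Qed.

Lemma prod_topology : is_topology (car P) (opens P).
Proof. by rewrite car_prod; exact: generated_topology. Qed.

Lemma rectangle_open u v : u ∈ opens S -> v ∈ opens S' -> Defs.prod u v ∈ opens P.
Proof. by move=> Hu Hv; apply: generated_sub; [apply rectangles_sub|rewrite in_rectangles; exists u, v]. Qed.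

Lemma pi1_car z : z ∈ car P -> pi1 z ∈ X. Proof. by rewrite car_prod => /prodP []. Qed.
Lemma pi2_car z : z ∈ car P -> pi2 z ∈ X'. Proof. by rewrite car_prod => /prodP []. Qed.

Lemma preim_pi1 a : a ⊆ X -> preim (car P) pi1 a = Defs.prod a X'.
Proof.
move=> Ha; apply: (ext T) => z; rewrite in_preim // car_prod; split.
  by rewrite !in_prod => -[[x [y [H1 [H2 ->]]]]]; rewrite pi1_pair => H3; exists x, y.
rewrite !in_prod => -[x [y [H1 [H2 ->]]]]; rewrite pi1_pair; split=> //.
by exists x, y; split=> //; apply: Ha.
Qed.

Lemma preim_pi2 a : a ⊆ X' -> preim (car P) pi2 a = Defs.prod X a.
Proof.
move=> Ha; apply: (ext T) => z; rewrite in_preim // car_prod; split.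
  by rewrite !in_prod => -[[x [y [H1 [H2 ->]]]]]; rewrite pi2_pair => H3; exists x, y.
rewrite !in_prod => -[x [y [H1 [H2 ->]]]]; rewrite pi2_pair; split=> //.
by exists x, y; do 2!split=> //; apply: Ha.
Qed.

Lemma preim_pi1_open u : u ∈ opens S -> preim (car P) pi1 u ∈ opens P.
Proof.
move=> Hu; rewrite preim_pi1; first by apply: rectangle_open => //; exact: topology_total.
by move=> x; apply: topology_sub.
Qed.

Lemma preim_pi2_open u : u ∈ opens S' -> preim (car P) pi2 u ∈ opens P.
Proof.
move=> Hu; rewrite preim_pi2; first by apply: rectangle_open => //; exact: topology_total.
by move=> x; apply: topology_sub.
Qed.

Lemma prod_separated : separated S -> separated S' -> separated P.
Proof.
move=> Hs Hs' x y Hx Hy H; move: (Hx) (Hy); rewrite !car_prod => /prodP [Ex _ _] /prodP [Ey _ _].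
rewrite Ex Ey; have -> : pi1 x = pi1 y.
  apply: Hs; [exact: pi1_car Hx|exact: pi1_car Hy|move=> u Hu].
  have := H _ (preim_pi1_open Hu); rewrite !in_preim //; tauto.
have -> : pi2 x = pi2 y; last by [].
apply: Hs'; [exact: pi2_car Hx|exact: pi2_car Hy|move=> u Hu].
 have := H _ (preim_pi2_open Hu); rewrite !in_preim //; tauto.
Qed.

End Products.

Section NiceProducts.

Context {V : Type} {T : model V}.
#[local] Hint Extern 0 (set_structure _) => exact (model_struct T) : typeclass_instances.
Local Notation re := (@re V T).
Local Notation rv := (@rv V T).
Local Notation nice := (@nice V T).
Local Notation cf := (@cf V T).

(** The functions are those of the two factors composed with the projections; the first index of A
    tells which factor is meant. *)
Lemma nice_prod S S' : nice S -> nice S' -> nice (prod_space S S').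
Proof.
move=> [HS Hsep [F [HF HFb]]] [HS' Hsep' [F' [HF' HFb']]].
have HP := @prod_topology V T S S'; set P := prod_space S S' in HP *.
pose (A (n m : V) := ite (n = emp) (lam (car P) (fun z : V => rv (re (F ∙ m ∙ pi1 z))))
   (lam (car P) (fun z : V => rv (re (F' ∙ m ∙ pi2 z))))).
have HA0 m : A emp m = lam (car P) (fun z : V => rv (re (F ∙ m ∙ pi1 z))) by rewrite /A ite_true.
have HA1 m : A (succ emp) m = lam (car P) (fun z : V => rv (re (F' ∙ m ∙ pi2 z))).
  by rewrite /A ite_false //; exact: succ_not_emp.
have C0 m : m ∈ omega -> lam (car P) (fun z => rv (re (F ∙ m ∙ pi1 z))) ∈ cf P.
  move=> Hm; apply: (@cf_lam V T P (fun z => re (F ∙ m ∙ pi1 z))); first by dfn.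
  apply: (@bcont_comp V T P S pi1 (fun x => re (F ∙ m ∙ x))) => //.
  - by move=> z; exact: pi1_car.
  - by move=> u; exact: preim_pi1_open.
  - by apply: cf_bcont; apply: fn_app HF Hm.
have C1 m : m ∈ omega -> lam (car P) (fun z => rv (re (F' ∙ m ∙ pi2 z))) ∈ cf P.
  move=> Hm; apply: (@cf_lam V T P (fun z => re (F' ∙ m ∙ pi2 z))); first by dfn.
  apply: (@bcont_comp V T P S' pi2 (fun x => re (F' ∙ m ∙ x))) => //.
  - by move=> z; exact: pi2_car.
  - by move=> u; exact: preim_pi2_open.
  - by apply: cf_bcont; apply: fn_app HF' Hm.
case: (@enumerate2 V T (cf P) A).
- by rewrite /A; dfn.
- move=> n m Hn Hm; rewrite /A; case: (classic (n = emp)) => E; first by rewrite ite_true //; exact: C0.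
  by rewrite ite_false //; exact: C1.
move=> G [HG HGA].
have G0 m : m ∈ omega -> exists k, k ∈ omega /\ forall z, z ∈ car P -> re (G ∙ k ∙ z) = re (F ∙ m ∙ pi1 z).
  move=> Hm; case: (HGA emp m emp_omega Hm) => k [Hk E]; exists k; split=> // z Hz.
  by rewrite E HA0 lam_app // re_rv.
have G1 m : m ∈ omega -> exists k, k ∈ omega /\ forall z, z ∈ car P -> re (G ∙ k ∙ z) = re (F' ∙ m ∙ pi2 z).
  move=> Hm; case: (HGA (succ emp) m (succ_omega emp_omega) Hm) => k [Hk E]; exists k; split=> // z Hz.
  by rewrite E HA1 lam_app // re_rv.
rewrite /P prod_spaceE; apply: (nice_generated (F := G)).
- exact: (@rectangles_sub V T S S' HS HS').
- by rewrite -prod_spaceE.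
- rewrite -car_prod => z Hz.
  case: (HFb _ (pi1 z) (topology_total HS)) => [|n [Hn H1 _]]; first exact: pi1_car Hz.
  by case: (G0 n Hn) => k [Hk E]; exists k; rewrite E.
- move=> w z; rewrite in_rectangles // => -[u [v [Hu [Hv ->]]]] Hz.
  have HzP : z ∈ car P.
    by apply: topology_sub (rectangle_open HS HS' Hu Hv) Hz.
  case/prodP: (Hz) => Ez H1 H2.
  case: (HFb u _ Hu H1) => n [Hn Hn1 Hn2]; case: (HFb' v _ Hv H2) => m [Hm Hm1 Hm2].
  case: (G0 n Hn) => k [Hk Ek]; case: (G1 m Hm) => l [Hl El]; exists k, l.
  split=> //; first by rewrite Ek // El.
  rewrite -car_prod => y Hy; rewrite Ek // El // => H3 H4.
  have := Hy; rewrite car_prod => /prodP [Ey H5 H6]; rewrite Ey pair_in_prod.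
  by split; [apply: Hn2|apply: Hm2].
- by rewrite -prod_spaceE; exact: prod_separated.
Qed.

End NiceProducts.

(** * Comparison of the two integrals *)

Section Mean.

Context {V : Type} {T : model V}.
#[local] Hint Extern 0 (set_structure _) => exact (model_struct T) : typeclass_instances.
Local Notation R := (model_reals T).
Local Notation K := (real_of T).
Local Notation re := (@re V T).
Local Notation rv := (@rv V T).
Variables S mu : V.
Hypothesis Hmu : mu ∈ Prob R S.
Local Notation X := (car S).
Local Notation C := (completion R S mu).
Local Notation cm := (fun a => re (measure R S mu a)).

Let Hm : is_measure X C cm := completion_measure Hmu.

Definition mean_is (F : V -> K) (r : K) : Prop := has_integral X C cm F r.

Lemma measure_rv a : a ∈ C -> measure R S mu a = rv (cm a).
Proof.
move=> Ha; rewrite {1}/measure; apply: theP; first by apply/(measure_isP Hmu).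
by move=> y /(measure_isP Hmu) [_ ->].
Qed.

(** A simple function within 3^-i of F becomes a lower one when 3^-i is subtracted from its values,
    so r is the supremum of the lower sums. *)
Lemma integral_value (F : V -> V) (r : K) : definable_term (fun e => F (e 0%N)) ->
  (forall x, x ∈ X -> F x ∈ RR R) -> mean_is (fun x => re (F x)) r -> integral R S mu F = rv r.
Proof.
move=> HF HFR Hr.
have meas_in a : (a ∈ C) = measurable R S mu a.
  apply: (in_compr (pow X)); first by rewrite /measurable; dfn.
  by move=> z [q [H _]]; rewrite in_pow.
pose (L (q : V) := exists n a c, @simple V T X C n a c /\
  (forall k x, k ∈ n -> x ∈ a ∙ k -> re (c ∙ k) <= re (F x)) /\ q = rv (simple_sum cm n a c)).
assert (HL : forall q, (exists n a c : V,
    n ∈ omega /\ fn a n (pow X) /\ fn c n (RR R) /\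
    (forall k, k ∈ n -> measurable R S mu (a ∙ k)) /\
    (forall k l, k ∈ n -> l ∈ n -> k <> l -> disjoint (a ∙ k) (a ∙ l)) /\
    (forall x, x ∈ X -> exists k, k ∈ n /\ x ∈ a ∙ k) /\
    (forall k x, k ∈ n -> x ∈ a ∙ k -> le R (c ∙ k) (F x)) /\
    q = sum R n (fun k => times R (c ∙ k) (measure R S mu (a ∙ k)))) <-> L q).
  move=> q.
  have Hsum n a c : n ∈ omega -> fn c n (RR R) -> (forall k, k ∈ n -> a ∙ k ∈ C) ->
      sum R n (fun k => times R (c ∙ k) (measure R S mu (a ∙ k))) = rv (simple_sum cm n a c).
    move=> Hn Hc Ha.
    have E k : k ∈ n -> times R (c ∙ k) (measure R S mu (a ∙ k)) = rv (re (c ∙ k) * cm (a ∙ k)).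
      by move=> Hk; rewrite rv_times rv_re; [rewrite -measure_rv //; apply: Ha|exact: fn_app Hc Hk].
    rewrite sum_ksum //; first congr rv; last by move=> k Hk; rewrite E //; exact: rv_in.
    by apply: ksum_ext => // k Hk; rewrite E // re_rv.
  split=> [[n [a [c [Hn [Ha [Hc [Hma [Hdis [Hcov [Hle ->]]]]]]]]]]|[n [a [c [[Hn Ha Hc [Hdis Hcov]] [Hle ->]]]]]].
    have HaC k : k ∈ n -> a ∙ k ∈ C by move=> /Hma; rewrite meas_in.
    exists n, a, c; split; last split; last exact: Hsum.
      by split=> //; apply: fn_sub Ha _.
    move=> k x Hk Hx; rewrite rv_le !rv_re; [exact: (Hle k x Hk Hx)| |exact: fn_app Hc Hk].
    by apply: HFR; have := fn_app Ha Hk; rewrite in_pow; apply.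
  have HaC k : k ∈ n -> a ∙ k ∈ C by apply: fn_app Ha.
  exists n, a, c; split=> //; split; first by apply: fn_cod Ha _; case: (completion_sigma Hmu).
  split=> //; split; first by move=> k /HaC; rewrite meas_in.
  do 2!split=> //; split; last by rewrite Hsum.
  move=> k x Hk Hx; have := Hle k x Hk Hx; rewrite rv_le !rv_re //; last exact: fn_app Hc Hk.
  by apply: HFR; apply: (sigma_sub (completion_sigma Hmu) (HaC k Hk)).
have Hlub : is_lub R L (rv r).
  split; first exact: rv_in.
  split=> [q [n [a [c [Hs [Hle ->]]]]]|u Hu Hub].
    rewrite -rv_le; apply: (@real_le_eps_mul _ _ _ _ 2); first by lra.
    move=> i Hi; case: (Hr i Hi) => N [a' [c' [Hs' Hc' /andP [H1 H2]]]].
    have := lower_sum_le Hm (F := fun x => re (F x)) (n := i) Hs Hs' Hle.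
    have Hc'' : forall k x, k ∈ N -> x ∈ a' ∙ k -> re (F x) <= re (c' ∙ k) + p3 i.
      by move=> k x Hk Hx; case/andP: (Hc' k x Hk Hx).
    by move=> /(_ Hc''); move: (simple_sum _ _ _ _) (simple_sum _ _ _ _) (p3 i) H1 H2 => *; lra.
  rewrite -(rv_re Hu) -rv_le; apply: (@real_le_eps_mul _ _ _ _ 2); first by lra.
  move=> i Hi; case: (Hr i Hi) => N [a' [c' [Hs' Hc' /andP [H1 H2]]]].
  case: (@simple_map V T X C N a' c' (fun x => x - p3 i)) => // Hs'' Hk''.
  have Hlow : L (rv (simple_sum cm N a' (lam N (fun k => rv (re (c' ∙ k) - p3 i))))).
    exists N, a', (lam N (fun k => rv (re (c' ∙ k) - p3 i))); do 2!split=> //.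
    by move=> k x Hk Hx; rewrite Hk'' //; case/andP: (Hc' k x Hk Hx).
  have := Hub _ Hlow; rewrite (simple_sum_shift Hm) // -(rv_re Hu) -rv_le re_rv.
  by move: (simple_sum _ _ _ _) (p3 i) H1 H2 => *; lra.
rewrite /integral (funeq (fun q => propeq (HL q))); apply: theP => // y [Hy [Hy1 Hy2]].
case: Hlub => H0 [H1 H2]; apply: (le_antisym (model_field T)); [exact: Hy2|exact: H2].
Qed.

End Mean.

(** * The weak topology *)

Section Delta.

Context {V : Type} {T : model V}.
#[local] Hint Extern 0 (set_structure _) => exact (model_struct T) : typeclass_instances.
Local Notation R := (model_reals T).
Local Notation K := (real_of T).
Local Notation re := (@re V T).
Local Notation rv := (@rv V T).
Local Notation dK F := (definable_term (fun e => rv (F (e 0%N)))).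
Local Notation open_set := (@open_set V T).
Local Notation cf := (@cf V T).

Lemma in_weak S w : (w ∈ ⟦ w | exists f u, bounded_continuous R S f /\ u ∈ opens (real_space R) /\
    w = preim (Prob R S) (fun mu => integral R S mu (app f)) u ⟧) =
  (exists f u, bounded_continuous R S f /\ u ∈ opens (real_space R) /\
    w = preim (Prob R S) (fun mu => integral R S mu (app f)) u).
Proof.
apply: (in_compr (pow (Prob R S))); first by dfn.
move=> z [f [u [_ [_ ->]]]]; rewrite in_pow => mu; rewrite in_preim; last by dfn.
by case.
Qed.

Lemma weak_sub S : ⟦ w | exists f u, bounded_continuous R S f /\ u ∈ opens (real_space R) /\
    w = preim (Prob R S) (fun mu => integral R S mu (app f)) u ⟧ ⊆ pow (Prob R S).
Proof.
move=> w; rewrite in_weak => -[f [u [_ [_ ->]]]]; rewrite in_pow => mu; rewrite in_preim; last by dfn.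
by case.
Qed.

Lemma car_Delta S : car (Delta R S) = Prob R S. Proof. exact: car_generated. Qed.

Lemma Delta_topology S : is_topology (car (Delta R S)) (opens (Delta R S)).
Proof. by rewrite car_Delta; exact: generated_topology. Qed.

(** [bcont] without the condition on the sign: the weak topology refers to all bounded continuous
    functions. *)
Definition rays S (F : V -> K) : Prop :=
  (exists b : K, forall x, x ∈ car S -> - b <= F x <= b) /\
  forall t : K, open_set S (fun x => t < F x) /\ open_set S (fun x => F x < t).

Lemma bounded_continuous_rays S f : bounded_continuous R S f -> rays S (fun x => re (f ∙ x)).
Proof.
move=> [Hf [[c [Hc Hb]] Hcont]].
have Hbd x : x ∈ car S -> - re c <= re (f ∙ x) <= re c.
  move=> Hx; have Hfx := fn_app Hf Hx; have [H1 H2] := Hb x Hx.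
  by apply/andP; rewrite !rv_le rv_opp !rv_re.
split; first by exists (re c).
have Hint (a b : K) : open_set S (fun x => a < re (f ∙ x) < b).
  exists (preim (car S) (app f) (open_interval R (rv a) (rv b))); split.
    by apply: Hcont; exact: interval_open.
  move=> x; rewrite in_preim; last by dfn.
  by split=> -[Hx]; rewrite -in_interval rv_re; [| exact: fn_app Hf Hx| |exact: fn_app Hf Hx].
move=> t; split.
  apply: open_set_ext (Hint t (re c + 1)) => x Hx; have := Hbd x Hx.
  by split=> [/andP []//|->]; lra.
apply: open_set_ext (Hint (- re c - 1) t) => x Hx; have := Hbd x Hx.
by split=> [/andP []//|->]; rewrite andbT; lra.
Qed.

Lemma cf_rays S f : f ∈ cf S -> rays S (fun x => re (f ∙ x)).
Proof.
rewrite in_cf => -[_ [[b Hb] H]]; split=> //; exists b => x /Hb; lra.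
Qed.

Section Nice.

Variable S : V.
Hypothesis HS : is_topology (car S) (opens S).
Local Notation X := (car S).
Local Notation C mu := (completion R S mu).
Local Notation mean_is := (@mean_is V T S).

Lemma cf_bounded_continuous f : f ∈ cf S -> bounded_continuous R S f.
Proof.
move=> Hf; have [[b Hb] Hrays] := cf_rays Hf; move: Hf; rewrite in_cf => -[Hf _]; split=> //; split.
  exists (rv b); split; first exact: rv_in.
  move=> x Hx; have /andP [H1 H2] := Hb x Hx; have Hfx := fn_app Hf Hx.
  by rewrite -rv_opp -(rv_re Hfx) -!rv_le.
move=> u Hu.
have : open_set S (fun x => f ∙ x ∈ u).
  apply: (open_local HS) => // x Hx Hxu; have Hfx := fn_app Hf Hx; rewrite -(rv_re Hfx) in Hxu.
  case: (open_real Hu Hxu) => a [c [/andP [Ha Hc] Hac]].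
  case: (open_set_and HS (proj1 (Hrays a)) (proj2 (Hrays c))) => w [Hw Hwx]; exists w; split=> //.
    by apply/Hwx.
  move=> y /Hwx [Hy [H1 H2]]; rewrite -(rv_re (fn_app Hf Hy)); apply: Hac.
  by rewrite H1.
move=> [w [Hw Hwx]]; have -> : preim X (app f) u = w; last by [].
by apply: (ext T) => x; rewrite in_preim //; rewrite (propeq (Hwx x)).
Qed.

Lemma open_measurable mu (P : V -> Prop) : mu ∈ Prob R S -> open_set S P ->
  exists a, a ∈ C mu /\ forall x, x ∈ a <-> x ∈ X /\ P x.
Proof.
move=> Hmu [u [Hu H]]; exists u; split=> //.
have : u ∈ borel S by apply: open_borel => //; case: HS.
by move/(completion_borel Hmu) => [].
Qed.

Lemma mean_exists mu F : mu ∈ Prob R S -> dK F -> rays S F -> exists r, mean_is mu F r.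
Proof.
move=> Hmu HF [[b Hb] Hrays].
apply: (integral_exists (completion_measure Hmu) HF (b := b)) => //.
by move=> t; apply: open_measurable => //; case: (Hrays t).
Qed.

Definition mean (f mu : V) : K := re (integral R S mu (app f)).

Lemma mean_value mu f : mu ∈ Prob R S -> fn f X (RR R) -> rays S (fun x => re (f ∙ x)) ->
  mean_is mu (fun x => re (f ∙ x)) (mean f mu) /\ integral R S mu (app f) = rv (mean f mu).
Proof.
move=> Hmu Hf Hr; case: (mean_exists Hmu _ Hr) => [|r Hr']; first by dfn.
have E : integral R S mu (app f) = rv r.
  by apply: (integral_value Hmu) => // x Hx; apply: fn_app Hf Hx.
by rewrite /mean E re_rv.
Qed.

Lemma cf_mean mu f : mu ∈ Prob R S -> f ∈ cf S ->
  mean_is mu (fun x => re (f ∙ x)) (mean f mu) /\ integral R S mu (app f) = rv (mean f mu).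
Proof.
move=> Hmu Hf; apply: mean_value => //; first by move: Hf; rewrite in_cf => -[].
exact: cf_rays.
Qed.

Lemma mean_bounds mu F r (a b : K) : mu ∈ Prob R S -> mean_is mu F r ->
  (forall x, x ∈ X -> a <= F x <= b) -> a <= r <= b.
Proof.
move=> Hmu Hr Hab; have Hm := completion_measure Hmu.
have H1 := integral_le Hm (e := 0) (integral_const Hm a) Hr.
have H2 := integral_le Hm (e := 0) Hr (integral_const Hm b).
rewrite !addr0 in H1 H2; apply/andP; split.
  by apply: H1 => x /Hab /andP []; rewrite addr0.
by apply: H2 => x /Hab /andP [].
Qed.

(** The means of f lie in [0, b], so an interval ending at b + 1 or starting at -1 acts as a ray. *)
Lemma mean_ray f (t : K) : f ∈ cf S -> open_set (Delta R S) (fun mu => t < mean f mu) /\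
  open_set (Delta R S) (fun mu => mean f mu < t).
Proof.
move=> Hf; have Hbc := cf_bounded_continuous Hf.
have [b Hb] : exists b : K, forall x, x ∈ X -> 0 <= re (f ∙ x) <= b.
  by move: Hf; rewrite in_cf => -[_ []].
have Hmb mu : mu ∈ Prob R S -> 0 <= mean f mu <= b.
  by move=> Hmu; case: (cf_mean Hmu Hf) => H _; apply: mean_bounds H Hb.
have Hint (a c : K) : open_set (Delta R S) (fun mu => a < mean f mu < c).
  exists (preim (Prob R S) (fun mu => integral R S mu (app f)) (open_interval R (rv a) (rv c))); split.
    apply: generated_sub; first by move=> w; exact: weak_sub.
    by rewrite in_weak; exists f, (open_interval R (rv a) (rv c)); do 2!split=> //; exact: interval_open.
  move=> mu; rewrite car_Delta in_preim; last by dfn.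
  by split=> -[Hmu]; case: (cf_mean Hmu Hf) => _ ->; rewrite in_interval.
have HD := Delta_topology S; split.
  apply: open_set_ext (Hint t (b + 1)) => mu; rewrite car_Delta => /Hmb.
  by move: (mean f mu) => z; split=> [/andP []//|->]; lra.
apply: open_set_ext (Hint (- 1) t) => mu; rewrite car_Delta => /Hmb.
by move: (mean f mu) => z; split=> [/andP []//|->]; rewrite andbT; lra.
Qed.

End Nice.

End Delta.

Ltac unfold_mean := unfold mean.

Section NiceDelta.

Context {V : Type} {T : model V}.
#[local] Hint Extern 0 (set_structure _) => exact (model_struct T) : typeclass_instances.
Local Notation R := (model_reals T).
Local Notation K := (real_of T).
Local Notation re := (@re V T).
Local Notation rv := (@rv V T).
Local Notation dK F := (definable_term (fun e => rv (F (e 0%N)))).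
Local Notation nice := (@nice V T).
Local Notation open_set := (@open_set V T).
Local Notation cf := (@cf V T).
Variable S : V.
Hypothesis HN : nice S.
Local Notation X := (car S).
Local Notation C mu := (completion R S mu).
Local Notation mean_is := (@mean_is V T S).
Local Notation mean := (@mean V T S).
Local Notation fmax := (@fmax V T).

Let HS : is_topology X (opens S). Proof. by case: HN. Qed.

Definition lsc (F : V -> K) : Prop := forall t : K, open_set S (fun x => t < F x).

(* Bounded continuous functions being lower semicontinuous, the weak topology
   is generated by the sets where the mean of a member of G exceeds a rational. *)
Definition determining (G : V) : Prop := fn G omega (cf S) /\
  forall F (b a s : K) mu, dK F -> lsc F -> (forall x, x ∈ X -> 0 <= F x <= b) ->
    mu ∈ Prob R S -> mean_is mu F s -> a < s ->
    exists n, [/\ n ∈ omega, forall x, x ∈ X -> re (G ∙ n ∙ x) <= F x & a < mean (G ∙ n) mu].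

(** The candidates are the functions min(q, k F_n), where q is the positive part of an enumerated
    rational; as k grows they increase to q on {0 < F_n} and vanish elsewhere. G consists of their
    finite maxima. Lower semicontinuity brings the candidates below f arbitrarily close to f at each
    point; if all their maxima had mean at most a, monotone convergence would give s ≤ a. *)
Lemma determining_exists : exists G, determining G.
Proof.
case: HN => _ _ [F [HF HFb]].
pose (g (n k m : V) := lam X (fun x => rv (Num.min (Num.max 0 (rational m)) (kn k * re (F ∙ n ∙ x))) : V)).
have Hg2 : definable_term (fun e => g (e 0%N) (pi1 (unpair ∙ e 1%N)) (pi2 (unpair ∙ e 1%N))).
  by rewrite /g /Order.min /Order.max; dfn.
have Hgd n k m : dK (fun x => Num.min (Num.max 0 (rational m)) (kn k * re (F ∙ n ∙ x))).
  by rewrite /Order.min /Order.max; dfn.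
have gE n k m x : x ∈ X -> re (g n k m ∙ x) = Num.min (Num.max 0 (rational m)) (kn k * re (F ∙ n ∙ x)).
  by move=> Hx; rewrite /g lam_app // re_rv.
have gcf n k m : n ∈ omega -> k ∈ omega -> g n k m ∈ cf S.
  move=> Hn Hk; apply: (@cf_lam V T S (fun x => Num.min (Num.max 0 (rational m)) (kn k * re (F ∙ n ∙ x)))) => //.
  apply: bcont_min => //.
    by apply: bcont_const => //; rewrite le_max lexx.
  by apply: bcont_scale => //; [exact: kn_ge0|apply: cf_bcont; apply: fn_app HF Hn].
clearbody g; clear Hgd.
case: (@enumerate2 V T (cf S) (fun n p => g n (pi1 (unpair ∙ p)) (pi2 (unpair ∙ p)))).
- exact: Hg2.
- by move=> n p Hn Hp; apply: gcf => //; case: (unpair_pi Hp).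
move=> G0 [HG0 HG0g]; case: (max_closure HS HG0) => G [HG HGG HGm].
have Gg n k m : n ∈ omega -> k ∈ omega -> m ∈ omega -> exists j, j ∈ omega /\ G ∙ j = g n k m.
  move=> Hn Hk Hm; case: (unpair_surj Hk Hm) => p [Hp Ep].
  case: (HG0g n p Hn Hp) => i [Hi Ei]; case: (HGG i Hi) => j [Hj Ej]; exists j.
  by split=> //; rewrite Ej Ei Ep pi1_pair pi2_pair.
exists G; split=> // f b a s mu Hf Hlsc Hfb Hmu Hs Has.
have Hm := completion_measure Hmu.
apply: NNPP => Hno.
have Hle n : n ∈ omega -> (forall x, x ∈ X -> re (G ∙ n ∙ x) <= f x) -> mean (G ∙ n) mu <= a.
  by move=> Hn H; rewrite leNgt; apply/negP => H'; apply: Hno; exists n.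
have [z [Hz Ez]] : exists z, z ∈ omega /\ forall x, x ∈ X -> re (G ∙ z ∙ x) = 0.
  case: (Gg emp emp emp) => // z [Hz Ez]; exists z; split=> // x Hx.
  by rewrite Ez gE // kn0 mul0r; apply/min_idPr; rewrite le_max lexx.
(* The maximum of those among the first n members of G that lie below f, starting from a member that
   vanishes. *)
pose (H (n : V) := rec (G ∙ z) (fun k r : V => ite (forall x, x ∈ X -> re (G ∙ k ∙ x) <= f x) (fmax S r (G ∙ k)) r) n).
have HHd : definable_term (fun e => H (e 0%N)) by rewrite /H /fmax /Order.max; dfn.
have H0 : H emp = G ∙ z by rewrite /H rec0 //; rewrite /fmax /Order.max; dfn.
have HSu n : n ∈ omega -> H (succ n) = ite (forall x, x ∈ X -> re (G ∙ n ∙ x) <= f x) (fmax S (H n) (G ∙ n)) (H n).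
  by move=> Hn; rewrite /H recS //; rewrite /fmax /Order.max; dfn.
clearbody H.
have HP n : n ∈ omega -> (exists j, j ∈ omega /\ H n = G ∙ j) /\ forall x, x ∈ X -> re (H n ∙ x) <= f x.
  move: n; apply: omega_ind; first by dfn.
    rewrite H0; split; first by exists z.
    by move=> x Hx; rewrite Ez //; case/andP: (Hfb x Hx).
  move=> n Hn [[j [Hj Ej]] Hx]; rewrite HSu //.
  case: (classic (forall x, x ∈ X -> re (G ∙ n ∙ x) <= f x)) => Hc; last by rewrite ite_false //; split=> //; exists j.
  rewrite ite_true //; split; last by move=> x HxX; rewrite fmax_app // ge_max Hx // Hc.
  by case: (HGm j n Hj Hn) => k [Hk Ek]; exists k; rewrite Ej Ek.
have HHcf n : n ∈ omega -> H n ∈ cf S by move=> Hn; case: (HP n Hn) => [[j [Hj ->]] _]; apply: fn_app HG Hj.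
have meas_of F' : lsc F' -> @measurable_real V T X (C mu) F'.
  by move=> HF' t; apply: open_measurable.
have : s <= a; last by rewrite leNgt Has.
apply: (integral_sup Hm (F := f) (G := fun n x => re (H n ∙ x)) (r := fun n => mean (H n) mu) (b := b)) => //.
- exact: meas_of.
- by move=> n Hn; apply: meas_of => t; case: (cf_rays (HHcf n Hn)) => _ /(_ t) [].
- by move=> n Hn; case: (cf_mean HS Hmu (HHcf n Hn)).
- move=> n x Hn Hx; rewrite HSu //; case: (classic (forall x, x ∈ X -> re (G ∙ n ∙ x) <= f x)) => Hc.
    by rewrite ite_true // fmax_app // le_max lexx.
  by rewrite ite_false.
- move=> n x Hn Hx; case/andP: (Hfb x Hx) => _ H1; apply: le_trans H1 _.
  by rewrite lerDr; apply: cf_ge0 (HHcf n Hn) Hx.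
- have [x0 Hx0] : exists x, x ∈ X.
    apply: NNPP => Hne; have E : X = emp.
      by apply: (ext T) => x; rewrite in_emp; split=> // Hx; apply: Hne; exists x.
    have := meas_one (prob_measure Hmu); rewrite E (meas_emp (prob_measure Hmu)) => /eqP.
    by rewrite eq_sym oner_eq0.
  by case/andP: (Hfb x0 Hx0) => H1 H2; apply: le_trans H1 H2.
- move=> x e Hx He; have [Hneg|Hpos] := ltP (f x - e) 0.
    by exists emp; split=> //; rewrite H0 Ez //; lra.
  have Hlt : f x - e < f x by lra.
  case: (rational_dense Hlt) => m [Hmo /andP [H1 H2]].
  case: (Hlsc (rational m)) => u [Hu Hux].
  case: (HFb u x Hu) => [|n [Hn Hn1 Hn2]]; first by apply/Hux.
  case: (@archimedean V T (rational m / re (F ∙ n ∙ x))) => k [Hk].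
  rewrite ltr_pdivrMr // => Hkm.
  case: (Gg n k m Hn Hk Hmo) => j [Hj Ej].
  have Em : Num.max 0 (rational m) = rational m :> K by apply/max_idPr; lra.
  have Hc : forall y, y ∈ X -> re (G ∙ j ∙ y) <= f y.
    move=> y Hy; rewrite Ej gE // Em ge_min; apply/orP.
    have [Hpy|Hpy] := ltP 0 (re (F ∙ n ∙ y)).
      by left; apply: ltW; have /Hux [] := Hn2 y Hy Hpy.
    right; apply: (@le_trans _ _ 0); last by case/andP: (Hfb y Hy).
    by rewrite mulr_ge0_le0 // kn_ge0.
  exists (succ j); split; first exact: succ_omega.
  rewrite HSu // ite_true // fmax_app // -ltrBlDr lt_max; apply/orP; right.
  by rewrite Ej gE // Em lt_min; apply/andP; split=> //; apply: lt_trans H1 Hkm.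
by move=> n Hn; case: (HP n Hn) => [[j [Hj Ej]] Hx]; rewrite Ej; apply: Hle => // x HxX; rewrite -Ej; apply: Hx.
Qed.

(** The indicator of a basic open set is lower semicontinuous, so its mean is approached from below
    by means of members of G, whose rays are weakly open. Measures in the same open sets thus agree
    on the base. *)
Lemma Delta_separated : separated (Delta R S).
Proof.
case: determining_exists => G [HG HGd]; case: HN => _ _ [F HF].
case: (nice_base HS HF) => F' [W [_ HW _]].
have Hle mu nu : mu ∈ Prob R S -> nu ∈ Prob R S ->
    (forall u, u ∈ opens (Delta R S) -> mu ∈ u -> nu ∈ u) ->
    forall n, n ∈ omega -> re (mu ∙ (W ∙ n)) <= re (nu ∙ (W ∙ n)).
  move=> Hmu Hnu H n Hn; rewrite leNgt; apply/negP => Hlt.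
  have HWo : W ∙ n ∈ opens S by case: HW => HWf _ _; apply: fn_app HWf Hn.
  have HWb : W ∙ n ∈ borel S by apply: open_borel => //; case: HS.
  pose (f (x : V) := re (ite (x ∈ W ∙ n) (rv 1) (zero R))).
  have Hf : dK f by rewrite /f; dfn.
  have f01 x : f x = 1 /\ x ∈ W ∙ n \/ f x = 0 /\ ~ x ∈ W ∙ n.
    rewrite /f; case: (classic (x ∈ W ∙ n)) => Hx; first by left; rewrite ite_true // re_rv.
    by right; rewrite ite_false // -rv_zero re_rv.
  have ind q : q ∈ Prob R S -> mean_is q f (re (q ∙ (W ∙ n))).
    move=> Hq; have [HC E] := completion_borel Hq HWb; rewrite -E -[re _]mul1r.
    exact: (integral_indicator (completion_measure Hq) 1 HC).
  case: (HGd f 1 _ _ mu Hf _ _ Hmu (ind mu Hmu) Hlt).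
  - move=> t; have [H1|H1] := ltP t 0.
      by apply: (open_set_all HS) => x _; case: (f01 x) => -[-> _] //; apply: lt_trans H1 _; exact: ltr01.
    have [H2|H2] := ltP t 1; last first.
      by apply: (open_set_none HS) => x _; case: (f01 x) => -[-> _]; rewrite ltNge ?H1 ?H2.
    exists (W ∙ n); split=> // x; split.
      move=> Hx; split; first exact: (topology_sub HS HWo Hx).
      by case: (f01 x) => -[-> //].
    by move=> [_]; case: (f01 x) => -[-> //]; rewrite ltNge H1.
  - by move=> x _; case: (f01 x) => -[-> _]; rewrite ?lexx ?ler01.
  move=> k [Hk Hkf Hkm].
  case: (mean_ray HS (re (nu ∙ (W ∙ n))) (fn_app HG Hk)) => -[u [Hu Hux]] _.
  have /(H u Hu)/Hux [_] : mu ∈ u by apply/Hux; rewrite car_Delta.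
  rewrite ltNge => /negP; apply.
  case: (cf_mean HS Hnu (fn_app HG Hk)) => Hmk _.
  have := integral_le (completion_measure Hnu) (e := 0) Hmk (ind nu Hnu); rewrite addr0; apply.
  by move=> x Hx; rewrite addr0; exact: Hkf.
move=> mu nu; rewrite car_Delta => Hmu Hnu H.
apply: (prob_base_ext HS HW Hmu Hnu) => n Hn.
have HWb : W ∙ n ∈ borel S by apply: (fn_app (base_fn HS HW)).
rewrite (prob_rv Hmu HWb) (prob_rv Hnu HWb); congr rv; apply/eqP; rewrite eq_le.
by apply/andP; split; apply: Hle => // u /H [].
Qed.

(** The functions are max(0, mean (G n) - q). A subbasic set is reduced to a < mean f < b; with c a
    bound of |f|, these are lower bounds for the means of the nonnegative functions f + c and c - f,
    and [determining] supplies one function for each. *)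
Lemma nice_Delta : nice (Delta R S).
Proof.
case: determining_exists => G [HG HGd].
pose (g (n m : V) := lam (Prob R S) (fun mu => rv (Num.max 0 (mean (G ∙ n) mu - rational m)) : V)).
have Hmd n : dK (mean (G ∙ n)) by unfold_mean; dfn.
have Hg : definable_term (fun e => g (e 0%N) (e 1%N)) by rewrite /g /Order.max; unfold_mean; dfn.
have gcf n m : n ∈ omega -> g n m ∈ cf (Delta R S).
  move=> Hn; rewrite /g -car_Delta.
  apply: (@cf_lam V T (Delta R S) (fun mu => Num.max 0 (mean (G ∙ n) mu - rational m))).
    by rewrite /Order.max; dfn.
  have HGn := fn_app HG Hn.
  have [b Hb] : exists b : K, forall x, x ∈ X -> 0 <= re (G ∙ n ∙ x) <= b.
    by move: HGn; rewrite in_cf => -[_ []].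
  apply: (@bcont_pos V T _ (@Delta_topology V T S) _ _ b).
    move=> mu; rewrite car_Delta => Hmu; case: (cf_mean HS Hmu HGn) => H _.
    by case/andP: (mean_bounds Hmu H Hb).
  by move=> t; apply: mean_ray.
case: (@enumerate2 V T (cf (Delta R S)) g) => //.
  by move=> n m Hn _; apply: gcf.
move=> P [HP HPg].
have Pg n m : n ∈ omega -> m ∈ omega -> exists k, k ∈ omega /\ forall mu, mu ∈ Prob R S ->
    re (P ∙ k ∙ mu) = Num.max 0 (mean (G ∙ n) mu - rational m).
  move=> Hn Hm; case: (HPg n m Hn Hm) => k [Hk E]; exists k; split=> // mu Hmu.
  by rewrite E /g lam_app ?re_rv //; rewrite /Order.max; dfn.
have posE (z : K) : 0 < Num.max 0 z <-> 0 < z by rewrite lt_max ltxx.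
have HSep := Delta_separated.
move: HP HSep; rewrite /Delta => HP HSep; apply: (nice_generated (F := P)) => //.
- by move=> w; exact: weak_sub.
(* Means of members of G are nonnegative, so with a negative q the function is positive
   everywhere. *)
- move=> mu Hmu; have H01 : -1 < 0 :> K by lra.
  case: (rational_dense H01) => m [Hm /andP [_ Hm0]].
  case: (Pg emp m emp_omega Hm) => k [Hk Ek]; exists k; split=> //; rewrite Ek // posE.
  have HGn := fn_app HG emp_omega.
  have [b Hb] : exists b : K, forall x, x ∈ X -> 0 <= re (G ∙ emp ∙ x) <= b.
    by move: HGn; rewrite in_cf => -[_ []].
  case: (cf_mean HS Hmu HGn) => H _; case/andP: (mean_bounds Hmu H Hb) => H1 _.
  lra.
move=> w mu; rewrite in_weak => -[f [u [Hf [Hu ->]]]]; rewrite in_preim; last by dfn.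
move=> [Hmu Hmuu].
have Hfr := bounded_continuous_rays Hf; have [c Hc] := proj1 Hfr; have Hfn := proj1 Hf.
have Hmean q : q ∈ Prob R S -> mean_is q (fun x => re (f ∙ x)) (mean f q) /\
    integral R S q (app f) = rv (mean f q) by move=> Hq; apply: mean_value.
case: (Hmean mu Hmu) => Hmf Ef; rewrite Ef in Hmuu.
case: (open_real Hu Hmuu) => a [b [/andP [Ha Hb] Hab]].
have lower (h : V -> K) (s t : K) : dK h -> lsc h -> (forall x, x ∈ X -> 0 <= h x <= 2 * c) ->
    mean_is mu h s -> t < s -> exists k, [/\ k ∈ omega, 0 < re (P ∙ k ∙ mu) &
      forall nu r, nu ∈ Prob R S -> mean_is nu h r -> 0 < re (P ∙ k ∙ nu) -> t < r].
  move=> Hh Hlsc Hhb Hs Hts.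
  case: (HGd h (2 * c) t s mu Hh Hlsc Hhb Hmu Hs Hts) => n [Hn Hnh Hnm].
  case: (rational_dense Hnm) => m [Hm /andP [H1 H2]].
  case: (Pg n m Hn Hm) => k [Hk Ek]; exists k; split=> //; first by rewrite Ek // posE subr_gt0.
  move=> nu r Hnu Hr; rewrite Ek // posE subr_gt0 => H3.
  case: (cf_mean HS Hnu (fn_app HG Hn)) => Hmn _.
  have H4 := integral_le (completion_measure Hnu) (e := 0) Hmn Hr.
  have : mean (G ∙ n) nu <= r + 0 by apply: H4 => x Hx; rewrite addr0; exact: Hnh.
  by rewrite addr0; apply: lt_le_trans; apply: lt_trans H1 H3.
have affine q (h : V -> K) (e z : K) : q ∈ Prob R S -> (h = (fun x => re (f ∙ x) + e) /\ z = mean f q + e) \/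
    (h = (fun x => e - re (f ∙ x)) /\ z = e - mean f q) -> (forall x, x ∈ X -> -c <= re (f ∙ x) <= c) -> e = c ->
    mean_is q h z.
  move=> Hq Hh _ Ee; have Hm := completion_measure Hq; case: (Hmean q Hq) => Hqf _.
  have Hrh : rays S h.
    have [_ Hr] := Hfr; case: Hh => -[-> _]; split; try by exists (2 * c) => x /Hc; rewrite Ee; lra.
      by move=> t; case: (Hr (t - e)) => H1 H2; split; [apply: open_set_ext H1|apply: open_set_ext H2] => x _;
        [rewrite ltrBlDr|rewrite ltrBrDr].
    by move=> t; case: (Hr (e - t)) => H1 H2; split; [apply: open_set_ext H2|apply: open_set_ext H1] => x _;
      [rewrite ltrBrDl ltrBrDr addrC|rewrite ltrBlDl ltrBlDr addrC].
  have Hhd : dK h by case: Hh => -[-> _]; dfn.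
  case: (mean_exists HS Hq Hhd Hrh) => r Hr; case: Hh => -[Eh ->].
    by rewrite -(integral_add Hm Hqf (integral_const Hm e) Hr) // => x _; rewrite Eh.
  rewrite -[e - _](_ : r = _) //.
  rewrite [RHS]addrC; apply: (integral_add Hm (integral_opp Hm Hqf) (integral_const Hm e) Hr) => x _.
  by rewrite Eh addrC.
have [_ Hr] := Hfr.
case: (lower (fun x => re (f ∙ x) + c) (mean f mu + c) (a + c)).
- by dfn.
- by move=> t; case: (Hr (t - c)) => H1 _; apply: open_set_ext H1 => x _; rewrite ltrBlDr.
- by move=> x /Hc; lra.
- by apply: affine => //; left.
- by rewrite ltrD2r.
move=> k [Hk Hkmu Hkn].
case: (lower (fun x => c - re (f ∙ x)) (c - mean f mu) (c - b)).
- by dfn.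
- by move=> t; case: (Hr (c - t)) => _ H1; apply: open_set_ext H1 => x _; rewrite ltrBrDl ltrBrDr addrC.
- by move=> x /Hc; lra.
- by apply: affine => //; right.
- by rewrite ltrD2l ltrN2.
move=> l [Hl Hlmu Hln]; exists k, l; split=> // nu Hnu H1 H2.
rewrite in_preim; last by dfn.
split=> //; case: (Hmean nu Hnu) => _ ->; apply: Hab.
have H3 := Hkn nu (mean f nu + c) Hnu (affine _ _ _ _ Hnu (or_introl (conj erefl erefl)) Hc erefl) H1.
have H4 := Hln nu (c - mean f nu) Hnu (affine _ _ _ _ Hnu (or_intror (conj erefl erefl)) Hc erefl) H2.
by move: H3 H4; rewrite ltrD2r ltrD2l ltrN2 => -> ->.
Qed.

End NiceDelta.

(** * Images and mixtures of measures *)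

(** The image of mu under h, read in the completion since the preimage of a Borel set may be any
    set; [image_measure] is the version for Borel maps. *)
Definition push {V : Type} {M : set_structure V} (R : real_data V) (S mu S' : V) (h : V -> V) : V :=
  lam (borel S') (fun b => measure R S mu (preim (car S) h b)).

(** The barycentre of the family of measures f x with respect to nu. *)
Definition mixture {V : Type} {M : set_structure V} (R : real_data V) (S nu S' f : V) : V :=
  lam (borel S') (fun b => integral R S nu (fun x => app (app f x) b)).

Section PolishMeasures.

Context {V : Type} {T : model V}.
#[local] Hint Extern 0 (set_structure _) => exact (model_struct T) : typeclass_instances.
Local Notation R := (model_reals T).
Local Notation K := (real_of T).
Local Notation re := (@re V T).
Local Notation rv := (@rv V T).
Local Notation dK F := (definable_term (fun e => rv (F (e 0%N)))).

Lemma dirac S s : s ∈ car S -> exists mu, mu ∈ Prob R S /\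
  forall b, b ∈ borel S -> mu ∙ b = one R <-> s ∈ b.
Proof.
move=> Hs; have HA := @borel_sigma V T S.
pose (m (b : V) := re (ite (s ∈ b) (rv 1) (zero R)) : K).
have m1 b : s ∈ b -> m b = 1 by move=> H; rewrite /m ite_true // re_rv.
have m0 b : ~ s ∈ b -> m b = 0 by move=> H; rewrite /m ite_false // -rv_zero re_rv.
have mE b : m b = 1 /\ s ∈ b \/ m b = 0 /\ ~ s ∈ b.
  by case: (classic (s ∈ b)) => H; [left; rewrite m1|right; rewrite m0].
have Hmd : dK m by rewrite /m; dfn.
have Hm : is_measure (car S) (borel S) m.
  split=> //; first by move=> a _; case: (mE a) => -[-> _].
  - exact: m1.
  - move=> a b Ha Hb Hab; case: (mE a) => -[-> Hsa]; case: (mE b) => -[-> Hsb].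
    + by have := Hab s Hsa Hsb.
    + by rewrite m1 ?addr0 // in_cup; left.
    + by rewrite m1 ?add0r // in_cup; right.
    + by rewrite m0 ?addr0 // in_cup; tauto.
  move=> F c HF HFA Hmono Hc; case: (mE (bigcup F)) => -[-> H]; last first.
    by apply: le_trans (Hc emp emp_omega); case: (mE (F emp)) => -[-> _].
  by move: H; rewrite in_bigcup // => -[n [Hn H]]; rewrite -(m1 _ H); apply: Hc.
exists (lam (borel S) (fun b => rv (m b))); split; first exact: measure_prob.
move=> b Hb; rewrite lam_app // -rv_one; split=> [/rv_inj E|/m1 -> //].
by apply: NNPP => /m0; rewrite E => /eqP; rewrite oner_eq0.
Qed.

Section Polish.

Variable S : V.
Hypothesis HP : polish R S.
Local Notation X := (car S).

Lemma polish_base : exists W, [/\ is_topology X (opens S), separated S & base S W].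
Proof. by case: (polish_nice HP) => HS Hsep [F /(nice_base HS) [G [W [_ HW _]]]]; exists W. Qed.

Lemma polish_measurable mu Y : mu ∈ Prob R S -> Y ⊆ X -> Y ∈ completion R S mu.
Proof.
case: polish_base => W [HS Hsep HW] Hmu HY.
apply: (measurable_all Hmu (base_fn HS HW)) => // x y; exact: (base_separates HW Hsep).
Qed.

Lemma polish_total mu : mu ∈ Prob R S ->
  is_measure X (pow X) (fun a => re (measure R S mu a)).
Proof.
move=> Hmu; have -> : pow X = completion R S mu; last exact: completion_measure.
apply: (ext T) => Y; rewrite in_pow; split; first exact: polish_measurable.
by move/(sigma_sub (completion_sigma Hmu)).
Qed.

Lemma polish_selection mu S' (P : V -> V -> Prop) : mu ∈ Prob R S -> polish R S' ->
  definable (fun e => P (e 0%N) (e 1%N)) ->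
  (forall x, x ∈ X -> exists q, q ∈ Prob R S' /\ P x q) ->
  exists f B, [/\ fn f X (Prob R S'), B ∈ borel S, mu ∙ B = one R & forall x, x ∈ B -> P x (f ∙ x)].
Proof.
case: polish_base => W [HS Hsep HW] Hmu HP' HPd HPe.
have [W' [HS' _ HW']] : exists W', [/\ is_topology (car S') (opens S'), separated S' & base S' W'].
  by case: (polish_nice HP') => HS' Hsep' [F /(nice_base HS') [G [W' [_ HW' _]]]]; exists W'.
have Hcd : definable_term (fun e => @prob_code V T W' (e 0%N)) by rewrite /prob_code; dfn.
case: (@selection V T S mu W Hmu (base_fn HS HW) (fun x y => base_separates HW Hsep (x := x) (y := y))
  (Prob R S') _ P Hcd HPd) => //.
- by move=> q _ n; rewrite in_prob_code => -[].
- by move=> q q' Hq Hq' E; exact: (prob_code_inj HS' HW' Hq Hq' E).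
move=> f [B [Hf HB EB HBP]]; exists f, B; split=> //.
by rewrite (prob_rv Hmu HB) EB rv_one.
Qed.

Section Push.

Variables (mu S' : V) (h : V -> V).
Hypotheses (Hmu : mu ∈ Prob R S) (Hh : definable_term (fun e => h (e 0%N)))
  (HhX : forall x, x ∈ X -> h x ∈ car S').
Local Notation cm := (fun a => re (measure R S mu a)).

Lemma push_app b : b ∈ borel S' -> push R S mu S' h ∙ b = rv (cm (preim X h b)).
Proof.
move=> Hb; rewrite /push lam_app; [|by dfn|by []].
apply: (measure_rv Hmu); apply: polish_measurable => //.
by move=> x; rewrite in_preim // => -[].
Qed.

Lemma push_prob : push R S mu S' h ∈ Prob R S'.
Proof.
have Hm := polish_total Hmu.
have Hti : is_measure (car S') (borel S') (fun b => cm (preim X h b)).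
  by apply: (total_image Hm Hh) => //; exact: (meas_one Hm).
have -> : push R S mu S' h = lam (borel S') (fun b => rv (cm (preim X h b))); last exact: measure_prob.
apply: lam_eq => b Hb; apply: (measure_rv Hmu); apply: polish_measurable => //.
by move=> x; rewrite in_preim // => -[].
Qed.

Lemma push_full b : b ∈ borel S' -> (exists c, [/\ c ∈ borel S, mu ∙ c = one R &
  forall x, x ∈ c -> h x ∈ b]) -> push R S mu S' h ∙ b = one R.
Proof.
move=> Hb [c [Hc Ec Hcb]]; rewrite push_app // -rv_one; congr rv.
have Hm := polish_total Hmu; have HpX : preim X h b ∈ pow X.
  by rewrite in_pow => x; rewrite in_preim // => -[].
have HcX := sigma_sub (@borel_sigma V T S) Hc.
apply/eqP; rewrite eq_le (meas_le1 Hm) //=.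
have [HcC Ecm] := completion_borel Hmu Hc.
have E1 : re (mu ∙ c) = 1 by rewrite Ec -rv_one re_rv.
rewrite -E1 -Ecm; apply: (meas_mono Hm) => //; first by rewrite in_pow.
by move=> x Hx; rewrite in_preim //; split; [apply: HcX|apply: Hcb].
Qed.

End Push.

Section Mixture.

Variables (nu S' f : V).
Hypotheses (Hnu : nu ∈ Prob R S) (Hf : fn f X (Prob R S')).
Local Notation cm := (fun a => re (measure R S nu a)).
Local Notation mix := (mixture R S nu S' f).

Let Hm : is_measure X (pow X) cm := polish_total Hnu.
Let HA := @borel_sigma V T S'.

Let fP x : x ∈ X -> is_measure (car S') (borel S') (fun b => re (f ∙ x ∙ b)).
Proof. by move=> Hx; apply: prob_measure; apply: fn_app Hf Hx. Qed.

Let f01 x b : x ∈ X -> b ∈ borel S' -> 0 <= re (f ∙ x ∙ b) <= 1.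
Proof. by move=> /fP H Hb; rewrite (meas_ge0 H) // (meas_le1 H). Qed.

Let total_measurable (F : V -> K) : dK F -> @measurable_real V T X (pow X) F.
Proof.
move=> HF t; separate X (fun x => t < F x) as a ina.
by exists a; rewrite in_pow; split=> x; rewrite ina // => -[].
Qed.

Lemma mix_integral b : b ∈ borel S' ->
  has_integral X (pow X) cm (fun x => re (f ∙ x ∙ b)) (re (mix ∙ b)) /\ mix ∙ b ∈ RR R.
Proof.
move=> Hb; have Hd : dK (fun x => re (f ∙ x ∙ b)) by dfn.
case: (@integral_exists V T X (pow X) _ Hm (fun x => re (f ∙ x ∙ b)) 1 Hd) => [||r Hr]; first exact: total_measurable.
  by move=> x /f01 /(_ Hb); lra.
have -> : mix ∙ b = rv r; last by rewrite re_rv; split=> //; exact: rv_in.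
rewrite /mixture lam_app //; apply: (integral_value Hnu) => //.
  by move=> x Hx; apply: (fn_app (prob_fn (fn_app Hf Hx)) Hb).
have E : pow X = completion R S nu; last by rewrite /mean_is -E.
apply: (ext T) => Y; rewrite in_pow; split; first exact: polish_measurable.
by move/(sigma_sub (completion_sigma Hnu)).
Qed.

Lemma mix_measure : is_measure (car S') (borel S') (fun b => re (mix ∙ b)).
Proof.
split=> //.
- move=> b Hb; case: (mix_integral Hb) => H _.
  have H1 := integral_le Hm (e := 0) (integral_const Hm 0) H.
  by rewrite addr0 in H1; apply: H1 => x /f01 /(_ Hb) /andP []; rewrite addr0.
- have HXb := sigma_total HA; case: (mix_integral HXb) => H _.
  have H1 := integral_le Hm (e := 0) H (integral_const Hm 1).
  have H2 := integral_le Hm (e := 0) (integral_const Hm 1) H.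
  rewrite !addr0 in H1 H2; apply/eqP; rewrite eq_le; apply/andP; split.
    by apply: H1 => x Hx; rewrite (meas_one (fP Hx)).
  by apply: H2 => x Hx; rewrite addr0 (meas_one (fP Hx)).
- move=> a b Ha Hb Hab; case: (mix_integral Ha) => H1 _; case: (mix_integral Hb) => H2 _.
  case: (mix_integral (sigma_cup HA Ha Hb)) => H3 _.
  by apply: (integral_add Hm H1 H2 H3) => x Hx; apply: (meas_add (fP Hx)).
move=> F c HF HFA Hmono Hc; case: (mix_integral (sigma_bigcup HA HF HFA)) => H _.
have HGd : definable_term (fun e => rv (re (f ∙ e 1%N ∙ F (e 0%N)))) by dfn.
apply: (integral_sup Hm (F := fun x => re (f ∙ x ∙ bigcup F)) (G := fun n x => re (f ∙ x ∙ F n))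
  (r := fun n => re (mix ∙ F n)) (b := 1)) => //.
- by apply: total_measurable; dfn.
- by move=> n Hn; apply: total_measurable; dfn.
- by move=> n Hn; case: (mix_integral (HFA n Hn)).
- by move=> n x Hn Hx; apply: (meas_mono (fP Hx)); auto; apply: HFA; apply: succ_omega.
- move=> n x Hn Hx; case/andP: (f01 Hx (sigma_bigcup HA HF HFA)) => _ H1.
  by apply: le_trans H1 _; rewrite lerDr; case/andP: (f01 Hx (HFA n Hn)).
move=> x e Hx He; apply: NNPP => Hno.
have : re (f ∙ x ∙ bigcup F) <= re (f ∙ x ∙ bigcup F) - e; last by lra.
apply: (meas_cont (fP Hx)) => // n Hn; rewrite leNgt; apply/negP => Hlt; apply: Hno.
by exists n; split=> //; rewrite -ltrBlDr.
Qed.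

Lemma mix_prob : mix ∈ Prob R S'.
Proof.
have := measure_prob mix_measure.
have -> : lam (borel S') (fun b => rv (re (mix ∙ b))) = mix; last by [].
apply: lam_eq => b Hb; case: (mix_integral Hb) => _ H; rewrite rv_re //.
by rewrite /mixture lam_app.
Qed.

Lemma full_of_total Y : Y ⊆ X -> cm Y = 1 -> exists D, [/\ D ∈ borel S, nu ∙ D = one R & D ⊆ Y].
Proof.
move=> HY E; have HC := polish_measurable Hnu HY.
case: (completion_inner Hnu HC) => D [HD HDY ED]; exists D; split=> //.
by rewrite (prob_rv Hnu HD) ED E rv_one.
Qed.

(** The function x ↦ f x (b) is bounded by 1 and has integral 1, so by Markov's inequality it is at
    most 1 - 3^-n only on a null set, for every n. *)
Lemma mix_full b : b ∈ borel S' -> mix ∙ b = one R ->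
  exists D, [/\ D ∈ borel S, nu ∙ D = one R & forall x, x ∈ D -> f ∙ x ∙ b = one R].
Proof.
move=> Hb Eb; case: (mix_integral Hb) => H _.
have Er : re (mix ∙ b) = 1 by rewrite Eb -rv_one re_rv.
rewrite Er in H.
pose (N (n : V) := ⟦ x | x ∈ X /\ re (f ∙ x ∙ b) <= 1 - p3 n ⟧).
have HN : definable_term (fun e => N (e 0%N)) by rewrite /N; dfn.
have inN n x : (x ∈ N n) = (x ∈ X /\ re (f ∙ x ∙ b) <= 1 - p3 n).
  by apply: (in_compr X) => [|z []//]; dfn.
have HNX n : N n ∈ pow X by rewrite in_pow => x; rewrite inN => -[].
have HN0 n : n ∈ omega -> N n ∈ pow X /\ cm (N n) = 0.
  move=> Hn; split=> //; apply/eqP; rewrite eq_le (meas_ge0 Hm) // andbT.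
  have Hp := p3_gt0 Hn (T := T).
  have H1 := integral_sum3 Hm (e := 1) H (integral_indicator Hm (p3 n) (HNX n)) (integral_const Hm 0).
  have : 1 + p3 n * cm (N n) + 0 <= 1.
    apply: H1 => x Hx; case: (classic (x ∈ N n)) => HxN.
      by rewrite ite_true // re_rv; move: HxN; rewrite inN => -[_]; lra.
    by rewrite ite_false // -rv_zero re_rv; case/andP: (f01 Hx Hb) => _; lra.
  have -> : (1 + p3 n * cm (N n) + 0 <= 1) = (p3 n * cm (N n) <= 0) by apply/idP/idP; lra.
  by rewrite pmulr_rle0.
have HU := meas_bigcup_null Hm HN HN0.
have HUX : bigcup N ∈ pow X by apply: (sigma_bigcup (pow_sigma X)).
case: (@full_of_total (diff X (bigcup N))) => [x||D [HD ED HDs]]; first by rewrite in_diff => -[].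
  by rewrite (meas_compl Hm) // HU subr0.
exists D; split=> // x /HDs; rewrite in_diff in_bigcup // => -[Hx Hno].
rewrite (prob_rv (fn_app Hf Hx) Hb) -rv_one; congr rv; case/andP: (f01 Hx Hb) => _ H1.
apply/eqP; rewrite eq_le H1 /=; apply: real_le_eps => n Hn; rewrite -lerBlDr leNgt.
by apply/negP => H2; apply: Hno; exists n; rewrite inN ltW.
Qed.

Lemma mix_one b D : b ∈ borel S' -> D ∈ borel S -> nu ∙ D = one R ->
  (forall x, x ∈ D -> f ∙ x ∙ b = one R) -> mix ∙ b = one R.
Proof.
move=> Hb HD ED HDb; case: (mix_integral Hb) => H HR; rewrite -(rv_re HR) -rv_one; congr rv.
apply/eqP; rewrite eq_le (meas_le1 mix_measure) //=.
have HDX := sigma_sub (@borel_sigma V T S) HD.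
have HDp : D ∈ pow X by rewrite in_pow.
have [_ Ecm] := completion_borel Hnu HD.
have E1 : cm D = 1 by rewrite Ecm ED -rv_one re_rv.
have H1 := integral_le Hm (e := 0) (integral_indicator Hm 1 HDp) H.
rewrite E1 mulr1 addr0 in H1; apply: H1 => x Hx; rewrite addr0.
case: (classic (x ∈ D)) => HxD; first by rewrite ite_true // re_rv (HDb x HxD) -rv_one re_rv.
by rewrite ite_false // -rv_zero re_rv; case/andP: (f01 Hx Hb).
Qed.

End Mixture.

End Polish.

(** Z need not be Borel but is measurable for the mixture. An outer Borel set c of Z has measure one
    for every f x with x ∈ D, hence for the mixture, where c and Z have the same measure. *)
Lemma mix_full_set S S' nu f Z D : polish R S -> polish R S' -> nu ∈ Prob R S ->
  fn f (car S) (Prob R S') -> Z ⊆ car S' -> D ∈ borel S -> nu ∙ D = one R ->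
  (forall x, x ∈ D -> measure_is R S' (f ∙ x) Z (one R)) ->
  measure_is R S' (mixture R S nu S' f) Z (one R).
Proof.
move=> HS HS' Hnu Hf HZ HD ED HDZ.
have Hmix := mix_prob HS Hnu Hf.
have HZC := polish_measurable HS' Hmix HZ.
case: (completion_outer Hmix HZC) => c [Hc HZc Ec].
have Hc1 : mixture R S nu S' f ∙ c = one R.
  apply: (mix_one HS Hnu Hf Hc HD ED) => x Hx.
  have HDX := sigma_sub (@borel_sigma V T S) HD.
  have HxX : x ∈ car S by apply: HDX.
  have Hfx := fn_app Hf HxX.
  case/(full_borel Hfx): (HDZ x Hx) => _ [b [Hb HbZ Eb]].
  rewrite (prob_rv Hfx Hc) -rv_one; congr rv; apply/eqP.
  rewrite eq_le (meas_le1 (prob_measure Hfx)) //=.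
  have <- : re (f ∙ x ∙ b) = 1 by rewrite Eb -rv_one re_rv.
  by apply: (meas_mono (prob_measure Hfx)) => //; apply: sub_trans HZc.
by apply/(full_measure Hmix); split=> //; rewrite -Ec Hc1 -rv_one re_rv.
Qed.

End PolishMeasures.

(** * Borel selections *)

Ltac dfn_player :=
  match goal with
  | H : forall k : player, definable (fun e => ?E k (e 0%N)) |- definable (fun e => ?E ?i (@?a e)) =>
      refine (@definable_subst _ _ (fun x _ => E i x) a id (H i) _)
  | H : forall k : player, definable (fun e => ?E k (e 0%N) (e 1%N)) |- definable (fun e => ?E ?i (@?a e) (@?b e)) =>
      refine (@definable_subst2 _ _ (E i) a b (H i) _ _)
  | H : forall k : player, definable_term (fun e => ?E k (e 0%N)) |- definable_term (fun e => ?E ?i (@?a e)) =>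
      refine (@term_subst _ _ (fun x _ => E i x) a id (H i) _)
  | H : forall k : player, definable_term (fun e => ?E k (e 0%N) (e 1%N)) |- definable_term (fun e => ?E ?i (@?a e) (@?b e)) =>
      refine (@term_subst2 _ _ (E i) a b (H i) _ _)
  end.

Ltac dfn_push :=
  lazymatch goal with
  | |- definable_term (fun e => push _ _ _ _ _) => unfold push
  | |- definable_term (fun e => mixture _ _ _ _ _) => unfold mixture
  end.

Ltac dfn_sym6 ::= first [ dfn_player | dfn_space2 | dfn_meas | dfn_code | dfn_push ].

Definition pairs {V : Type} {M : set_structure V} (A : player -> V) : V := Defs.prod (A P1) (A P2).

Section Players.

Context {V : Type} {T : model V}.
#[local] Hint Extern 0 (set_structure _) => exact (model_struct T) : typeclass_instances.

Lemma sel_both k (F : player -> V) : sel k (both F) = F k.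
Proof. by case: k; rewrite /both /=; [exact: pi1_pair|exact: pi2_pair]. Qed.

Lemma player_cases (i k : player) : k = i \/ k = other i. Proof. by case: i; case: k; auto. Qed.

Lemma other_other k : other (other k) = k. Proof. by case: k. Qed.

Lemma in_pairs (A : player -> V) p : p ∈ pairs A -> forall k, sel k p ∈ A k.
Proof. by move/prodP => [_ H1 H2] []. Qed.

Lemma both_pairs (A F : player -> V) : (forall k, F k ∈ A k) -> both F ∈ pairs A.
Proof. by move=> H; rewrite /pairs pair_in_prod. Qed.

Lemma player_choice (A : player -> V) (P : player -> V -> Prop) :
  (forall k, exists y, y ∈ A k /\ P k y) -> exists p, p ∈ pairs A /\ forall k, P k (sel k p).
Proof.
move=> H; have [y1 [H1 HP1]] := H P1; have [y2 [H2 HP2]] := H P2.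
pose F k := match k with P1 => y1 | P2 => y2 end.
exists (both F); split; first by apply: both_pairs => -[].
by move=> k; rewrite sel_both; case: k.
Qed.

End Players.

Section BorelSelection.

Context {V : Type} {T : model V}.
#[local] Hint Extern 0 (set_structure _) => exact (model_struct T) : typeclass_instances.
Local Notation R := (model_reals T).
Local Notation re := (@re V T).
Local Notation rv := (@rv V T).
Variables (X : player -> V) (E : player -> V -> V -> Prop) (Z : player -> V).
Hypotheses (HX : forall k, polish R (X k))
  (HE : forall k, definable (fun e => E k (e 0%N) (e 1%N)))
  (HZX : forall k x, x ∈ Z k -> x ∈ car (X k))
  (HZ : forall k x, x ∈ Z k -> exists mu, [/\ mu ∈ Prob R (X (other k)),
     measure_is R (X (other k)) mu (Z (other k)) (one R) & E k x mu]).
Local Notation Y k := (X (other k)).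
Local Notation PB k := (Prob R (Y k)).

Definition good k x mu := [/\ x ∈ Z k, measure_is R (Y k) mu (Z (other k)) (one R) & E k x mu].

Lemma definable_good k : definable (fun e => good k (e 0%N) (e 1%N)).
Proof. by rewrite /good; dfn. Qed.

(* nu and f are pairs: nu_k is carried by Z_k and f_k selects good beliefs
   almost everywhere. *)
Definition stage (nu f : V) : Prop := forall k,
  [/\ sel k nu ∈ Prob R (X k), fn (sel k f) (car (X k)) (PB k) &
      exists D, [/\ D ∈ borel (X k), sel k nu ∙ D = one R & forall x, x ∈ D -> good k x (sel k f ∙ x)]].

Definition next (nu f nu' : V) : Prop := forall k,
  sel (other k) nu' = mixture R (X k) (sel k nu) (Y k) (sel k f).

(** Selection wants a relation that is total on X_k, so goodness is asked of x only if x ∈ Z_k.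
    Since nu_k is carried by Z_k, the selected belief is good on a Borel set of measure one. *)
Lemma complete_stage (nu : V) : (forall k, sel k nu ∈ Prob R (X k)) ->
  (forall k, measure_is R (X k) (sel k nu) (Z k) (one R)) ->
  exists f, f ∈ pairs (fun k => pow (Defs.prod (car (X k)) (PB k))) /\ stage nu f.
Proof.
move=> Hnu HnuZ.
have Hg := definable_good.
case: (@player_choice V T (fun k => pow (Defs.prod (car (X k)) (PB k)))
  (fun k f => fn f (car (X k)) (PB k) /\ exists D, [/\ D ∈ borel (X k), sel k nu ∙ D = one R &
     forall x, x ∈ D -> good k x (f ∙ x)])); last first.
  by move=> f [Hf H]; exists f; split=> // k; have [H1 H2] := H k.
move=> k; case: (@polish_selection V T (X k) (HX k) (sel k nu) (Y k) (fun x q => x ∈ Z k -> good k x q)) => //.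
- move=> x Hx; case: (classic (x ∈ Z k)) => HxZ.
    by case: (HZ HxZ) => mu [H1 H2 H3]; exists mu.
  by exists (sel (other k) nu).
move=> f [B [Hf HB EB HBg]]; exists f; split; first by rewrite in_pow; case: Hf.
split=> //; case/(full_borel (Hnu k)): (HnuZ k) => _ [b [Hb HbZ Eb]].
have HA := @borel_sigma V T (X k); have Hm := prob_measure (Hnu k).
have one_eq c : c ∈ borel (X k) -> re (sel k nu ∙ c) = 1 -> sel k nu ∙ c = one R.
  by move=> Hc E'; rewrite (prob_rv (Hnu k) Hc) E' rv_one.
exists (cap B b); split; first exact: (sigma_cap HA).
  apply: one_eq; first exact: (sigma_cap HA).
  by apply: (meas_full_cap Hm) => //; rewrite ?EB ?Eb -rv_one re_rv.
by move=> x; rewrite in_cap => -[HxB Hxb]; apply: HBg => //; apply: HbZ.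
Qed.

Lemma next_exists nu f : stage nu f -> exists nu' f', [/\ nu' ∈ pairs (fun k => Prob R (X k)),
  f' ∈ pairs (fun k => pow (Defs.prod (car (X k)) (PB k))), stage nu' f' & next nu f nu'].
Proof.
move=> Hs; pose (F (k : player) := mixture R (Y k) (sel (other k) nu) (X k) (sel (other k) f)).
have HfY k : fn (sel (other k) f) (car (Y k)) (Prob R (X k)).
  by case: (Hs (other k)) => _; rewrite other_other.
have HF k : F k ∈ Prob R (X k).
  by apply: mix_prob => //; case: (Hs (other k)).
case: (@complete_stage (both F)).
- by move=> k; rewrite sel_both.
- move=> k; rewrite sel_both; case: (Hs (other k)) => Hnu _ [D [HD ED HDg]].
  apply: (mix_full_set (HX (other k)) (HX k) Hnu (HfY k) _ HD ED); first by move=> x; apply: HZX.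
  by move=> x /HDg [_]; rewrite other_other.
move=> f' [Hf' Hs']; exists (both F), f'; split=> //.
  exact: both_pairs.
by move=> k; rewrite sel_both /F other_other.
Qed.

Lemma stages_exist i s : s ∈ Z i -> exists N G, [/\
  forall n, n ∈ omega -> stage (N ∙ n) (G ∙ n),
  forall n, n ∈ omega -> next (N ∙ n) (G ∙ n) (N ∙ succ n) &
  forall b, b ∈ borel (X i) -> sel i (N ∙ emp) ∙ b = one R -> s ∈ b].
Proof.
move=> Hs; case: (HZ Hs) => mu [Hmu HmuZ HEs].
case: (dirac (HZX Hs)) => ds [Hds Hdsb].
have HdsZ : measure_is R (X i) ds (Z i) (one R).
  have Hsub : Z i ⊆ car (X i) by move=> x; apply: HZX.
  apply/(full_measure Hds); split; first exact: (polish_measurable (HX i) Hds Hsub).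
  case: (completion_outer Hds (polish_measurable (HX i) Hds Hsub)) => c [Hc HZc <-].
  by rewrite (proj2 (Hdsb c Hc) (HZc s Hs)) -rv_one re_rv.
pose F0 k := match i, k with P1, P1 | P2, P2 => ds | _, _ => mu end.
have F0i : F0 i = ds by rewrite /F0; case: (i).
have F0o : F0 (other i) = mu by rewrite /F0; case: (i).
clearbody F0.
case: (@complete_stage (both F0)).
- by move=> k; rewrite sel_both; case: (player_cases i k) => ->; rewrite ?F0i ?F0o.
- by move=> k; rewrite sel_both; case: (player_cases i k) => ->; rewrite ?F0i ?F0o.
move=> f0 [Hf0 Hs0].
have Hg := definable_good.
have Hst : definable (fun e => stage (pi1 (e 0%N)) (pi2 (e 0%N))) by rewrite /stage; dfn.
separate (Defs.prod (pairs (fun k => Prob R (X k))) (pairs (fun k => pow (Defs.prod (car (X k)) (PB k)))))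
  (fun q => stage (pi1 q) (pi2 q)) as Q inQ.
case: (@dependent_choice V T Q ⟨both F0, f0⟩ (fun q q' => next (pi1 q) (pi2 q) (pi1 q'))).
- by rewrite /next; dfn.
- rewrite inQ pair_in_prod pi1_pair pi2_pair; split=> //; split=> //; apply: both_pairs.
  by move=> k; case: (player_cases i k) => ->; rewrite ?F0i ?F0o.
- move=> q; rewrite inQ => -[_ /next_exists [nu' [f' [H1 H2 H3 H4]]]]; exists ⟨nu', f'⟩.
  by rewrite inQ pair_in_prod !pi1_pair pi2_pair.
move=> g [Hg' g0 gS]; exists (lam omega (fun n => pi1 (g ∙ n))), (lam omega (fun n => pi2 (g ∙ n))); split.
- by move=> n Hn; rewrite !lam_app //; have := fn_app Hg' Hn; rewrite inQ => -[].
- by move=> n Hn; rewrite !lam_app //; [exact: gS|exact: succ_omega].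
move=> b Hb; rewrite lam_app // g0 pi1_pair sel_both F0i => /(Hdsb b Hb) //.
Qed.

(** By [next], the other player's set of stage n + 1 has measure one for the mixture of the beliefs
    at stage n, hence for almost all of these beliefs, by [mix_full]. The new set of stage n keeps
    the points with such beliefs. *)
Lemma shrink (N G Dn : V) : (forall n, n ∈ omega -> stage (N ∙ n) (G ∙ n)) ->
  (forall n, n ∈ omega -> next (N ∙ n) (G ∙ n) (N ∙ succ n)) ->
  fn Dn omega (pairs (fun k => borel (X k))) ->
  (forall n k, n ∈ omega -> sel k (N ∙ n) ∙ sel k (Dn ∙ n) = one R) ->
  exists D', [/\ fn D' omega (pairs (fun k => borel (X k))),
    forall n k, n ∈ omega -> sel k (N ∙ n) ∙ sel k (D' ∙ n) = one R &
    forall n, n ∈ omega -> forall k, sel k (D' ∙ n) ⊆ sel k (Dn ∙ n) /\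
      forall x, x ∈ sel k (D' ∙ n) -> sel k (G ∙ n) ∙ x ∙ sel (other k) (Dn ∙ succ n) = one R].
Proof.
move=> HN HS HD HD1.
case: (@countable_choice V T (pairs (fun k => borel (X k))) (fun n d => forall k,
  sel k (N ∙ n) ∙ sel k d = one R /\ sel k d ⊆ sel k (Dn ∙ n) /\
  forall x, x ∈ sel k d -> sel k (G ∙ n) ∙ x ∙ sel (other k) (Dn ∙ succ n) = one R)).
- by rewrite /sub; dfn.
- move=> n Hn; apply: (@player_choice V T (fun k => borel (X k)) (fun k y =>
    sel k (N ∙ n) ∙ y = one R /\ y ⊆ sel k (Dn ∙ n) /\
    forall x, x ∈ y -> sel k (G ∙ n) ∙ x ∙ sel (other k) (Dn ∙ succ n) = one R)) => k.
  case: (HN n Hn k) => Hnu Hf _; have HSn := succ_omega Hn.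
  have Hb : sel (other k) (Dn ∙ succ n) ∈ borel (Y k).
    by have := in_pairs (fn_app HD HSn) (other k).
  have Hb' : sel k (Dn ∙ n) ∈ borel (X k) by have := in_pairs (fn_app HD Hn) k.
  case: (mix_full (HX k) Hnu Hf Hb) => [|B [HB EB HBb]].
    by rewrite -(HS n Hn k); apply: HD1.
  have HA := @borel_sigma V T (X k); have Hm := prob_measure Hnu.
  have HC := sigma_cap HA HB Hb'.
  exists (cap B (sel k (Dn ∙ n))); split=> //; split; last split.
  + rewrite (prob_rv Hnu HC) -rv_one; congr rv.
    by apply: (meas_full_cap Hm) => //; rewrite ?EB ?HD1 // -rv_one re_rv.
  + by move=> x; rewrite in_cap => -[].
  + by move=> x; rewrite in_cap => -[/HBb].
move=> D' [HD' H]; exists D'; split=> //; first by move=> n k Hn; case: (H n Hn k).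
by move=> n Hn k; case: (H n Hn k) => _ [].
Qed.

(* Start from the Dirac measure at s and a belief that makes s a best response;
   given measures nu_n and selections f_n, let nu_{n+1} be the mixture of the
   beliefs f_n x with respect to nu_n.  The Borel sets where f_n is good are then shrunk by dependent choice
   until each belief gives measure one to the next set. *)
Theorem borel_selection i s : s ∈ Z i -> exists B F, [/\
  forall k, sel k B ∈ borel (X k) /\ fn (sel k F) (car (X k)) (PB k),
  forall k x, x ∈ sel k B -> E k x (sel k F ∙ x) /\ sel k F ∙ x ∙ sel (other k) B = one R &
  s ∈ sel i B].
Proof.
move=> Hs; case: (stages_exist Hs) => N [G [HN HS Hs0]].
have Hg := definable_good.
case: (@countable_choice V T (pairs (fun k => borel (X k))) (fun n d => forall k,
  sel k (N ∙ n) ∙ sel k d = one R /\ forall x, x ∈ sel k d -> good k x (sel k (G ∙ n) ∙ x))) => //.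
  move=> n Hn; apply: (@player_choice V T (fun k => borel (X k)) (fun k y =>
    sel k (N ∙ n) ∙ y = one R /\ forall x, x ∈ y -> good k x (sel k (G ∙ n) ∙ x))) => k.
  by case: (HN n Hn k) => _ _ [D [HD ED HDg]]; exists D.
move=> D0 [HD0 HD0g].
separate (pow (Defs.prod omega (pairs (fun k => borel (X k))))) (fun d =>
  fn d omega (pairs (fun k => borel (X k))) /\
  forall n, n ∈ omega -> forall k, sel k (N ∙ n) ∙ sel k (d ∙ n) = one R) as Q inQ.
case: (@dependent_choice V T Q D0 (fun d d' => forall n, n ∈ omega -> forall k, sel k (d' ∙ n) ⊆ sel k (d ∙ n) /\
      forall x, x ∈ sel k (d' ∙ n) -> sel k (G ∙ n) ∙ x ∙ sel (other k) (d ∙ succ n) = one R)).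
- by rewrite /sub; dfn.
- rewrite inQ; split; first by rewrite in_pow; case: HD0.
  by split=> // n Hn k; case: (HD0g n Hn k).
- move=> d; rewrite inQ => -[_ [Hd Hd1]]; case: (shrink HN HS Hd) => [n k Hn|d' [H1 H2 H3]]; first exact: Hd1.
  exists d'; rewrite inQ; split=> //; split; first by rewrite in_pow; case: H1.
  by split=> // n Hn k; apply: H2.
move=> h [Hh h0 hS].
have hQ m : m ∈ omega -> fn (h ∙ m) omega (pairs (fun k => borel (X k))) /\
    forall n, n ∈ omega -> forall k, sel k (N ∙ n) ∙ sel k (h ∙ m ∙ n) = one R.
  by move=> Hm; have := fn_app Hh Hm; rewrite inQ => -[].
(* The limit of the shrinking at stage n. A point that survives round m + 1 has a belief giving
   measure one to the m-th set of the next stage; so a point of D k n has a belief giving measure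
   one to their intersection D (other k) (succ n). *)
pose (D (k : player) (n : V) := ⟦ x | x ∈ car (X k) /\ forall m, m ∈ omega -> x ∈ sel k (h ∙ m ∙ n) ⟧).
have HDd : forall k, definable_term (fun e => D k (e 0%N)) by move=> k; rewrite /D; dfn.
have inD k n x : (x ∈ D k n) = (x ∈ car (X k) /\ forall m, m ∈ omega -> x ∈ sel k (h ∙ m ∙ n)).
  by apply: (in_compr (car (X k))) => [|z []//]; dfn.
have Dfull k n mu : n ∈ omega -> mu ∈ Prob R (X k) ->
    (forall m, m ∈ omega -> mu ∙ sel k (h ∙ m ∙ n) = one R) -> D k n ∈ borel (X k) /\ mu ∙ D k n = one R.
  move=> Hn Hmu Hone; have Hm := prob_measure Hmu.
  case: (@bigcap_full V T _ _ _ (fun m => sel k (h ∙ m ∙ n)) Hm) => [||b [Hb Eb Hbx]] //.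
    move=> m Hmo; split; last by rewrite Hone // -rv_one re_rv.
    by case: (hQ m Hmo) => H _; apply: (in_pairs (fn_app H Hn)).
  have -> : D k n = b by apply: (ext T) => x; rewrite inD (propeq (Hbx x)).
  by split=> //; rewrite (prob_rv Hmu Hb) Eb rv_one.
have DB k n : n ∈ omega -> D k n ∈ borel (X k).
  move=> Hn; case: (HN n Hn k) => Hnu _ _.
  by case: (Dfull k n (sel k (N ∙ n)) Hn Hnu) => // m Hm; case: (hQ m Hm) => _ /(_ n Hn k).
have Dgood k n x : n ∈ omega -> x ∈ D k n -> good k x (sel k (G ∙ n) ∙ x) /\
    sel k (G ∙ n) ∙ x ∙ D (other k) (succ n) = one R.
  move=> Hn; rewrite inD => -[Hx Hxm]; case: (HN n Hn k) => _ Hf _; split.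
    by have := Hxm emp emp_omega; rewrite h0; case: (HD0g n Hn k) => _; apply.
  have Hfx := fn_app Hf Hx.
  case: (Dfull (other k) (succ n) _ (succ_omega Hn) Hfx) => // m Hm.
  by case: (hS m Hm n Hn k) => _; apply; apply: Hxm; apply: succ_omega.
(* The stages are merged. A point of B k uses the belief of the first stage that contains it; this
   belief is carried by the following stage of the other player, which lies in B (other k). *)
pose (B (k : player) := bigcup (D k)).
have inB k x : (x ∈ B k) = (exists n, n ∈ omega /\ x ∈ D k n) by rewrite /B in_bigcup.
have BB k : B k ∈ borel (X k) by apply: (sigma_bigcup (@borel_sigma V T (X k))) => // n; exact: DB.
pose (first k x n := n ∈ omega /\ x ∈ D k n /\ forall j, j ∈ n -> ~ x ∈ D k j).
pose (idx k x := ite (x ∈ B k) (the (model_struct T) (first k x)) emp).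
have idxP k x : x ∈ B k -> idx k x ∈ omega /\ x ∈ D k (idx k x).
  move=> Hx; rewrite /idx ite_true //; move: Hx; rewrite inB => -[n [Hn Hxn]].
  case: (@omega_least V T (fun n => x ∈ D k n) n) => // j [Hj Hxj Hmin].
  have -> : the (model_struct T) (first k x) = j; last by [].
  apply: theP => // l [Hl [Hxl Hmin']].
  by case: (omega_total Hj Hl) => [/Hmin|[//|/Hmin']].
have idx_omega k x : idx k x ∈ omega.
  case: (classic (x ∈ B k)) => Hx; first by case: (idxP k x Hx).
  by rewrite /idx ite_false.
have Hidx : forall k, definable_term (fun e => idx k (e 0%N)).
  by move=> k; rewrite /idx /B; dfn; rewrite /first; dfn.
clearbody idx B.
pose (F (k : player) := lam (car (X k)) (fun x : V => sel k (G ∙ idx k x) ∙ x)).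
exists (both B), (both F); split.
- move=> k; rewrite !sel_both; split=> //; apply: lam_fn; first by dfn.
  by move=> x Hx; case: (HN (idx k x) (idx_omega k x) k) => _ Hf _; apply: fn_app Hf Hx.
- move=> k x; rewrite !sel_both => Hx; case: (idxP k x Hx) => Hn Hxn.
  have HxX : x ∈ car (X k) by move: Hxn; rewrite inD => -[].
  rewrite /F lam_app //.
  case: (Dgood k _ x Hn Hxn) => -[_ _ HEx] H1; split=> //.
  case: (HN _ Hn k) => _ Hf _; have Hfx := fn_app Hf HxX; have Hm := prob_measure Hfx.
  rewrite (prob_rv Hfx (BB (other k))) -rv_one; congr rv; apply/eqP.
  rewrite eq_le (meas_le1 Hm) //=.
  have <- : re (sel k (G ∙ idx k x) ∙ x ∙ D (other k) (succ (idx k x))) = 1 by rewrite H1 -rv_one re_rv.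
  have HSn := succ_omega Hn.
  apply: (meas_mono Hm) => //; first exact: DB.
  by move=> y Hy; rewrite inB; exists (succ (idx k x)).
rewrite sel_both inB; exists emp; split=> //.
have H0 : D i emp ∈ borel (X i) by apply: DB.
apply: (Hs0 _ H0); case: (HN emp emp_omega i) => Hnu _ _.
by case: (Dfull i emp (sel i (N ∙ emp)) emp_omega Hnu) => // m Hm; case: (hQ m Hm) => _ /(_ emp emp_omega i).
Qed.

End BorelSelection.

(** * Rationalizability *)

Section Ordinals.

Context {V : Type} {T : model V}.
#[local] Hint Extern 0 (set_structure _) => exact (model_struct T) : typeclass_instances.

Lemma ordinal_mem a b : ordinal a -> b ∈ a -> ordinal b.
Proof. by move=> [H1 H2] Hb; split=> [|c Hc]; apply: H2 => //; apply: H1 Hc. Qed.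

Lemma ordinal_trans a b c : ordinal a -> b ∈ a -> c ∈ b -> c ∈ a.
Proof. by move=> [H _] Hb; apply: H. Qed.

Lemma ordinal_succ a : ordinal a -> ordinal (succ a).
Proof.
move=> [H1 H2]; split=> x.
  by rewrite in_succ => -[Hx|->] y Hy; rewrite in_succ; left=> //; apply: H1 Hy.
by rewrite in_succ => -[/H2|->].
Qed.

Lemma ordinal_ind (P : V -> Prop) : definable (fun e => P (e 0%N)) ->
  (forall a, ordinal a -> (forall b, b ∈ a -> P b) -> P a) -> forall a, ordinal a -> P a.
Proof.
move=> HP IH a Ha; apply: NNPP => HnP.
separate (succ a) (fun b => ~ P b) as B inB.
case: (zf_foundation (model_ZF T) (a := B)) => [|b].
  by exists a; rewrite inB in_succ; auto.
rewrite inB => -[[Hb HnPb] Hmin].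
have Hbo : ordinal b by apply: ordinal_mem (ordinal_succ Ha) Hb.
apply: HnPb; apply: IH => // c Hc; apply: NNPP => HnPc; apply: (Hmin c Hc); rewrite inB; split=> //.
exact: ordinal_trans (ordinal_succ Ha) Hb Hc.
Qed.

Lemma ordinal_total a b : ordinal a -> ordinal b -> a ∈ b \/ a = b \/ b ∈ a.
Proof.
move=> Ha; move: a Ha b.
apply: (@ordinal_ind (fun a => forall b, ordinal b -> a ∈ b \/ a = b \/ b ∈ a)); first by dfn.
move=> a Ha IHa; apply: (@ordinal_ind (fun b => a ∈ b \/ a = b \/ b ∈ a)); first by dfn.
move=> b Hb IHb; apply: NNPP => Hno'; apply: (Hno'); right; left; apply: (ext T) => x; split=> Hx.
  case: (IHa x Hx b Hb) => [//|[E|H]]; case: Hno'; right; right; first by rewrite -E.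
  exact: ordinal_trans H.
case: (IHb x Hx) => [H|[E|//]]; case: Hno'; left; last by rewrite E.
exact: ordinal_trans H.
Qed.

Lemma union_succ_ordinal a : ordinal a -> union (succ a) = a.
Proof.
move=> [Ha _]; apply: (ext T) => x; rewrite in_union; split.
  by move=> [b []]; rewrite in_succ => -[Hb|->] // Hx; apply: Ha Hx.
by move=> Hx; exists a; rewrite in_succ; auto.
Qed.

Lemma pred_ordinal a c : ordinal a -> a = succ c -> c ∈ a /\ ordinal c.
Proof.
move=> Ha E; have Hc : c ∈ a by rewrite E; apply: in_succ_self.
by split=> //; exact: ordinal_mem Ha Hc.
Qed.

End Ordinals.

Section Rationalizable.

Context {V : Type} {T : model V}.
#[local] Hint Extern 0 (set_structure _) => exact (model_struct T) : typeclass_instances.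
Local Notation R := (model_reals T).
Variable G : game V.
Local Notation X := (strategies G).
Local Notation br := (best_response R G).

Lemma term_rat_stage : definable_term (fun e => rat_stage R G (e 0%N)).
Proof. by rewrite /rat_stage /rat_sequence /rat_step; dfn. Qed.

Definition limit_value (b h : V) : V :=
  both (fun i => ⟦ s | s ∈ car (X i) /\ forall c, c ∈ b -> s ∈ sel i (h ∙ c) ⟧).

(** The three clauses of the recursion in one term, with [union b] as the predecessor of a successor
    ordinal b. *)
Definition stage_value (b h : V) : V :=
  ite (b = emp) (both (fun i => car (X i)))
    (ite (exists c, b = succ c) (rat_step R G (h ∙ union b)) (limit_value b h)).

Lemma term_stage_value : definable_term (fun e => stage_value (e 0%N) (e 1%N)).
Proof. by rewrite /stage_value /limit_value /rat_step; dfn. Qed.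

Lemma in_limit_value k b h x : (x ∈ sel k (limit_value b h)) =
  (x ∈ car (X k) /\ forall c, c ∈ b -> x ∈ sel k (h ∙ c)).
Proof. by rewrite sel_both; apply: (in_compr (car (X k))) => [|z []//]; dfn. Qed.

Lemma in_rat_step k A x : (x ∈ sel k (rat_step R G A)) =
  (x ∈ sel k A /\ exists mu, mu ∈ Prob R (X (other k)) /\
     measure_is R (X (other k)) mu (sel (other k) A) (one R) /\ ⟨x, mu⟩ ∈ br k).
Proof. by rewrite sel_both; apply: (in_compr (sel k A)) => [|z []//]; dfn. Qed.

Lemma stage_value_ext b h h' : ordinal b -> (forall c, c ∈ b -> h ∙ c = h' ∙ c) ->
  stage_value b h = stage_value b h'.
Proof.
move=> Hb E; rewrite /stage_value; case: (classic (b = emp)) => H0; first by rewrite !ite_true.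
rewrite !(@ite_false V T (b = emp) _ _ H0); case: (classic (exists c, b = succ c)) => H1.
  rewrite !ite_true //; case: H1 => c Ec; have [Hcb Hc] := pred_ordinal Hb Ec.
  by rewrite Ec union_succ_ordinal // E.
rewrite !(@ite_false V T _ _ _ H1) /limit_value /both; congr opair; apply: compr_eq => x;
  by split=> -[Hx H]; split=> // c Hc; have := H c Hc; rewrite E.
Qed.

Definition valued h a := fn_on h a /\ forall b, b ∈ a -> h ∙ b = stage_value b h.

Lemma valued_agree h a h' a' : ordinal a -> ordinal a' -> valued h a -> valued h' a' ->
  forall b, b ∈ a -> b ∈ a' -> h ∙ b = h' ∙ b.
Proof.
move=> Ha Ha' [_ Hh] [_ Hh'] b Hb; have Hbo := ordinal_mem Ha Hb; move: b Hbo Hb.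
apply: (@ordinal_ind V T (fun b => b ∈ a -> b ∈ a' -> h ∙ b = h' ∙ b)); first by dfn.
move=> b Hb IH Hba Hba'; rewrite Hh // Hh' //; apply: stage_value_ext => // c Hc.
by apply: IH => //; [apply: ordinal_trans Hba Hc|apply: ordinal_trans Hba' Hc].
Qed.

Lemma valued_ext h a h' : ordinal a -> valued h a -> valued h' a -> h = h'.
Proof.
move=> Ha H H'; have [[c Hf] _] := H; have [[c' Hf'] _] := H'.
by apply: (fn_ext Hf Hf') => x Hx; apply: (valued_agree Ha Ha H H').
Qed.

(** Transfinite recursion. By uniqueness the approximation on each b ∈ a is given by description,
    hence definable in b; the values that these approximations determine at b form the approximation
    on a. *)
Lemma valued_exists a : ordinal a -> exists h, valued h a.
Proof.
have Hsv := term_stage_value.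
move: a; apply: (@ordinal_ind V T (fun a => exists h, valued h a)); first by rewrite /valued; dfn.
move=> a Ha IH.
pose (H (b : V) := the (model_struct T) (fun h => valued h b)).
have Hd : definable_term (fun e => H (e 0%N)) by rewrite /H /valued; dfn.
have HH b : b ∈ a -> valued (H b) b.
  move=> Hb; case: (IH b Hb) => h Hh; have -> : H b = h; last by [].
  by apply: theP => // y Hy; apply: valued_ext Hy Hh; apply: ordinal_mem Hb.
exists (lam a (fun b => stage_value b (H b))); split; first by apply: lam_fn_on; dfn.
move=> b Hb; have Hbo := ordinal_mem Ha Hb; rewrite lam_app //.
apply: stage_value_ext => // c Hc.
have Hca := ordinal_trans Ha Hb Hc; have Hco := ordinal_mem Ha Hca.
rewrite lam_app //; case: (HH b Hb) => _ -> //.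
apply: stage_value_ext => // d Hd'.
by apply: (valued_agree Hbo Hco (HH b Hb) (HH c Hca)) => //; apply: ordinal_trans Hc Hd'.
Qed.

Lemma rat_sequence_valued h a : ordinal a -> rat_sequence R G h a <-> valued h a.
Proof.
move=> Ha; split=> -[Hf H]; split=> // b Hb; have Hbo := ordinal_mem Ha Hb.
  case: (H b Hb) => H0 [HS HL]; rewrite /stage_value.
  case: (classic (b = emp)) => E0; first by rewrite ite_true //; apply: H0.
  rewrite ite_false //; case: (classic (exists c, b = succ c)) => E1.
    rewrite ite_true //; case: E1 => c Ec; have [_ Hc] := pred_ordinal Hbo Ec.
    by rewrite (HS c Ec) Ec union_succ_ordinal.
  rewrite ite_false //; apply: HL; do 2!split=> //.
  by move=> c Ec; apply: E1; exists c.
rewrite H // /stage_value; split; first by move=> E0; rewrite ite_true.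
split=> [c Ec|[_ [E0 E1]]].
  have [_ Hc] := pred_ordinal Hbo Ec.
  rewrite ite_false; last by rewrite Ec; exact: succ_not_emp.
  by rewrite ite_true; [rewrite Ec union_succ_ordinal|exists c].
by rewrite ite_false // ite_false // => -[c Ec]; case: (E1 c).
Qed.

Lemma rat_stageE a h : ordinal a -> valued h (succ a) -> rat_stage R G a = h ∙ a.
Proof.
move=> Ha Hh; have HSa := ordinal_succ Ha; apply: theP.
  by exists h; split=> //; apply/(rat_sequence_valued _ HSa).
move=> A [h' [/(rat_sequence_valued _ HSa) Hh' ->]].
by apply: (valued_agree HSa HSa Hh' Hh); apply: in_succ_self.
Qed.

Lemma rat_stage_value a h : ordinal a -> valued h a -> rat_stage R G a = stage_value a h.
Proof.
move=> Ha Hh; have HSa := ordinal_succ Ha; case: (valued_exists HSa) => g Hg.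
rewrite (rat_stageE Ha Hg); case: (Hg) => _ ->; last exact: in_succ_self.
apply: stage_value_ext => // c Hc; apply: (valued_agree HSa Ha Hg Hh) => //.
by rewrite in_succ; left.
Qed.

Lemma valued_stage a h b : ordinal a -> valued h a -> b ∈ a -> h ∙ b = rat_stage R G b.
Proof.
move=> Ha Hh Hb; have Hbo := ordinal_mem Ha Hb.
case: (valued_exists Hbo) => g Hg; rewrite (rat_stage_value Hbo Hg).
case: (Hh) => _ -> //; apply: stage_value_ext => // c Hc.
by apply: (valued_agree Ha Hbo Hh Hg) => //; apply: ordinal_trans Hb Hc.
Qed.

Lemma ordinal_emp : ordinal emp.
Proof. by split=> x; rewrite in_emp. Qed.

Lemma stage_emp : rat_stage R G emp = both (fun i => car (X i)).
Proof.
case: (valued_exists ordinal_emp) => h Hh; rewrite (rat_stage_value ordinal_emp Hh).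
by rewrite /stage_value ite_true.
Qed.

Lemma stage_succ a : ordinal a -> rat_stage R G (succ a) = rat_step R G (rat_stage R G a).
Proof.
move=> Ha; have HSa := ordinal_succ Ha; case: (valued_exists HSa) => h Hh.
rewrite (rat_stage_value HSa Hh) /stage_value ite_false; last exact: succ_not_emp.
rewrite ite_true; last by exists a.
by rewrite union_succ_ordinal // (valued_stage HSa Hh) //; apply: in_succ_self.
Qed.

Lemma stage_cases a : ordinal a -> a = emp \/ (exists c, a = succ c /\ ordinal c) \/
  (forall k x, x ∈ sel k (rat_stage R G a) <-> x ∈ car (X k) /\ forall c, c ∈ a -> x ∈ sel k (rat_stage R G c)) /\
  exists F, rat_stage R G a = both F.
Proof.
move=> Ha; case: (classic (a = emp)) => E0; auto; right.
case: (classic (exists c, a = succ c)) => E1.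
  by case: E1 => c Ec; left; exists c; split=> //; case: (pred_ordinal Ha Ec).
right; case: (valued_exists Ha) => h Hh.
rewrite (rat_stage_value Ha Hh) /stage_value ite_false // ite_false //; split.
  move=> k x; rewrite in_limit_value; split=> -[Hx H]; split=> // c Hc.
    by rewrite -(valued_stage Ha Hh Hc); apply: H.
  by rewrite (valued_stage Ha Hh Hc); apply: H.
by rewrite /limit_value; eexists.
Qed.

Lemma stage_pair a : ordinal a -> exists F, rat_stage R G a = both F.
Proof.
move=> Ha; case: (stage_cases Ha) => [->|[[c [-> Hc]]|[_ //]]].
  by rewrite stage_emp; eexists.
by rewrite stage_succ // /rat_step; eexists.
Qed.

Lemma stage_decreasing a : ordinal a -> forall b, b ∈ a -> forall k,
  sel k (rat_stage R G a) ⊆ sel k (rat_stage R G b).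
Proof.
have Hst := term_rat_stage.
move: a; apply: (@ordinal_ind V T (fun a => forall b, b ∈ a -> forall k, sel k (rat_stage R G a) ⊆ sel k (rat_stage R G b))); first by dfn.
move=> a Ha IH b Hb k; case: (stage_cases Ha) => [E|[[c [Ec Hc]]|[H _]]].
- by rewrite E in_emp in Hb.
- rewrite Ec stage_succ // => x; rewrite in_rat_step => -[Hx _].
  move: Hb; rewrite Ec in_succ => -[Hb|-> //]; apply: (IH c) Hx => //.
  by rewrite Ec; apply: in_succ_self.
by move=> x /H [_]; apply.
Qed.

Lemma stage_car a k : ordinal a -> sel k (rat_stage R G a) ⊆ car (X k).
Proof.
move=> Ha; case: (classic (a = emp)) => [->|E]; first by rewrite stage_emp sel_both.
have H0 : emp ∈ a.
  case: (ordinal_total ordinal_emp Ha) => [//|[E'|]]; first by case: E.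
  by rewrite in_emp.
by move=> x /(stage_decreasing Ha H0); rewrite stage_emp sel_both.
Qed.

(** If no stage were stable, the stages would decrease strictly and the ordinals would embed in a
    set of pairs of subsets. By Replacement along the inverse map they would form a set, itself an
    ordinal and hence a member of itself. *)
Lemma stable_exists : exists a, rat_stable R G a.
Proof.
apply: NNPP => Hno.
have Hst := term_rat_stage.
have Hinj a b : ordinal a -> ordinal b -> rat_stage R G a = rat_stage R G b -> a = b.
  have Hlt c d : ordinal c -> ordinal d -> c ∈ d -> rat_stage R G c <> rat_stage R G d.
    move=> Hc Hd Hcd E; apply: Hno; exists c; split=> //.
    have HSc := ordinal_succ Hc.
    have Hle k : sel k (rat_stage R G (succ c)) = sel k (rat_stage R G c).
      apply: sub_antisym; first by apply: stage_decreasing => //; apply: in_succ_self.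
      rewrite E; case: (ordinal_total HSc Hd) => [H|[->//|]]; first exact: stage_decreasing.
      by rewrite in_succ => -[H|H]; [case: (mem_asym H Hcd)|rewrite H in Hcd; case: (mem_irrefl Hcd)].
    case: (stage_pair HSc) => F EF; case: (stage_pair Hc) => F' EF'.
    rewrite EF EF' /both; have := Hle P1; have := Hle P2; rewrite EF EF' !sel_both => -> ->//.
  move=> Ha Hb E; case: (ordinal_total Ha Hb) => [/(Hlt a b Ha Hb) //|[//|/(Hlt b a Hb Ha) H]].
  by case: H.
separate (Defs.prod (pow (car (X P1))) (pow (car (X P2)))) (fun A => exists a, ordinal a /\ A = rat_stage R G a) as C inC.
pose (inv (A : V) := the (model_struct T) (fun a => ordinal a /\ A = rat_stage R G a)).
have Hinv : definable_term (fun e => inv (e 0%N)) by rewrite /inv; dfn.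
have invK a : ordinal a -> inv (rat_stage R G a) = a.
  by move=> Ha; apply: theP => // b [Hb E]; apply: Hinj.
have inO a : (a ∈ image C inv) = ordinal a.
  rewrite in_image //; apply: propeq; split.
    by move=> [A [+ ->]]; rewrite inC => -[_ [b [Hb ->]]]; rewrite invK.
  move=> Ha; exists (rat_stage R G a); rewrite invK //; split=> //; rewrite inC; split; last by exists a.
  have HP1 := @stage_car a P1 Ha; have HP2 := @stage_car a P2 Ha.
  case: (stage_pair Ha) => F EF; rewrite EF !sel_both in HP1 HP2 *.
  by rewrite /both pair_in_prod !in_pow.
have : ordinal (image C inv).
  split=> a; rewrite inO => Ha; last by case: Ha.
  by move=> b Hb; rewrite inO; apply: ordinal_mem Hb.
by rewrite -inO; exact: mem_irrefl.
Qed.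

Definition postfixed (Z : player -> V) : Prop :=
  (forall k, Z k ⊆ car (X k)) /\
  forall k x, x ∈ Z k -> exists mu, [/\ mu ∈ Prob R (X (other k)),
    measure_is R (X (other k)) mu (Z (other k)) (one R) & ⟨x, mu⟩ ∈ br k].

Lemma postfixed_stage Z a : postfixed Z -> ordinal a -> forall k, Z k ⊆ sel k (rat_stage R G a).
Proof.
move=> [HZ1 HZ2].
have Hst := term_rat_stage.
move: a; apply: (@ordinal_ind V T (fun a => forall k, Z k ⊆ sel k (rat_stage R G a))); first by dfn.
move=> a Ha IH k; case: (stage_cases Ha) => [->|[[c [Ec Hc]]|[H _]]].
- by rewrite stage_emp sel_both.
- have Hca : c ∈ a by rewrite Ec; apply: in_succ_self.
  rewrite Ec stage_succ // => x Hx; rewrite in_rat_step; split; first exact: (IH c Hca k).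
  case: (HZ2 k x Hx) => mu [Hmu Hm Hbr]; exists mu; do 2!split=> //.
  move: Hm => /(full_borel Hmu) [_ [b [Hb HbZ Eb]]].
  apply/(full_borel Hmu); split; first exact: stage_car.
  by exists b; split=> //; apply: sub_trans HbZ _; apply: IH.
by move=> x Hx; apply/H; split=> [|c Hc]; [apply: (HZ1 k)|apply: (IH c Hc k)].
Qed.

(** The stable stage is post-fixed by stability and contains every post-fixed pair by induction on
    the stages. *)
Theorem RAT_postfixed i s : s ∈ RAT R G i <-> exists Z, postfixed Z /\ s ∈ Z i.
Proof.
have Hst := term_rat_stage.
case: stable_exists => a0 Ha0.
have [a [Ha Hmin]] : exists a, rat_stable R G a /\ forall b, b ∈ a -> ~ rat_stable R G b.
  have [Ho _] := Ha0; apply: NNPP => Hno.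
  have : ~ rat_stable R G a0; last by [].
  move: a0 Ho {Ha0}; apply: (@ordinal_ind V T (fun a => ~ rat_stable R G a)).
    by rewrite /rat_stable; dfn.
  by move=> a Ha IH Hs; apply: Hno; exists a.
have [Hao Hstable] := Ha.
have E : RAT R G i = sel i (rat_stage R G a).
  apply: theP; first by exists a.
  move=> A [b [Hb [Hbmin ->]]]; case: (ordinal_total Hao (proj1 Hb)) => [/Hbmin //|[->//|/Hmin //]].
rewrite E; split=> [Hs|[Z [HZ Hs]]]; last exact: (postfixed_stage HZ Hao).
exists (fun k => sel k (rat_stage R G a)); split=> //; split=> [k|k x]; first exact: stage_car.
rewrite -{1}Hstable stage_succ // in_rat_step => -[_ [mu [H1 [H2 H3]]]].
by exists mu.
Qed.

End Rationalizable.

(** * The Gale-Stewart game *)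

Section GaleStewart.

Context {V : Type} {T : model V}.
#[local] Hint Extern 0 (set_structure _) => exact (model_struct T) : typeclass_instances.
Local Notation R := (model_reals T).
Variable G : game V.
Hypothesis HX : forall k, polish R (strategies G k).
Local Notation X := (strategies G).
Local Notation br := (best_response R G).
Local Notation postfixed := (@postfixed V T G).
Local Notation moves := (cup (car (X P1)) (car (X P2))).

Lemma in_best_response k p : p ∈ br k -> exists s mu, [/\ p = ⟨s, mu⟩, s ∈ car (X k) & mu ∈ Prob R (X (other k))].
Proof.
have -> : (p ∈ br k) = (exists s mu, p = ⟨s, mu⟩ /\ s ∈ car (X k) /\ mu ∈ Prob R (X (other k)) /\
    forall s', s' ∈ car (X k) -> Defs.le R (expected_payoff R G k s' mu) (expected_payoff R G k s mu)).
  apply: (in_compr (Defs.prod (car (X k)) (Prob R (X (other k))))).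
    by rewrite /expected_payoff /payoff; case: k => /=; dfn.
  by move=> z [x [mu [-> [Hx [Hmu _]]]]]; rewrite pair_in_prod.
by move=> [x [mu [-> [Hx [Hmu _]]]]]; exists x, mu.
Qed.

Lemma best_response_pair k x mu : ⟨x, mu⟩ ∈ br k -> x ∈ car (X k) /\ mu ∈ Prob R (X (other k)).
Proof. by move/in_best_response => [x' [mu' [/opair_inj [-> ->] H1 H2]]]. Qed.

Lemma car_moves k x : x ∈ car (X k) -> x ∈ moves.
Proof. by rewrite in_cup; case: k; auto. Qed.

Lemma even_step n : n ∈ omega -> rec emp (fun _ p => diff (succ emp) p) n = emp \/
  rec emp (fun _ p => diff (succ emp) p) n = succ emp.
Proof.
move: n; apply: omega_ind; first by dfn.
  by left; rewrite rec0 //; dfn.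
move=> n Hn H; rewrite recS //; case: H => ->; [right|left]; apply: (ext T) => x;
  by rewrite in_diff ?in_emp; tauto.
Qed.

Lemma even_emp : Defs.even emp.
Proof. by rewrite /Defs.even rec0 //; dfn. Qed.

Lemma even_succ n : n ∈ omega -> Defs.even (succ n) <-> ~ Defs.even n.
Proof.
move=> Hn; rewrite /Defs.even recS //.
case: (even_step Hn) => ->; split=> // H.
- have : emp ∈ diff (succ emp) emp by rewrite in_diff in_succ in_emp; split; auto.
  by rewrite H in_emp.
- exact: succ_not_emp.
by apply: (ext T) => x; rewrite in_diff in_emp; tauto.
Qed.

Variables (i : player) (s : V).
Hypothesis Hs : s ∈ car (X i).

Lemma turn_exists n : exists k, gs_turn i n k.
Proof. by case: (classic (Defs.even n)) => H; [exists i|exists (other i)]; [left|right]. Qed.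

Lemma turn_uniq n k l : gs_turn i n k -> gs_turn i n l -> k = l.
Proof. by move=> [[H1 ->]|[H1 ->]] [[H2 ->]|[H2 ->]]. Qed.

Lemma turn_succ n k : n ∈ omega -> gs_turn i n k -> gs_turn i (succ n) (other k).
Proof.
move=> Hn; rewrite /gs_turn (propeq (even_succ Hn)) => -[[H ->]|[H ->]].
  by right; split=> // H'; apply: H'.
by left; rewrite other_other.
Qed.

Lemma gs_point0 y : gs_point s y emp = s.
Proof.
apply: theP; first by left.
by move=> x [[_ ->]//|[m [_ [E _]]]]; case: (succ_not_emp (esym E)).
Qed.

Lemma gs_pointS y n : n ∈ omega -> gs_point s y (succ n) = y ∙ n.
Proof.
move=> Hn; apply: theP; first by right; exists n.
by move=> x [[/succ_not_emp //]|[m [_ [/succ_inj <- ->]]]].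
Qed.

(** The length of a finite sequence: a strategy is given the sequence of moves alone and has to
    recover the stage from it. *)
Definition dom (u : V) : V := the (model_struct T) (fun n => fn_on u n).

Lemma dom_fn u n a : fn u n a -> dom u = n.
Proof.
move=> Hu; apply: theP; first by exists a.
move=> m [b Hb]; apply: (ext T) => x; split=> Hx.
  exact: (fn_dom Hu (app_in Hb Hx)).
exact: (fn_dom Hb (app_in Hu Hx)).
Qed.

Lemma point_restrict y n m : fn y omega moves -> n ∈ omega -> m ∈ succ n ->
  gs_point s (restrict y n) m = gs_point s y m.
Proof.
move=> Hy Hn Hm; have Hmo := omega_trans (succ_omega Hn) Hm.
case: (omega_case Hmo) => [->|[j [Hj Ej]]]; first by rewrite !gs_point0.
rewrite Ej !gs_pointS // (restrict_app Hy) //; first by move=> x; apply: omega_trans.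
have Hjm : j ∈ m by rewrite Ej; apply: in_succ_self.
by move: Hm; rewrite in_succ => -[Hm|<- //]; apply: omega_mem_trans Hm Hjm.
Qed.

Lemma in_finite_sequences a u : (u ∈ finite_sequences a) = (exists n, n ∈ omega /\ fn u n a).
Proof.
apply: (in_compr (pow (Defs.prod omega a))); first by dfn.
move=> z [n [Hn Hz]]; rewrite in_pow => w; rewrite (in_fn _ Hz) => -[x [Hx ->]].
by rewrite pair_in_prod; split; [apply: omega_trans Hx|apply: fn_app Hz Hx].
Qed.

Lemma I_wins_of_postfixed Z : postfixed Z -> s ∈ Z i -> gs_I_wins R G br i s.
Proof.
move=> [HZ1 HZ2] HsZ.
case: (@borel_selection V T X (fun k x mu => ⟨x, mu⟩ ∈ br k) Z HX _ HZ1 HZ2 i s HsZ) => // B [F [HBF HBE HsB]].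
(* The value of f at the player to move at stage n. Players are not elements of V, so the case
   distinction is made by a term in n. *)
pose (k0 (n : V) (f : player -> V) := ite (Defs.even n) (f i) (f (other i))).
have k0E n k f : gs_turn i n k -> k0 n f = f k.
  by rewrite /k0 => -[[H ->]|[H ->]]; [rewrite ite_true|rewrite ite_false].
pose (mv (u : V) := k0 (dom u) (fun k => ⟨sel k F ∙ gs_point s u (dom u), sel (other k) B⟩)).
have Hmv : definable_term (fun e => mv (e 0%N)) by rewrite /mv /k0 /dom /gs_point; dfn.
exists (lam (finite_sequences moves) mv); split; first exact: lam_fn_on.
move=> y Hy.
have sub_omega n : n ∈ omega -> n ⊆ omega by move=> Hn x; apply: omega_trans.
have sigmaE n k : n ∈ omega -> gs_turn i n k ->
    lam (finite_sequences moves) mv ∙ restrict y n = ⟨sel k F ∙ gs_point s y n, sel (other k) B⟩.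
  move=> Hn Hk; have Hr := restrict_fn Hy (sub_omega n Hn).
  rewrite lam_app //; last by rewrite in_finite_sequences; exists n.
  rewrite /mv (dom_fn Hr) (k0E n k) // point_restrict //; exact: in_succ_self.
move=> n Hn Hleg.
have [k Hk] := turn_exists n.
(* At the start this is [HsB]; later the Borel set that I announced at the previous stage was B for
   the player now to move, and II answered inside it. *)
have HxB : gs_point s y n ∈ sel k B.
  case: (omega_case Hn) => [E|[m [Hm E]]].
    rewrite E gs_point0; suff -> : k = i by [].
    by apply: turn_uniq Hk _; rewrite E; left; split=> //; exact: even_emp.
  have [l Hl] := turn_exists m.
  have Hmn : m ∈ n by rewrite E; apply: in_succ_self.
  case: (Hleg m Hmn) => _ [mu [b [Emb Hb]]].
  move: Emb; rewrite (sigmaE m l Hm Hl) => /opair_inj [_ Eb].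
  have Ekl : k = other l by apply: turn_uniq Hk _; rewrite E; apply: turn_succ.
  by rewrite Ekl Eb E.
exists (sel k F ∙ gs_point s y n), (sel (other k) B); split; first exact: sigmaE.
move=> l Hl; have <- := turn_uniq Hk Hl.
case: (HBE k _ HxB) => H1 H2; case: (best_response_pair H1) => _ Hmu.
by do !split=> //; case: (HBF (other k)).
Qed.

(* Z_k consists of the points at which k may have to move in a legal play
   against the winning strategy. *)
Lemma postfixed_of_I_wins : gs_I_wins R G br i s -> exists Z, postfixed Z /\ s ∈ Z i.
Proof.
move=> [sigma [_ Hwin]].
pose (legal (y n : V) := gs_legal_I R G br i s sigma y n /\ gs_legal_II s sigma y n).
have Hlegal : definable (fun e => legal (e 0%N) (e 1%N)).
  by rewrite /legal /gs_legal_I /gs_legal_II /gs_turn /gs_point; dfn.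
pose (Q (k : player) (x : V) := exists y n, [/\ fn y omega moves, n ∈ omega, forall m, m ∈ n -> legal y m &
   gs_turn i n k /\ x = gs_point s y n]).
have HQ k : definable (fun e => Q k (e 0%N)).
  by rewrite /Q /gs_turn /gs_point; clearbody legal; dfn.
have [Z inZ] : exists Z : player -> V, forall k x, (x ∈ Z k) = (x ∈ car (X k) /\ Q k x).
  have [Z1 H1] := @separation V T (car (X P1)) _ (HQ P1).
  have [Z2 H2] := @separation V T (car (X P2)) _ (HQ P2).
  by exists (fun k => match k with P1 => Z1 | P2 => Z2 end) => -[].
have HZX k : Z k ⊆ car (X k) by move=> x; rewrite inZ => -[].
exists Z; split; last first.
  rewrite inZ; split=> //; exists (lam omega (fun _ => s)), emp; split=> //.
  - by apply: lam_fn => // x _; apply: car_moves Hs.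
  - by move=> m; rewrite in_emp.
  - by split; [left; split=> //; exact: even_emp|rewrite gs_point0].
split=> // k x; rewrite inZ => -[Hx [y [n [Hy Hn Hleg [Hk Ex]]]]].
case: (Hwin y Hy n Hn Hleg) => mu [b [Esig /(_ k Hk) [Hmu [Hbr [Hb Eb]]]]].
exists mu; rewrite Ex; split=> //; apply/(full_borel Hmu); split; first exact: HZX.
have HbX := sigma_sub (@borel_sigma V T (X (other k))) Hb.
exists b; split=> // x' Hx'; rewrite inZ; split; first exact: HbX.
(* II answers x' at stage n. The moves of II before n are unchanged, so the moves of I up to stage n
   are the same as along y. *)
pose (y' := lam omega (fun m => ite (m = n) x' (y ∙ m))).
have Hy' : fn y' omega moves.
  apply: lam_fn => // m Hm; case: (classic (m = n)) => E.
    by rewrite ite_true //; apply: (car_moves (k := other k)); apply: HbX.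
  by rewrite ite_false //; apply: fn_app Hy Hm.
have yE m : m ∈ n -> y' ∙ m = y ∙ m.
  move=> Hm; rewrite /y' lam_app // ?ite_false //; last exact: omega_trans Hn Hm.
  by move=> E; rewrite E in Hm; case: (mem_irrefl Hm).
have resE m : m ∈ succ n -> restrict y' m = restrict y m.
  move=> Hm; have Hmo := omega_trans (succ_omega Hn) Hm.
  apply: (restrict_ext Hy' Hy); first by move=> z; apply: omega_trans.
  move=> z Hz; apply: yE; move: Hm; rewrite in_succ => -[Hm|<- //].
  exact: omega_mem_trans Hn Hm Hz.
have ptE m : m ∈ succ n -> gs_point s y' m = gs_point s y m.
  move=> Hm; have Hmo := omega_trans (succ_omega Hn) Hm.
  by rewrite -(point_restrict Hy' Hmo (in_succ_self m)) resE // point_restrict //; apply: in_succ_self.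
have Ey'n : y' ∙ n = x' by rewrite /y' lam_app // ite_true.
have legI m : m ∈ succ n -> gs_legal_I R G br i s sigma y m -> gs_legal_I R G br i s sigma y' m.
  by move=> Hm; rewrite /gs_legal_I resE // ptE.
exists y', (succ n); split=> //; first exact: succ_omega.
- move=> m; rewrite in_succ => -[Hm|->].
    case: (Hleg m Hm) => H1 H2; split; first by apply: legI => //; rewrite in_succ; left.
    move: H2; rewrite /gs_legal_II resE; last by rewrite in_succ; left.
    by rewrite ptE //; apply: succ_mem.
  split; first by apply: legI; [apply: in_succ_self|apply: Hwin].
  exists mu, b; rewrite resE; last by apply: in_succ_self.
  by rewrite gs_pointS // Ey'n.
- by split; [apply: turn_succ|rewrite gs_pointS].
Qed.

Theorem gale_stewart : gs_I_wins R G br i s <-> exists Z, postfixed Z /\ s ∈ Z i.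
Proof. by split=> [|[Z [HZ HsZ]]]; [exact: postfixed_of_I_wins|exact: I_wins_of_postfixed HZ HsZ]. Qed.

End GaleStewart.

(** * Continuous maps and Borel graphs *)

Section Maps.

Context {V : Type} {T : model V}.
#[local] Hint Extern 0 (set_structure _) => exact (model_struct T) : typeclass_instances.
Local Notation R := (model_reals T).
Local Notation re := (@re V T).
Local Notation rv := (@rv V T).
Local Notation open_set := (@open_set V T).

Definition continuous S S' (h : V -> V) : Prop :=
  (forall x, x ∈ car S -> h x ∈ car S') /\ forall u, u ∈ opens S' -> preim (car S) h u ∈ opens S.

Lemma continuous_generated S X B h : is_topology (car S) (opens S) ->
  definable_term (fun e => h (e 0%N)) -> (forall x, x ∈ car S -> h x ∈ X) -> B ⊆ pow X ->
  (forall w, w ∈ B -> preim (car S) h w ∈ opens S) -> continuous S (generated_space X B) h.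
Proof.
move=> HS Hh HX HB HBo; split; first by move=> x; rewrite car_generated; apply: HX.
move=> u Hu.
have H : open_set S (fun x => h x ∈ u).
  apply: (open_local HS) => // x Hx Hxu.
  have : exists w, [/\ w ∈ opens S, x ∈ w & forall y, y ∈ w -> h y ∈ u]; last by [].
  apply: (@generated_open_ind V T X B (fun u z => z = h x -> exists w, [/\ w ∈ opens S, x ∈ w & forall y, y ∈ w -> h y ∈ u]) u (h x)) => //.
  - move=> v z Hv Hz Ez; exists (preim (car S) h v); split; first exact: HBo.
      by rewrite in_preim // -Ez.
    by move=> y; rewrite in_preim // => -[].
  - move=> z Hz Ez; exists (car S); split=> //; exact: topology_total.
  - move=> v v' z _ _ H1 H2 Ez; case: (H1 Ez) => w [Hw Hxw Hwv]; case: (H2 Ez) => w' [Hw' Hxw' Hwv'].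
    exists (cap w w'); split; [exact: topology_cap|by rewrite in_cap|].
    by move=> y; rewrite !in_cap => -[/Hwv H3 /Hwv' H4].
  - move=> v v' z Hvv' _ H1 Ez; case: (H1 Ez) => w [Hw Hxw Hwv]; exists w; split=> // y /Hwv /Hvv'; exact.
case: H => w [Hw Hwx]; have -> : preim (car S) h u = w; last by [].
by apply: (ext T) => x; rewrite in_preim // (propeq (Hwx x)).
Qed.

Lemma continuous_prod S A B h h1 h2 : is_topology (car S) (opens S) ->
  is_topology (car A) (opens A) -> is_topology (car B) (opens B) ->
  definable_term (fun e => h (e 0%N)) -> definable_term (fun e => h1 (e 0%N)) ->
  definable_term (fun e => h2 (e 0%N)) -> (forall x, x ∈ car S -> h x = ⟨h1 x, h2 x⟩) ->
  continuous S A h1 -> continuous S B h2 -> continuous S (prod_space A B) h.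
Proof.
move=> HS HA HB Hh Hh1 Hh2 E [H1 H1'] [H2 H2']; rewrite prod_spaceE.
apply: (continuous_generated HS Hh); first by move=> x Hx; rewrite E // pair_in_prod; split; auto.
  exact: (@rectangles_sub V T A B HA HB).
move=> w; rewrite in_rectangles // => -[u [v [Hu [Hv ->]]]].
have -> : preim (car S) h (Defs.prod u v) = cap (preim (car S) h1 u) (preim (car S) h2 v).
  apply: (ext T) => x; rewrite in_cap !in_preim //; split.
    by move=> [Hx]; rewrite E // pair_in_prod; tauto.
  by move=> [[Hx H3] [_ H4]]; split=> //; rewrite E // pair_in_prod.
by apply: (topology_cap HS); auto.
Qed.

Lemma preim_borel S S' h : is_topology (car S) (opens S) -> is_topology (car S') (opens S') -> definable_term (fun e => h (e 0%N)) ->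
  continuous S S' h -> forall b, b ∈ borel S' -> preim (car S) h b ∈ borel S.
Proof.
move=> HS HS' Hh [HX Hpre] b Hb; have HA := @borel_sigma V T S.
have inp c x : (x ∈ preim (car S) h c) = (x ∈ car S /\ h x ∈ c) by rewrite in_preim.
separate (pow (car S')) (fun b => preim (car S) h b ∈ borel S) as B inB.
have HB : sigma_algebra (car S') B.
  split; first by move=> x; rewrite inB => -[].
  split.
    rewrite inB in_pow; split=> //.
    have -> : preim (car S) h (car S') = car S; last exact: (sigma_total HA).
    by apply: (ext T) => x; rewrite inp; split=> [[]|H] //; split=> //; exact: HX.
  split=> [c|f Hf]; rewrite inB.
    move=> [Hc Hc']; rewrite inB in_pow; split; first by move=> x; rewrite in_diff => -[].
    have -> : preim (car S) h (diff (car S') c) = diff (car S) (preim (car S) h c); last exact: (sigma_compl HA).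
    apply: (ext T) => x; rewrite inp !in_diff inp; split=> [[Hx [_ H]]|[Hx H]].
      by split=> // -[].
    by split=> //; split; [exact: HX|move=> H'; apply: H].
  split.
    rewrite in_pow => x; rewrite in_Union_seq => -[n [Hn Hx]].
    by have := fn_app Hf Hn; rewrite inB in_pow => -[H _]; apply: H.
  have -> : preim (car S) h (Union_seq f) = bigcup (fun n => preim (car S) h (f ∙ n)).
    apply: (ext T) => x; rewrite inp in_Union_seq in_bigcup //; split.
      by move=> [Hx [n [Hn Hxn]]]; exists n; rewrite inp.
    by move=> [n [Hn]]; rewrite inp => -[Hx Hxn]; split=> //; exists n.
  by apply: (sigma_bigcup HA) => // n Hn; have := fn_app Hf Hn; rewrite inB => -[].
move: Hb; rewrite in_borel => -[Hb Hb'].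
have : b ∈ B; last by rewrite inB => -[].
apply: Hb' => // u Hu; rewrite inB; split; last by apply: open_borel; [case: HS|apply: Hpre].
by case: HS' => H _; apply: H.
Qed.

Lemma car_subspace S a : car (subspace S a) = a. Proof. exact: car_pair. Qed.

Lemma in_subspace_opens S a w : a ⊆ car S -> (w ∈ opens (subspace S a)) = (exists u, u ∈ opens S /\ w = cap u a).
Proof.
move=> Ha; rewrite opens_pair; apply: (in_compr (pow a)); first by dfn.
by move=> z [u [_ ->]]; rewrite in_pow => x; rewrite in_cap => -[].
Qed.

Lemma subspace_topology S a : is_topology (car S) (opens S) -> a ⊆ car S ->
  is_topology (car (subspace S a)) (opens (subspace S a)).
Proof.
move=> HS Ha; rewrite car_subspace; have inO := fun w => in_subspace_opens w Ha.
split; first by move=> w; rewrite inO => -[u [_ ->]]; rewrite in_pow => x; rewrite in_cap => -[].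
split; first by rewrite inO; exists emp; split; [exact: topology_emp|apply: (ext T) => x; rewrite in_cap in_emp; tauto].
split.
  rewrite inO; exists (car S); split; first exact: topology_total.
  by apply: (ext T) => x; rewrite in_cap; split=> [Hx|[]] //; split=> //; apply: Ha.
split=> [u v|U HU]; rewrite !inO.
  move=> [u' [Hu ->]] [v' [Hv ->]]; exists (cap u' v'); split; first exact: topology_cap.
  by apply: (ext T) => x; rewrite !in_cap; tauto.
separate (opens S) (fun u => cap u a ∈ U) as U' inU'.
exists (union U'); split; first by apply: topology_union => // u; rewrite inU' => -[].
apply: (ext T) => x; rewrite in_cap !in_union; split.
  move=> [w [Hw Hx]]; have := HU w Hw; rewrite inO => -[u [Hu Ew]]; move: Hx; rewrite Ew in_cap => -[Hxu Hxa].
  by split=> //; exists u; rewrite inU' -Ew.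
move=> [[u []]]; rewrite inU' => -[Hu HuU] Hxu Hxa; exists (cap u a); split=> //.
by rewrite in_cap.
Qed.

(** * Borel sets of a subspace *)

Section Trace.

Variables S1 S2 a : V.
Hypotheses (HS1 : is_topology (car S1) (opens S1)) (HS2 : is_topology (car S2) (opens S2))
  (Ha : a ⊆ car S2).
Local Notation P := (prod_space S1 S2).
Local Notation Q := (prod_space S1 (subspace S2 a)).

Let HP : is_topology (car P) (opens P) := @prod_topology V T S1 S2.
Let HQ : is_topology (car Q) (opens Q) := @prod_topology V T S1 (subspace S2 a).
Let HS2a : is_topology (car (subspace S2 a)) (opens (subspace S2 a)) := subspace_topology HS2 (@Ha).

Lemma car_trace : car Q = Defs.prod (car S1) a.
Proof. by rewrite car_prod car_subspace. Qed.

Lemma trace_sub : car Q ⊆ car P.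
Proof.
move=> z; rewrite car_trace car_prod !in_prod => -[x [y [Hx [Hy ->]]]].
by exists x, y; do 2!split=> //; apply: Ha.
Qed.

Lemma inclusion_continuous : continuous Q P (fun z => z).
Proof.
rewrite (prod_spaceE S1 S2); apply: (continuous_generated HQ) => //.
- by move=> z /trace_sub; rewrite car_prod.
- exact: (@rectangles_sub V T S1 S2 HS1 HS2).
move=> w; rewrite in_rectangles // => -[u [v [Hu [Hv ->]]]].
have -> : preim (car Q) (fun z => z) (Defs.prod u v) = Defs.prod u (cap v a).
  apply: (ext T) => z; rewrite in_preim // car_trace; split.
    move=> [/prodP [Ez _ H1] /prodP [_ H2 H3]]; rewrite Ez pair_in_prod in_cap //.
  move=> /prodP [Ez H1]; rewrite in_cap => -[H2 H3]; rewrite Ez !pair_in_prod.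
  by do !split=> //; apply: (topology_sub HS1 Hu).
by apply: rectangle_open => //; rewrite in_subspace_opens //; exists v.
Qed.

Lemma borel_trace c : c ∈ borel P -> cap c (car Q) ∈ borel Q.
Proof.
move=> Hc; have := preim_borel HQ HP _ inclusion_continuous Hc.
have -> : preim (car Q) (fun z => z) c = cap c (car Q).
  by apply: (ext T) => z; rewrite in_preim // in_cap; tauto.
by apply; dfn.
Qed.

(** The traces of Borel sets of P form a σ-algebra on Q containing its open sets. Hence a measure on
    Q is determined by its values on traces, which is how beliefs about worlds are specified. *)
Lemma trace_exists b : b ∈ borel Q -> exists c, c ∈ borel P /\ b = cap c (car Q).
Proof.
pose proof (@borel_sigma V T P) as HA.
separate (pow (car Q)) (fun b => exists c, c ∈ borel P /\ b = cap c (car Q)) as B inB.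
rewrite in_borel => -[Hb H]; have : b ∈ B; last by rewrite inB => -[].
apply: H.
  split; first by move=> x; rewrite inB => -[].
  split.
    rewrite inB in_pow; split=> //; exists (car P); split; first exact: (sigma_total HA).
    by apply: (ext T) => x; rewrite in_cap; split=> [Hx|[]] //; split=> //; apply: trace_sub.
  split=> [d|f Hf].
    rewrite !inB => -[_ [c [Hc Ed]]]; split; first by rewrite in_pow => x; rewrite in_diff => -[].
    exists (diff (car P) c); split; first exact: (sigma_compl HA).
    apply: (ext T) => x; rewrite in_cap !in_diff Ed in_cap; have := @trace_sub x; tauto.
  case: (@countable_choice V T (borel P) (fun n c => f ∙ n = cap c (car Q))) => //.
    by move=> n Hn; have := fn_app Hf Hn; rewrite inB => -[_ [c [Hc E]]]; exists c.
  move=> g [Hg Hgf]; rewrite inB; split.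
    rewrite in_pow => x; rewrite in_Union_seq => -[n [Hn]]; rewrite (Hgf n Hn) in_cap => -[].
    by [].
  exists (bigcup (app g)); split; first by apply: (sigma_bigcup HA) => // n Hn; apply: fn_app Hg Hn.
  apply: (ext T) => x; rewrite in_cap in_Union_seq in_bigcup //; split.
    by move=> [n [Hn]]; rewrite (Hgf n Hn) in_cap => -[H1 H2]; split=> //; exists n.
  by move=> [[n [Hn Hx]] Hxq]; exists n; rewrite (Hgf n Hn) in_cap.
have HT : is_topology (car Q) (opens (subspace P (car Q))).
  by have := subspace_topology HP (@trace_sub); rewrite car_subspace.
move=> u Hu.
have : u ∈ opens (subspace P (car Q)).
  move: Hu; rewrite {1}prod_spaceE in_generated_opens => -[_]; apply; first by rewrite -car_prod.
  move=> w; rewrite in_rectangles // => -[u1 [v1 [Hu1 [+ ->]]]].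
  rewrite in_subspace_opens // => -[v [Hv ->]].
  rewrite in_subspace_opens; last by move=> z; exact: trace_sub.
  exists (Defs.prod u1 v); split; first exact: rectangle_open.
  apply: (ext T) => z; rewrite in_cap car_trace; split.
    move=> /prodP [Ez H1]; rewrite in_cap => -[H2 H3]; rewrite Ez !pair_in_prod.
    by do !split=> //; apply: (topology_sub HS1 Hu1).
  by move=> [/prodP [Ez H1 H2] /prodP [_ _ H3]]; rewrite Ez pair_in_prod in_cap.
rewrite in_subspace_opens; last by move=> z; exact: trace_sub.
move=> [v [Hv Eu]]; rewrite inB; split; first by case: HQ => HQ1 _; apply: HQ1.
by exists v; split=> //; apply: open_borel => //; case: HP.
Qed.

End Trace.

Section Images.

Variables S mu : V.
Hypotheses (HP : polish R S) (Hmu : mu ∈ Prob R S).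
Local Notation X := (car S).

(** Functoriality of images for q = p ∘ h, with p a Borel map and h and q arbitrary definable
    maps. *)
Lemma image_push S' S'' (h p q : V -> V) : definable_term (fun e => h (e 0%N)) ->
  definable_term (fun e => p (e 0%N)) -> definable_term (fun e => q (e 0%N)) ->
  (forall x, x ∈ X -> h x ∈ car S') -> (forall x, x ∈ X -> p (h x) = q x) ->
  (forall z, z ∈ car S' -> p z ∈ car S'') ->
  (forall b, b ∈ borel S'' -> preim (car S') p b ∈ borel S') ->
  image_measure S' S'' p (push R S mu S' h) = push R S mu S'' q.
Proof.
move=> Hh Hp Hq HhX Hpq HpX Hpre; apply: lam_eq => b Hb.
rewrite (push_app HP Hmu Hh (Hpre b Hb)) -(measure_rv Hmu); last first.
  by apply: polish_measurable => // x; rewrite in_preim // => -[].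
congr (measure _ _ _ _); apply: (ext T) => x; rewrite !in_preim //; split.
  by move=> [Hx [_]]; rewrite Hpq.
by move=> [Hx H]; split=> //; split; [exact: HhX|rewrite Hpq].
Qed.

Lemma push_id : push R S mu S (fun x => x) = mu.
Proof.
have Hp : push R S mu S (fun x => x) ∈ Prob R S by apply: push_prob.
apply: (@prob_ext V T S) => // b Hb; rewrite push_app //.
have [_ E] := completion_borel Hmu Hb; rewrite (prob_rv Hmu Hb) -E; congr (rv (re (measure _ _ _ _))).
apply: (ext T) => x; rewrite in_preim //; split=> [[]|Hx] //; split=> //.
by apply: (sigma_sub (@borel_sigma V T S) Hb).
Qed.

(* The preimage of U_n agrees with a Borel set b_n on a Borel set of measure
   one, over which the graph is {(x, y) : x ∈ b_n <-> y ∈ U_n for all n}. *)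
Lemma graph_borel S' (U : V) (g : V -> V) B0 : is_topology (car S') (opens S') ->
  fn U omega (borel S') -> (forall x y, x ∈ car S' -> y ∈ car S' ->
     (forall n, n ∈ omega -> x ∈ U ∙ n <-> y ∈ U ∙ n) -> x = y) ->
  definable_term (fun e => g (e 0%N)) -> (forall x, x ∈ X -> g x ∈ car S') ->
  B0 ∈ borel S -> mu ∙ B0 = one R ->
  exists Gr, [/\ Gr ∈ borel (prod_space S S'),
    forall z, z ∈ Gr -> exists x, x ∈ B0 /\ z = ⟨x, g x⟩ &
    push R S mu (prod_space S S') (fun x => ⟨x, g x⟩) ∙ Gr = one R].
Proof.
move=> HS' HU Hsep Hg HgX HB0 EB0; case: (polish_nice HP) => HS _ _.
have HA := @borel_sigma V T S; have Hm := prob_measure Hmu.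
pose proof (@borel_sigma V T (prod_space S S')) as HAP.
have HPt := @prod_topology V T S S'.
have B1 b : b ∈ borel S -> preim (car (prod_space S S')) pi1 b ∈ borel (prod_space S S').
  apply: (preim_borel HPt HS) => //; split; first by move=> z; exact: pi1_car.
  by move=> u; exact: preim_pi1_open.
have B2 b : b ∈ borel S' -> preim (car (prod_space S S')) pi2 b ∈ borel (prod_space S S').
  apply: (preim_borel HPt HS') => //; split; first by move=> z; exact: pi2_car.
  by move=> u; exact: preim_pi2_open.
have Hd1 : definable_term (fun e => preim (car (prod_space S S')) pi1 (pi1 (e 0%N))) by dfn.
case: (@countable_choice V T (Defs.prod (borel S) (borel S)) (fun n q => mu ∙ pi2 q = one R /\
   forall x, x ∈ pi2 q -> x ∈ pi1 q <-> g x ∈ U ∙ n)) => //.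
  move=> n Hn; have HY : preim X g (U ∙ n) ⊆ X by move=> x; rewrite in_preim // => -[].
  have HC := polish_measurable HP Hmu HY.
  case: (completion_inner Hmu HC) => b [Hb HbY Eb]; case: (completion_outer Hmu HC) => c [Hc HYc Ec].
  have Hcb := sigma_diff HA Hc Hb; have Hd := sigma_compl HA Hcb.
  (* Off the null set c \ b, membership in the inner set b agrees with membership in the preimage of
     U_n. *)
  exists ⟨b, diff X (diff c b)⟩; rewrite pair_in_prod pi1_pair pi2_pair; split=> //; split.
    rewrite (prob_rv Hmu Hd) (meas_compl Hm) // -rv_one; congr rv.
    have := meas_split Hm Hc Hb; have -> : cap c b = b.
      by apply: (ext T) => x; rewrite in_cap; split=> [[]|Hx] //; split=> //; apply: HYc; apply: HbY.
    by rewrite Eb Ec => E; lra.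
  move=> x; rewrite !in_diff => -[Hx Hno]; split=> H.
    by have := HbY x H; rewrite in_preim // => -[].
  apply: NNPP => Hxb; apply: Hno; split=> //; apply: HYc; by rewrite in_preim.
move=> f [Hf Hfn].
have Hfb n : n ∈ omega -> pi1 (f ∙ n) ∈ borel S /\ pi2 (f ∙ n) ∈ borel S.
  by move=> Hn; case/prodP: (fn_app Hf Hn).
case: (@bigcap_full V T _ _ _ (fun n => pi2 (f ∙ n)) Hm) => [||d [Hd Ed Hdx]] //.
  move=> n Hn; case: (Hfn n Hn) => E _; split; last by rewrite E -rv_one re_rv.
  by case: (Hfb n Hn).
pose (b' := cap B0 d).
have Hb' : b' ∈ borel S by apply: (sigma_cap HA).
have Eb' : mu ∙ b' = one R.
  rewrite (prob_rv Hmu Hb') -rv_one; congr rv; apply: (meas_full_cap Hm) => //.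
  by rewrite EB0 -rv_one re_rv.
have inb' x : x ∈ b' -> x ∈ B0 /\ forall n, n ∈ omega -> x ∈ pi1 (f ∙ n) <-> g x ∈ U ∙ n.
  rewrite in_cap (propeq (Hdx x)) => -[H1 [Hx H2]]; split=> // n Hn.
  by case: (Hfn n Hn) => _; apply; apply: H2.
pose (p1 (b : V) := preim (car (prod_space S S')) pi1 b).
pose (p2 (b : V) := preim (car (prod_space S S')) pi2 b).
pose (D (n : V) := cup (diff (p1 (pi1 (f ∙ n))) (p2 (U ∙ n))) (diff (p2 (U ∙ n)) (p1 (pi1 (f ∙ n))))).
have HDd : definable_term (fun e => D (e 0%N)) by rewrite /D /p1 /p2; dfn.
have in1 b z : (z ∈ p1 b) = (z ∈ car (prod_space S S') /\ pi1 z ∈ b) by rewrite /p1 in_preim.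
have in2 b z : (z ∈ p2 b) = (z ∈ car (prod_space S S') /\ pi2 z ∈ b) by rewrite /p2 in_preim.
have HDb n : n ∈ omega -> D n ∈ borel (prod_space S S').
  move=> Hn; case: (Hfb n Hn) => H1 _; have H2 := fn_app HU Hn.
  by apply: (sigma_cup HAP); apply: (sigma_diff HAP); first [exact: B1|exact: B2].
have HGr : diff (p1 b') (bigcup D) ∈ borel (prod_space S S').
  by apply: (sigma_diff HAP); [exact: B1|apply: (sigma_bigcup HAP)].
have inGr z : z ∈ diff (p1 b') (bigcup D) <-> [/\ z ∈ car (prod_space S S'), pi1 z ∈ b' &
    forall n, n ∈ omega -> pi1 z ∈ pi1 (f ∙ n) <-> pi2 z ∈ U ∙ n].
  rewrite in_diff in1 in_bigcup //; split.
    move=> [[Hz Hzb] Hno]; split=> // n Hn; split=> H; apply: NNPP => H'; apply: Hno; exists n; split=> //;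
      rewrite /D in_cup !in_diff !in1 !in2; tauto.
  move=> [Hz Hzb H]; split=> // -[n [Hn]]; have := H n Hn.
  by rewrite /D in_cup !in_diff !in1 !in2; tauto.
clearbody D p1 p2 b'.
have Hpg : definable_term (fun e => ⟨e 0%N, g (e 0%N)⟩) by dfn.
exists (diff (p1 b') (bigcup D)); split=> //.
  move=> z /inGr [Hz Hzb H]; exists (pi1 z); case: (inb' _ Hzb) => H1 H2; split=> //.
  have := Hz; rewrite car_prod => /prodP [Ez Hz1 Hz2]; rewrite {1}Ez; congr opair.
  apply: Hsep => //; first exact: HgX.
  by move=> n Hn; rewrite -(propeq (H n Hn)) (propeq (H2 n Hn)).
apply (@push_full V T S HP mu (prod_space S S') (fun x => ⟨x, g x⟩) Hmu Hpg _ HGr); exists b'; split=> // x Hx; apply/inGr.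
have HxX := sigma_sub HA Hb'; case: (inb' x Hx) => H1 H2.
rewrite pi1_pair pi2_pair; split=> //; rewrite car_prod pair_in_prod.
by split; [apply: HxX|apply: HgX; apply: HxX].
Qed.

End Images.

End Maps.

Ltac unfold_continuous := unfold continuous.

(** * Type spaces *)

Section TypeSpaces.

Context {V : Type} {T : model V}.
#[local] Hint Extern 0 (set_structure _) => exact (model_struct T) : typeclass_instances.
Local Notation R := (model_reals T).
Local Notation nice := (@nice V T).
Local Notation continuous := (@continuous V T).
Variable G : game V.
Hypothesis HX : forall k, polish R (strategies G k).
Local Notation X := (strategies G).
Local Notation Xn := (Xn R G).
Local Notation T0 := (T0 R G).
Local Notation P k := (prod_space (X (other k)) (T0 (other k))).

Lemma term_hierarchy : definable_term (fun e => hierarchy R G (e 0%N)).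
Proof. by rewrite /hierarchy; dfn. Qed.

Lemma term_Xn k : definable_term (fun e => Xn k (e 0%N)).
Proof. by have H := term_hierarchy; rewrite /Defs.Xn; dfn. Qed.

Lemma Xn0 k : Xn k emp = X (other k).
Proof. by rewrite /Defs.Xn /hierarchy rec0 ?sel_both //; dfn. Qed.

Lemma XnS k n : n ∈ omega -> Xn k (succ n) = prod_space (Xn k n) (Delta R (Xn (other k) n)).
Proof. by move=> Hn; rewrite /Defs.Xn /hierarchy recS ?sel_both //; dfn. Qed.

Lemma topology_X k : is_topology (car (X k)) (opens (X k)).
Proof. by case: (polish_nice (HX k)). Qed.

Lemma nice_Xn n : n ∈ omega -> forall k, nice (Xn k n).
Proof.
have HXn1 := @term_Xn P1; have HXn2 := @term_Xn P2.
move: n; apply: omega_ind.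
- apply: definable_all_player => k.
  by unfold_nice; case: k; dfn.
- by move=> k; rewrite Xn0; exact: polish_nice.
- move=> n Hn IH k; rewrite XnS //; apply: nice_prod => //; exact: nice_Delta.
Qed.

Lemma topology_Xn k n : n ∈ omega -> is_topology (car (Xn k n)) (opens (Xn k n)).
Proof. by move=> Hn; case: (nice_Xn Hn k). Qed.

Lemma Xn_continuous k n : n ∈ omega -> continuous (Xn k (succ n)) (Xn k n) pi1.
Proof.
move=> Hn; rewrite XnS //; split; first by move=> z; exact: pi1_car.
by move=> u; apply: preim_pi1_open; [exact: topology_Xn|exact: Delta_topology].
Qed.

Lemma in_T0 k t : (t ∈ car (T0 k)) = (fn_on t omega /\ forall n, n ∈ omega -> t ∙ n ∈ Prob R (Xn k n)).
Proof.
have HXn := @term_Xn k; rewrite car_generated.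
apply: (in_compr (pow (Defs.prod omega (union (image omega (fun n => Prob R (Xn k n))))))); first by dfn.
move=> z [[b Hb] H]; rewrite in_pow.
have : fn z omega (union (image omega (fun n => Prob R (Xn k n)))); last by case.
apply: (fn_sub Hb) => n Hn; rewrite in_union; exists (Prob R (Xn k n)); split; last exact: H.
by rewrite in_image; [exists n|dfn].
Qed.

Lemma in_T0_sub k w : (w ∈ ⟦ w | exists n u, n ∈ omega /\ u ∈ opens (Delta R (Xn k n)) /\
    w = preim (car (T0 k)) (fun t => t ∙ n) u ⟧) =
  (exists n u, n ∈ omega /\ u ∈ opens (Delta R (Xn k n)) /\ w = preim (car (T0 k)) (fun t => t ∙ n) u).
Proof.
have HXn := @term_Xn k; have Hc : definable_term (fun _ : nat -> V => car (T0 k)) by exact: term_const.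
apply: (in_compr (pow (car (T0 k)))); first by move: (car (T0 k)) Hc => C Hc; dfn.
move=> z [n [u [_ [_ ->]]]]; rewrite in_pow => t; rewrite in_preim; last by dfn.
by case.
Qed.

Lemma T0_space k : T0 k = generated_space (car (T0 k)) ⟦ w | exists n u, n ∈ omega /\ u ∈ opens (Delta R (Xn k n)) /\
    w = preim (car (T0 k)) (fun t => t ∙ n) u ⟧.
Proof. by rewrite {1}/Defs.T0 /= car_generated. Qed.

#[local] Opaque Defs.Xn Defs.T0.

Lemma T0_sub k : ⟦ w | exists n u, n ∈ omega /\ u ∈ opens (Delta R (Xn k n)) /\
    w = preim (car (T0 k)) (fun t => t ∙ n) u ⟧ ⊆ pow (car (T0 k)).
Proof.
move=> w; rewrite in_T0_sub => -[n [u [_ [_ ->]]]]; rewrite in_pow => t; rewrite in_preim; last by dfn.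
by case.
Qed.

Lemma topology_T0 k : is_topology (car (T0 k)) (opens (T0 k)).
Proof. by rewrite T0_space car_generated; exact: generated_topology. Qed.

Lemma topology_P k : is_topology (car (P k)) (opens (P k)).
Proof. exact: prod_topology. Qed.

Lemma coordinate_continuous k n : n ∈ omega -> continuous (T0 k) (Delta R (Xn k n)) (fun t => t ∙ n).
Proof.
move=> Hn; split; first by move=> t; rewrite in_T0 car_Delta => -[_]; apply.
move=> u Hu; rewrite {2}T0_space; apply: generated_sub; first by move=> w; exact: T0_sub.
by rewrite in_T0_sub; exists n, u.
Qed.

Lemma T0_ext k t t' : t ∈ car (T0 k) -> t' ∈ car (T0 k) -> (forall n, n ∈ omega -> t ∙ n = t' ∙ n) -> t = t'.
Proof. by rewrite !in_T0 => -[[b Hb] _] [[b' Hb'] _]; apply: fn_ext Hb Hb'. Qed.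

(** Countable choice takes its values in one set, so the bases of all the spaces S n are collected
    as sequences of open sets of any of them. *)
Lemma choose_base (S : V -> V) : definable_term (fun e => S (e 0%N)) ->
  (forall n, n ∈ omega -> nice (S n)) -> exists W, fn_on W omega /\ forall n, n ∈ omega -> base (S n) (W ∙ n).
Proof.
move=> HSd HS.
have Himd : definable_term (fun e => opens (S (e 0%N))) by dfn.
case: (@countable_choice V T (pow (Defs.prod omega (union (image omega (fun n => opens (S n))))))
  (fun n W => base (S n) W)).
- by rewrite /base; dfn.
- move=> n Hn; case: (HS n Hn) => H1 _ [F HF]; case: (nice_base H1 HF) => G' [W [_ HW _]]; exists W; split=> //.
  case: HW => HWf _ _; rewrite in_pow.
  have : fn W omega (union (image omega (fun n => opens (S n)))); last by case.
  apply: (fn_cod HWf) => u Hu; rewrite in_union; exists (opens (S n)); split=> //.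
  by rewrite in_image //; exists n.
by move=> W [HW HWn]; exists W; split=> //; exists (pow (Defs.prod omega (union (image omega (fun n => opens (S n)))))).
Qed.

(** The members of U are the cylinders over basic open sets of single coordinates; a hierarchy is
    determined by its coordinates, and each of these by the basic sets containing it. *)
Lemma T0_separating k : exists U, fn U omega (opens (T0 k)) /\
  forall x y, x ∈ car (T0 k) -> y ∈ car (T0 k) -> (forall n, n ∈ omega -> x ∈ U ∙ n <-> y ∈ U ∙ n) -> x = y.
Proof.
have HXn := @term_Xn k.
case: (@choose_base (fun n => Delta R (Xn k n))) => [||W [_ HW]].
- by dfn.
- by move=> n Hn; apply: nice_Delta; exact: nice_Xn.
have HCd : definable_term (fun e => preim (car (T0 k)) (fun t => t ∙ e 0%N) (W ∙ e 0%N ∙ e 1%N)).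
  by move: (car (T0 k)) => C; dfn.
case: (@enumerate2 V T (opens (T0 k)) (fun n m => preim (car (T0 k)) (fun t => t ∙ n) (W ∙ n ∙ m))) => //.
- by move=> n m Hn Hm; case: (coordinate_continuous k Hn) => _; apply; case: (HW n Hn) => HWf _ _; apply: fn_app HWf Hm.
move=> U [HU HUn]; exists U; split=> // x y Hx Hy H; apply: (T0_ext Hx Hy) => n Hn.
apply: (base_separates (HW n Hn)).
- exact: (@Delta_separated V T (Xn k n) (nice_Xn Hn k)).
- by rewrite car_Delta; move: Hx; rewrite in_T0 => -[_]; apply.
- by rewrite car_Delta; move: Hy; rewrite in_T0 => -[_]; apply.
move=> m Hm; case: (HUn n m Hn Hm) => j [Hj E]; have := H j Hj; rewrite E !in_preim //; tauto.
Qed.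

Lemma term_proj : definable_term (fun e => proj (e 0%N) (e 1%N)).
Proof. by rewrite /proj; dfn. Qed.

Lemma proj0 z : proj emp z = pi1 z.
Proof. by rewrite /proj rec0 //; dfn. Qed.

Lemma projS n z : n ∈ omega -> proj (succ n) z = ⟨proj n z, pi2 z ∙ n⟩.
Proof. by move=> Hn; rewrite /proj recS //; dfn. Qed.

Lemma proj_continuous k n : n ∈ omega -> continuous (P k) (Xn k n) (proj n).
Proof.
have HXn := @term_Xn k; have Hpr := term_proj.
move: n; apply: omega_ind; first by unfold_continuous; dfn.
  rewrite Xn0; split; first by move=> z Hz; rewrite proj0; exact: pi1_car Hz.
  move=> u Hu; have -> : preim (car (P k)) (proj emp) u = preim (car (P k)) pi1 u.
    by apply: (ext T) => z; rewrite !in_preim // proj0.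
  by apply: preim_pi1_open => //; [exact: topology_X|exact: topology_T0].
move=> n Hn IH; rewrite (XnS k Hn).
have Hc := coordinate_continuous (other k) Hn.
apply: (@continuous_prod V T (P k) (Xn k n) (Delta R (Xn (other k) n)) (proj (succ n)) (proj n) (fun z => pi2 z ∙ n)
  (topology_P k) (topology_Xn k Hn) (@Delta_topology V T (Xn (other k) n)) _ _ _ _ IH).
- by dfn.
- by dfn.
- by dfn.
- by move=> z _; exact: projS.
case: Hc => H1 H2; split; first by move=> z Hz; apply: H1; exact: pi2_car Hz.
move=> u Hu; have -> : preim (car (P k)) (fun z => pi2 z ∙ n) u =
    preim (car (P k)) pi2 (preim (car (T0 (other k))) (fun t => t ∙ n) u).
  apply: (ext T) => z; rewrite !in_preim //; split; last by tauto.
  by move=> [Hz H3]; do !split=> //; exact: pi2_car Hz.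
by apply: preim_pi2_open; [exact: topology_X|exact: topology_T0|apply: H2].
Qed.

End TypeSpaces.

(* Uniqueness of the extension of a hierarchy *)
#[local] Opaque Defs.Xn Defs.T0.

Section Extensions.

Context {V : Type} {T : model V}.
#[local] Hint Extern 0 (set_structure _) => exact (model_struct T) : typeclass_instances.
Local Notation R := (model_reals T).
Local Notation continuous := (@continuous V T).
Variable G : game V.
Hypothesis HX : forall k, polish R (strategies G k).
Local Notation X := (strategies G).
Local Notation Xn := (Xn R G).
Local Notation T0 := (T0 R G).
Local Notation P k := (prod_space (X (other k)) (T0 (other k))).

Lemma image_measure_app S S' p nu b : definable_term (fun e => p (e 0%N)) -> b ∈ borel S' ->
  image_measure S S' p nu ∙ b = nu ∙ preim (car S) p b.
Proof. by move=> Hp Hb; rewrite /image_measure lam_app. Qed.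

(** A cylinder over level n is also one over any later level, so two cylinders can be intersected at
    a common level. *)
Lemma proj_lift k m : m ∈ omega -> forall n, n ∈ succ m -> forall b, b ∈ opens (Xn k n) ->
  exists b', b' ∈ opens (Xn k m) /\ preim (car (P k)) (proj n) b = preim (car (P k)) (proj m) b'.
Proof.
have HXn := @term_Xn V T G k; have Hpr := @term_proj V T.
move: m; apply: omega_ind; first by move: (car (P k)) => C; dfn.
  by move=> n; rewrite in_succ in_emp => -[//|->] b Hb; exists b.
move=> m Hm IH n; rewrite in_succ => -[Hn|->] b Hb; last by exists b.
case: (IH n Hn b Hb) => b' [Hb' ->].
have [_ Hc] := Xn_continuous HX k Hm; have [Hp _] := proj_continuous HX k (succ_omega Hm).
exists (preim (car (Xn k (succ m))) pi1 b'); split; first exact: Hc.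
apply: (ext T) => z; rewrite !in_preim //; split=> -[Hz]; last first.
  by move=> [_]; rewrite (projS _ Hm) pi1_pair.
by move=> H; do 2!split=> //; [exact: Hp|rewrite (projS _ Hm) pi1_pair].
Qed.

(* The cylinders over the finite levels of the hierarchy contain a countable
   base of X_j × T_j^0. *)
Lemma cylinder_unique k nu nu' : nu ∈ Prob R (P k) -> nu' ∈ Prob R (P k) ->
  (forall n, n ∈ omega -> image_measure (P k) (Xn k n) (proj n) nu = image_measure (P k) (Xn k n) (proj n) nu') ->
  nu = nu'.
Proof.
move=> Hnu Hnu' E.
have HXn := @term_Xn V T G k; have Hpr := @term_proj V T.
have HPt := @topology_P V T G k.
case: (@choose_base V T (fun n => Xn k n)) => [||W [_ HW]].
- by dfn.
- by move=> n Hn; apply: nice_Xn.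
have Hpc n : n ∈ omega -> continuous (P k) (Xn k n) (proj n) by exact: proj_continuous.
have Hdef1 : definable (fun e => exists n b, n ∈ omega /\ b ∈ opens (Xn k n) /\ e 0%N = preim (car (P k)) (proj n) b).
  by move: (car (P k)) => C; dfn.
separate (opens (P k)) (fun c => exists n b, n ∈ omega /\ b ∈ opens (Xn k n) /\ c = preim (car (P k)) (proj n) b) as A inA.
have Acap a b : a ∈ A -> b ∈ A -> cap a b ∈ A.
  rewrite !inA => -[Ha [n [c [Hn [Hc Ea]]]]] [Hb [m [d [Hm [Hd Eb]]]]]; split; first exact: topology_cap.
  case: (omega_max Hn Hm) => l [Hl Hnl Hml]; rewrite !omega_sub // in Hnl Hml.
  case: (proj_lift Hl Hnl Hc) => c' [Hc' Ec]; case: (proj_lift Hl Hml Hd) => d' [Hd' Ed].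
  exists l, (cap c' d'); split=> //; split; first by apply: topology_cap => //; exact: topology_Xn.
  rewrite Ea Eb Ec Ed; apply: (ext T) => z; rewrite in_cap !in_preim // ?in_cap; tauto.
have HCd : definable_term (fun e => preim (car (P k)) (proj (e 0%N)) (W ∙ e 0%N ∙ e 1%N)).
  by move: (car (P k)) => C; dfn.
case: (@enumerate2 V T A (fun n m => preim (car (P k)) (proj n) (W ∙ n ∙ m)) HCd).
  move=> n m Hn Hm; have Ho : W ∙ n ∙ m ∈ opens (Xn k n) by case: (HW n Hn) => HWf _ _; apply: fn_app HWf Hm.
  rewrite inA; split; first by case: (Hpc n Hn) => _; apply.
  by exists n, (W ∙ n ∙ m).
move=> u [Hu Hun].
case: (operation_closure (W := A) (op := cap) _ Acap _ Hu) => [//||U [HU HUu HUc]].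
  by move=> a _; apply: (ext T) => z; rewrite in_cap; tauto.
have HUo n : n ∈ omega -> U ∙ n ∈ opens (P k) by move=> Hn; have := fn_app HU Hn; rewrite inA => -[].
have UX n y : n ∈ omega -> y ∈ U ∙ n -> y ∈ car (P k).
  intros Hn Hy; destruct HPt as [H _]; pose proof (H (U ∙ n) (HUo n Hn)) as Hs; rewrite in_pow in Hs; exact (Hs y Hy).
have sub1 m o z : m ∈ omega -> o ∈ opens (Xn k m) -> z ∈ car (P k) -> proj m z ∈ o ->
    exists n, [/\ n ∈ omega, z ∈ U ∙ n & forall y, y ∈ U ∙ n -> proj m y ∈ o].
  move=> Hm Ho Hz Hzo; case: (HW m Hm) => _ Hb _; case: (Hb o _ Ho Hzo) => j [Hj Hzj Hjo].
  case: (Hun m j Hm Hj) => l [Hl El]; case: (HUu l Hl) => n [Hn En]; exists n.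
  rewrite En El; split=> //; first by rewrite in_preim.
  by move=> y; rewrite in_preim // => -[_ /Hjo].
have sub2 n m z : n ∈ omega -> m ∈ omega -> z ∈ U ∙ n -> z ∈ U ∙ m ->
    exists l, [/\ l ∈ omega, z ∈ U ∙ l & forall y, y ∈ U ∙ l -> y ∈ U ∙ n /\ y ∈ U ∙ m].
  move=> Hn Hm H1 H2; case: (HUc n m Hn Hm) => l [Hl El]; exists l; rewrite El in_cap; split=> //.
  by move=> y; rewrite in_cap.
have all z : z ∈ car (P k) -> exists n, n ∈ omega /\ z ∈ U ∙ n.
  move=> Hz; case: (sub1 emp (car (Xn k emp)) z) => // [||n [Hn H _]]; last by exists n.
    by apply: topology_total; exact: topology_Xn.
  by case: (Hpc emp emp_omega) => H _; apply: H.
have sub3 v t : v ∈ opens (T0 (other k)) -> t ∈ v -> forall z, z ∈ car (P k) -> pi2 z = t ->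
    exists n, [/\ n ∈ omega, z ∈ U ∙ n & forall y, y ∈ U ∙ n -> pi2 y ∈ v].
  move=> Hv Ht.
  apply: (@generated_open_ind V T (car (T0 (other k))) _ (fun v t => forall z, z ∈ car (P k) -> pi2 z = t ->
    exists n, [/\ n ∈ omega, z ∈ U ∙ n & forall y, y ∈ U ∙ n -> pi2 y ∈ v]) v t _ (@T0_sub V T G (other k))).
  - by move: (car (P k)) => C; dfn.
  - move=> w t'; rewrite in_T0_sub => -[m [o [Hm [Ho ->]]]]; rewrite in_preim; last by dfn.
    move=> [_ Ht'] z Hz Ez.
    (* Coordinate m of the type is the second component of the projection to level m + 1, so a
       condition on it is a cylinder over that level. *)
    have Hr : Defs.prod (car (Xn k m)) o ∈ opens (Xn k (succ m)).
      rewrite (XnS G k Hm); apply: rectangle_open => //; first exact: topology_Xn.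
        exact: Delta_topology.
      by apply: topology_total; exact: topology_Xn.
    case: (sub1 (succ m) _ z (succ_omega Hm) Hr Hz) => [|n [Hn H1 H2]].
      rewrite (projS _ Hm) pair_in_prod Ez; split=> //.
      by case: (Hpc m Hm) => H _; apply: H.
    exists n; split=> // y Hy; have := H2 y Hy; rewrite (projS _ Hm) pair_in_prod => -[_ H3].
    rewrite in_preim; last by dfn.
    by split=> //; exact: (pi2_car (UX n y Hn Hy)).
  - move=> t' _ z Hz _; case: (all z Hz) => n [Hn H]; exists n; split=> // y Hy.
    by exact: (pi2_car (UX n y Hn Hy)).
  - move=> v1 v2 t' _ _ H1 H2 z Hz Ez; case: (H1 z Hz Ez) => n [Hn Hzn Hn1]; case: (H2 z Hz Ez) => m [Hm Hzm Hm2].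
    case: (sub2 n m z Hn Hm Hzn Hzm) => l [Hl Hzl Hll]; exists l; split=> // y /Hll [/Hn1 H3 /Hm2 H4].
    by rewrite in_cap.
  - move=> v1 v2 t' H12 _ H1 z Hz Ez; case: (H1 z Hz Ez) => n [Hn Hzn Hn1]; exists n; split=> // y /Hn1.
    exact: H12.
  - by rewrite -T0_space.
  - exact: Ht.
have HUb : base (P k) U.
  rewrite prod_spaceE; apply: base_generated.
  - by apply: rectangles_sub; [exact: topology_X|exact: topology_T0].
  - by rewrite -prod_spaceE; apply: (fn_sub HU).
  - exact: HUc.
  - by rewrite -car_prod; exact: all.
  move=> w z; rewrite in_rectangles; [|exact: topology_X|exact: topology_T0].
  move=> [a [v [Ha [Hv ->]]]] Hz.
  have HzP : z ∈ car (P k).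
    destruct HPt as [H _]; pose proof (H _ (rectangle_open (topology_X HX (other k)) (topology_T0 G (other k)) Ha Hv)) as Hs.
    rewrite in_pow in Hs; exact (Hs z Hz).
  case/prodP: (Hz) => _ H1 H2.
  case: (sub1 emp a z emp_omega) => //; first by rewrite Xn0.
    by rewrite proj0.
  move=> n [Hn Hzn Hn1]; case: (sub3 v (pi2 z) Hv H2 z HzP erefl) => m [Hm Hzm Hm1].
  case: (sub2 n m z Hn Hm Hzn Hzm) => l [Hl Hzl Hll]; exists l; split=> // y Hy.
  case: (Hll y Hy) => /Hn1 H3 /Hm1 H4; rewrite proj0 in H3.
  have := UX l y Hl Hy; rewrite car_prod => /prodP [Ey _ _].
  by rewrite Ey pair_in_prod.
apply: (prob_base_ext HPt HUb Hnu Hnu') => n Hn.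
have := fn_app HU Hn; rewrite inA => -[_ [m [b [Hm [Hb ->]]]]].
have Hbb : b ∈ borel (Xn k m) by apply: open_borel => //; case: (topology_Xn HX k Hm).
have Hpm : definable_term (fun e => proj m (e 0%N)) by dfn.
by rewrite -(image_measure_app (P k) nu Hpm Hbb) -(image_measure_app (P k) nu' Hpm Hbb) E.
Qed.

End Extensions.

Section Generic.
Context {V : Type} {M : set_structure V}.
Variables (R : real_data V) (G : game V) (F : V).
Local Notation X := (strategies G).

(** The levels of both players must be built together: level n + 1 of y appends to level n the image
    of the belief F_j y under the other player's level n. Each level is stored as a set function on
    strategies, as recursion inside V requires. *)
Definition tower (n : V) : V :=
  rec (both (fun k => lam (car (X (other k))) (fun y => y)))
    (fun n r => both (fun k => lam (car (X (other k)))
      (fun y => opair (app (sel k r) y) (push R (X (other (other k))) (app (sel (other k) F) y) (Defs.Xn R G (other k) n) (app (sel (other k) r)))))) n.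

(* The hierarchy of beliefs of a player k who expects each strategy y of the
   opponent to be accompanied by the measure F_j y; belief_level k n y is the
   n-th level of what the opponent's strategy y reveals. *)
Definition belief_level k n y : V := app (sel k (tower n)) y.
Definition belief_type k x : V :=
  lam omega (fun n => push R (X (other k)) (app (sel k F) x) (Defs.Xn R G k n) (belief_level k n)).
Definition with_type k y : V := opair y (belief_type (other k) y).
End Generic.

(** * The types generated by beliefs on strategies *)

Section Towers.

Context {V : Type} {T : model V}.
#[local] Hint Extern 0 (set_structure _) => exact (model_struct T) : typeclass_instances.
Local Notation R := (model_reals T).
Variable G : game V.
Hypothesis HX : forall k, polish R (strategies G k).
Local Notation X := (strategies G).
Local Notation Xn := (Xn R G).
Local Notation T0 := (T0 R G).
Local Notation T1 := (T1 R G).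
Local Notation P k := (prod_space (X (other k)) (T0 (other k))).
Variable F : V.
Hypothesis HF : forall k, fn (sel k F) (car (X k)) (Prob R (X (other k))).
Local Notation level := (belief_level R G F).
Local Notation tau := (belief_type R G F).
Local Notation typed := (with_type R G F).

Lemma term_tower : definable_term (fun e => tower R G F (e 0%N)).
Proof. by have HXn := @term_Xn V T G; rewrite /tower; dfn. Qed.

Lemma term_level k : definable_term (fun e => level k (e 0%N) (e 1%N)).
Proof. by have H := term_tower; rewrite /belief_level; dfn. Qed.

Lemma term_belief_type k : definable_term (fun e => tau k (e 0%N)).
Proof. by have H := term_level k; have HXn := @term_Xn V T G k; rewrite /belief_type; dfn. Qed.

Lemma term_typed k : definable_term (fun e => typed k (e 0%N)).
Proof. by have H := term_belief_type (other k); rewrite /with_type; dfn. Qed.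

Lemma belief_type_app k x n : n ∈ omega ->
  tau k x ∙ n = push R (X (other k)) (sel k F ∙ x) (Xn k n) (level k n).
Proof. by move=> Hn; have H := term_level k; have HXn := @term_Xn V T G k; rewrite /belief_type lam_app. Qed.

Lemma level0 k y : y ∈ car (X (other k)) -> level k emp y = y.
Proof. by move=> Hy; have HXn := @term_Xn V T G; rewrite /belief_level /tower rec0 ?sel_both ?lam_app //; dfn. Qed.

Lemma levelS k n y : n ∈ omega -> y ∈ car (X (other k)) ->
  level k (succ n) y = ⟨level k n y, tau (other k) y ∙ n⟩.
Proof.
move=> Hn Hy; have HXn := @term_Xn V T G; rewrite (belief_type_app (other k) y Hn) {1}/belief_level {1}/tower recS //.
by rewrite -/(tower R G F n) sel_both lam_app //; dfn.
Qed.

Lemma level_car n : n ∈ omega -> forall k y, y ∈ car (X (other k)) -> level k n y ∈ car (Xn k n).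
Proof.
have HXn := @term_Xn V T G; have Hl := term_level.
move: n; apply: omega_ind.
- by apply: definable_all_player => k; dfn.
- by move=> k y Hy; rewrite level0 // Xn0.
move=> n Hn IH k y Hy; rewrite (levelS Hn Hy) (XnS G k Hn) car_prod pair_in_prod; split; first exact: IH.
rewrite car_Delta (belief_type_app (other k) y Hn); apply: push_prob => //.
- exact: (fn_app (HF (other k)) Hy).
- exact: IH.
Qed.

Lemma belief_type_prob k x n : n ∈ omega -> x ∈ car (X k) -> tau k x ∙ n ∈ Prob R (Xn k n).
Proof.
move=> Hn Hx; have Hl := term_level; rewrite (belief_type_app k x Hn); apply: push_prob => //.
- exact: (fn_app (HF k) Hx).
- exact: level_car.
Qed.

Lemma belief_type_car k x : x ∈ car (X k) -> tau k x ∈ car (T0 k).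
Proof.
move=> Hx; have HXn := @term_Xn V T G k; have Hl := term_level k.
rewrite in_T0; split; last by move=> n Hn; exact: belief_type_prob.
exists (union (image omega (fun n => Prob R (Xn k n)))); apply: lam_fn; [by dfn|].
move=> n Hn; rewrite -(belief_type_app k x Hn).
have := belief_type_prob Hn Hx.
by move=> H; rewrite in_union; exists (Prob R (Xn k n)); split=> //; rewrite (@in_image V T omega (fun n => Prob R (Xn k n))); [exists n|dfn].
Qed.

Lemma typed_car k y : y ∈ car (X (other k)) -> typed k y ∈ car (P k).
Proof. by move=> Hy; rewrite car_prod /with_type pair_in_prod; split=> //; exact: belief_type_car. Qed.

Lemma proj_typed n : n ∈ omega -> forall k y, y ∈ car (X (other k)) -> proj n (typed k y) = level k n y.
Proof.
have Hl := term_level; have Ht := term_typed; have Hp := @term_proj V T.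
move: n; apply: omega_ind; first by apply: definable_all_player => k; dfn.
  by move=> k y Hy; rewrite proj0 level0 // /with_type pi1_pair.
move=> n Hn IH k y Hy; rewrite (projS _ Hn) (levelS Hn Hy) (IH k y Hy).
by rewrite {1}/with_type pi2_pair.
Qed.

(** Coherence is the identity [pi1 (level k (succ n) y) = level k n y] carried over to images of F_k
    x. *)
Lemma belief_type_T1 k x : x ∈ car (X k) -> tau k x ∈ T1 k.
Proof.
move=> Hx; have HXn := @term_Xn V T G k; have Hl := term_level k.
have : tau k x ∈ car (T0 k) /\ forall n, n ∈ omega ->
    image_measure (Xn k (succ n)) (Xn k n) pi1 (tau k x ∙ succ n) = tau k x ∙ n; last first.
  by move=> H; rewrite /Defs.T1 (@in_compr V T (car (T0 k))) // => z [].
split=> [|n Hn]; first exact: belief_type_car.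
rewrite (belief_type_app k x (succ_omega Hn)) (belief_type_app k x Hn).
have [Hc1 Hc2] := Xn_continuous HX k Hn.
apply: (image_push (HX (other k)) (fn_app (HF k) Hx)).
- by dfn.
- by dfn.
- by dfn.
- by move=> y Hy; apply: level_car => //; exact: succ_omega.
- by move=> y Hy; rewrite (levelS Hn Hy) pi1_pair.
- exact: Hc1.
apply: preim_borel => //; [exact: (topology_Xn HX k (succ_omega Hn))|exact: (topology_Xn HX k Hn)].
Qed.

(** The image under [typed] has the prescribed projections, as [proj n (typed k y) = level k n y],
    and cylinders leave room for one such measure only. *)
Lemma belief_type_extension k x : x ∈ car (X k) ->
  extension R G k (tau k x) = push R (X (other k)) (sel k F ∙ x) (P k) (typed k).
Proof.
move=> Hx; have Hl := term_level k; have Ht := term_typed k; have Hp := @term_proj V T.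
have Hnu : push R (X (other k)) (sel k F ∙ x) (P k) (typed k) ∈ Prob R (P k).
  by apply: push_prob => //; [exact: (fn_app (HF k) Hx)|move=> y Hy; exact: typed_car].
have HE n : n ∈ omega -> image_measure (P k) (Xn k n) (proj n) (push R (X (other k)) (sel k F ∙ x) (P k) (typed k)) = tau k x ∙ n.
  move=> Hn; rewrite (belief_type_app k x Hn).
  have [Hc1 Hc2] := proj_continuous HX k Hn.
  apply: (image_push (HX (other k)) (fn_app (HF k) Hx)).
  - by dfn.
  - by dfn.
  - by dfn.
  - by move=> y Hy; exact: typed_car.
  - by move=> y Hy; exact: proj_typed.
  - exact: Hc1.
  by apply: preim_borel => //; [exact: (@topology_P V T G k)|exact: (topology_Xn HX k Hn)].
rewrite /extension; apply: theP; first by split.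
move=> nu [Hnu' HE']; apply: (cylinder_unique HX Hnu' Hnu) => n Hn.
by rewrite HE' // HE.
Qed.

End Towers.

Ltac dfn_types :=
  lazymatch goal with
  | |- definable_term (fun e => extension _ _ _ _) => unfold extension
  end.

Ltac dfn_sym6 ::= first [ dfn_player | dfn_space2 | dfn_meas | dfn_code | dfn_push | dfn_types ].

(** * Common belief in coherence and the measure λ(t) *)

Section TypeSpace.

Context {V : Type} {T : model V}.
#[local] Hint Extern 0 (set_structure _) => exact (model_struct T) : typeclass_instances.
Local Notation R := (model_reals T).
Local Notation re := (@re V T).
Local Notation rv := (@rv V T).
Variable G : game V.
Hypothesis HX : forall k, polish R (strategies G k).
Local Notation X := (strategies G).
Local Notation Xn := (Xn R G).
Local Notation T0 := (T0 R G).
Local Notation T1 := (T1 R G).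
Local Notation P k := (prod_space (X (other k)) (T0 (other k))).
Local Notation Tk := (Tk R G).
Local Notation world := (world R G).
Local Notation types k := (car (type_space R G k)).
Local Notation belief := (belief R G).

Lemma in_T1 k t : (t ∈ T1 k) = (t ∈ car (T0 k) /\ forall n, n ∈ omega ->
    image_measure (Xn k (succ n)) (Xn k n) pi1 (t ∙ succ n) = t ∙ n).
Proof.
have HXn := @term_Xn V T G k.
by rewrite /Defs.T1 (@in_compr V T (car (T0 k))) // => z [].
Qed.

Lemma definable_extension k : definable_term (fun e => extension R G k (e 0%N)).
Proof.
have HXn := @term_Xn V T G k; have Hp := @term_proj V T.
by rewrite /extension; move: (P k) => Q; dfn.
Qed.

Definition types_step (S : V) : V := both (fun i => ⟦ t | t ∈ T1 i /\
  measure_is R (P i) (extension R G i t) (Defs.prod (car (X (other i))) (sel (other i) S)) (one R) ⟧).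

Lemma term_types_step : definable_term (fun e => types_step (e 0%N)).
Proof.
have He := definable_extension; rewrite /types_step.
by apply: term_both => k; move: (P k) (T1 k) => Q C; dfn.
Qed.

Lemma TkE n : Tk n = rec (both (fun k => T1 k)) (fun _ S => types_step S) n.
Proof. by []. Qed.

Lemma Tk0 k : sel k (Tk emp) = T1 k.
Proof. by have H := term_types_step; rewrite TkE rec0 ?sel_both. Qed.

Lemma TkS k n : n ∈ omega -> forall t, (t ∈ sel k (Tk (succ n))) = (t ∈ T1 k /\
  measure_is R (P k) (extension R G k t) (Defs.prod (car (X (other k))) (sel (other k) (Tk n))) (one R)).
Proof.
move=> Hn t; have H := term_types_step; have He := definable_extension k.
rewrite TkE recS // -TkE /types_step.
by rewrite sel_both (@in_compr V T (T1 k)) // => z [].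
Qed.

Lemma term_Tk : definable_term (fun e => Tk (e 0%N)).
Proof. by have H := term_types_step; rewrite /Defs.Tk -/types_step; dfn. Qed.

Lemma Tk_sub n : n ∈ omega -> forall k t, t ∈ sel k (Tk n) -> t ∈ T1 k.
Proof.
move=> Hn k t; case: (omega_case Hn) => [->|[m [Hm ->]]]; first by rewrite Tk0.
by rewrite (TkS k Hm) => -[].
Qed.

Lemma in_types k t : (t ∈ types k) = (t ∈ T1 k /\ forall n, n ∈ omega -> t ∈ sel k (Tk n)).
Proof.
have HT := term_Tk.
by rewrite /type_space car_subspace (@in_compr V T (T1 k)) // => z [].
Qed.

Lemma types_sub k : types k ⊆ car (T0 k).
Proof. by move=> t; rewrite in_types in_T1 => -[[]]. Qed.

Lemma type_spaceE k : type_space R G k = subspace (T0 k) (types k).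
Proof. by rewrite /type_space car_subspace. Qed.

Lemma topology_type_space k : is_topology (car (type_space R G k)) (opens (type_space R G k)).
Proof.
have := @subspace_topology V T (T0 k) (types k) (@topology_T0 V T G k) (@types_sub k).
by rewrite -type_spaceE.
Qed.

Lemma worldE k : world k = prod_space (X (other k)) (subspace (T0 (other k)) (types (other k))).
Proof. by rewrite /Defs.world {1}type_spaceE. Qed.

Lemma type_space_separating k : exists U, fn U omega (borel (type_space R G k)) /\
  forall x y, x ∈ types k -> y ∈ types k -> (forall n, n ∈ omega -> x ∈ U ∙ n <-> y ∈ U ∙ n) -> x = y.
Proof.
case: (@T0_separating V T G HX k) => U [HU Hsep].
have Hd : definable_term (fun e => cap (U ∙ e 0%N) (types k)) by move: (types k) => C; dfn.
exists (lam omega (fun n => cap (U ∙ n) (types k))); split.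
  apply: lam_fn => // n Hn; apply: open_borel; first by case: (topology_type_space k).
  rewrite [X in _ ∈ X](congr1 opens (type_spaceE k)) in_subspace_opens; last by move=> t Ht; exact: (@types_sub k t Ht).
  by exists (U ∙ n); split=> //; apply: fn_app HU Hn.
move=> x y Hx Hy H; apply: Hsep; [exact: (@types_sub k x Hx)|exact: (@types_sub k y Hy)|] => n Hn.
have := H n Hn; rewrite lam_app // !in_cap; tauto.
Qed.

Lemma borel_P_separating k : exists U, fn U omega (borel (T0 k)) /\
  forall x y, x ∈ car (T0 k) -> y ∈ car (T0 k) -> (forall n, n ∈ omega -> x ∈ U ∙ n <-> y ∈ U ∙ n) -> x = y.
Proof.
case: (@T0_separating V T G HX k) => U [HU Hsep]; exists U; split=> //.
apply: (fn_sub HU) => n Hn; apply: open_borel; first by case: (@topology_T0 V T G k).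
exact: fn_app HU Hn.
Qed.

(** Since g takes its values in W, its image measure on Q, read on the subspace W, is its image
    measure on W. Every Borel set of W is a trace, so no other measure satisfies the description. *)
Lemma restrict_push S mu Q W g : polish R S -> mu ∈ Prob R S -> definable_term (fun e => g (e 0%N)) ->
  (forall y, y ∈ car S -> g y ∈ car W) -> (forall c, c ∈ borel Q -> cap c (car W) ∈ borel W) ->
  (forall b, b ∈ borel W -> exists c, c ∈ borel Q /\ b = cap c (car W)) ->
  the _ (fun nu => nu ∈ Prob R W /\ forall c, c ∈ borel Q -> nu ∙ cap c (car W) = push R S mu Q g ∙ c) =
  push R S mu W g.
Proof.
move=> HS Hmu Hg HgW Htr Hex.
have E c : c ∈ borel Q -> push R S mu W g ∙ cap c (car W) = push R S mu Q g ∙ c.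
  move=> Hc; rewrite (push_app HS Hmu Hg (Htr c Hc)) (push_app HS Hmu Hg Hc).
  congr (rv (re (measure _ _ _ _))); apply: (ext T) => y; rewrite in_preim // in_cap in_preim //.
  by split=> [[Hy []]|[Hy H]] //; do 2!split=> //; exact: HgW.
have Hw := push_prob HS Hmu Hg HgW.
apply: theP => // nu [Hnu E']; apply: (@prob_ext V T W) => // b Hb.
by case: (Hex b Hb) => c [Hc ->]; rewrite E' // E.
Qed.

Section BeliefTypes.

Variable F : V.
Hypothesis HF : forall k, fn (sel k F) (car (X k)) (Prob R (X (other k))).
Local Notation tau := (belief_type R G F).
Local Notation typed := (with_type R G F).

(** X_j × T_j^n need not be Borel in X_j × T_j^0. By induction it contains the graph of the map from
    strategies to types, in which [graph_borel] finds a Borel set of measure one. *)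
Lemma belief_type_Tk n : n ∈ omega -> forall k x, x ∈ car (X k) -> tau k x ∈ sel k (Tk n).
Proof.
have HT := term_Tk; have Ht := @term_belief_type V T G F.
move: n; apply: omega_ind; first by apply: definable_all_player => k; dfn.
  by move=> k x Hx; rewrite Tk0; exact: belief_type_T1.
move=> n Hn IH k x Hx; rewrite (TkS k Hn); split; first exact: belief_type_T1.
rewrite (belief_type_extension HX HF Hx).
have Hmu := fn_app (HF k) Hx.
have Hpp : push R (X (other k)) (sel k F ∙ x) (P k) (typed k) ∈ Prob R (P k).
  apply: (push_prob (HX (other k)) Hmu (@term_typed V T G F k)) => y Hy; exact: (typed_car HX HF Hy).
apply/(full_borel Hpp); split.
  move=> z; rewrite in_prod car_prod in_prod => -[y [t [Hy [Ht' ->]]]]; exists y, t; do 2!split=> //.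
  by have := Tk_sub Hn Ht'; rewrite in_T1 => -[].
case: (borel_P_separating (other k)) => U [HU Hsep].
case: (@graph_borel V T (X (other k)) (sel k F ∙ x) (HX (other k)) Hmu (T0 (other k)) U (tau (other k)) (car (X (other k)))
   (@topology_T0 V T G (other k)) HU Hsep (Ht (other k))).
- by move=> y Hy; exact: (belief_type_car HX HF Hy).
- exact: (sigma_total (@borel_sigma V T (X (other k)))).
- by move: Hmu; rewrite in_Prob => -[_ [_ []]].
move=> Gr [HGr HGs HG1]; exists Gr; split=> //.
by move=> z /HGs [y [Hy ->]]; rewrite pair_in_prod; split=> //; exact: IH.
Qed.

Lemma belief_type_type k x : x ∈ car (X k) -> tau k x ∈ types k.
Proof.
move=> Hx; rewrite in_types; split; first exact: (belief_type_T1 HX HF Hx).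
by move=> n Hn; exact: belief_type_Tk.
Qed.

Lemma typed_world k y : y ∈ car (X (other k)) -> typed k y ∈ car (world k).
Proof. by move=> Hy; rewrite /Defs.world car_prod /with_type pair_in_prod; split=> //; exact: belief_type_type. Qed.

Lemma belief_belief_type k x : x ∈ car (X k) ->
  belief k (tau k x) = push R (X (other k)) (sel k F ∙ x) (world k) (typed k).
Proof.
move=> Hx; have Hmu := fn_app (HF k) Hx; have Ht := @term_typed V T G F k.
have Htw : forall y, y ∈ car (X (other k)) -> typed k y ∈ car (world k) by move=> y; exact: typed_world.
have HtX : is_topology (car (X (other k))) (opens (X (other k))) by exact: topology_X.
have Htr c : c ∈ borel (P k) -> cap c (car (world k)) ∈ borel (world k).
  rewrite worldE; apply: borel_trace => //; [exact: (@topology_T0 V T G (other k))|exact: (@types_sub (other k))].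
rewrite /Defs.belief (belief_type_extension HX HF Hx); apply: (restrict_push (HX (other k)) Hmu Ht Htw Htr).
move=> b; rewrite worldE; apply: trace_exists => //; [exact: (@topology_T0 V T G (other k))|exact: (@types_sub (other k))].
Qed.

Lemma preim_pi1_world k b : b ∈ borel (X (other k)) -> preim (car (world k)) pi1 b ∈ borel (world k).
Proof.
have H1 : is_topology (car (X (other k))) (opens (X (other k))) by exact: topology_X.
apply: preim_borel => //; first exact: (@prod_topology V T (X (other k)) (type_space R G (other k))).
split; first by move=> z; exact: pi1_car.
by move=> u; apply: preim_pi1_open => //; exact: topology_type_space.
Qed.

(** The first component of [typed k y] is y, so projecting the belief gives back F_k x. *)
Lemma belief_marginal k x : x ∈ car (X k) ->
  image_measure (world k) (X (other k)) pi1 (belief k (tau k x)) = sel k F ∙ x.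
Proof.
move=> Hx; have Hmu := fn_app (HF k) Hx; have Ht := @term_typed V T G F k.
rewrite (belief_belief_type Hx) -[RHS](push_id (HX (other k)) Hmu).
apply: (image_push (HX (other k)) Hmu).
- by dfn.
- by dfn.
- by dfn.
- by move=> y; exact: typed_world.
- by move=> y Hy; rewrite /with_type pi1_pair.
- by move=> z; exact: pi1_car.
by move=> b; exact: preim_pi1_world.
Qed.

End BeliefTypes.

End TypeSpace.

(** * Common belief in rationality *)

Section CommonBelief.

Context {V : Type} {T : model V}.
#[local] Hint Extern 0 (set_structure _) => exact (model_struct T) : typeclass_instances.
Local Notation R := (model_reals T).
Variable G : game V.
Hypothesis HX : forall k, polish R (strategies G k).
Local Notation X := (strategies G).
Local Notation T0 := (T0 R G).
Local Notation P k := (prod_space (X (other k)) (T0 (other k))).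
Local Notation Rn := (Rn R G).
Local Notation world := (world R G).
Local Notation types k := (car (type_space R G k)).
Local Notation belief := (belief R G).
Local Notation br := (best_response R G).

Lemma term_belief k : definable_term (fun e => belief k (e 0%N)).
Proof.
have He := @definable_extension V T G k.
by rewrite /Defs.belief; move: (world k) (borel (P k)) (car (world k)) => W BP cW; dfn.
Qed.

Definition rational_pairs : V := both (fun i => ⟦ p | exists s t, p = ⟨s, t⟩ /\
  s ∈ car (X i) /\ t ∈ types i /\
  ⟨s, image_measure (world i) (X (other i)) pi1 (belief i t)⟩ ∈ br i ⟧).

Definition believe_step (A : V) : V := both (fun i => ⟦ p | p ∈ sel i A /\
  measure_is R (world i) (belief i (pi2 p)) (sel (other i) A) (one R) ⟧).

Lemma RnE n : Rn n = rec rational_pairs (fun _ A => believe_step A) n.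
Proof. by []. Qed.

Lemma term_believe_step : definable_term (fun e => believe_step (e 0%N)).
Proof.
have Hb := term_belief; rewrite /believe_step.
by apply: term_both => k; move: (world k) => W; dfn.
Qed.

Lemma Rn0 k p : (p ∈ sel k (Rn emp)) = exists s t, p = ⟨s, t⟩ /\ s ∈ car (X k) /\ t ∈ types k /\
  ⟨s, image_measure (world k) (X (other k)) pi1 (belief k t)⟩ ∈ br k.
Proof.
have H := term_believe_step; have Hb := term_belief k; rewrite RnE rec0 // /rational_pairs sel_both.
apply: (in_compr (Defs.prod (car (X k)) (types k))).
  by move: (world k) (types k) (car (X k)) (br k) => W Ty CX BR; dfn.
by move=> z [s [t [-> [Hs [Ht _]]]]]; rewrite pair_in_prod.
Qed.

Lemma RnS k n : n ∈ omega -> forall p, (p ∈ sel k (Rn (succ n))) = (p ∈ sel k (Rn n) /\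
  measure_is R (world k) (belief k (pi2 p)) (sel (other k) (Rn n)) (one R)).
Proof.
move=> Hn p; have H := term_believe_step; have Hb := term_belief k.
rewrite RnE recS // -RnE /believe_step sel_both.
by apply: (in_compr (sel k (Rn n))) => [|z []//]; move: (world k) => W; dfn.
Qed.

Lemma term_Rn : definable_term (fun e => Rn (e 0%N)).
Proof. by have H := term_believe_step; change (definable_term (fun e => rec rational_pairs (fun _ A => believe_step A) (e 0%N))); dfn. Qed.

Lemma Rn_sub n : n ∈ omega -> forall k p, p ∈ sel k (Rn n) -> p ∈ Defs.prod (car (X k)) (types k).
Proof.
have HR := term_Rn.
move: n; apply: omega_ind.
- by apply: definable_all_player => k; move: (types k) => Ty; dfn.
- by move=> k p; rewrite Rn0 => -[s [t [-> [Hs [Ht _]]]]]; rewrite pair_in_prod.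
by move=> n Hn IH k p; rewrite (RnS k Hn) => -[/IH].
Qed.

Lemma Rn_world n k p : n ∈ omega -> p ∈ sel (other k) (Rn n) -> p ∈ car (world k).
Proof. by move=> Hn Hp; rewrite car_prod; exact: (Rn_sub Hn Hp). Qed.

Lemma in_RCBR k s : (s ∈ RCBR R G k) = (s ∈ car (X k) /\ exists t, t ∈ types k /\
  forall n, n ∈ omega -> ⟨s, t⟩ ∈ sel k (Rn n)).
Proof.
have HR := term_Rn.
by apply: (in_compr (car (X k))) => [|z []//]; move: (types k) => Ty; dfn.
Qed.

(* Otherwise the description defining the belief has the empty set as value, all
   the values of its image are the same junk, and zero = one. *)
Lemma belief_prob k s t : ⟨s, image_measure (world k) (X (other k)) pi1 (belief k t)⟩ ∈ br k ->
  belief k t ∈ Prob R (world k).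
Proof.
move=> /best_response_pair [_ Hmu].
case: (classic (exists! nu, nu ∈ Prob R (world k) /\
    forall c, c ∈ borel (P k) -> nu ∙ cap c (car (world k)) = extension R G k t ∙ c)) => [[nu [H1 H2]]|Hno].
  have -> : belief k t = nu; last by case: H1.
  by rewrite /Defs.belief; apply: theP => // nu' /H2.
have Eb a : belief k t ∙ a = belief k t ∙ emp.
  have H0 z : ~ z ∈ belief k t by apply: the_junk.
  by rewrite !(app_empty _ H0).
have Hd1 : definable_term (fun e => pi1 (e 0%N)) by dfn.
have HA := @borel_sigma V T (X (other k)).
have E b : b ∈ borel (X (other k)) -> image_measure (world k) (X (other k)) pi1 (belief k t) ∙ b = belief k t ∙ emp.
  by move=> Hb; rewrite (image_measure_app (world k) (belief k t) Hd1 Hb) Eb.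
exfalso; apply: (@zero_neq_one V (model_struct T) R (model_field T)).
have Hm := prob_measure Hmu.
have E0 := prob_rv Hmu (sigma_emp HA); rewrite (meas_emp Hm) in E0.
have E1 : image_measure (world k) (X (other k)) pi1 (belief k t) ∙ car (X (other k)) = one R.
  by move: Hmu; rewrite in_Prob => -[_ [_ []]].
by rewrite -rv_zero -E0 -E1 (E _ (sigma_emp HA)) (E _ (sigma_total HA)).
Qed.

(** If t witnesses s, then λ(t) gives measure one to Borel subsets of all R_j^n, hence to their
    intersection, whose points project into RCBR_j. As RCBR_j need not be Borel, the conclusion is
    drawn for an outer Borel set c of the same marginal measure. *)
Lemma RCBR_is_postfixed : @postfixed V T G (fun k => RCBR R G k).
Proof.
split=> [k s|k s]; rewrite in_RCBR; first by case.
move=> [Hs [t [Ht Hst]]].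
have := Hst emp emp_omega; rewrite Rn0 => -[s' [t' [/opair_inj [<- <-] [_ [_ Hbr]]]]].
have Hb := belief_prob Hbr; have [_ Hmu] := best_response_pair Hbr.
exists (image_measure (world k) (X (other k)) pi1 (belief k t)); split=> //.
have Hsub : RCBR R G (other k) ⊆ car (X (other k)) by move=> y; rewrite in_RCBR => -[].
have HC := polish_measurable (HX (other k)) Hmu (@Hsub).
apply/(full_measure Hmu); split=> //.
case: (completion_outer Hmu HC) => c [Hc Hsc <-].
have HR := term_Rn.
case: (@countable_choice V T (borel (world k)) (fun n b => b ⊆ sel (other k) (Rn n) /\ belief k t ∙ b = one R)) => //.
  move=> n Hn; have := Hst (succ n) (succ_omega Hn); rewrite (RnS k Hn) pi2_pair => -[_ /(full_borel Hb) [_ [b [H1 H2 H3]]]].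
  by exists b.
move=> f [Hf Hfn]; have Hm := prob_measure Hb.
case: (@bigcap_full V T _ _ _ (fun n => f ∙ n) Hm) => [||b [Hbb Eb Hbx]] //.
  move=> n Hn; case: (Hfn n Hn) => _ E; split; last by rewrite E -rv_one re_rv.
  exact: fn_app Hf Hn.
have Hpc := @preim_pi1_world V T G HX k c Hc.
have Hd1 : definable_term (fun e => pi1 (e 0%N)) by dfn.
rewrite (image_measure_app (world k) (belief k t) Hd1 Hc).
apply/eqP; rewrite eq_le (meas_le1 Hm Hpc) -{1}Eb; apply: (meas_mono Hm) => // z Hz.
have := Hbx z; rewrite (propeq (Hbx z)) in Hz; case: Hz => HzW Hzn _.
rewrite in_preim //; split=> //; apply: Hsc; rewrite in_RCBR.
have := HzW; rewrite car_prod => /prodP [Ez H1 H2]; split=> //; exists (pi2 z); split=> // n Hn.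
by case: (Hfn n Hn) => H3 _; rewrite -Ez; apply: H3; exact: Hzn.
Qed.

(** By induction on n, every x ∈ B_k paired with its type lies in R_k^n. The belief of this type
    gives measure one to a Borel set found by [graph_borel] inside the graph over B_j, which lies in
    R_j^n by the induction hypothesis. *)
Lemma postfixed_RCBR Z i s : @postfixed V T G Z -> s ∈ Z i -> s ∈ RCBR R G i.
Proof.
move=> [HZX HZ] Hs.
have HEd : forall k : player, definable (fun e => (fun k x mu => ⟨x, mu⟩ ∈ br k) k (e 0%N) (e 1%N)).
  by move=> k; move: (br k) => b; dfn.
case: (borel_selection HX HEd HZX HZ Hs) => B [F [HB HE HsB]].
have HF k := (HB k).2.
have HBb k : sel k B ∈ borel (X k) by case: (HB k).
have HBX k x : x ∈ sel k B -> x ∈ car (X k) by exact: (sigma_sub (@borel_sigma V T (X k)) (HBb k)).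
have HR := term_Rn; have Htau := @term_belief_type V T G F.
have main n : n ∈ omega -> forall k x, x ∈ sel k B -> ⟨x, belief_type R G F k x⟩ ∈ sel k (Rn n).
  move: n; apply: omega_ind; first by apply: definable_all_player => k; dfn.
    move=> k x Hx; have HxX := HBX k x Hx; rewrite Rn0; exists x, (belief_type R G F k x); do 2!split=> //.
    split; first exact: (belief_type_type HX HF HxX).
    by rewrite (belief_marginal HX HF HxX); case: (HE k x Hx).
  move=> n Hn IH k x Hx; have HxX := HBX k x Hx; rewrite (RnS k Hn); split; first exact: IH.
  have Hmu := fn_app (HF k) HxX.
  have Hw : push R (X (other k)) (sel k F ∙ x) (world k) (with_type R G F k) ∈ Prob R (world k).
    by apply: (push_prob (HX (other k)) Hmu (@term_typed V T G F k)) => y Hy; exact: (typed_world HX HF Hy).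
  rewrite pi2_pair (belief_belief_type HX HF HxX); apply/(full_borel Hw); split.
    by move=> z Hz; exact: (Rn_world Hn Hz).
  case: (@type_space_separating V T G HX (other k)) => U [HU Hsep].
  case: (@graph_borel V T (X (other k)) (sel k F ∙ x) (HX (other k)) Hmu (type_space R G (other k)) U
     (belief_type R G F (other k)) (sel (other k) B) (@topology_type_space V T G (other k)) HU Hsep (Htau (other k))).
  - by move=> y Hy; exact: (belief_type_type HX HF Hy).
  - exact: HBb.
  - by case: (HE k x Hx).
  move=> Gr [HGr HGs HG1]; exists Gr; split=> //.
  by move=> z /HGs [y [Hy ->]]; exact: IH.
have HsX := HBX i s HsB.
rewrite in_RCBR; split=> //; exists (belief_type R G F i s); split; first exact: (belief_type_type HX HF HsX).
by move=> n Hn; exact: main.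
Qed.

Theorem RCBR_postfixed i s : s ∈ RCBR R G i <-> exists Z, @postfixed V T G Z /\ s ∈ Z i.
Proof.
split=> [Hs|[Z [HZ Hs]]]; last exact: postfixed_RCBR HZ Hs.
by exists (fun k => RCBR R G k); split=> //; exact: RCBR_is_postfixed.
Qed.

End CommonBelief.

Theorem theorem4 (V : Type) (M : set_structure V) (R : real_data V)
  (HZF : ZF V M) (HDC : DC V M)
  (HR : complete_ordered_field R) (HMUP : MUP R)
  (G : game V) (HG : is_game R G)
  (i : player) (s : V) (Hs : s ∈ car (strategies G i)) :
  (s ∈ RAT R G i <-> s ∈ RCBR R G i) /\
  (s ∈ RCBR R G i <-> gs_I_wins R G (best_response R G) i s).
Proof.
have [HX _] := HG.
pose T := Model HZF HDC HR HMUP.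
have H1 := @RAT_postfixed V T G i s.
have H2 := @RCBR_postfixed V T G HX i s.
have H3 := @gale_stewart V T G HX i s Hs.
by split; [exact: iff_trans H1 (iff_sym H2)|exact: iff_trans H2 (iff_sym H3)].
Qed.
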